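(* Let $\Bbbk$ be a field, $s$ a natural number, $G$ a finite abelian group, and $\chi$ an alternating bicharacter on $G$ with values in $\Bbbk^*$. If $\mathbf{x}$ ranges over all finite sets of indeterminates, $\Bbbk_{\mathfrak q}[\mathbf{x}]$ ranges among all skew polynomial rings with group of colors $G$ and bicharacter $\chi$, and $I$ ranges over all ideals in $\Bbbk_{\mathfrak q}[\mathbf{x}]$ minimally generated by $s$ monomials of degree at least $2$, then there exists only a finite number of isomorphism classes of the graded color Lie algebras $\pi^{\geq2}(\Bbbk_{\mathfrak q}[\mathbf{x}]/I)$.
   Context: Skew polynomial ring: $\mathbf x=\{x_1,\ldots,x_n\}$, $\mathfrak q=(q_{i,j})$ is an $n\times n$ matrix with entries in $\Bbbk^*$, $q_{i,i}=1$, $q_{i,j}=q_{j,i}^{-1}$. $R=\Bbbk_{\mathfrak q}[\mathbf x]$ is the Ore extension with $\Bbbk$ central and $x_ix_j=q_{i,j}x_jx_i$. Monomials are $\mathbf{x}^{\mathbf a}=x_1^{a_1}\cdots x_n^{a_n}$, $\mathbf a\in\mathbb{N}^n$; ''degree at least 2'' means $a_1+\dots+a_n\ge2$. Let $\sigma_i$ be the automorphism of $R$ over $\Bbbk$ with $\sigma_i(x_j)=q_{i,j}x_j$; the group of colors of $R$ is the abelian group $\langle\sigma_1,\ldots,\sigma_n\rangle$, and its bicharacter is the alternating bicharacter (multiplicative in each variable, $1$ on the diagonal) with $(\sigma_i,\sigma_j)\mapsto q_{i,j}$. ''$R$ has group of colors $G$ and bicharacter $\chi$'' means that the group of colors of $R$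 is identified with $G$ by a group isomorphism carrying its bicharacter to $\chi$. $R$ is $\mathbb{Z}\times G$-graded: $\mathbf x^{\mathbf a}$ has internal degree $\sum a_id_i$ ($d_i=\deg x_i\in\mathbb{Z}^+$ fixed) and $G$-degree $\prod\sigma_i^{a_i}$. $\chi(x,y)$ denotes $\chi$ of the $G$-degrees of $x,y$. Color DG algebra: an associative unital algebra $A$ graded by homological degree $|\cdot|\ge0$, internal degree and $G$-degree, with a differential $\partial$ of homological degree $-1$ preserving internal and $G$-degree, $\partial^2=0$, $\partial(ab)=\partial(a)b+(-1)^{|a|}a\partial(b)$; color commutative means $xy=(-1)^{|x||y|}\chi(x,y)yx$ for trihomogeneous $x,y$ and $x^2=0$ for $|x|$ odd. Here $A=S=R/I$, concentrated in homological degree $0$, with augmentation $S\to\Bbbk=S/(x_1,\dots,x_n)$. Acyclic closure: adjoining to $A$ a variable $x$ killing a trihomogeneous cycle $z$ of homological degree $i$ means forming the color commutative DG algebra $A\langle x\mid\partial x=z\rangle$, with $|x|=i+1$, and internal and $G$-degree of $x$ those of $z$; for $|x|$ odd it is free over $A$ on $1,x$ with $x^2=0$; for $|x|$ even it is free over $A$ on the divided powers $x^{(k)}$, $k\ge0$, with $x^{(0)}=1$, $x^{(1)}=x$, $x^{(h)}x^{(k)}=\binom{h+k}{h}x^{(h+k)}$, $\partial(x^{(k)})=\partial(x)x^{(k-1)}$. An acyclic closure $A\langle X\rangle$ of $\Bbbk$ over $A$, $X=\bigcup_{i\ge1}X_i$, is obtained by adjoining successively variables $X_1$ of homological degree 1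 whose boundaries represent a minimal trihomogeneous generating set of $\ker(H_0(A)\to\Bbbk)$, and for $i\ge1$ variables $X_{i+1}$ of homological degree $i+1$ whose boundaries represent a minimal trihomogeneous generating set of $H_i(A\langle X_{\le i}\rangle)$; then $A\langle X\rangle\to\Bbbk$ is a quasi-isomorphism. Homotopy Lie algebra: $\mathrm{Der}_A(A\langle X\rangle,A\langle X\rangle)$ consists of (sums of trihomogeneous) additive maps $D$ with $D(a)=0$ for $a\in A$, $D(bb')=D(b)b'+(-1)^{|D||b|}\chi(D,b)bD(b')$, and $D(x^{(i)})=D(x)x^{(i-1)}$ for $x\in X$ of even homological degree. It has differential $D\mapsto\partial D-(-1)^{|D|}D\partial$, bracket $[D,D']=DD'-(-1)^{|D||D'|}\chi(D,D')D'D$, and square $D\mapsto D^2$ for $|D|$ odd. $\pi(A)$ is its homology with the induced bracket and square; $\pi^i(A)$ (cohomological degree $i$) is the homology in homological degree $-i$. $\pi^{\ge2}(S)=\bigoplus_{i\ge2}\pi^i(S)$. An isomorphism of graded color Lie algebras is a $\Bbbk$-linear bijection preserving cohomological degree, $G$-degree, brackets and squares. *)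

(* Defs.v *)
From HB Require Import structures.
From mathcomp Require Import all_boot all_order all_algebra.
From mathcomp Require Import boolp functions.

Set Implicit Arguments.
Unset Strict Implicit.
Unset Printing Implicit Defensive.

Import GRing.Theory Num.Theory.
Local Open Scope quotient_scope.
Local Open Scope ring_scope.

(* Abelian groups are written additively. *)
Record alt_bicharacter (G : zmodType) (k : fieldType) := AltBicharacter {
  bichar :> G -> G -> k;
  bichar_neq0 : forall g h, bichar g h != 0;
  bicharDl : forall g g' h, bichar (g + g') h = bichar g h * bichar g' h;
  bicharDr : forall g h h', bichar g (h + h') = bichar g h * bichar g h';
  bichar_alt : forall g, bichar g g = 1 }.

(* (homological degree, internal degree, color) *)
Notation tridegree G := (int * int * G)%type.

Record skew_matrix (k : fieldType) (n : nat) (q : 'M[k]_n) : Prop := {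
  skew_neq0 : forall i j, q i j != 0;
  skew_diag : forall i, q i i = 1;
  skew_inv : forall i j, q i j = (q j i)^-1 }.

Definition monomial (R : pzRingType) (n : nat) (x : 'I_n -> R)
  (a : {ffun 'I_n -> nat}) : R := \prod_(i < n) x i ^+ a i.

(* [R] is the iterated Ore extension of k in the variables [x]: the ordered
   monomials form a k-basis (k being central since R is a k-algebra). *)
Record skew_polynomial_ring (k : fieldType) (n : nat) (q : 'M[k]_n)
    (R : algType k) (x : 'I_n -> R) : Prop := {
  skew_comm : forall i j, x i * x j = q i j *: (x j * x i);
  skew_span : forall f : R,
    exists (r : seq {ffun 'I_n -> nat}) (c : {ffun 'I_n -> nat} -> k),
      f = \sum_(a <- r) c a *: monomial x a;
  skew_free : forall (r : seq {ffun 'I_n -> nat})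
      (c : {ffun 'I_n -> nat} -> k),
    uniq r -> \sum_(a <- r) c a *: monomial x a = 0 ->
    forall a, a \in r -> c a = 0 }.

(* [f] is the automorphism sigma_i : x_j |-> q_ij x_j *)
Definition is_sigma (k : fieldType) (n : nat) (q : 'M[k]_n) (R : algType k)
    (x : 'I_n -> R) (i : 'I_n) (f : R -> R) : Prop :=
  exists2 h : {lrmorphism R -> R}, f = h & forall j, h (x j) = q i j *: x j.

Inductive color_group (k : fieldType) (n : nat) (q : 'M[k]_n) (R : algType k)
    (x : 'I_n -> R) : (R -> R) -> Prop :=
| color_group_sigma i f : is_sigma q x i f -> color_group q x f
| color_group_id : color_group q x id
| color_group_comp f f' :
    color_group q x f -> color_group q x f' -> color_group q x (f \o f')
| color_group_inv f f' :
    color_group q x f -> cancel f f' -> cancel f' f -> color_group q x f'.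

(* [phi] is an isomorphism from [G] onto the group of colors; [g i] is the
   element of [G] corresponding to sigma_i.  A bicharacter is determined by
   its values on generators, so the last field says that the bicharacter of
   the group of colors is carried to [chi]. *)
Record color_identification (k : fieldType) (G : zmodType)
    (chi : alt_bicharacter G k) (n : nat) (q : 'M[k]_n) (R : algType k)
    (x : 'I_n -> R) (phi : G -> R -> R) (g : 'I_n -> G) : Prop := {
  color_morph : forall a b, phi (a + b) = phi a \o phi b;
  color_inj : injective phi;
  color_range : forall f, color_group q x f <-> exists a, f = phi a;
  color_sigma : forall i, is_sigma q x i (phi (g i));
  color_bichar : forall i j, chi (g i) (g j) = q i j }.

Definition ideal_gen (R : pzRingType) (F : R -> Prop) (r : R) : Prop :=
  exists (N : nat) (a u b : 'I_N -> R),
    (forall l, F (u l)) /\ r = \sum_(l < N) a l * u l * b l.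

(* [I] is generated by [s] monomials of degree at least 2, and by no proper
   subfamily of them. *)
Definition min_gen_by_monomials (s n : nat) (R : pzRingType) (x : 'I_n -> R)
    (I : R -> Prop) : Prop :=
  exists m : 'I_s -> {ffun 'I_n -> nat},
    (forall l, (2 <= \sum_(i < n) m l i)%N) /\
    (forall P : {set 'I_s},
      (forall r, I r <->
        ideal_gen (fun u => exists2 l, l \in P & u = monomial x (m l)) r)
      <-> P = [set: 'I_s]).

Section ColorDGA.
Variables (k : fieldType) (G : zmodType) (chi : alt_bicharacter G k).
Implicit Types t u v w : tridegree G.

Definition csign u v : k := (-1) ^ (u.1.1 * v.1.1) * chi u.2 v.2.

Record is_color_dga (B : algType k) (hom : tridegree G -> B -> Prop)
    (dif : B -> B) : Prop := {
  hom_sub0 : forall t, hom t 0;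
  hom_lin : forall t c a b, hom t a -> hom t b -> hom t (c *: a + b);
  hom_span : forall a, exists (r : seq (tridegree G)) (c : tridegree G -> B),
    (forall t, hom t (c t)) /\ a = \sum_(t <- r) c t;
  hom_free : forall (r : seq (tridegree G)) (c : tridegree G -> B),
    uniq r -> (forall t, hom t (c t)) -> \sum_(t <- r) c t = 0 ->
    forall t, t \in r -> c t = 0;
  hom_ge0 : forall t a, t.1.1 < 0 -> hom t a -> a = 0;
  hom_one : hom 0 1;
  hom_mul : forall t u a b, hom t a -> hom u b -> hom (t + u) (a * b);
  dif_add : {morph dif : a b / a + b};
  dif_hom : forall t a, hom t a -> hom (t + (-1, 0, 0)) (dif a);
  dif_dif : forall a, dif (dif a) = 0;
  dif_mul : forall t a b, hom t a ->
    dif (a * b) = dif a * b + (-1) ^ t.1.1 *: (a * dif b);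
  color_comm : forall t u a b, hom t a -> hom u b ->
    a * b = csign t u *: (b * a);
  color_odd_sq : forall t a, hom t a -> odd `|t.1.1|%N -> a * a = 0 }.

Record color_dga := ColorDGA {
  dga_alg :> algType k;
  hom : tridegree G -> dga_alg -> Prop;
  dif : dga_alg -> dga_alg;
  dgaP : is_color_dga hom dif }.

(* [x l] stands for the divided power x^(l); when |x| is odd ([o] holds) only
   x^(0) = 1 and x^(1) = x exist. *)
Definition dpow_ok (o : bool) (l : nat) : bool := o ==> (l < 2)%N.

(* the left C-submodule spanned by the divided powers of x *)
Definition adjoin (B : pzRingType) (o : bool) (C : B -> Prop) (x : nat -> B)
    (b : B) : Prop :=
  exists (N : nat) (c : nat -> B), (forall l, C (c l)) /\
    b = \sum_(l < N | dpow_ok o l) c l * x l.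

Definition dpow_free (B : pzRingType) (o : bool) (C : B -> Prop)
    (x : nat -> B) : Prop :=
  forall (N : nat) (c : nat -> B), (forall l, C (c l)) ->
    \sum_(l < N | dpow_ok o l) c l * x l = 0 ->
    forall l, (l < N)%N -> dpow_ok o l -> c l = 0.

Section AcyclicClosure.
Variables (S : algType k) (n : nat) (y : 'I_n -> S).
Variables (d : 'I_n -> nat) (g : 'I_n -> G).

Section Levels.
Variables (B : color_dga) (iota : S -> B).
Variables (num : nat -> nat) (var : nat -> nat -> nat -> B).

(* [var i m l] is the l-th divided power of the m-th variable of homological
   degree i+1, for m < num i. *)
Fixpoint adjoin_first (C : B -> Prop) (i m : nat) : B -> Prop :=
  if m is m'.+1 then adjoin (odd i.+1) (adjoin_first C i m') (var i m')
  else C.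

(* A<X_(<= i)> *)
Fixpoint level (i : nat) : B -> Prop :=
  if i is i'.+1 then adjoin_first (level i') i' (num i')
  else fun b => exists a, b = iota a.

(* the elements of homological degree i, not necessarily trihomogeneous *)
Definition hom_deg (i : nat) (b : B) : Prop :=
  exists (N : nat) (t : 'I_N -> tridegree G) (c : 'I_N -> B),
    (forall l, (t l).1.1 = i%:Z /\ hom (t l) (c l)) /\ b = \sum_(l < N) c l.

(* the cycles to be killed by the variables of homological degree i+1: those
   of A<X_(<= i)> of homological degree i if i > 0, and the augmentation
   ideal (y_1, ..., y_n) of A if i = 0 *)
Definition to_kill (i : nat) (z : B) : Prop :=
  if i is 0%N then
    exists2 a, ideal_gen (fun b => exists j, b = y j) a & z = iota a
  else [/\ level i z, hom_deg i z & dif z = 0].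

(* every such cycle is, modulo boundaries of A<X_(<= i)>, a combination of
   the boundaries of the variables indexed by P *)
Definition kills (i : nat) (P : {set 'I_(num i)}) : Prop :=
  forall z, to_kill i z -> exists (c : 'I_(num i) -> S) (w : B),
    [/\ level i w, hom_deg i.+1 w &
      z = \sum_(m in P) iota (c m) * dif (var i m 1) + dif w].

End Levels.

(* Acyclic closure of k over A = S, for S generated by [y] with y_i of degree
   (0, d_i, g_i), and augmentation S -> S/(y_1, ..., y_n).  S is noetherian,
   so each H_i(A<X_(<= i)>) is finitely generated and its minimal sets of
   generators are finite. *)
Record acyclic_closure_of := AcyclicClosure {
  ac_dga :> color_dga;
  ac_incl : {lrmorphism S -> ac_dga};
  ac_num : nat -> nat;
  ac_var : nat -> nat -> nat -> ac_dga;
  ac_deg : nat -> nat -> tridegree G;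
  ac_incl_inj : injective ac_incl;
  ac_incl_dif : forall a, dif (ac_incl a) = 0;
  ac_incl_hom : forall i, hom (0, (d i)%:Z, g i) (ac_incl (y i));
  ac_deg1 : forall i m, (m < ac_num i)%N -> (ac_deg i m).1.1 = i.+1%:Z;
  ac_var_hom : forall i m l, (m < ac_num i)%N -> dpow_ok (odd i.+1) l ->
    hom (ac_deg i m *+ l) (ac_var i m l);
  ac_var0 : forall i m, (m < ac_num i)%N -> ac_var i m 0 = 1;
  ac_varM : forall i m h l, (m < ac_num i)%N -> ~~ odd i.+1 ->
    ac_var i m h * ac_var i m l = ac_var i m (h + l)%N *+ 'C(h + l, h);
  ac_var_dif : forall i m l, (m < ac_num i)%N -> ~~ odd i.+1 ->
    dif (ac_var i m l.+1) = dif (ac_var i m 1) * ac_var i m l;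
  ac_var_free : forall i m, (m < ac_num i)%N ->
    dpow_free (odd i.+1)
      (adjoin_first ac_var (level ac_incl ac_num ac_var i) i m) (ac_var i m);
  ac_var_kill : forall i m, (m < ac_num i)%N ->
    to_kill ac_incl ac_num ac_var i (dif (ac_var i m 1));
  ac_var_min : forall i (P : {set 'I_(ac_num i)}),
    kills ac_incl ac_var P <-> P = [set: 'I_(ac_num i)];
  ac_union : forall b, exists i, level ac_incl ac_num ac_var i b }.

End AcyclicClosure.
End ColorDGA.

Record subspace (k : fieldType) (V : lmodType k) := Subspace {
  subspace_mem :> V -> Prop;
  subspace0 : subspace_mem 0;
  subspace_lin : forall c u v,
    subspace_mem u -> subspace_mem v -> subspace_mem (c *: u + v) }.

Section Subquotient.
Variables (k : fieldType) (V : lmodType k) (Z B : subspace V).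

Definition subspace_pred : {pred V} := fun v => `[< Z v >].

Lemma subspace_pred_closed : submod_closed subspace_pred.
Proof.
split=> [|c u v /asboolP Zu /asboolP Zv]; apply/asboolP.
  exact: subspace0.
exact: subspace_lin.
Qed.

HB.instance Definition _ :=
  GRing.isSubmodClosed.Build k V subspace_pred subspace_pred_closed.

Record sub_of := SubOf { sub_val : V; _ : sub_val \in subspace_pred }.

HB.instance Definition _ := [isSub for sub_val].
HB.instance Definition _ := [Choice of sub_of by <:].
HB.instance Definition _ := [SubChoice_isSubLmodule of sub_of by <:].

Lemma sub_ofP (z : sub_of) : Z (sub_val z).
Proof. exact/asboolP/(valP z). Qed.

Definition sub_of_mem (v : V) (Zv : Z v) : sub_of := SubOf (asboolT Zv).

Definition relator : {pred sub_of} := fun z => `[< B (sub_val z) >].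

Lemma relator_closed : submod_closed relator.
Proof.
split=> [|c u v /asboolP Bu /asboolP Bv]; apply/asboolP.
  exact: subspace0.
exact: (subspace_lin c Bu Bv).
Qed.

HB.instance Definition _ :=
  GRing.isSubmodClosed.Build k sub_of relator relator_closed.

Definition subquot : Type := Quotient.quot relator.

HB.instance Definition _ := GRing.Zmodule.on subquot.
HB.instance Definition _ := EqQuotient.on subquot.

Definition subquot_pi (u : sub_of) : subquot := \pi u.

Definition subquot_scale (c : k) (x : subquot) : subquot :=
  subquot_pi (c *: repr x).

Lemma subquot_reprK x : subquot_pi (repr x) = x.
Proof. exact: reprK. Qed.

Lemma subquot_piP u v :
  subquot_pi u = subquot_pi v <-> B (sub_val u - sub_val v).
Proof.
have e : (u - v \in relator) = (subquot_pi u == subquot_pi v).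
  exact: Quotient.idealrBE.
split=> [/eqP|Buv]; first by rewrite -e => /asboolP.
by apply/eqP; rewrite -e; apply/asboolP.
Qed.

Lemma subquot_piD u v : subquot_pi (u + v) = subquot_pi u + subquot_pi v.
Proof. by rewrite /subquot_pi piE. Qed.

Lemma subquot_piZ c u : subquot_scale c (subquot_pi u) = subquot_pi (c *: u).
Proof.
apply/subquot_piP; have /subquot_piP := subquot_reprK (subquot_pi u).
move=> Bu; have := subspace_lin c Bu (subspace0 B).
by rewrite addr0 scalerBr.
Qed.

Lemma subquot_ind (P : subquot -> Prop) :
  (forall u, P (subquot_pi u)) -> forall x, P x.
Proof. by move=> Ppi x; rewrite -(subquot_reprK x). Qed.

Lemma subquot_scaleA a b x :
  subquot_scale a (subquot_scale b x) = subquot_scale (a * b) x.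
Proof.
by elim/subquot_ind: x => u; rewrite 2!(subquot_piZ _ u) subquot_piZ scalerA.
Qed.

Lemma subquot_scale1 : left_id 1 subquot_scale.
Proof. by elim/subquot_ind=> u; rewrite (subquot_piZ _ u) scale1r. Qed.

Lemma subquot_scaleDr : right_distributive subquot_scale +%R.
Proof.
move=> c; elim/subquot_ind=> u; elim/subquot_ind=> v.
by rewrite -subquot_piD 3!subquot_piZ scalerDr subquot_piD.
Qed.

Lemma subquot_scaleDl x : {morph subquot_scale^~ x : a b / a + b}.
Proof.
by elim/subquot_ind: x => u a b; rewrite 3!subquot_piZ scalerDl subquot_piD.
Qed.

HB.instance Definition _ := GRing.Zmodule_isLmodule.Build k subquot
  subquot_scaleA subquot_scale1 subquot_scaleDr subquot_scaleDl.

Definition subquot_class (v : V) (Zv : Z v) : subquot :=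
  subquot_pi (sub_of_mem Zv).

Definition subquot_repr (x : subquot) : V := sub_val (repr x).

Lemma subquot_reprP x : Z (subquot_repr x).
Proof. exact: sub_ofP. Qed.

End Subquotient.

(* The data of a graded color Lie algebra, given by its components L^i_g.  The
   square is an operation on each L^i_g with i odd: it is not defined on sums
   of elements of different colors.  The Lie axioms are not recorded, as
   isomorphisms only involve the data. *)
Record graded_color_lie (k : fieldType) (G : zmodType) := GradedColorLie {
  lie_comp :> nat -> G -> lmodType k;
  lie_br : forall i j g h,
    lie_comp i g -> lie_comp j h -> lie_comp (i + j)%N (g + h);
  lie_sq : forall i g, odd i -> lie_comp i g -> lie_comp (i + i)%N (g + g) }.

Definition lie_iso (k : fieldType) (G : zmodType)
    (L M : graded_color_lie k G) : Prop :=
  exists f : forall i g, {linear L i g -> M i g},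
    [/\ forall i g, bijective (f i g),
        forall i j g h (a : L i g) (b : L j h),
          f _ _ (lie_br a b) = lie_br (f _ _ a) (f _ _ b) &
        forall i g (oi : odd i) (a : L i g),
          f _ _ (lie_sq oi a) = lie_sq oi (f _ _ a)].

Section DegreeGe2.
Variables (k : fieldType) (G : zmodType) (L : graded_color_lie k G).

Definition ge2_comp (i : nat) (g : G) : lmodType k :=
  match i with 0 | 1 => 'rV[k]_0 | _ => L i g end.

Definition ge2_br i j g h :
    ge2_comp i g -> ge2_comp j h -> ge2_comp (i + j)%N (g + h) :=
  match i, j with
  | i'.+2, j'.+2 => fun (a : L i'.+2 g) (b : L j'.+2 h) => lie_br a b
  | _, _ => fun _ _ => 0
  end.

Definition ge2_sq i g :
    odd i -> ge2_comp i g -> ge2_comp (i + i)%N (g + g) :=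
  match i with
  | i'.+2 => fun oi (a : L i'.+2 g) => lie_sq oi a
  | _ => fun _ _ => 0
  end.

Definition lie_ge2 : graded_color_lie k G :=
  GradedColorLie (@ge2_br) (@ge2_sq).

End DegreeGe2.

Lemma signz_absz (F : fieldType) (i : int) :
  (-1 : F) ^ i = (-1) ^+ odd `|i|%N.
Proof.
case: i => m; rewrite signr_odd //.
by rewrite -[LHS]/(((-1) ^+ m.+1)^-1) -exprVn invrN1.
Qed.

Lemma odd_abszD (i j : int) : odd `|(i + j)%R|%N = odd `|i|%N (+) odd `|j|%N.
Proof.
apply/eqP; rewrite -(inj_eq (@signr_inj rat)) signr_addb -!signz_absz.
by rewrite expfzDr ?oppr_eq0 ?oner_neq0.
Qed.

Section Signs.
Variables (k : fieldType) (G : zmodType) (chi : alt_bicharacter G k).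
Implicit Types (u v w : tridegree G) (i j : int).

Let N1_neq0 : (-1 : k) != 0. Proof. by rewrite oppr_eq0 oner_neq0. Qed.

Lemma signzD i j : (-1 : k) ^ (i + j) = (-1) ^ i * (-1) ^ j.
Proof. exact: expfzDr. Qed.

Lemma signzK i : (-1 : k) ^ i * (-1) ^ i = 1.
Proof. by rewrite -expfzMl mulrNN mulr1 exp1rz. Qed.

Lemma bichar0r g : chi g 0 = 1.
Proof.
by apply: (mulfI (bichar_neq0 chi g 0)); rewrite -bicharDr addr0 mulr1.
Qed.

Lemma bichar0l g : chi 0 g = 1.
Proof.
by apply: (mulfI (bichar_neq0 chi 0 g)); rewrite -bicharDl addr0 mulr1.
Qed.

Lemma bichar_swap g h : chi g h * chi h g = 1.
Proof.
by have := bichar_alt chi (g + h); rewrite bicharDl !bicharDr !bichar_alt mul1r mulr1.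
Qed.

Lemma csignDl u v w : csign chi (u + v) w = csign chi u w * csign chi v w.
Proof. by rewrite /csign /= mulrDl signzD bicharDl mulrACA. Qed.

Lemma csignDr u v w : csign chi u (v + w) = csign chi u v * csign chi u w.
Proof. by rewrite /csign /= mulrDr signzD bicharDr mulrACA. Qed.

Lemma csign_swap u v : csign chi u v * csign chi v u = 1.
Proof. by rewrite /csign mulrACA bichar_swap mulr1 [v.1.1 * _]mulrC signzK. Qed.

Lemma csign0r u : csign chi u 0 = 1.
Proof. by rewrite /csign /= mulr0 expr0z bichar0r mulr1. Qed.

Lemma csign_even u (m : nat) : u.1.1 = m%:Z -> ~~ odd m -> csign chi u u = 1.
Proof.
move=> um om; rewrite /csign bichar_alt mulr1 um -exprz_exp.
have -> : (-1 : k) ^ m%:Z = 1.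
  by rewrite -[LHS]/((-1) ^+ m) -signr_odd (negbTE om) expr0.
by rewrite exp1rz.
Qed.

Lemma csign_odd u : odd `|u.1.1|%N -> csign chi u u = -1.
Proof.
by move=> ou; rewrite /csign bichar_alt mulr1 -exprz_exp !(signz_absz, ou).
Qed.

End Signs.

Section HomotopyLie.
Variables (k : fieldType) (G : zmodType) (chi : alt_bicharacter G k).
Variables (S : algType k) (n : nat) (y : 'I_n -> S).
Variables (d : 'I_n -> nat) (g : 'I_n -> G).
Variable B : acyclic_closure_of chi y d g.
Implicit Types (D E : B -> B) (i j : int) (a b : G).

(* trihomogeneous A-linear color derivations of A<X> *)
Record color_derivation (u : tridegree G) (D : B -> B) : Prop := {
  der_add : {morph D : x z / x + z};
  der_hom : forall t x, hom t x -> hom (t + u) (D x);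
  der_incl : forall s, D (ac_incl B s) = 0;
  der_mul : forall t x z, hom t x ->
    D (x * z) = D x * z + csign chi u t *: (x * D z);
  der_dpow : forall r m l, (m < ac_num B r)%N -> ~~ odd r.+1 ->
    D (ac_var B r m l.+1) = D (ac_var B r m 1) * ac_var B r m l }.

(* the component of Der_A(A<X>, A<X>) of homological degree i and color a:
   finite sums of trihomogeneous derivations of varying internal degree *)
Inductive derivation (i : int) (a : G) : (B -> B) -> Prop :=
| derivation0 : derivation i a 0
| derivationD e D E : color_derivation (i, e, a) D -> derivation i a E ->
    derivation i a (D + E).

(* [D, E] for D of degree (i, a) and E of degree (j, b) *)
Definition der_br i j a b (D E : B -> B) : B -> B :=
  D \o E - ((-1) ^ (i * j) * chi a b) *: (E \o D).

Definition der_dif i (D : B -> B) : B -> B :=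
  dif (c := B) \o D - (-1) ^ i *: (D \o dif (c := B)).

Lemma color_derivationZ u D c x : color_derivation u D -> D (c *: x) = c *: D x.
Proof.
move=> dD; rewrite -[x]mul1r scalerAl (der_mul dD (t := 0)); last first.
  rewrite -[c *: 1]addr0; apply: (hom_lin (dgaP B)) (hom_sub0 (dgaP B) 0).
  exact: (hom_one (dgaP B)).
have -> : (c *: 1 : B) = ac_incl B (c *: 1) by rewrite linearZ /= rmorph1.
rewrite (der_incl dD) mul0r add0r csign0r scale1r linearZ /= rmorph1.
by rewrite -scalerAl !mul1r.
Qed.

Lemma derivation_lin i a D c x z :
  derivation i a D -> D (c *: x + z) = c *: D x + D z.
Proof.
elim=> [|e D1 E dD1 _ IH]; first by rewrite /= scaler0 addr0.
rewrite !fctE IH (der_add dD1) (color_derivationZ _ _ dD1) scalerDr.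
by rewrite addrACA.
Qed.

Lemma br_mul_aux (V : lmodType k) (p p' q r : k) (P1 P2 P3 P4 P5 P6 : V) :
  p * p' = 1 ->
  P1 + (q * p) *: P2 + r *: (P3 + q *: P4)
    - p *: (P5 + (r * p') *: P3 + q *: (P2 + r *: P6))
  = P1 - p *: P5 + (q * r) *: (P4 - p *: P6).
Proof.
move=> pp; rewrite !scalerDr !scalerN !scalerA mulrCA pp mulr1.
rewrite [r * q]mulrC [p * q]mulrC [q * p * r]mulrAC.
apply/eqP; rewrite subr_eq; apply/eqP; symmetry.
by rewrite [LHS](AC ((2*2)*(2*2)) ((1*7*(6*3))*(2*5)*(4*8))) /= !addNr !addr0.
Qed.

Lemma derivation_at0 i a D : derivation i a D -> D 0 = 0.
Proof.
by move/(derivation_lin (-1) 0 0); rewrite scaler0 addr0 scaleN1r addNr.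
Qed.

Lemma derivation_of_color i e a D :
  color_derivation (i, e, a) D -> derivation i a D.
Proof.
by move=> dD; rewrite -[D]addr0; apply: derivationD dD (derivation0 i a).
Qed.

Lemma derivation_add i a D E :
  derivation i a D -> derivation i a E -> derivation i a (D + E).
Proof.
move=> dD dE; elim: dD => [|e D1 D2 dD1 _ IH]; first by rewrite add0r.
by rewrite -addrA; apply: derivationD dD1 IH.
Qed.

Lemma color_derivation_scale u c D :
  color_derivation u D -> color_derivation u (c *: D).
Proof.
move=> dD; split=> [x z|t x hx|s|t x z hx|r m l rm or] /=.
- by rewrite !fctE (der_add dD) scalerDr.
- rewrite -[(c *: D) x]addr0; apply: (hom_lin (dgaP B)).
    exact: der_hom dD _ _ hx.
  exact: (hom_sub0 (dgaP B)).
- by rewrite !fctE (der_incl dD) scaler0.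
- rewrite !fctE (der_mul dD _ hx) scalerDr scalerAl.
  by rewrite -scalerAr !scalerA mulrC.
- by rewrite !fctE (der_dpow dD) // scalerAl.
Qed.

Lemma derivation_scale i a c D : derivation i a D -> derivation i a (c *: D).
Proof.
elim=> [|e D1 E dD1 _ IH]; first by rewrite scaler0; apply: derivation0.
by rewrite scalerDr; apply: derivationD (color_derivation_scale c dD1) IH.
Qed.

Lemma color_derivation_br i e a j e' b D E :
  color_derivation (i, e, a) D -> color_derivation (j, e', b) E ->
  color_derivation (i + j, e + e', a + b) (der_br i j a b D E).
Proof.
set u := (i, e, a); set v := (j, e', b) => dD dE.
have brE x : der_br i j a b D E x = D (E x) - csign chi u v *: E (D x) by [].
split=> [x z|t x hx|s|t x z hx|r m l rm or].
- rewrite !brE (der_add dE) (der_add dD) (der_add dD) (der_add dE).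
  by rewrite scalerDr opprD addrACA.
- rewrite brE [D (E x) - _]addrC -scaleNr.
  apply: (hom_lin (dgaP B)).
    have := der_hom dE (der_hom dD hx); by rewrite -addrA.
  have := der_hom dD (der_hom dE hx); by rewrite -addrA [v + u]addrC.
- rewrite brE (der_incl dD) (der_incl dE).
  have := der_incl dD 0; have := der_incl dE 0; rewrite rmorph0 => E0 D0.
  by rewrite D0 E0 scaler0 subr0.
- have -> : (i + j, e + e', a + b) = u + v by [].
  rewrite !brE (der_mul dE _ hx) (der_mul dD _ hx).
  rewrite (der_add dD) (der_add dE) !(color_derivationZ _ _ dD).
  rewrite !(color_derivationZ _ _ dE).
  rewrite (der_mul dD _ (der_hom dE hx)) (der_mul dE _ (der_hom dD hx)).
  rewrite (der_mul dD _ hx) (der_mul dE _ hx) !csignDr !csignDl.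
  rewrite mulrBl mulrBr -scalerAl -scalerAr.
  exact: br_mul_aux (csign_swap _ _ _).
- have hv := ac_var_hom rm (l := 1%N) (implybT _); rewrite mulr1n in hv.
  set t := ac_deg B r m in hv; set x := ac_var B r m in hv *.
  have ctt : csign chi t t = 1.
    exact: csign_even (ac_deg1 rm) or.
  rewrite !brE (der_dpow dE l rm or) (der_dpow dD l rm or).
  rewrite (der_mul dD _ (der_hom dE hv)) (der_mul dE _ (der_hom dD hv)).
  rewrite mulrBl scalerDr -scalerAl opprD addrACA scalerA -[RHS]addr0.
  congr (_ + _); case: l => [|l].
    rewrite /x (ac_var0 rm) -(rmorph1 (ac_incl B)) (der_incl dD) (der_incl dE).
    by rewrite !mulr0 !scaler0 subr0.
  rewrite (der_dpow dD l rm or) (der_dpow dE l rm or).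
  rewrite (mulrA (E (x 1))) (mulrA (D (x 1))).
  rewrite (color_comm (dgaP B) (der_hom dE hv) (der_hom dD hv)).
  rewrite -scalerAl scalerA -scalerBl -[RHS](scale0r (D (x 1) * E (x 1) * x l)).
  congr (_ *: _); apply/eqP; rewrite subr_eq0; apply/eqP.
  rewrite (csignDr chi u t v) (csignDl chi t v) (csignDr chi t t u) ctt mul1r.
  by rewrite mulrACA csign_swap mul1r (csignDr chi v t u).
Qed.

Lemma derivation_br i a j b D E : derivation i a D -> derivation j b E ->
  derivation (i + j) (a + b) (der_br i j a b D E).
Proof.
move=> dD; elim=> [|e' E1 E2 dE1 _ IH].
  have -> : der_br i j a b D 0 = 0; last exact: derivation0.
  apply/funext=> x; rewrite /der_br !fctE (derivation_at0 dD).
  by rewrite scaler0 subr0.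
have -> : der_br i j a b D (E1 + E2) = der_br i j a b D E1 + der_br i j a b D E2.
  apply/funext=> x; have := derivation_lin 1 (E1 x) (E2 x) dD.
  rewrite !scale1r /der_br !fctE => ->.
  by rewrite scalerDr opprD addrACA.
apply: derivation_add IH; elim: dD => [|e D1 D2 dD1 _ IH].
  have -> : der_br i j a b 0 E1 = 0; last exact: derivation0.
  apply/funext=> x.
  rewrite /der_br !fctE (derivation_at0 (derivation_of_color dE1)).
  by rewrite scaler0 subr0.
have -> : der_br i j a b (D1 + D2) E1 = der_br i j a b D1 E1 + der_br i j a b D2 E1.
  apply/funext=> x.
  have := derivation_lin 1 (D1 x) (D2 x) (derivation_of_color dE1).
  rewrite !scale1r /der_br !fctE => ->.
  by rewrite scalerDr opprD addrACA.
exact: derivation_add (derivation_of_color (color_derivation_br dD1 dE1)) IH.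
Qed.

Lemma color_derivation_sq i e a D : odd `|i|%N ->
  color_derivation (i, e, a) D ->
  color_derivation (i + i, e + e, a + a) (D \o D).
Proof.
set u := (i, e, a) => oi dD; have cuu : csign chi u u = -1.
  exact: (@csign_odd _ _ chi u).
have -> : (i + i, e + e, a + a) = u + u by [].
split=> [x z|t x hx|s|t x z hx|r m l rm or] /=.
- by rewrite !(der_add dD).
- by have := der_hom dD (der_hom dD hx); rewrite -addrA.
- by have := der_incl dD 0; rewrite rmorph0 (der_incl dD).
- rewrite (der_mul dD _ hx) (der_add dD) (color_derivationZ _ _ dD).
  rewrite (der_mul dD _ (der_hom dD hx)) (der_mul dD _ hx).
  rewrite csignDr csignDl cuu mulrN1 scaleNr scalerDr addrA subrK scalerA.
  by [].
- have hv := ac_var_hom rm (l := 1%N) (implybT _); rewrite mulr1n in hv.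
  set t := ac_deg B r m in hv; set x := ac_var B r m in hv *.
  rewrite (der_dpow dD l rm or) (der_mul dD _ (der_hom dD hv)).
  rewrite -[RHS]addr0; congr (_ + _); case: l => [|l].
    rewrite /x (ac_var0 rm) -(rmorph1 (ac_incl B)) (der_incl dD).
    by rewrite mulr0 scaler0.
  rewrite (der_dpow dD l rm or) mulrA.
  rewrite (color_odd_sq (dgaP B) (der_hom dD hv)) ?mul0r ?scaler0 //.
  by rewrite odd_abszD (ac_deg1 rm) oi (negbTE or).
Qed.

Lemma derivation_sq i a D : odd `|i|%N ->
  derivation i a D -> derivation (i + i) (a + a) (D \o D).
Proof.
move=> oi; elim=> [|e D1 D2 dD1 dD2 IH].
  by have -> : (0 : B -> B) \o 0 = 0 by []; apply: derivation0.
have dD1' := derivation_of_color dD1.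
have cii : (-1) ^ (i * i) * chi a a = -1.
  exact: (@csign_odd _ _ chi (i, 0, a)).
have -> : (D1 + D2) \o (D1 + D2) =
    D1 \o D1 + (der_br i i a a D1 D2 + (D2 \o D2)).
  apply/funext=> x; have := derivation_lin 1 (D1 x) (D2 x) dD1'.
  have := derivation_lin 1 (D1 x) (D2 x) dD2.
  rewrite /der_br cii scaleN1r opprK !fctE !scale1r => -> ->.
  by rewrite -!addrA.
apply: derivation_add (derivation_of_color (color_derivation_sq oi dD1)) _.
exact: derivation_add (derivation_br dD1' dD2) IH.
Qed.

Lemma color_derivation_dif : color_derivation (-1, 0, 0) (dif (c := B)).
Proof.
split=> [x z|t x hx|u|t x z hx|r m l rm or].
- exact: dif_add (dgaP B) x z.
- by have := dif_hom (dgaP B) hx.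
- exact: ac_incl_dif.
- rewrite (dif_mul (dgaP B) _ hx) /csign /= bichar0l mulr1 mulN1r.
  by rewrite !signz_absz abszN.
- exact: ac_var_dif.
Qed.

Lemma derivation_dif : derivation (-1) 0 (dif (c := B)).
Proof. exact: derivation_of_color color_derivation_dif. Qed.

Lemma der_difE i a D : der_dif i D = der_br (-1) i 0 a (dif (c := B)) D.
Proof.
by rewrite /der_br bichar0l mulr1 mulN1r /der_dif !signz_absz abszN.
Qed.

(* cohomological degree i is homological degree -i *)
Definition is_cocycle (i : nat) (a : G) (D : B -> B) : Prop :=
  derivation (- i%:Z) a D /\ der_dif (- i%:Z) D = 0.

Definition is_coboundary (i : nat) (a : G) (D : B -> B) : Prop :=
  exists2 E, derivation (1 - i%:Z) a E & D = der_dif (1 - i%:Z) E.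

Lemma der_dif_lin i c D E :
  der_dif i (c *: D + E) = c *: der_dif i D + der_dif i E.
Proof.
apply/funext=> x; rewrite /der_dif !fctE.
rewrite (derivation_lin _ _ _ derivation_dif) scalerDr opprD addrACA.
by rewrite scalerBr !scalerA mulrC.
Qed.

Lemma der_dif0 i : der_dif i 0 = 0.
Proof.
by have := der_dif_lin i (-1) 0 0; rewrite scaler0 addr0 scaleN1r addNr.
Qed.

Lemma is_cocycle0 (i : nat) a : is_cocycle i a 0.
Proof. by split; [apply: derivation0 | apply: der_dif0]. Qed.

Lemma is_cocycle_lin (i : nat) a c D E :
  is_cocycle i a D -> is_cocycle i a E -> is_cocycle i a (c *: D + E).
Proof.
move=> [dD D0] [dE E0]; split; last by rewrite der_dif_lin D0 E0 scaler0 addr0.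
exact: derivation_add (derivation_scale c dD) dE.
Qed.

Lemma is_coboundary0 (i : nat) a : is_coboundary i a 0.
Proof. by exists 0; [apply: derivation0 | rewrite der_dif0]. Qed.

Lemma is_coboundary_lin (i : nat) a c D E :
  is_coboundary i a D -> is_coboundary i a E -> is_coboundary i a (c *: D + E).
Proof.
move=> [D' dD ->] [E' dE ->]; exists (c *: D' + E'); last by rewrite der_dif_lin.
exact: derivation_add (derivation_scale c dD) dE.
Qed.

Definition cocycles (i : nat) a := Subspace (is_cocycle0 i a) (@is_cocycle_lin i a).
Definition coboundaries (i : nat) a :=
  Subspace (is_coboundary0 i a) (@is_coboundary_lin i a).

Lemma der_dif_comm i D x : der_dif i D = 0 -> dif (D x) = (-1) ^ i *: D (dif x).
Proof. by move/(congr1 (fun f => f x))/subr0_eq. Qed.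

Lemma is_cocycle_br (i j : nat) a b D E : is_cocycle i a D -> is_cocycle j b E ->
  is_cocycle (i + j) (a + b) (der_br (- i%:Z) (- j%:Z) a b D E).
Proof.
rewrite /is_cocycle PoszD opprD => -[dD D0] [dE E0].
split; first exact: derivation_br.
apply/funext=> x; apply/eqP; rewrite /der_dif /der_br !fctE subr_eq0; apply/eqP.
rewrite -scaleNr addrC (derivation_lin _ _ _ derivation_dif).
have EZ c z : E (c *: z) = c *: E z.
  by rewrite -[c *: z]addr0 (derivation_lin _ _ _ dE) (derivation_at0 dE) addr0.
have DZ c z : D (c *: z) = c *: D z.
  by rewrite -[c *: z]addr0 (derivation_lin _ _ _ dD) (derivation_at0 dD) addr0.
rewrite !(der_dif_comm _ D0, der_dif_comm _ E0) EZ DZ.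
move: (D (E _)) (E (D _)) => P Q; rewrite signzD scalerBr !scalerA -scaleNr.
rewrite addrC; congr (_ + _); congr (_ *: _).
by rewrite -mulrA mulNr [_ * ((-1) ^ _ * _)]mulrC [(-1) ^ (- j%:Z) * _]mulrC.
Qed.

Lemma is_cocycle_sq (i : nat) a D : odd i -> is_cocycle i a D ->
  is_cocycle (i + i) (a + a) (D \o D).
Proof.
rewrite /is_cocycle PoszD opprD => oi [dD D0].
split; first by apply: derivation_sq => //; rewrite abszN.
apply/funext=> x; apply/eqP; rewrite /der_dif !fctE subr_eq0; apply/eqP.
have DZ c z : D (c *: z) = c *: D z.
  by rewrite -[c *: z]addr0 (derivation_lin _ _ _ dD) (derivation_at0 dD) addr0.
by rewrite !(der_dif_comm _ D0) DZ scalerA signzD.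
Qed.

(* The induced bracket and square are computed on chosen representatives; for
   an acyclic closure, the resulting classes do not depend on the choice. *)
Definition homotopy_comp (i : nat) (a : G) : lmodType k :=
  subquot (cocycles i a) (coboundaries i a).

Definition homotopy_br (i j : nat) a b (x : homotopy_comp i a) (z : homotopy_comp j b) :
    homotopy_comp (i + j)%N (a + b) :=
  subquot_class (Z := cocycles (i + j) (a + b)) (coboundaries (i + j) (a + b))
    (is_cocycle_br (subquot_reprP x) (subquot_reprP z)).

Definition homotopy_sq (i : nat) a (oi : odd i) (x : homotopy_comp i a) :
    homotopy_comp (i + i)%N (a + a) :=
  subquot_class (Z := cocycles (i + i) (a + a)) (coboundaries (i + i) (a + a))
    (is_cocycle_sq oi (subquot_reprP x)).

Definition homotopy_lie : graded_color_lie k G :=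
  GradedColorLie homotopy_br homotopy_sq.

End HomotopyLie.

(* S = k_q[x]/I with I minimally generated by [s] monomials of degree at
   least 2, where k_q[x] has group of colors [G] and bicharacter [chi]. *)
Record monomial_quotient (k : fieldType) (s : nat) (G : zmodType)
    (chi : alt_bicharacter G k) := MonomialQuotient {
  mq_n : nat;
  mq_q : 'M[k]_mq_n;
  mq_skew : skew_matrix mq_q;
  mq_R : algType k;
  mq_x : 'I_mq_n -> mq_R;
  mq_poly : skew_polynomial_ring mq_q mq_x;
  mq_phi : G -> mq_R -> mq_R;
  mq_g : 'I_mq_n -> G;
  mq_colors : color_identification chi mq_q mq_x mq_phi mq_g;
  mq_d : 'I_mq_n -> nat;
  mq_d_gt0 : forall i, (0 < mq_d i)%N;
  mq_I : mq_R -> Prop;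
  mq_min_gen : min_gen_by_monomials s mq_x mq_I;
  mq_S : algType k;
  mq_proj : {lrmorphism mq_R -> mq_S};
  mq_proj_surj : forall a, exists f, a = mq_proj f;
  mq_proj_ker : forall f, mq_proj f = 0 <-> mq_I f }.

Definition acyclic_closure (k : fieldType) (s : nat) (G : zmodType)
    (chi : alt_bicharacter G k) (Q : monomial_quotient s chi) :=
  acyclic_closure_of chi (fun i => mq_proj Q (mq_x i)) (@mq_d _ _ _ _ Q)
    (@mq_g _ _ _ _ Q).

Definition pi_ge2 (k : fieldType) (s : nat) (G : zmodType)
    (chi : alt_bicharacter G k) (Q : monomial_quotient s chi)
    (X : acyclic_closure Q) : graded_color_lie k G :=
  lie_ge2 (homotopy_lie X).

(* Main.v *)
(** Writing the generators as [m_l = prod_(A containing l) w_A], where [w_A]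
  collects the powers of variables dividing exactly the [m_l] with [l] in [A],
  the [w_A] are pairwise coprime, and the Koszul-type relations among the [m_l]
  only depend on the set [D] of the [A] with [w_A <> 1] and on the colors of the
  [w_A].  Over the skew polynomial ring in indeterminates indexed by [D], with
  these colors, the squarefree monomials [prod_(A containing l) y_A] generate an
  ideal [U]; the Koszul complex [Ku] of the quotient by [U] maps to the Koszul
  complex of [k_q[x]/I] by a quasi-isomorphism: this is checked on principal
  monomial submodules and propagated to unions by Mayer-Vietoris.

  Adjoining to [Ku] variables that kill the homology in degrees [1, 2, ...] gives
  a common minimal model [W] of all the acyclic closures with the same invariant:
  by an exchange argument, the variables of each closure can be replaced by the
  images of those of [W].  A class in [pi^i] is determined by the augmented values
  of a representing derivation on the variables of degree [i]; every derivation is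
  homotopic, along [W -> A<X>], to a derivation of [W] with the same values, and a
  homotopy does not contribute to the augmented values of composites.  Hence
  brackets and squares are computed in [W].  As there are finitely many [A] and
  [G] is finite, the invariant takes finitely many values. *)

Require Import Defs.
From HB Require Import structures.
From mathcomp Require Import all_boot all_order all_algebra.
From mathcomp Require Import boolp functions.
From mathcomp Require Import ring zify.
Import Defs.

Set Implicit Arguments.
Unset Strict Implicit.
Unset Printing Implicit Defensive.

Import Order.TTheory GRing.Theory Num.Theory.
Local Open Scope ring_scope.

(** Three obstacles shape the proof. The substitution sending the indeterminate of A to w_A need not
    be flat; but it carries lcms of the squarefree generators to lcms of the corresponding m_l, and
    lcm-closed families of principal ideals are all that Mayer-Vietoris asks for. Next, in positive
    characteristic an even variable can be exchanged for another element only if that element has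
    divided powers, and these must be respected by every derivation of A<X>, not only by the
    differential; hence the care about families of divided powers that are stable under all the
    operations of the exchange. Finally, the number of indeterminates, and with it the dimension of
    pi^1, is not bounded by the invariant: the whole of A<X_1> is therefore treated as a base,
    replaced by the Koszul complex, and variables are compared from degree 2 on. Two closures at a
    time suffice, and for a given bracket or square finitely many stages of the model. *)

Module GradedToolkit.

(** * Homogeneous components, twists and morphisms of color DG algebras *)

Lemma sum_supp (I : eqType) (V : zmodType) (r R : seq I) (F : I -> V) :
 uniq r -> uniq R -> {subset r <= R} ->
 (forall i, i \notin r -> F i = 0) -> \sum_(i <- R) F i = \sum_(i <- r) F i.
Proof.
move=> ur uR sub F0; rewrite (bigID (mem r)) /= [X in _ + X]big1 ?addr0 //.
rewrite -big_filter; apply: perm_big; apply: uniq_perm => //; first exact: filter_uniq.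
by move=> i; rewrite mem_filter andb_idr //; apply: sub.
Qed.

Lemma sum_supp2 (I : eqType) (V : zmodType) (r R : seq I) (F : I -> V) :
 uniq r -> uniq R -> (forall i, i \notin r -> F i = 0) ->
 (forall i, i \notin R -> F i = 0) -> \sum_(i <- R) F i = \sum_(i <- r) F i.
Proof.
move=> ur uR F0 F1; have uU := undup_uniq (r ++ R).
rewrite -(sum_supp ur uU) => [|i ir|//]; last by rewrite mem_undup mem_cat ir.
rewrite -(sum_supp uR uU) => // i iR; by rewrite mem_undup mem_cat iR orbT.
Qed.

Section Toolkit.
Variables (k : fieldType) (G : zmodType) (chi : alt_bicharacter G k).
Notation T := (tridegree G).

Lemma tdown_up : (-1, 0, 0) + (1, 0, 0) = 0 :> T.
Proof. by congr (_, _, _); rewrite /= ?addr0. Qed.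
Lemma tup_down : (1, 0, 0) + (-1, 0, 0) = 0 :> T.
Proof. by rewrite addrC tdown_up. Qed.

Implicit Types A B : color_dga chi.

Section One.
Variable A : color_dga chi.
Implicit Types (a b : A) (t u : T).

Lemma hom0 t : hom t (0 : A). Proof. exact: (hom_sub0 (dgaP A)). Qed.
Lemma homL t c a b : hom t a -> hom t b -> hom t (c *: a + b).
Proof. exact: (hom_lin (dgaP A)). Qed.
Lemma homZ t c a : hom t a -> hom t (c *: a).
Proof. by move=> ha; rewrite -[c *: a]addr0; apply: homL => //; apply: hom0. Qed.
Lemma homD t a b : hom t a -> hom t b -> hom t (a + b).
Proof. by move=> ha hb; rewrite -[a]scale1r; apply: homL. Qed.
Lemma homN t a : hom t a -> hom t (- a).
Proof. by rewrite -scaleN1r; apply: homZ. Qed.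
Lemma homB t a b : hom t a -> hom t b -> hom t (a - b).
Proof. by move=> ha hb; apply: homD => //; apply: homN. Qed.
Lemma hom_sum t (I : Type) (r : seq I) (P : pred I) (F : I -> A) :
 (forall i, P i -> hom t (F i)) -> hom t (\sum_(i <- r | P i) F i).
Proof. by move=> h; elim/big_ind: _ => //; [exact: hom0 | exact: homD]. Qed.
Lemma homMn t a n : hom t a -> hom t (a *+ n).
Proof. by move=> h; rewrite -scaler_nat; apply: homZ. Qed.
Lemma homM t u a b : hom t a -> hom u b -> hom (t + u) (a * b).
Proof. exact: (hom_mul (dgaP A)). Qed.
Lemma hom1 : hom 0 (1 : A). Proof. exact: (hom_one (dgaP A)). Qed.
Lemma homC c : hom 0 (c *: (1 : A)). Proof. exact: homZ hom1. Qed.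
Lemma hom_dif t a : hom t a -> hom (t + (-1, 0, 0)) (dif a).
Proof. exact: (dif_hom (dgaP A)). Qed.
Lemma hom_neg t a : t.1.1 < 0 -> hom t a -> a = 0.
Proof. exact: (hom_ge0 (dgaP A)). Qed.

(** The list given by [hom_span] may repeat a degree; components of equal degree are merged, so that
    it becomes duplicate-free. *)
Lemma homogeneous_decomposition a : exists p : seq T * (T -> A),
 [/\ uniq p.1, forall t, hom t (p.2 t) & a = \sum_(t <- p.1) p.2 t].
Proof.
have [r [c [hc ->]]] := hom_span (dgaP A) a.
elim: r => [|t r [[s d] /= [us hd es]]].
 by exists ([::], fun=> 0) => /=; split=> //; [move=> t; apply: hom0 | rewrite !big_nil].
rewrite big_cons es; case: (boolP (t \in s)) => ts.
 exists (s, fun u => if u == t then c t + d t else d u); split=> //= [u|].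
  by case: eqP => [->|_] //; apply: homD.
 rewrite [RHS](bigD1_seq t) //= eqxx (bigD1_seq t) //= addrA; congr (_ + _).
 by apply: eq_bigr => u /negbTE ->.
exists (t :: s, fun u => if u == t then c t else d u); split=> /= [|u|].
- by rewrite ts us.
- by case: eqP => [->|_].
rewrite big_cons eqxx; congr (_ + _); rewrite !big_seq.
by apply: eq_bigr => u us'; case: eqP us' ts => // -> ->.
Qed.

Definition dec a : seq T * (T -> A) := projT1 (cid (homogeneous_decomposition a)).
Definition dsupp a : seq T := (dec a).1.
Definition prj t a : A := if t \in dsupp a then (dec a).2 t else 0.

Lemma dsupp_uniq a : uniq (dsupp a).
Proof. by rewrite /dsupp /dec; case: cid => p []. Qed.

Lemma hom_prj t a : hom t (prj t a).
Proof.
rewrite /prj; case: ifP => _; last exact: hom0.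
by rewrite /dec; case: cid => p [].
Qed.

Lemma prj_out t a : t \notin dsupp a -> prj t a = 0.
Proof. by rewrite /prj => /negbTE ->. Qed.

Lemma sum_prj_dsupp a : \sum_(t <- dsupp a) prj t a = a.
Proof.
rewrite [RHS](_ : a = \sum_(t <- dsupp a) (dec a).2 t).
 by rewrite !big_seq; apply: eq_bigr => t ts; rewrite /prj ts.
by rewrite /dsupp /dec; case: cid => p [].
Qed.

Lemma sum_prj a R : uniq R -> (forall t, t \notin R -> prj t a = 0) ->
 \sum_(t <- R) prj t a = a.
Proof.
move=> uR R0; rewrite -[RHS]sum_prj_dsupp; apply: sum_supp2 => //.
 exact: dsupp_uniq.
by move=> t /prj_out.
Qed.

(** [prj] reads a decomposition picked by choice; by [hom_free] any other decomposition has the same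
    components. *)
Lemma prj_uniq (R : seq T) (c : T -> A) a t : uniq R ->
 (forall t, hom t (c t)) -> (forall t, t \notin R -> c t = 0) ->
 a = \sum_(t <- R) c t -> prj t a = c t.
Proof.
move=> uR hc c0 ea; apply/eqP; rewrite -subr_eq0; apply/eqP.
set U := undup (t :: dsupp a ++ R).
have uU : uniq U by apply: undup_uniq.
apply: (hom_free (dgaP A) (r := U) (c := fun t => prj t a - c t)) => //.
- by move=> u; apply: homB => //; apply: hom_prj.
- rewrite sumrB sum_prj // => [|u]; last first.
  by rewrite mem_undup inE mem_cat !negb_or => /and3P[_ /prj_out].
 rewrite {1}ea (sum_supp uR uU) ?subrr // => u uR'.
 by rewrite mem_undup inE mem_cat uR' !orbT.
- by rewrite mem_undup mem_head.
Qed.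

Lemma prj_hom t u a : hom u a -> prj t a = if t == u then a else 0.
Proof.
move=> ha; apply: (@prj_uniq [:: u] (fun t => if t == u then a else 0)) => //.
- by move=> s; case: eqP => [->|_] //; apply: hom0.
- by move=> s; rewrite inE => /negbTE ->.
- by rewrite big_seq1 eqxx.
Qed.

Lemma prj_id t a : hom t a -> prj t a = a.
Proof. by move/(prj_hom t) ->; rewrite eqxx. Qed.

Lemma prjP c t a b : prj t (c *: a + b) = c *: prj t a + prj t b.
Proof.
set U := undup (dsupp a ++ dsupp b).
have uU : uniq U by apply: undup_uniq.
have ha u : u \notin U -> prj u a = 0.
 by rewrite mem_undup mem_cat negb_or => /andP[/prj_out].
have hb u : u \notin U -> prj u b = 0.
 by rewrite mem_undup mem_cat negb_or => /andP[_ /prj_out].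
apply: (@prj_uniq U (fun t => c *: prj t a + prj t b)) => //.
- by move=> u; apply: homL; apply: hom_prj.
- by move=> u uU'; rewrite ha // hb // scaler0 addr0.
- by rewrite big_split -scaler_sumr /= !sum_prj.
Qed.

Lemma prjD t a b : prj t (a + b) = prj t a + prj t b.
Proof. by have := prjP 1 t a b; rewrite !scale1r. Qed.
Lemma prj0 t : prj t (0 : A) = 0.
Proof. by rewrite (prj_hom _ (hom0 0)); case: ifP. Qed.
Lemma prjZ t c a : prj t (c *: a) = c *: prj t a.
Proof. by have := prjP c t a 0; rewrite !addr0 prj0 addr0. Qed.
Lemma prjN t a : prj t (- a) = - prj t a.
Proof. by rewrite -!scaleN1r prjZ. Qed.
Lemma prjB t a b : prj t (a - b) = prj t a - prj t b.
Proof. by rewrite prjD prjN. Qed.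
Lemma prj_sum t (I : Type) (r : seq I) (P : pred I) (F : I -> A) :
 prj t (\sum_(i <- r | P i) F i) = \sum_(i <- r | P i) prj t (F i).
Proof. exact: (big_morph (prj t) (prjD t) (prj0 t)). Qed.

Lemma prj_inj a b : (forall t, prj t a = prj t b) -> a = b.
Proof.
move=> e; rewrite -(sum_prj_dsupp a) -(sum_prj (R := dsupp a) (dsupp_uniq a) (a := b)).
 by apply: eq_bigr => t _; rewrite e.
by move=> t /prj_out; rewrite e.
Qed.

Lemma dga_ind (P : A -> Prop) : P 0 -> (forall a b, P a -> P b -> P (a + b)) ->
 (forall t a, hom t a -> P a) -> forall a, P a.
Proof.
move=> P0 PD Ph a; rewrite -(sum_prj_dsupp a); elim/big_ind: _ => // t _.
exact: Ph (hom_prj t a).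
Qed.

Lemma prj_mulr t u a b : hom u b -> prj t (a * b) = prj (t - u) a * b.
Proof.
move=> hb; elim/dga_ind: a => [|a a' Ha Ha'|s a ha].
- by rewrite mul0r !prj0 mul0r.
- by rewrite mulrDl !prjD mulrDl Ha Ha'.
rewrite (prj_hom _ ha) (prj_hom _ (homM ha hb)) subr_eq.
by case: ifP; rewrite ?mul0r.
Qed.

Lemma prj_mull t u a b : hom u a -> prj t (a * b) = a * prj (t - u) b.
Proof.
move=> ha; elim/dga_ind: b => [|b b' Hb Hb'|s b hb].
- by rewrite mulr0 !prj0 mulr0.
- by rewrite mulrDr !prjD mulrDr Hb Hb'.
rewrite (prj_hom _ hb) (prj_hom _ (homM ha hb)) subr_eq addrC.
by case: ifP; rewrite ?mulr0.
Qed.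

Lemma difD a b : dif (a + b) = dif a + dif b.
Proof. exact: (dif_add (dgaP A)). Qed.
Lemma dif0 : dif (0 : A) = 0.
Proof. by apply: (addIr (dif 0)); rewrite -difD !add0r. Qed.
Lemma difN a : dif (- a) = - dif a.
Proof. by apply/eqP; rewrite -subr_eq0 opprK -difD addNr dif0. Qed.
Lemma difB a b : dif (a - b) = dif a - dif b.
Proof. by rewrite difD difN. Qed.
Lemma difK a : dif (dif a) = 0. Proof. exact: (dif_dif (dgaP A)). Qed.

Lemma dif_homM t a b : hom t a ->
 dif (a * b) = dif a * b + (-1) ^ t.1.1 *: (a * dif b).
Proof. exact: (dif_mul (dgaP A)). Qed.

Lemma dif_hom0 t a : t.1.1 = 0 -> hom t a -> dif a = 0.
Proof. by move=> t0 /hom_dif; apply: hom_neg; rewrite /= t0. Qed.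

Lemma difZ c a : dif (c *: a) = c *: dif a.
Proof.
rewrite -[a in LHS]mul1r scalerAl (dif_homM _ (homC c)) (dif_hom0 _ (homC c)) //.
by rewrite mul0r add0r scale1r -scalerAl mul1r.
Qed.
Lemma dif1 : dif (1 : A) = 0. Proof. exact: dif_hom0 hom1. Qed.
Lemma dif_sum (I : Type) (r : seq I) (P : pred I) (F : I -> A) :
 dif (\sum_(i <- r | P i) F i) = \sum_(i <- r | P i) dif (F i).
Proof. exact: (big_morph (dif (c := A)) difD dif0). Qed.

Lemma prj_dif t a : prj t (dif a) = dif (prj (t + (1, 0, 0)) a).
Proof.
elim/dga_ind: a => [|a b Ha Hb|u a ha]; first by rewrite dif0 !prj0 dif0.
 by rewrite difD !prjD difD Ha Hb.
rewrite (prj_hom _ ha) (prj_hom _ (hom_dif ha)).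
have -> : (t == u + (-1, 0, 0)) = (t + (1, 0, 0) == u).
 by rewrite -[RHS](inj_eq (addIr (-1, 0, 0))) -addrA tup_down addr0.
by case: ifP; rewrite ?dif0.
Qed.

(** Multiplies the component of each degree t by f t. With the sign of the homological degree it
    becomes [tau]; with [csign chi t] it is the effect of moving past an element of degree t. In
    this way the Leibniz and commutation rules can be stated for inhomogeneous elements ([difM],
    [comm_tw]). *)
Definition tw (f : T -> k) a : A := \sum_(t <- dsupp a) f t *: prj t a.

Lemma twE f a R : uniq R -> (forall t, t \notin R -> prj t a = 0) ->
 tw f a = \sum_(t <- R) f t *: prj t a.
Proof.
move=> uR R0; apply: sum_supp2 => //; first exact: dsupp_uniq.
 by move=> t /R0 ->; rewrite scaler0.
by move=> t /prj_out ->; rewrite scaler0.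
Qed.

Lemma tw_hom f t a : hom t a -> tw f a = f t *: a.
Proof.
move=> ha; rewrite (@twE _ _ [:: t]) // ?big_seq1 ?prj_id // => u.
by rewrite inE (prj_hom _ ha) => /negbTE ->.
Qed.

Lemma twP f c a b : tw f (c *: a + b) = c *: tw f a + tw f b.
Proof.
set U := undup (dsupp a ++ dsupp b).
have uU : uniq U by apply: undup_uniq.
have ha u : u \notin U -> prj u a = 0.
 by rewrite mem_undup mem_cat negb_or => /andP[/prj_out].
have hb u : u \notin U -> prj u b = 0.
 by rewrite mem_undup mem_cat negb_or => /andP[_ /prj_out].
rewrite !(@twE f _ U) // => [|u uU']; last by rewrite prjP ha ?hb ?scaler0 ?addr0.
rewrite scaler_sumr -big_split; apply: eq_bigr => u _ /=.
by rewrite prjP scalerDr !scalerA mulrC.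
Qed.

Lemma tw0 f : tw f 0 = 0.
Proof. by rewrite (tw_hom f (hom0 0)) scaler0. Qed.
Lemma twD f a b : tw f (a + b) = tw f a + tw f b.
Proof. by have := twP f 1 a b; rewrite !scale1r. Qed.
Lemma twZ f c a : tw f (c *: a) = c *: tw f a.
Proof. by have := twP f c a 0; rewrite !addr0 tw0 addr0. Qed.

Lemma hom_tw f t a : hom t a -> hom t (tw f a).
Proof. by move=> ha; rewrite (tw_hom _ ha); apply: homZ. Qed.
Lemma prj_tw f t a : prj t (tw f a) = f t *: prj t a.
Proof.
elim/dga_ind: a => [|a b Ha Hb|u a ha]; first by rewrite tw0 !prj0 scaler0.
 by rewrite twD !prjD scalerDr Ha Hb.
rewrite (tw_hom _ ha) prjZ (prj_hom _ ha); case: eqP => [->//|_].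
by rewrite !scaler0.
Qed.

Lemma tw_comp f g h a : (forall t, f t * g t = h t) -> tw f (tw g a) = tw h a.
Proof.
move=> fg; apply: prj_inj => t; by rewrite !prj_tw scalerA fg.
Qed.

Lemma tw_id f a : (forall t, f t = 1) -> tw f a = a.
Proof. by move=> f1; apply: prj_inj => t; rewrite prj_tw f1 scale1r. Qed.

Lemma tw_mul f a b : (forall t u, f (t + u) = f t * f u) ->
 tw f (a * b) = tw f a * tw f b.
Proof.
move=> fM; elim/dga_ind: a => [|a a' Ha Ha'|t a ha]; first by rewrite mul0r tw0 mul0r.
 by rewrite mulrDl !twD mulrDl Ha Ha'.
elim/dga_ind: b => [|b b' Hb Hb'|u b hb]; first by rewrite mulr0 tw0 mulr0.
 by rewrite mulrDr !twD mulrDr Hb Hb'.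
by rewrite (tw_hom _ ha) (tw_hom _ hb) (tw_hom _ (homM ha hb)) fM -scalerAl -scalerAr scalerA.
Qed.

Lemma tw1 f : f 0 = 1 -> tw f (1 : A) = 1.
Proof. by move=> f0; rewrite (tw_hom _ hom1) f0 scale1r. Qed.

Definition sg (t : T) : k := (-1) ^ t.1.1.
Definition tau := tw sg.

Lemma sgD t u : sg (t + u) = sg t * sg u. Proof. exact: signzD. Qed.
Lemma sgK t : sg t * sg t = 1. Proof. exact: signzK. Qed.

Lemma sg_down : sg (-1, 0, 0) = -1.
Proof. by rewrite /sg /= exprN1 invrN1. Qed.

Lemma difM a b : dif (a * b) = dif a * b + tau a * dif b.
Proof.
elim/dga_ind: a => [|a a' Ha Ha'|t a ha].
- by rewrite /tau mul0r tw0 !dif0 !mul0r addr0.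
- by rewrite /tau mulrDl !difD twD !mulrDl Ha Ha' addrACA.
by rewrite (dif_homM _ ha) /tau (tw_hom _ ha) scalerAl.
Qed.

Lemma tauK a : tau (tau a) = a.
Proof.
by rewrite /tau (tw_comp _ (h := fun=> 1)) ?tw_id // => t; rewrite sgK.
Qed.

Lemma dif_tau a : dif (tau a) = - tau (dif a).
Proof.
elim/dga_ind: a => [|a a' Ha Ha'|t a ha].
- by rewrite /tau dif0 !tw0 dif0 oppr0.
- by rewrite /tau twD !difD twD Ha Ha' opprD.
rewrite /tau (tw_hom _ ha) (tw_hom _ (hom_dif ha)) difZ sgD.
by rewrite sg_down mulrN1 scaleNr opprK.
Qed.

Lemma commM t u a b : hom t a -> hom u b -> a * b = csign chi t u *: (b * a).
Proof. exact: (color_comm (dgaP A)). Qed.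

Lemma comm_tw t a b : hom t a -> a * b = tw (csign chi t) b * a.
Proof.
move=> ha; elim/dga_ind: b => [|b b' Hb Hb'|u b hb].
- by rewrite mulr0 tw0 mul0r.
- by rewrite mulrDr twD mulrDl Hb Hb'.
by rewrite (tw_hom _ hb) (commM ha hb) scalerAl.
Qed.

Lemma odd_sq t a : hom t a -> odd `|t.1.1|%N -> a * a = 0.
Proof. exact: (color_odd_sq (dgaP A)). Qed.

(** Stability under homogeneous components is what lets the twists [tw] act on [C]. *)
Record gsub (C : A -> Prop) : Prop := {
 gsub0 : C 0;
 gsubL : forall c a b, C a -> C b -> C (c *: a + b);
 gsubP : forall t a, C a -> C (prj t a) }.

Section GSub.
Variables (C : A -> Prop) (hC : gsub C).
Lemma gsubD a b : C a -> C b -> C (a + b).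
Proof. by move=> Ca Cb; rewrite -[a]scale1r; apply: gsubL. Qed.
Lemma gsubZ c a : C a -> C (c *: a).
Proof. by move=> Ca; rewrite -[c *: a]addr0; apply: gsubL => //; apply: gsub0. Qed.
Lemma gsubN a : C a -> C (- a). Proof. by rewrite -scaleN1r; apply: gsubZ. Qed.
Lemma gsubB a b : C a -> C b -> C (a - b).
Proof. by move=> Ca Cb; apply: gsubD => //; apply: gsubN. Qed.
Lemma gsub_sum (I : Type) (r : seq I) (P : pred I) (F : I -> A) :
 (forall i, P i -> C (F i)) -> C (\sum_(i <- r | P i) F i).
Proof. by move=> h; elim/big_ind: _ => //; [exact: gsub0 | exact: gsubD]. Qed.
Lemma gsub_tw f a : C a -> C (tw f a).
Proof. by move=> Ca; apply: gsub_sum => t _; apply: gsubZ; apply: gsubP. Qed.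
Lemma gsubMn a n : C a -> C (a *+ n).
Proof. by move=> Ca; rewrite -scaler_nat; apply: gsubZ. Qed.
End GSub.

Record galg (C : A -> Prop) : Prop := {
 galg_sub : gsub C;
 galg1 : C 1;
 galgM : forall a b, C a -> C b -> C (a * b) }.

End One.

Record is_dmap A B (f : A -> B) : Prop := {
 dmapL : forall c a b, f (c *: a + b) = c *: f a + f b;
 dmapM : forall a b, f (a * b) = f a * f b;
 dmap1 : f 1 = 1;
 dmap_hom : forall t a, hom t a -> hom t (f a);
 dmap_dif : forall a, f (dif a) = dif (f a) }.

Section DMap.
Variables (A B : color_dga chi) (f : A -> B) (hf : is_dmap f).
Lemma dmapD a b : f (a + b) = f a + f b.
Proof. by have := dmapL hf 1 a b; rewrite !scale1r. Qed.
Lemma dmap0 : f 0 = 0.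
Proof. by apply: (addIr (f 0)); rewrite -dmapD !add0r. Qed.
Lemma dmapZ c a : f (c *: a) = c *: f a.
Proof. by have := dmapL hf c a 0; rewrite !addr0 dmap0 addr0. Qed.
Lemma dmapN a : f (- a) = - f a. Proof. by rewrite -!scaleN1r dmapZ. Qed.
Lemma dmapB a b : f (a - b) = f a - f b. Proof. by rewrite dmapD dmapN. Qed.
Lemma dmap_sum (I : Type) (r : seq I) (P : pred I) (F : I -> A) :
 f (\sum_(i <- r | P i) F i) = \sum_(i <- r | P i) f (F i).
Proof. exact: (big_morph f dmapD dmap0). Qed.
Lemma dmap_prj t a : f (prj t a) = prj t (f a).
Proof.
elim/dga_ind: a => [|a b Ha Hb|u a ha]; first by rewrite dmap0 !prj0 dmap0.
 by rewrite dmapD !prjD dmapD Ha Hb.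
rewrite (prj_hom _ ha) (prj_hom _ (dmap_hom hf ha)).
by case: ifP; rewrite ?dmap0.
Qed.
Lemma dmap_tw g a : f (tw g a) = tw g (f a).
Proof.
elim/dga_ind: a => [|a b Ha Hb|u a ha]; first by rewrite tw0 dmap0 tw0.
 by rewrite twD !dmapD twD Ha Hb.
by rewrite (tw_hom _ ha) (tw_hom _ (dmap_hom hf ha)) dmapZ.
Qed.
End DMap.

Lemma dmap_id A : is_dmap (fun a : A => a).
Proof. by split. Qed.

Lemma dmap_comp A B (D : color_dga chi) (f : A -> B) (g : B -> D) :
 is_dmap f -> is_dmap g -> is_dmap (g \o f).
Proof.
move=> hf hg; split=> [c a b|a b||t a ha|a] /=.
- by rewrite (dmapL hf) (dmapL hg).
- by rewrite (dmapM hf) (dmapM hg).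
- by rewrite (dmap1 hf) (dmap1 hg).
- by apply: (dmap_hom hg); apply: (dmap_hom hf).
- by rewrite (dmap_dif hf) (dmap_dif hg).
Qed.

End Toolkit.

End GradedToolkit.
Import GradedToolkit.

(** * Monoid algebras twisted by a cocycle, over a color DG algebra *)

Module TwistedMonoidAlgebra.

Section Decomposable.
Variables (G : zmodType) (V : zmodType) (hm : tridegree G -> V -> Prop).
Hypotheses (hm0 : forall t, hm t 0)
 (hmD : forall t a b, hm t a -> hm t b -> hm t (a + b)).

Definition decomposable v := exists (r : seq (tridegree G)) (c : tridegree G -> V),
 (forall t, hm t (c t)) /\ v = \sum_(t <- r) c t.

Lemma decomposable0 : decomposable 0.
Proof. by exists [::], (fun=> 0); split=> //; rewrite big_nil. Qed.

Lemma decomposable_hom t x v : hm t x -> decomposable v -> decomposable (x + v).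
Proof.
move=> hx [r [c [hc ->]]].
have : exists s d, [/\ uniq s, forall t, hm t (d t) &
  \sum_(t <- r) c t = \sum_(t <- s) d t].
 elim: r => [|u r [s [d [us hd es]]]].
  by exists [::], (fun=> 0); split=> //; rewrite !big_nil.
 rewrite big_cons es; case: (boolP (u \in s)) => ts.
  exists s, (fun v => if v == u then c u + d u else d v); split=> // [w|].
   by case: eqP => [->|_] //; apply: hmD.
  rewrite [RHS](bigD1_seq u) //= eqxx (bigD1_seq u) //= addrA; congr (_ + _).
  by apply: eq_bigr => w /negbTE ->.
 exists (u :: s), (fun w => if w == u then c u else d w); split=> [|w|] /=.
 - by rewrite ts us.
 - by case: eqP => [->|_].
 rewrite big_cons eqxx; congr (_ + _); rewrite !big_seq.
 by apply: eq_bigr => w us'; case: eqP us' ts => // -> ->.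
case=> s [d [us hd ->]]; case: (boolP (t \in s)) => ts.
 exists s, (fun w => if w == t then x + d t else d w); split=> [w|].
  by case: eqP => [->|_] //; apply: hmD.
 rewrite [RHS](bigD1_seq t) //= eqxx (bigD1_seq t) //= addrA; congr (_ + _).
 by apply: eq_bigr => w /negbTE ->.
exists (t :: s), (fun w => if w == t then x else d w); split=> [w|].
 by case: eqP => [->|_].
rewrite big_cons eqxx; congr (_ + _); rewrite !big_seq.
by apply: eq_bigr => w us'; case: eqP us' ts => // -> ->.
Qed.

Lemma decomposableD u v : decomposable u -> decomposable v -> decomposable (u + v).
Proof.
move=> [r [c [hc ->]]] dv; elim: r => [|t r IH]; first by rewrite big_nil add0r.
by rewrite big_cons -addrA; apply: decomposable_hom (hc t) IH.
Qed.

End Decomposable.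

(** Structure constants of an algebra with basis the exponents in [tE], product u v = tb u v (u +
    v), and u + v read as 0 outside [tE]; [tbA] is the cocycle identity. One construction covers
    both algebras of the proof: divided powers of one variable (M = nat, binomial constants) and
    skew monomials modulo a monomial ideal (M the vectors of exponents). *)
Record twist (k : fieldType) (G : zmodType) (chi : alt_bicharacter G k)
  (M : nmodType) := Twist {
 tE : pred M;
 tb : M -> M -> k;
 tdeg : M -> tridegree G;
 tE0 : tE 0;
 tE_down : forall u v, tE (u + v) -> tE u;
 tb0l : forall u, tb 0 u = 1;
 tb0r : forall u, tb u 0 = 1;
 tbA : forall u v w, tb u v * tb (u + v) w = tb v w * tb u (v + w);
 tbC : forall u v, tE (u + v) -> tb u v = csign chi (tdeg u) (tdeg v) * tb v u;
 tdeg0 : tdeg 0 = 0;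
 tdegD : forall u v, tdeg (u + v) = tdeg u + tdeg v;
 tdeg_ge0 : forall u, 0 <= (tdeg u).1.1;
 tb_odd : forall u, odd `|(tdeg u).1.1|%N -> tE (u + u) -> tb u u = 0 }.

Section TwistedAlgebra.
Variables (k : fieldType) (G : zmodType) (chi : alt_bicharacter G k).
Variables (W : color_dga chi) (M : nmodType) (td : twist chi M).
Notation T := (tridegree G).
Notation E := (tE td).
Notation beta := (tb td).
Notation deg := (tdeg td).
Implicit Types (u v : M) (w : W).

Definition finsupp (f : M -> W) : Prop :=
 (exists s : seq M, forall u, u \notin s -> f u = 0) /\ forall u, ~~ E u -> f u = 0.

Lemma finsupp0 : finsupp 0. Proof. by split; first by exists [::]. Qed.

Lemma finsupp_lin c f g : finsupp f -> finsupp g -> finsupp (c *: f + g).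
Proof.
move=> [[r hr] Ef] [[s hs] Eg]; split.
 exists (r ++ s) => u; rewrite mem_cat negb_or => /andP[ur us].
 by rewrite !fctE hr // hs // scaler0 addr0.
by move=> u Eu; rewrite !fctE Ef // Eg // scaler0 addr0.
Qed.

Definition twalg : Type := sub_of (Subspace finsupp0 finsupp_lin).
HB.instance Definition _ := GRing.Lmodule.on twalg.

Definition coef (a : twalg) u : W := sub_val a u.
Arguments coef : simpl never.

Lemma coefP a b : (forall u, coef a u = coef b u) -> a = b.
Proof. by move=> e; apply: val_inj; apply/funext. Qed.

Lemma coefL c a b u : coef (c *: a + b) u = c *: coef a u + coef b u.
Proof. by []. Qed.
Lemma coefD a b u : coef (a + b) u = coef a u + coef b u. Proof. by []. Qed.
Lemma coef0 u : coef 0 u = 0. Proof. by []. Qed.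

Lemma coef_sum (I : Type) (r : seq I) (P : pred I) (F : I -> twalg) u :
 coef (\sum_(i <- r | P i) F i) u = \sum_(i <- r | P i) coef (F i) u.
Proof. exact: (big_morph (coef^~ u) (fun a b => coefD a b u) (coef0 u)). Qed.

Lemma coefE a u : ~~ E u -> coef a u = 0.
Proof. by case: (sub_ofP a) => _; apply. Qed.

Lemma supp_ex (a : twalg) : exists s : seq M, uniq s /\ forall u, u \notin s -> coef a u = 0.
Proof.
have [[s hs] _] := sub_ofP a; exists (undup s); split; first exact: undup_uniq.
by move=> u; rewrite mem_undup => /hs.
Qed.

Definition supp a : seq M := projT1 (cid (supp_ex a)).
Lemma supp_uniq a : uniq (supp a). Proof. by rewrite /supp; case: cid => s []. Qed.
Lemma supp_out a u : u \notin supp a -> coef a u = 0.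
Proof. by rewrite /supp; case: cid => s [us hs]; apply: hs. Qed.

Lemma mono_finsupp u w : finsupp (fun v => if (v == u) && E u then w else 0).
Proof.
split; first by exists [:: u] => v; rewrite inE => /negbTE ->.
by move=> v /negbTE Ev; case: eqP => [<-|]; rewrite ?Ev.
Qed.

Definition mono u w : twalg := sub_of_mem (Z := Subspace finsupp0 finsupp_lin) (mono_finsupp u w).

Lemma coef_mono u w v : coef (mono u w) v = if (v == u) && E u then w else 0.
Proof. by []. Qed.

Lemma monoL u c w w' : mono u (c *: w + w') = c *: mono u w + mono u w'.
Proof.
by apply: coefP => v; rewrite coefL !coef_mono; case: ifP; rewrite ?scaler0 ?addr0.
Qed.
Lemma mono0 u : mono u 0 = 0.
Proof. by apply: coefP => v; rewrite coef_mono if_same. Qed.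
Lemma monoD u w w' : mono u (w + w') = mono u w + mono u w'.
Proof. by have := monoL u 1 w w'; rewrite !scale1r. Qed.
Lemma monoZ u c w : mono u (c *: w) = c *: mono u w.
Proof. by have := monoL u c w 0; rewrite mono0 !addr0. Qed.
Lemma monoN u w : mono u (- w) = - mono u w.
Proof. by rewrite -!scaleN1r monoZ. Qed.
Lemma mono_out u w : ~~ E u -> mono u w = 0.
Proof. by move=> /negbTE Eu; apply: coefP => v; rewrite coef_mono Eu andbF. Qed.

Lemma mono_expand a R : uniq R -> (forall u, u \notin R -> coef a u = 0) ->
 a = \sum_(u <- R) mono u (coef a u).
Proof.
move=> uR R0; apply: coefP => v; rewrite coef_sum.
case: (boolP (v \in R)) => vR; last first.
 rewrite R0 // big1_seq // => u /andP[_ uR']; rewrite coef_mono.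
 by case: eqP uR' vR => [->->|].
rewrite (bigD1_seq v) //= coef_mono eqxx big1 ?addr0; last first.
 by move=> u uv; rewrite coef_mono eq_sym (negbTE uv).
by case: ifPn => // /coefE ->.
Qed.

Lemma mono_supp a : a = \sum_(u <- supp a) mono u (coef a u).
Proof. by apply: mono_expand; [exact: supp_uniq | move=> u /supp_out]. Qed.

Lemma twalg_ind (P : twalg -> Prop) : P 0 -> (forall a b, P a -> P b -> P (a + b)) ->
 (forall u w, P (mono u w)) -> forall a, P a.
Proof. by move=> P0 PD Pm a; rewrite (mono_supp a); elim/big_ind: _. Qed.

(** The change that a coefficient of [W] undergoes when the basis element u moves past it. *)
Definition sgm u := tw (A := W) (csign chi (deg u)).

Definition mulT (a b : twalg) : twalg := \sum_(u <- supp a) \sum_(v <- supp b)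
 mono (u + v) (beta u v *: (coef a u * sgm u (coef b v))).

Lemma mulTE a b R S : uniq R -> uniq S -> (forall u, u \notin R -> coef a u = 0) ->
 (forall u, u \notin S -> coef b u = 0) ->
 mulT a b = \sum_(u <- R) \sum_(v <- S)
  mono (u + v) (beta u v *: (coef a u * sgm u (coef b v))).
Proof.
move=> uR uS R0 S0; rewrite /mulT.
rewrite -(sum_supp2 uR (supp_uniq a)) => [|u uR'|u ua].
- apply: eq_bigr => u _; apply: sum_supp2 => //; first exact: supp_uniq.
  by move=> v /S0 ->; rewrite /sgm tw0 mulr0 scaler0 mono0.
 by move=> v /supp_out ->; rewrite /sgm tw0 mulr0 scaler0 mono0.
- by rewrite big1 // => v _; rewrite R0 // mul0r scaler0 mono0.
- by rewrite big1 // => v _; rewrite supp_out // mul0r scaler0 mono0.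
Qed.

Lemma mulTlin1 c a a' b : mulT (c *: a + a') b = c *: mulT a b + mulT a' b.
Proof.
set U := undup (supp a ++ supp a'); have uU : uniq U := undup_uniq _.
have h1 u : u \notin U -> coef a u = 0.
 by rewrite mem_undup mem_cat negb_or => /andP[/supp_out].
have h2 u : u \notin U -> coef a' u = 0.
 by rewrite mem_undup mem_cat negb_or => /andP[_ /supp_out].
have hb u : u \notin supp b -> coef b u = 0 by move/supp_out.
rewrite !(mulTE uU (supp_uniq b) _ hb) //; last first.
 by move=> u uU'; rewrite coefL h1 // h2 // scaler0 addr0.
rewrite scaler_sumr -big_split; apply: eq_bigr => u _ /=.
rewrite scaler_sumr -big_split; apply: eq_bigr => v _ /=.
rewrite coefL mulrDl scalerDr monoD -monoZ scalerA mulrC -scalerA.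
by rewrite -[(c *: coef a u) * _]scalerAl.
Qed.

Lemma mulTlin2 c a b b' : mulT a (c *: b + b') = c *: mulT a b + mulT a b'.
Proof.
set U := undup (supp b ++ supp b'); have uU : uniq U := undup_uniq _.
have h1 u : u \notin U -> coef b u = 0.
 by rewrite mem_undup mem_cat negb_or => /andP[/supp_out].
have h2 u : u \notin U -> coef b' u = 0.
 by rewrite mem_undup mem_cat negb_or => /andP[_ /supp_out].
have ha u : u \notin supp a -> coef a u = 0 by move/supp_out.
rewrite !(mulTE (supp_uniq a) uU ha) //; last first.
 by move=> u uU'; rewrite coefL h1 // h2 // scaler0 addr0.
rewrite scaler_sumr -big_split; apply: eq_bigr => u _ /=.
rewrite scaler_sumr -big_split; apply: eq_bigr => v _ /=.
rewrite coefL /sgm twP mulrDr scalerDr monoD -monoZ scalerA mulrC -scalerA.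
by rewrite -[coef a u * (c *: _)]scalerAr.
Qed.

Lemma mulT_mono u v w w' : mulT (mono u w) (mono v w') =
 mono (u + v) (beta u v *: (w * sgm u w')).
Proof.
rewrite (@mulTE _ _ [:: u] [:: v]) // ?big_seq1; first last.
- by move=> s; rewrite inE coef_mono => /negbTE ->.
- by move=> s; rewrite inE coef_mono => /negbTE ->.
rewrite !coef_mono !eqxx /=; case: ifPn => Eu; last first.
 have nE : ~~ E (u + v) by apply: contra Eu; apply: tE_down.
 by rewrite !mono_out.
case: ifPn => // Ev; have nE : ~~ E (u + v).
 by apply: contra Ev; rewrite addrC; apply: tE_down.
by rewrite !mono_out.
Qed.

Lemma mulTDl : left_distributive mulT +%R.
Proof. by move=> a b c; have := mulTlin1 1 a b c; rewrite !scale1r. Qed.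
Lemma mulTDr : right_distributive mulT +%R.
Proof. by move=> a b c; have := mulTlin2 1 a b c; rewrite !scale1r. Qed.
Lemma mulT0l a : mulT 0 a = 0.
Proof. by apply: (addIr (mulT 0 a)); rewrite -mulTDl !add0r. Qed.
Lemma mulT0r a : mulT a 0 = 0.
Proof. by apply: (addIr (mulT a 0)); rewrite -mulTDr !add0r. Qed.

Definition oneT : twalg := mono 0 1.

Lemma sgmD u v w : sgm u (sgm v w) = sgm (u + v) w.
Proof. by apply: tw_comp => t; rewrite tdegD csignDl. Qed.
Lemma sgmM u w w' : sgm u (w * w') = sgm u w * sgm u w'.
Proof. by apply: tw_mul => s t; rewrite csignDr. Qed.
Lemma csign0l (t : T) : csign chi 0 t = 1.
Proof. by rewrite /csign /= mul0r expr0z bichar0l mulr1. Qed.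
Lemma sgm0 w : sgm 0 w = w.
Proof. by apply: tw_id => t; rewrite tdeg0 csign0l. Qed.
Lemma sgm1 u : sgm u 1 = 1. Proof. by apply: tw1; apply: csign0r. Qed.

Lemma mulTA : associative mulT.
Proof.
elim/twalg_ind=> [b c|a a' Ha Ha' b c|u w]; first by rewrite !mulT0l.
 by rewrite !mulTDl Ha Ha'.
elim/twalg_ind=> [c|b b' Hb Hb' c|v w']; first by rewrite mulT0l !mulT0r mulT0l.
 by rewrite mulTDl !mulTDr mulTDl Hb Hb'.
elim/twalg_ind=> [|c c' Hc Hc'|s w'']; first by rewrite !mulT0r.
 by rewrite !mulTDr Hc Hc'.
rewrite !mulT_mono addrA; congr (mono _ _).
rewrite /sgm twZ -/(sgm u _) sgmM sgmD -!(scalerAl, scalerAr) !scalerA mulrA.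
by rewrite [X in X *: _]mulrC -tbA mulrC.
Qed.

Lemma mulT1l : left_id oneT mulT.
Proof.
elim/twalg_ind=> [|b b' Hb Hb'|v w]; first by rewrite mulT0r.
 by rewrite mulTDr Hb Hb'.
by rewrite mulT_mono add0r tb0l scale1r mul1r sgm0.
Qed.
Lemma mulT1r : right_id oneT mulT.
Proof.
elim/twalg_ind=> [|b b' Hb Hb'|v w]; first by rewrite mulT0l.
 by rewrite mulTDl Hb Hb'.
by rewrite mulT_mono addr0 tb0r scale1r sgm1 mulr1.
Qed.
Lemma oneT_neq0 : oneT != 0.
Proof.
apply/eqP => /(congr1 (fun a => coef a 0)); rewrite coef_mono coef0 eqxx tE0.
by apply/eqP; rewrite oner_eq0.
Qed.

HB.instance Definition _ := GRing.Zmodule_isNzRing.Build twalg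
 mulTA mulT1l mulT1r mulTDl mulTDr oneT_neq0.

Lemma twalg_scaleAl c (a b : twalg) : c *: (a * b) = (c *: a) * b.
Proof. by have := mulTlin1 c a 0 b; rewrite mulT0l !addr0. Qed.
HB.instance Definition _ := GRing.Lmodule_isLalgebra.Build k twalg twalg_scaleAl.
Lemma twalg_scaleAr c (a b : twalg) : c *: (a * b) = a * (c *: b).
Proof. by have := mulTlin2 c a b 0; rewrite mulT0r !addr0. Qed.
HB.instance Definition _ := GRing.Lalgebra_isAlgebra.Build k twalg twalg_scaleAr.

Lemma monoM u v w w' : mono u w * mono v w' =
 mono (u + v) (beta u v *: (w * sgm u w')).
Proof. exact: mulT_mono. Qed.

Definition homT (t : T) (a : twalg) : Prop := forall u, hom (t - deg u) (coef a u).

Lemma homT0 t : homT t 0. Proof. by move=> u; apply: hom0. Qed.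
Lemma homTL t c a b : homT t a -> homT t b -> homT t (c *: a + b).
Proof. by move=> ha hb u; apply: homL. Qed.
Lemma homTD t a b : homT t a -> homT t b -> homT t (a + b).
Proof. by move=> ha hb u; apply: homD. Qed.
Lemma homT_mono t u w : hom t w -> homT (t + deg u) (mono u w).
Proof.
move=> hw v; rewrite coef_mono; case: ifP => [/andP[/eqP -> _]|_]; last exact: hom0.
by rewrite addrK.
Qed.
Lemma homT_ind t (P : twalg -> Prop) : P 0 ->
 (forall a b, homT t a -> homT t b -> P a -> P b -> P (a + b)) ->
 (forall u w, hom (t - deg u) w -> P (mono u w)) -> forall a, homT t a -> P a.
Proof.
move=> P0 PD Pm a ha; rewrite (mono_supp a).
suff [] : homT t (\sum_(u <- supp a) mono u (coef a u)) /\
 P (\sum_(u <- supp a) mono u (coef a u)) by [].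
elim/big_ind: _ => [|b c [hb Pb] [hc Pc]|u _]; first by split=> //; apply: homT0.
 by split; [apply: homTD | apply: PD].
split; last exact: Pm.
by rewrite -(subrK (deg u) t); apply: homT_mono.
Qed.

Lemma homT_span a : exists (r : seq T) (c : T -> twalg),
 (forall t, homT t (c t)) /\ a = \sum_(t <- r) c t.
Proof.
change (decomposable homT a).
have d0 := decomposable0 homT0; have dD := decomposableD homT0 homTD.
elim/twalg_ind: a => [|a b Ha Hb|u w]; [exact: d0 | exact: dD |].
elim/dga_ind: w => [|w w' Hw Hw'|t w hw]; first by rewrite mono0; apply: d0.
 by rewrite monoD; apply: dD.
rewrite -[mono u w]addr0.
exact: (decomposable_hom homT0 homTD (homT_mono u hw) d0).
Qed.

Lemma homT_free (r : seq T) (c : T -> twalg) :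
 uniq r -> (forall t, homT t (c t)) -> \sum_(t <- r) c t = 0 ->
 forall t, t \in r -> c t = 0.
Proof.
move=> ur hc s0 t tr; apply: coefP => u; rewrite coef0.
have := hom_free (dgaP W) (r := [seq s - deg u | s <- r])
 (c := fun s => coef (c (s + deg u)) u) _ _ _ (t := t - deg u).
rewrite subrK; apply.
- by rewrite map_inj_uniq //; apply: addIr.
- by move=> s; have := hc (s + deg u) u; rewrite addrK.
- rewrite big_map; under eq_bigr do rewrite subrK.
 by rewrite -coef_sum s0.
- exact: map_f.
Qed.

Lemma homT_neg t a : t.1.1 < 0 -> homT t a -> a = 0.
Proof.
move=> t0 ha; apply: coefP => u; apply: hom_neg (ha u).
by rewrite /= subr_lt0 (lt_le_trans t0) // tdeg_ge0.
Qed.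

Lemma homT1 : homT 0 1.
Proof. by have := homT_mono 0 (hom1 W); rewrite tdeg0 addr0. Qed.

Lemma homTM t s a b : homT t a -> homT s b -> homT (t + s) (a * b).
Proof.
move=> ha hb; elim/homT_ind: ha => [|a1 a2 _ _ H1 H2|u w hw].
- by rewrite mul0r; apply: homT0.
- by rewrite mulrDl; apply: homTD.
elim/homT_ind: hb => [|b1 b2 _ _ H1 H2|v w' hw'].
- by rewrite mulr0; apply: homT0.
- by rewrite mulrDr; apply: homTD.
rewrite monoM.
rewrite [t + s](_ : _ = (t - deg u) + (s - deg v) + deg (u + v)).
 by apply: homT_mono; apply: homZ; apply: homM => //; apply: hom_tw.
by rewrite tdegD addrACA !subrK.
Qed.

Lemma mono_comm t s u v w w' : hom t w -> hom s w' ->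
 mono u w * mono v w' = csign chi (t + deg u) (s + deg v) *: (mono v w' * mono u w).
Proof.
move=> hw hw'; rewrite !monoM -monoZ addrC.
case: (boolP (E (u + v))) => [Euv|nE]; last by rewrite addrC in nE *; rewrite !mono_out.
congr (mono _ _); rewrite /sgm (tw_hom _ hw) (tw_hom _ hw') -!scalerAr !scalerA.
rewrite (commM hw hw') scalerA (tbC Euv) !(csignDl, csignDr); congr (_ *: _).
have := csign_swap chi (deg v) t; move: (csign _ _ _) (csign _ t (deg v)) => x x' xx.
move: (csign _ _ _) (csign _ _ _) (csign _ _ _) (beta v u) => a b c d.
rewrite [RHS](_ : _ = x * x' * (a * b * c * d)); last by ring.
by rewrite xx mul1r; ring.
Qed.

Lemma homT_comm t s a b : homT t a -> homT s b -> a * b = csign chi t s *: (b * a).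
Proof.
move=> ha hb; elim/homT_ind: ha => [|a1 a2 _ _ H1 H2|u w hw].
- by rewrite mul0r mulr0 scaler0.
- by rewrite mulrDl mulrDr scalerDr H1 H2.
elim/homT_ind: hb => [|b1 b2 _ _ H1 H2|v w' hw'].
- by rewrite mul0r mulr0 scaler0.
- by rewrite mulrDl mulrDr scalerDr H1 H2.
by rewrite (mono_comm _ _ hw hw') !subrK.
Qed.

Lemma homT_odd_sq t a : homT t a -> odd `|t.1.1|%N -> a * a = 0.
Proof.
move=> ha ot; elim/homT_ind: ha => [|a1 a2 h1 h2 H1 H2|u w hw].
- by rewrite mul0r.
- rewrite mulrDl !mulrDr H1 H2 add0r addr0 (homT_comm h2 h1) csign_odd //.
 by rewrite scaleN1r subrr.
(* In a monomial of odd degree either the exponent is odd, and [tb_odd] applies, or the coefficient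
   is, and its square vanishes in [W]. *)
rewrite monoM /sgm (tw_hom _ hw) -scalerAr.
case ou: (odd `|(deg u).1.1|%N).
 case: (boolP (E (u + u))) => Eu; last by rewrite mono_out.
 by rewrite (tb_odd ou Eu) scale0r mono0.
rewrite (odd_sq hw) ?scaler0 ?mono0 //=.
have := odd_abszD (t - deg u)%R.1.1 (deg u).1.1.
by rewrite ou addbF => <-; rewrite subrK.
Qed.

Lemma twalg_dgaP (D : twalg -> twalg) : {morph D : a b / a + b} ->
 (forall t a, homT t a -> homT (t + (-1, 0, 0)) (D a)) ->
 (forall a, D (D a) = 0) ->
 (forall t a b, homT t a -> D (a * b) = D a * b + (-1) ^ t.1.1 *: (a * D b)) ->
 is_color_dga chi homT D.
Proof.
move=> DD Dh DDD DM; split=> //; [exact: homT0 | exact: homTL | exact: homT_span |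
 exact: homT_free | exact: homT_neg | exact: homT1 | by move=> *; apply: homTM |
 exact: homT_comm | exact: homT_odd_sq].
Qed.

Lemma mono_mul u w : mono u w = mono 0 w * mono u 1.
Proof. by rewrite monoM add0r tb0l scale1r sgm0 mulr1. Qed.

Section Lift.
Variables (B : color_dga chi) (f : W -> B) (x : M -> B) (hf : is_dmap f).
Hypotheses (x0 : x 0 = 1) (hx : forall u, E u -> hom (deg u) (x u))
 (xM : forall u v, E u -> E v -> x u * x v = if E (u + v) then beta u v *: x (u + v) else 0).

Definition tlift (a : twalg) : B := \sum_(u <- supp a) f (coef a u) * x u.

Lemma tliftE a R : uniq R -> (forall u, u \notin R -> coef a u = 0) ->
 tlift a = \sum_(u <- R) f (coef a u) * x u.
Proof.
move=> uR R0; apply: sum_supp2 => //; first exact: supp_uniq.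
 by move=> u /R0 ->; rewrite (dmap0 hf) mul0r.
by move=> u /supp_out ->; rewrite (dmap0 hf) mul0r.
Qed.

Lemma tliftL c a b : tlift (c *: a + b) = c *: tlift a + tlift b.
Proof.
set U := undup (supp a ++ supp b); have uU : uniq U := undup_uniq _.
have ha u : u \notin U -> coef a u = 0.
 by rewrite mem_undup mem_cat negb_or => /andP[/supp_out].
have hb u : u \notin U -> coef b u = 0.
 by rewrite mem_undup mem_cat negb_or => /andP[_ /supp_out].
rewrite !(tliftE uU) //; last by move=> u uU'; rewrite coefL ha ?hb ?scaler0 ?addr0.
rewrite scaler_sumr -big_split; apply: eq_bigr => u _ /=.
by rewrite coefL (dmapL hf) mulrDl scalerAl.
Qed.

Lemma tliftD a b : tlift (a + b) = tlift a + tlift b.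
Proof. by have := tliftL 1 a b; rewrite !scale1r. Qed.
Lemma tlift0 : tlift 0 = 0.
Proof. by apply: (addIr (tlift 0)); rewrite -tliftD !add0r. Qed.

Lemma tlift_mono u w : tlift (mono u w) = if E u then f w * x u else 0.
Proof.
rewrite (@tliftE _ [:: u]) // ?big_seq1 ?coef_mono ?eqxx /=.
 by case: ifP => //; rewrite (dmap0 hf) mul0r.
by move=> v; rewrite inE coef_mono => /negbTE ->.
Qed.

Lemma tlift_incl w : tlift (mono 0 w) = f w.
Proof. by rewrite tlift_mono tE0 x0 mulr1. Qed.

Lemma tliftM a b : tlift (a * b) = tlift a * tlift b.
Proof.
elim/twalg_ind: a => [|a a' Ha Ha'|u w]; first by rewrite mul0r tlift0 mul0r.
 by rewrite mulrDl !tliftD mulrDl Ha Ha'.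
elim/twalg_ind: b => [|b b' Hb Hb'|v w']; first by rewrite mulr0 tlift0 mulr0.
 by rewrite mulrDr !tliftD mulrDr Hb Hb'.
rewrite monoM !tlift_mono.
case: (boolP (E u)) => Eu; last first.
 have /negbTE -> : ~~ E (u + v) by apply: contra Eu; apply: tE_down.
 by rewrite mul0r.
case: (boolP (E v)) => Ev; last first.
 have /negbTE -> : ~~ E (u + v).
  by apply: contra Ev; rewrite addrC; apply: tE_down.
 by rewrite mulr0.
rewrite -mulrA [x u * _]mulrA (comm_tw _ (hx Eu)) -(dmap_tw hf).
rewrite -/(sgm u w') -!mulrA xM //; case: ifP => _; last by rewrite !mulr0.
by rewrite (dmapZ hf) (dmapM hf) -!scalerAl -!scalerAr mulrA.
Qed.

Lemma tlift_hom t a : homT t a -> hom t (tlift a).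
Proof.
move=> ha; elim/homT_ind: ha => [|a1 a2 _ _ H1 H2|u w hw].
- by rewrite tlift0; apply: hom0.
- by rewrite tliftD; apply: homD.
rewrite tlift_mono; case: ifP => Eu; last exact: hom0.
by rewrite -(subrK (deg u) t); apply: homM; [apply: (dmap_hom hf) | apply: hx].
Qed.

End Lift.

End TwistedAlgebra.

End TwistedMonoidAlgebra.
Import TwistedMonoidAlgebra.

(** * Adjoining one variable that kills a cycle, and its universal property *)

Module AdjoiningVariables.

Section Base.
Variables (k : fieldType) (G : zmodType) (chi : alt_bicharacter G k).
Notation T := (tridegree G).

Definition base_hom (t : T) (a : k^o) : Prop := t = 0 \/ a = 0.

Lemma base_dgaP : is_color_dga chi base_hom (fun _ : k^o => 0).
Proof.
split=> //.
- by right.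
- move=> t c a b [->|->]; first by left.
 by case=> [->|->]; [left | right; rewrite scaler0 addr0].
- move=> a; exists [:: 0], (fun t => if t == 0 then a else 0); split=> [t|].
  by case: eqP => [->|_]; [left | right].
 by rewrite big_seq1 eqxx.
- move=> r c ur hc s0 t tr; have [t0|//] := hc t; move: s0.
 rewrite (bigD1_seq t) //= big1 ?addr0 // => u /eqP ut.
 by have [u0|//] := hc u; rewrite u0 t0 in ut.
- by move=> t a t0 [t0'|//]; rewrite t0' in t0.
- by left.
- move=> t u a b [->|->]; last by right; rewrite mul0r.
 by case=> [->|->]; [left; rewrite addr0 | right; rewrite mulr0].
- by move=> a b; rewrite addr0.
- by move=> t a _; right.
- by move=> t a b _; rewrite mul0r mulr0 scaler0 addr0.
- move=> t u a b [->|->]; last by rewrite mul0r mulr0 scaler0.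
 case=> [->|->]; last by rewrite mul0r mulr0 scaler0.
 by rewrite csign0r scale1r mulrC.
- by move=> t a [->|->] //; rewrite mul0r.
Qed.

Definition base_dga : color_dga chi := ColorDGA base_dgaP.

Lemma base_dmap (B : color_dga chi) : is_dmap (fun c : base_dga => c *: (1 : B)).
Proof.
split=> [c a b|a b||t a|a].
- by rewrite scalerDl scalerA.
- by rewrite -scalerAl mul1r scalerA.
- exact: scale1r.
- by case=> ->; [apply: homC | rewrite scale0r; apply: hom0].
- by rewrite difZ dif1 scaler0 scale0r.
Qed.

Lemma csignMn (t s : T) u v : csign chi (t *+ u) (s *+ v) = csign chi t s ^+ (u * v)%N.
Proof.
elim: u => [|u IH]; first by rewrite mulr0n csign0l mul0n.
rewrite mulrSr csignDl IH mulSn exprD mulrC; congr (_ * _).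
elim: v {IH} => [|v IH]; first by rewrite csign0r.
by rewrite mulrSr csignDr IH exprS mulrC.
Qed.

Lemma tdegMn1 (t : T) l : (t *+ l).1.1 = t.1.1 *+ l.
Proof. by elim: l => // l IH; rewrite !mulrS /= IH. Qed.

Lemma odd_tdegMn (t : T) l : odd `|(t *+ l).1.1|%N = odd `|t.1.1|%N && odd l.
Proof. by rewrite tdegMn1 -mulr_natr abszM oddM natz absz_nat. Qed.

Lemma csign_self (t : T) : csign chi t t = (-1) ^+ odd `|t.1.1|%N.
Proof.
case ot: (odd _); first by rewrite csign_odd.
rewrite /csign bichar_alt mulr1 -exprz_exp signz_absz ot expr0 exp1rz //.
Qed.

End Base.

Section AdjoinVariable.
Variables (k : fieldType) (G : zmodType) (chi : alt_bicharacter G k).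
Notation T := (tridegree G).
Variables (t : T).

Notation o := (odd `|t.1.1|%N).

Lemma dpow_okD u v : dpow_ok o (u + v) -> dpow_ok o u.
Proof. by rewrite /dpow_ok; case: o => //=; apply: leq_ltn_trans (leq_addr _ _). Qed.

Lemma bin_assoc u v w : ('C(u + v, u) * 'C(u + v + w, u + v) = 'C(v + w, v) * 'C(u + (v + w), u))%N.
Proof.
have p : (0 < u`! * v`! * w`!)%N by rewrite !muln_gt0 !fact_gt0.
apply/eqP; rewrite -(eqn_pmul2r p); apply/eqP.
have e1 := bin_fact (leq_addr v u); have e2 := bin_fact (leq_addr w (u + v)%N).
have e3 := bin_fact (leq_addr w v); have e4 := bin_fact (leq_addr (v + w) u)%N.
rewrite !addKn in e1 e2 e3 e4.
transitivity ((u + v + w)`!)%N.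
 by rewrite -e2 -e1; ring.
by rewrite -addnA -e4 -e3; ring.
Qed.

Hypothesis t_gt0 : 0 < t.1.1.

Let b (u v : nat) : k := ('C(u + v, u))%:R.

Lemma adj_tbC u v : dpow_ok o (u + v)%N ->
 b u v = csign chi (t *+ u) (t *+ v) * b v u.
Proof.
rewrite /b /dpow_ok csignMn csign_self [in 'C(v + u, _)]addnC.
have -> : 'C(u + v, v) = 'C(u + v, u) by rewrite -bin_sub ?leq_addl // addnK.
case: o => /= [uv|_]; last by rewrite expr0 expr1n mul1r.
by case: u v uv => [|[|u]] [|[|v]] //= _; rewrite ?mul1r.
Qed.

Lemma adj_tb_odd u : odd `|(t *+ u).1.1|%N -> dpow_ok o (u + u)%N -> b u u = 0.
Proof.
by rewrite odd_tdegMn /dpow_ok => /andP[-> ou] /=; case: u ou => [|[|u]].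
Qed.

Lemma adj_tb0l u : b 0 u = 1. Proof. by rewrite /b bin0. Qed.
Lemma adj_tb0r u : b u 0 = 1. Proof. by rewrite /b addn0 binn. Qed.
Lemma adj_tbA u v w : b u v * b (u + v) w = b v w * b u (v + w).
Proof. by rewrite /b -!natrM bin_assoc. Qed.
Lemma adj_tdeg_ge0 u : 0 <= (t *+ u).1.1.
Proof. by rewrite tdegMn1 mulrn_wge0 // ltW. Qed.
Lemma adj_tE0 : dpow_ok o 0. Proof. by rewrite /dpow_ok implybT. Qed.

(** The binomial constants serve in odd degree too: only the exponents 0 and 1 survive there, and x
    x is cut off by [dpow_ok]. *)
Definition adj_twist : twist chi nat :=
 @Twist k G chi nat (dpow_ok o) b (fun l => t *+ l) adj_tE0 dpow_okD adj_tb0l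
  adj_tb0r adj_tbA adj_tbC (mulr0n t) (mulrnDr t) adj_tdeg_ge0 adj_tb_odd.

Variables (W : color_dga chi) (z : W).
Hypotheses (hz : hom (t + (-1, 0, 0)) z) (dz : dif z = 0).

Notation A := (twalg W adj_twist).

(** Coefficient of x^(u) in the boundary of the sum of the a_u x^(u): the boundary of a_u, plus
    tau(a_(u+1)) z coming from d(x^(u+1)) = z x^(u). *)
Definition adj_dif_fun (a : A) (u : nat) : W :=
 dif (coef a u) + (if dpow_ok o u then tau (coef a u.+1) * z else 0).

Lemma adj_dif_subproof a : @finsupp _ _ _ W _ adj_twist (adj_dif_fun a).
Proof.
split.
 exists (supp a ++ map predn (supp a)) => u; rewrite mem_cat negb_or => /andP[ua pa].
 rewrite /adj_dif_fun supp_out // dif0 supp_out ?/tau ?tw0 ?mul0r ?if_same ?addr0 //.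
 by apply: contra pa => ua'; apply/mapP; exists u.+1.
move=> u Eu; have /negbTE Eu' : ~~ dpow_ok o u := Eu.
by rewrite /adj_dif_fun (@coefE _ _ _ _ _ adj_twist) // dif0 Eu' addr0.
Qed.

Definition adj_dif (a : A) : A :=
 sub_of_mem (Z := Subspace (@finsupp0 _ _ _ W _ adj_twist) (@finsupp_lin _ _ _ W _ adj_twist))
  (adj_dif_subproof a).

Lemma coef_adj_dif a u : coef (adj_dif a) u =
 dif (coef a u) + (if dpow_ok o u then tau (coef a u.+1) * z else 0).
Proof. by []. Qed.

Lemma adj_difD : {morph adj_dif : a b / a + b}.
Proof.
move=> a c; apply: coefP => u; rewrite coefD !coef_adj_dif !coefD difD -!addrA.
congr (_ + _); rewrite addrCA; congr (_ + _); case: ifP => _; last by rewrite addr0.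
by rewrite /tau twD mulrDl.
Qed.

Lemma adj_dif_mono0 w : adj_dif (mono _ 0 w) = mono _ 0 (dif w).
Proof.
apply: coefP => u; rewrite coef_adj_dif !coef_mono (_ : (u.+1 == 0) = false) // /tau tw0 mul0r if_same addr0.
by case: ifP; rewrite ?dif0.
Qed.

Lemma adj_dif_mono u w : dpow_ok o u.+1 ->
 adj_dif (mono _ u.+1 w) = mono _ u.+1 (dif w) + mono _ u (tau w * z).
Proof.
move=> Eu; have Eu' : dpow_ok o u by apply: (@dpow_okD u 1); rewrite addn1.
apply: coefP => v; rewrite coefD coef_adj_dif !coef_mono /= Eu Eu' !andbT eqSS.
congr (_ + _); first by case: ifP; rewrite ?dif0.
by case: eqP => [->|_]; rewrite ?Eu' //= /tau tw0 mul0r if_same.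
Qed.

Lemma adj_dif_hom s a : homT s a -> homT (s + (-1, 0, 0)) (adj_dif a).
Proof.
move=> ha u; rewrite coef_adj_dif; apply: homD.
 by have := hom_dif (ha u); rewrite addrAC.
case: ifP => _; last exact: hom0.
have := homM (hom_tw (sg (G := G) k) (ha u.+1)) hz; rewrite /tau.
rewrite [_ + (t + _)](_ : _ = s + (-1, 0, 0) - tdeg adj_twist u) //=.
by rewrite mulrSr opprD [RHS]addrAC !addrA subrK.
Qed.

Lemma adj_difK a : adj_dif (adj_dif a) = 0.
Proof.
elim/twalg_ind: a => [|a c Ha Hc|u w].
- by apply: (addIr (adj_dif (adj_dif 0))); rewrite -!adj_difD !add0r.
- by rewrite !adj_difD Ha Hc addr0.
case: u => [|u]; first by rewrite !adj_dif_mono0 difK mono0.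
case: (boolP (dpow_ok o u.+1)) => Eu; last first.
 rewrite mono_out //; apply: (addIr (adj_dif (adj_dif 0))).
 by rewrite -!adj_difD !add0r.
rewrite adj_dif_mono // adj_difD adj_dif_mono // difK mono0 add0r.
have dtz : dif (tau w * z) = - (tau (dif w) * z).
 by rewrite difM dz mulr0 addr0 dif_tau mulNr.
case: u Eu => [|u] Eu; first by rewrite adj_dif_mono0 dtz monoN subrr.
have Eu' : dpow_ok o u.+1 by apply: (@dpow_okD u.+1 1); rewrite addn1.
rewrite adj_dif_mono // dtz monoN addrA subrr add0r.
(* The remaining term contains z z. A second divided power exists only for even x, and then z is
   odd, so z z = 0. *)
rewrite {1}/tau tw_mul ?(tw_hom _ hz) //; last by move=> *; apply: sgD.
rewrite -scalerAr -scalerAl -mulrA (odd_sq hz) ?mulr0 ?scaler0 ?mono0 //.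
have := odd_abszD t.1.1 (-1); rewrite /= => ->; rewrite addbT.
by move: Eu; rewrite /dpow_ok; case: o.
Qed.

Lemma twsg_csign s (w : W) : tw (csign chi (s + (-1, 0, 0))) w = tw (csign chi s) (tau w).
Proof.
symmetry; apply: tw_comp => r; rewrite csignDl; congr (_ * _).
by rewrite /csign /= bichar0l mulr1 mulN1r /sg !signz_absz abszN.
Qed.

Let u0 w' : adj_dif (mono _ 0 w') = mono _ 0 (dif w') := adj_dif_mono0 w'.

Lemma adj_dif0 : adj_dif 0 = 0.
Proof. by apply: (addIr (adj_dif 0)); rewrite -adj_difD !add0r. Qed.

Lemma csign_downr (s : T) : csign chi s (-1, 0, 0) = sg k s.
Proof. by rewrite /csign /= bichar0r mulr1 mulrN1 /sg !signz_absz abszN. Qed.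

Lemma csign_down_self u : csign chi (t *+ u) (t + (-1, 0, 0)) * sg k (t *+ u) =
 ((-1) ^+ o) ^+ u.
Proof.
rewrite csignDr csign_downr -mulrA sgK mulr1.
by rewrite -{2}[t]mulr1n csignMn muln1 csign_self.
Qed.

Lemma sgm_dif u (w : W) : dif (sgm adj_twist u w) = sg k (t *+ u) *: sgm adj_twist u (dif w).
Proof.
apply: prj_inj => s; rewrite prjZ /sgm prj_tw prj_dif prj_tw difZ prj_dif scalerA.
congr (_ *: _); rewrite csignDr mulrC; congr (_ * _).
by rewrite /csign /= mulr1 bichar0r mulr1.
Qed.

Section Leibniz.
Variables (s : T) (u v : nat) (w x : W).
Hypothesis hw : hom (s - t *+ u) w.

Let y := tau w * tau (sgm adj_twist u x) * z.

Lemma adj_leib1 : tau (w * sgm adj_twist u x) * z = y.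
Proof. by rewrite /y /tau tw_mul // => r r'; rewrite sgD. Qed.

Lemma adj_leib2 u' : u = u'.+1 -> tau w * z * sgm adj_twist u' x = y.
Proof.
move=> uE; rewrite /y -!mulrA (comm_tw _ hz) twsg_csign uE; congr (_ * (_ * _)).
apply: prj_inj => r; rewrite /tau /sgm !prj_tw /= !scalerA mulrSr csignDl.
by congr (_ *: _); ring.
Qed.

Lemma adj_leib3 : (-1) ^ s.1.1 *: (w * sgm adj_twist u (tau x * z)) = ((-1) ^+ o) ^+ u *: y.
Proof.
rewrite -csign_down_self -/(sg k s) -{1}(subrK (t *+ u) s) sgD sgmM.
have tww : tau w = sg k (s - t *+ u) *: w := tw_hom _ hw.
have szz : sgm adj_twist u z = csign chi (t *+ u) (t + (-1, 0, 0)) *: z := tw_hom _ hz.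
rewrite szz /y tww -!scalerAr -!scalerAl !scalerA mulrA.
congr (_ *: _); first by rewrite /=; ring.
congr (_ * _ * _); apply: prj_inj => r; rewrite /tau /sgm !prj_tw !scalerA.
by congr (_ *: _); ring.
Qed.

Lemma adj_leib0 : dif (w * sgm adj_twist u x) =
 dif w * sgm adj_twist u x + (-1) ^ s.1.1 *: (w * sgm adj_twist u (dif x)).
Proof.
rewrite difM sgm_dif /tau (tw_hom _ hw) -scalerAr -scalerAl scalerA mulrC -sgD subrK.
by [].
Qed.

End Leibniz.

Lemma adj_dif_homM s a c : homT s a ->
 adj_dif (a * c) = adj_dif a * c + (-1) ^ s.1.1 *: (a * adj_dif c).
Proof.
have d0 := adj_dif0.
move=> ha; elim/homT_ind: ha => [|a1 a2 _ _ H1 H2|u w hw].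
- by rewrite d0 !mul0r d0 scaler0 addr0.
- by rewrite mulrDl !adj_difD !mulrDl scalerDr H1 H2 addrACA.
elim/twalg_ind: c => [|c1 c2 H1 H2|v x].
- by rewrite d0 !mulr0 d0 scaler0 addr0.
- by rewrite mulrDr !adj_difD !mulrDr scalerDr H1 H2 addrACA.
case: (boolP (dpow_ok o u)) => Eu; last by rewrite !(@mono_out _ _ _ _ _ adj_twist u) // d0 !mul0r d0 scaler0 addr0.
case: (boolP (dpow_ok o v)) => Ev; last by rewrite !(@mono_out _ _ _ _ _ adj_twist v) // d0 !mulr0 d0 scaler0 addr0.
have E0 := @adj_leib0 s u w x hw.
have E1 := @adj_leib1 u w x.
have E2 := @adj_leib2 u w x.
have E3 := @adj_leib3 s u w x hw.
case: u Eu hw E0 E1 E2 E3 => [|u] Eu hw E0 E1 E2 E3.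
 case: v Ev => [|v] Ev.
  rewrite !u0 !monoM add0r -!monoZ -monoD u0 /= /tb /= /b bin0 !scale1r.
  by rewrite E0.
 have e : (0 + v.+1)%R = v.+1 by [].
 rewrite u0 adj_dif_mono // mulrDr !monoM e adj_dif_mono // !tb0l.
 rewrite !scale1r E0 E1 monoD scalerDr -!monoZ E3 expr0 scale1r addrA.
 by rewrite [(0 + v)%R]add0n.
case: v Ev => [|v] Ev.
 have e : (u.+1 + 0)%R = u.+1 by exact: addn0.
 have e' : (u + 0)%R = u by exact: addn0.
 rewrite u0 adj_dif_mono // mulrDl !monoM e e' adj_dif_mono // !tb0r.
 rewrite !scale1r E0 E1 monoD -!monoZ E2 //.
 by rewrite addrAC.
have e : (u.+1 + v.+1)%R = (u + v).+2 by rewrite [LHS]addnS.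
have e1 : (u + v.+1)%R = (u + v).+1 by exact: addnS.
have e2 : (u.+1 + v)%R = (u + v).+1 by [].
rewrite !adj_dif_mono // mulrDl mulrDr scalerDr !monoM e e1 e2 -!monoZ /=.
(* Pascal's rule: the two binomial coefficients are those of the terms obtained by differentiating
   the left and the right factor. *)
have bE : b u.+1 v.+1 = ('C((u + v).+1, u) + 'C((u + v).+1, u.+1))%:R.
 by rewrite /b addSn addnS binS addnC.
rewrite E2 // [(-1) ^ _ *: (b u.+1 v *: _)]scalerA [_ * b _ _]mulrC -scalerA E3.
case: (boolP (dpow_ok o (u + v).+2)) => Euv.
 rewrite adj_dif_mono // difZ /tau twZ -/(tau _) -scalerAl E1 E0 bE.
 have -> : o = false by move: Euv; rewrite /dpow_ok; case: o.
 rewrite expr0 expr1n scale1r !scalerDr natrD scalerDl !monoD.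
 rewrite /b !addSn !addnS scalerA [_ * (-1) ^ _]mulrC -scalerA -!addrA.
 congr (_ + (_ + _)); rewrite [RHS]addrCA; congr (_ + _).
 by rewrite scalerDl monoD.
(* Odd variable: both factors are multiples of x, their product is 0, and the two terms on the right
   cancel by sign. *)
have oT : o = true by move: Euv; rewrite /dpow_ok; case: o.
have m2 w' : mono adj_twist (u + v).+2 w' = 0 :> A by apply: mono_out.
rewrite !m2 d0 !add0r.
have [-> ->] : u = 0%N /\ v = 0%N.
 by move: Eu Ev; rewrite /dpow_ok oT /=; case: (u) (v) => [|?] [|?].
by rewrite oT /b /= expr1 scaleN1r !scale1r monoN subrr.
Qed.

Definition adj_dga : color_dga chi :=
 ColorDGA (twalg_dgaP adj_difD adj_dif_hom adj_difK adj_dif_homM).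

Definition adj_incl (w : W) : adj_dga := mono adj_twist 0 w.
Definition adj_var (l : nat) : adj_dga := mono adj_twist l 1.

Lemma adj_incl_dmap : is_dmap adj_incl.
Proof.
split=> [c a a'|a a'||s a ha|a].
- exact: monoL.
- by rewrite /adj_incl [RHS]monoM addr0 tb0r scale1r sgm0.
- by [].
- by have := homT_mono adj_twist 0 ha; rewrite tdeg0 addr0.
- by rewrite /adj_incl [RHS]adj_dif_mono0.
Qed.

Lemma adj_incl_inj : injective adj_incl.
Proof. by move=> a a' /(congr1 (fun b => @coef _ _ _ W _ (adj_twist) b 0)); rewrite !coef_mono eqxx tE0. Qed.

End AdjoinVariable.

Section DividedPowers.
Variables (k : fieldType) (G : zmodType) (chi : alt_bicharacter G k).
Notation T := (tridegree G).

(** The sequence is total, and [dps_out] puts 0 at the powers that an odd variable lacks; thus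
    variables with the same powers are equal as functions, which the universal property of towers
    states as an equality of lists. *)
Record dps (B : color_dga chi) (t : T) (x : nat -> B) : Prop := {
 dps0 : x 0 = 1;
 dps_hom : forall l, dpow_ok (odd `|t.1.1|%N) l -> hom (t *+ l) (x l);
 dpsM : forall h l, ~~ odd `|t.1.1|%N -> x h * x l = x (h + l)%N *+ 'C(h + l, h);
 dps_dif : forall l, ~~ odd `|t.1.1|%N -> dif (x l.+1) = dif (x 1) * x l;
 dps_out : forall l, ~~ dpow_ok (odd `|t.1.1|%N) l -> x l = 0 }.

Lemma dps_hom1 (B : color_dga chi) t (x : nat -> B) : dps t x -> hom t (x 1).
Proof. by move=> hx; rewrite -[t]mulr1n; apply: (dps_hom hx); rewrite /dpow_ok implybT. Qed.

Lemma dps_mul (B : color_dga chi) t (x : nat -> B) h l : dps t x ->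
 dpow_ok (odd `|t.1.1|%N) h -> dpow_ok (odd `|t.1.1|%N) l ->
 x h * x l = if dpow_ok (odd `|t.1.1|%N) (h + l) then x (h + l)%N *+ 'C(h + l, h) else 0.
Proof.
move=> hx; case ot: (odd _); last first.
 by rewrite /dpow_ok /= => _ _; apply: (dpsM hx); rewrite ot.
rewrite /dpow_ok /=; case: h l => [|[|h]] [|[|l]] //= _ _.
- by rewrite (dps0 hx) mulr1.
- by rewrite (dps0 hx) mul1r.
- by rewrite (dps0 hx) mulr1.
- by rewrite (odd_sq (dps_hom1 hx)).
Qed.

Section AdjLift.
Variables (t : T) (t_gt0 : 0 < t.1.1) (W : color_dga chi) (z : W).
Hypotheses (hz : hom (t + (-1, 0, 0)) z) (dz : dif z = 0).
Notation A := (adj_dga t_gt0 hz dz).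

Lemma adj_var_dps : dps t (adj_var t_gt0 hz dz).
Proof.
have E0 : dpow_ok (odd `|t.1.1|%N) 0 by rewrite /dpow_ok implybT.
split=> // [l _|h l oe|l oe|l ol]; last exact: mono_out.
- by have := homT_mono (adj_twist chi t_gt0) l (hom1 W); rewrite add0r.
- by rewrite /adj_var [LHS]monoM sgm1 mul1r monoZ scaler_nat.
- have E1 n : dpow_ok (odd `|t.1.1|%N) n by rewrite /dpow_ok (negbTE oe).
 rewrite /adj_var [dif _]adj_dif_mono // [in RHS]/dif /= adj_dif_mono //.
 rewrite !dif1 !mono0 !add0r [RHS]monoM add0r tb0l scale1r sgm0 mulr1.
 by [].
Qed.

Lemma adj_var_dif : dif (adj_var t_gt0 hz dz 1) = adj_incl t_gt0 hz dz z.
Proof.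
have E1 : dpow_ok (odd `|t.1.1|%N) 1 by rewrite /dpow_ok implybT.
rewrite [LHS]adj_dif_mono // dif1 mono0 add0r /tau tw1 ?mul1r //.
Qed.

Lemma adj_ind (P : A -> Prop) : P 0 -> (forall a b, P a -> P b -> P (a + b)) ->
 (forall w l, dpow_ok (odd `|t.1.1|%N) l -> P (adj_incl t_gt0 hz dz w * adj_var t_gt0 hz dz l)) ->
 forall a, P a.
Proof.
move=> P0 PD Pm; apply: (@twalg_ind _ _ _ W _ (adj_twist chi t_gt0)) => // u w.
case: (boolP (dpow_ok (odd `|t.1.1|%N) u)) => Eu; last by rewrite mono_out.
by rewrite mono_mul; apply: Pm.
Qed.

Section Target.
Variables (B : color_dga chi) (f : W -> B) (x : nat -> B).
Hypotheses (hf : is_dmap f) (hx : dps t x) (dx : dif (x 1) = f z).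

Definition adj_lift : A -> B := @tlift _ _ _ _ _ (adj_twist chi t_gt0) _ f x.

Let xM u v : tE (adj_twist chi t_gt0) u -> tE (adj_twist chi t_gt0) v -> x u * x v =
 if tE (adj_twist chi t_gt0) (u + v) then tb (adj_twist chi t_gt0) u v *: x (u + v) else 0.
Proof.
move=> Eu Ev; have e : tE (adj_twist chi t_gt0) (u + v) = dpow_ok (odd `|t.1.1|%N) (u + v)%N by [].
by rewrite (dps_mul hx Eu Ev) e; case: ifP => // _; rewrite -scaler_nat.
Qed.

Let xh u : tE (adj_twist chi t_gt0) u -> hom (tdeg (adj_twist chi t_gt0) u) (x u).
Proof. exact: (dps_hom hx). Qed.

Lemma adj_lift_incl w : adj_lift (adj_incl t_gt0 hz dz w) = f w.
Proof. by apply: tlift_incl => //; apply: (dps0 hx). Qed.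

Lemma adj_lift_var l : dpow_ok (odd `|t.1.1|%N) l -> adj_lift (adj_var t_gt0 hz dz l) = x l.
Proof.
by move=> El; rewrite /adj_lift [LHS]tlift_mono // [tE _ _]El (dmap1 hf) mul1r.
Qed.

Lemma adj_lift_dmap : is_dmap adj_lift.
Proof.
have LM a b : adj_lift (a * b) = adj_lift a * adj_lift b by apply: (tliftM hf xh xM).
have LD a b : adj_lift (a + b) = adj_lift a + adj_lift b by apply: tliftD.
have L0 : adj_lift 0 = 0 by apply: tlift0.
split=> //.
- by move=> c a b; apply: tliftL.
- by rewrite -(dmap1 hf) -adj_lift_incl (dmap1 (adj_incl_dmap t_gt0 hz dz)).
- by move=> s a ha; apply: (tlift_hom hf xh).
apply: adj_ind => [|a b Ha Hb|w l El].
- by rewrite dif0 L0 dif0.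
- by rewrite difD !LD difD Ha Hb.
have hi := adj_incl_dmap t_gt0 hz dz.
have dvar : adj_lift (dif (adj_var t_gt0 hz dz l)) = dif (x l).
 case: l El => [|l] El.
  by rewrite (dps0 hx) dif1 (dps0 adj_var_dps) dif1 L0.
 case: (boolP (odd `|t.1.1|%N)) => ot.
  have -> : l = 0%N by move: El; rewrite /dpow_ok ot; case: (l).
  by rewrite adj_var_dif adj_lift_incl dx.
 rewrite (dps_dif adj_var_dps) // LM adj_var_dif adj_lift_incl -dx (dps_dif hx l) //.
 by rewrite adj_lift_var // /dpow_ok; case: (odd _) ot.
rewrite difM !LD !LM difM -(dmap_dif hi) !adj_lift_incl -(dmap_dif hf) dvar adj_lift_var //.
by rewrite /tau -(dmap_tw hi) (adj_lift_incl (tw _ w)) (dmap_tw hf).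
Qed.

End Target.
End AdjLift.
End DividedPowers.

End AdjoiningVariables.
Import AdjoiningVariables.

(** * Spans and freeness of lists of variables over a subspace of coefficients *)

Module SpansOfDividedPowers.

Section Adjoin.
Variables (k : fieldType) (G : zmodType) (chi : alt_bicharacter G k).
Notation T := (tridegree G).

Section One.
Variable (B : color_dga chi).
Implicit Types (C F : B -> Prop) (x : nat -> B) (t : T).

(** Normal form of coefficients: 0 beyond N and at missing powers, so that expansions of different
    lengths can be added and compared. *)
Definition nice_coefs (o : bool) C (N : nat) (c : nat -> B) : Prop :=
 (forall l, C (c l)) /\ (forall l, (N <= l)%N || ~~ dpow_ok o l -> c l = 0).

Lemma adjoinP o C x b : C 0 -> adjoin o C x b <->
 exists N c, nice_coefs o C N c /\ b = \sum_(l < N) c l * x l.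
Proof.
move=> C0; split=> [[N [c [Cc ->]]]|[N [c [[Cc c0] ->]]]].
 exists N, (fun l => if (l < N)%N && dpow_ok o l then c l else 0); split.
  split=> [l|l]; first by case: ifP.
  by rewrite leqNgt; case: (l < N)%N => //= /negbTE ->.
 rewrite big_mkcond; apply: eq_bigr => l _; rewrite ltn_ord /=.
 by case: ifP; rewrite ?mul0r.
exists N, c; split=> //; rewrite [in RHS]big_mkcond; apply: eq_bigr => l _.
by case: ifPn => // nl; rewrite c0 ?nl ?orbT // mul0r.
Qed.

Lemma nice_widen o C N N' c : (N <= N')%N -> nice_coefs o C N c -> nice_coefs o C N' c.
Proof.
move=> NN [Cc c0]; split=> // l /orP[h|h]; apply: c0; last by rewrite h orbT.
by rewrite (leq_trans NN h).
Qed.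

Lemma sum_widen o C N N' c x : (N <= N')%N -> nice_coefs o C N c ->
 \sum_(l < N') c l * x l = \sum_(l < N) c l * x l.
Proof.
move=> NN [Cc c0]; rewrite -(subnKC NN) big_split_ord /= [X in _ + X]big1 ?addr0 //.
by move=> l _; rewrite c0 ?mul0r // leq_addr.
Qed.

Lemma adjoin_mem o C x l c : C 0 -> dpow_ok o l -> C c -> adjoin o C x (c * x l).
Proof.
move=> C0 ol Cc; apply/adjoinP => //; exists l.+1, (fun m => if m == l then c else 0).
split.
 split=> m; first by case: eqP.
 by case: eqP => // ->; rewrite ltnn ol.
rewrite big_ord_recr /= eqxx big1 ?add0r // => m _.
by rewrite ltn_eqF ?mul0r.
Qed.

Lemma adjoin_sub o C x c : C 0 -> x 0 = 1 -> C c -> adjoin o C x c.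
Proof.
move=> C0 x0 Cc; rewrite -[c]mulr1 -x0; apply: adjoin_mem => //.
by rewrite /dpow_ok implybT.
Qed.

Lemma adjoin_mono o C C' x b : (forall a, C a -> C' a) -> adjoin o C x b -> adjoin o C' x b.
Proof. by move=> CC [N [c [Cc ->]]]; exists N, c; split=> // l; apply: CC. Qed.

Lemma dpow_free_mono o C C' x : (forall a, C a -> C' a) -> dpow_free o C' x -> dpow_free o C x.
Proof. by move=> CC fr N c Cc; apply: fr => l; apply: CC. Qed.

Section GSub.
Variables (C : B -> Prop) (hC : gsub C) (t : T) (x : nat -> B) (hx : dps t x).
Notation o := (odd `|t.1.1|%N).
Let C0 := gsub0 hC.

Lemma adjoinD a b : adjoin o C x a -> adjoin o C x b -> adjoin o C x (a + b).
Proof.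
move=> /adjoinP-/(_ C0)[N [c [nc ->]]] /adjoinP-/(_ C0)[M [d [nd ->]]]; apply/adjoinP => //.
have le1 : (N <= maxn N M)%N by apply: leq_maxl.
have le2 : (M <= maxn N M)%N by apply: leq_maxr.
exists (maxn N M), (fun l => c l + d l); split.
 have [[Cc c0] [Cd d0]] := (nice_widen le1 nc, nice_widen le2 nd).
 by split=> [l|l hl]; [apply: (gsubD hC) | rewrite c0 ?d0 ?addr0].
rewrite -(sum_widen x le1 nc) -(sum_widen x le2 nd) -big_split /=.
by apply: eq_bigr => l _; rewrite mulrDl.
Qed.

Lemma adjoin0 : adjoin o C x 0.
Proof. by exists 0, (fun=> 0); split=> //; rewrite big_ord0. Qed.

Lemma adjoinZ e a : adjoin o C x a -> adjoin o C x (e *: a).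
Proof.
move=> [N [c [Cc ->]]]; exists N, (fun l => e *: c l); split=> [l|]; first exact: (gsubZ hC).
by rewrite scaler_sumr; apply: eq_bigr => l _; rewrite scalerAl.
Qed.

Lemma adjoin_ind (P : B -> Prop) : P 0 -> (forall a b, P a -> P b -> P (a + b)) ->
 (forall c l, dpow_ok o l -> C c -> P (c * x l)) -> forall a, adjoin o C x a -> P a.
Proof.
move=> P0 PD Pm a [N [c [Cc ->]]]; elim/big_ind: _ => // l ol.
exact: Pm.
Qed.

Lemma adjoin_gsub : gsub (adjoin o C x).
Proof.
split; first exact: adjoin0.
 by move=> c a b ha hb; apply: adjoinD => //; apply: adjoinZ.
move=> s a ha; elim/adjoin_ind: ha => [|a1 a2|c l ol Cc].
- by rewrite prj0; apply: adjoin0.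
- by rewrite prjD; apply: adjoinD.
rewrite (prj_mulr _ _ (dps_hom hx ol)); apply: adjoin_mem => //.
exact: gsubP.
Qed.

Lemma adjoin_incl c : C c -> adjoin o C x c.
Proof. by apply: adjoin_sub => //; apply: (dps0 hx). Qed.

Lemma adjoin_dif a : (forall c, C c -> C (dif c)) -> (forall c, C c -> C (c * dif (x 1))) ->
 adjoin o C x a -> adjoin o C x (dif a).
Proof.
move=> dC zC ha; have gA := adjoin_gsub; elim/adjoin_ind: ha => [|a1 a2|c l ol Cc].
- by rewrite dif0; apply: adjoin0.
- by rewrite difD; apply: adjoinD.
rewrite difM; apply: (gsubD gA); first by apply: adjoin_mem => //; apply: dC.
have Ctc : C (tau c) by apply: gsub_tw.
case: l ol => [|l] ol; first by rewrite (dps0 hx) dif1 mulr0; apply: adjoin0.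
case/orP: (orbN o) => ot.
 have -> : l = 0%N by move: ol; rewrite /dpow_ok ot; case: (l).
 by apply: adjoin_incl; apply: zC.
rewrite (dps_dif hx) // mulrA; apply: adjoin_mem; last exact: zC.
 exact: C0.
by rewrite /dpow_ok (negbTE ot).
Qed.

Lemma adjoin_mulr a b : (forall c, C c -> C (c * b)) -> gsub (fun b => forall c, C c -> C (c * b)) ->
 adjoin o C x a -> adjoin o C x (a * b).
Proof.
move=> Cb gR ha; elim/adjoin_ind: ha => [|a1 a2|c l ol Cc].
- by rewrite mul0r; apply: adjoin0.
- by rewrite mulrDl; apply: adjoinD.
rewrite -mulrA (comm_tw _ (dps_hom hx ol)) mulrA; apply: adjoin_mem => //.
exact: (gsub_tw gR).
Qed.

End GSub.

Lemma adjoin_galg C t x : galg C -> dps t x -> galg (adjoin (odd `|t.1.1|%N) C x).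
Proof.
move=> [gC C1 CM] hx; have C0 := gsub0 gC; have gA := adjoin_gsub gC hx.
split=> //; first exact: adjoin_incl.
move=> a b ha hb; elim/adjoin_ind: ha => [|a1 a2|c l ol Cc].
- by rewrite mul0r; apply: (gsub0 gA).
- by rewrite mulrDl; apply: (gsubD gA).
elim/adjoin_ind: hb => [|b1 b2|d m om Cd].
- by rewrite mulr0; apply: (gsub0 gA).
- by rewrite mulrDr; apply: (gsubD gA).
rewrite -mulrA [x l * _]mulrA (comm_tw _ (dps_hom hx ol)) -mulrA mulrA (dps_mul hx ol om).
have Cct : C (c * tw (csign chi (t *+ l)) d) by apply: CM => //; apply: gsub_tw.
case: ifP => olm; last by rewrite mulr0; apply: (gsub0 gA).
rewrite mulrnAr; apply: (gsubMn gA); exact: adjoin_mem.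
Qed.

Lemma freeP C t x N c : gsub C -> dpow_free (odd `|t.1.1|%N) C x ->
 nice_coefs (odd `|t.1.1|%N) C N c -> \sum_(l < N) c l * x l = 0 -> forall l, c l = 0.
Proof.
move=> gC fr [Cc c0] s0 l.
case: (boolP ((N <= l)%N || ~~ dpow_ok (odd `|t.1.1|%N) l)) => [/c0//|].
rewrite negb_or -ltnNge negbK => /andP[lN ol]; apply: (fr N c) => //.
rewrite -[RHS]s0 big_mkcond /=; apply: eq_bigr => m _.
by case: ifPn => // nm; rewrite c0 ?nm ?orbT // mul0r.
Qed.

Lemma free_uniq C t x N M c d : gsub C -> dpow_free (odd `|t.1.1|%N) C x ->
 nice_coefs (odd `|t.1.1|%N) C N c -> nice_coefs (odd `|t.1.1|%N) C M d ->
 \sum_(l < N) c l * x l = \sum_(l < M) d l * x l -> forall l, c l = d l.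
Proof.
move=> gC fr nc nd e l.
have le1 : (N <= maxn N M)%N by apply: leq_maxl.
have le2 : (M <= maxn N M)%N by apply: leq_maxr.
apply/eqP; rewrite -subr_eq0; apply/eqP.
apply: (freeP (N := maxn N M) (c := fun l => c l - d l) gC fr).
 have [[Cc c0] [Cd d0]] := (nice_widen le1 nc, nice_widen le2 nd).
 by split=> [m|m hm]; [apply: (gsubB gC) | rewrite c0 ?d0 ?subr0].
under eq_bigr do rewrite mulrBl.
by rewrite sumrB (sum_widen x le1 nc) (sum_widen x le2 nd) e subrr.
Qed.

Lemma adjoin_hom_coefs C t x s b : gsub C -> dps t x ->
 adjoin (odd `|t.1.1|%N) C x b -> hom s b ->
 exists N c, [/\ nice_coefs (odd `|t.1.1|%N) C N c,
  forall l, hom (s - t *+ l) (c l) & b = \sum_(l < N) c l * x l].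
Proof.
move=> gC hx /adjoinP-/(_ (gsub0 gC))[N [c [[Cc c0] eb]]] hb.
exists N, (fun l => prj (s - t *+ l) (c l)); split.
- by split=> [l|l hl]; [apply: gsubP | rewrite c0 // prj0].
- by move=> l; apply: hom_prj.
rewrite -[LHS](prj_id hb) eb prj_sum; apply: eq_bigr => l _.
case: (boolP (dpow_ok (odd `|t.1.1|%N) l)) => ol; last first.
 by rewrite c0 ?ol ?orbT // mul0r !prj0 mul0r.
by rewrite (prj_mulr _ _ (dps_hom hx ol)).
Qed.

Definition var : Type := (T * (nat -> B))%type.
Definition vodd (v : var) : bool := odd `|v.1.1.1|%N.
Definition adj1 C (v : var) : B -> Prop := adjoin (vodd v) C v.2.
Definition spanL C (L : seq var) : B -> Prop := foldl adj1 C L.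
Fixpoint freeL C (L : seq var) : Prop :=
 if L is v :: L' then dpow_free (vodd v) C v.2 /\ freeL (adj1 C v) L' else True.
Definition allP (L : seq var) (P : var -> Prop) : Prop := foldr (fun v Q => P v /\ Q) True L.
Definition dpsL L := allP L (fun v => dps v.1 v.2).

Lemma allP_cat L L' P : allP (L ++ L') P <-> allP L P /\ allP L' P.
Proof.
elim: L => [|v L IH] /=; first by split=> // -[].
by rewrite IH; split=> [[? []]|[[]]].
Qed.
Lemma allP_impl L (P Q : var -> Prop) : (forall v, P v -> Q v) -> allP L P -> allP L Q.
Proof. by move=> PQ; elim: L => //= v L IH [Pv /IH]; split=> //; apply: PQ. Qed.

Lemma spanL_cat C L L' : spanL C (L ++ L') = spanL (spanL C L) L'.
Proof. exact: foldl_cat. Qed.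
Lemma freeL_cat C L L' : freeL C (L ++ L') <-> freeL C L /\ freeL (spanL C L) L'.
Proof.
elim: L C => [|v L IH] C /=; first by split=> // -[].
by rewrite IH; split=> [[? []]|[[]]].
Qed.

Lemma spanL_mono C C' L b : (forall a, C a -> C' a) -> spanL C L b -> spanL C' L b.
Proof.
elim: L C C' => [|v L IH] C C' CC /=; first exact: CC.
by apply: IH => a; apply: adjoin_mono.
Qed.
Lemma freeL_mono C C' L : (forall a, C a -> C' a) -> freeL C' L -> freeL C L.
Proof.
elim: L C C' => [|v L IH] C C' CC //= [f1 f2]; split; first exact: dpow_free_mono f1.
by apply: IH f2 => a; apply: adjoin_mono.
Qed.
Lemma spanL_gsub C L : gsub C -> dpsL L -> gsub (spanL C L).
Proof.
elim: L C => [|v L IH] C gC //= [dv dL]; apply: IH => //; exact: adjoin_gsub.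
Qed.
Lemma spanL_galg C L : galg C -> dpsL L -> galg (spanL C L).
Proof.
elim: L C => [|v L IH] C gC //= [dv dL]; apply: IH => //; exact: adjoin_galg.
Qed.
Lemma spanL_incl C L a : gsub C -> dpsL L -> C a -> spanL C L a.
Proof.
elim: L C => [|v L IH] C gC //= [dv dL] Ca; apply: IH => //; first exact: adjoin_gsub.
exact: adjoin_incl.
Qed.
Lemma spanL_ext C C' L : (forall b, C b <-> C' b) -> forall b, spanL C L b <-> spanL C' L b.
Proof. by move=> e b; split; apply: spanL_mono => a /e. Qed.

Lemma adj1_ind C v (P : B -> Prop) : P 0 -> (forall a b, P a -> P b -> P (a + b)) ->
 (forall c l, dpow_ok (vodd v) l -> C c -> P (c * v.2 l)) -> forall a, adj1 C v a -> P a.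
Proof. exact: adjoin_ind. Qed.

Lemma adj1_cap C D F v b : gsub C -> gsub D -> gsub F -> (forall a, C a -> F a) ->
 (forall a, D a -> F a) -> dps v.1 v.2 -> dpow_free (vodd v) F v.2 ->
 adj1 C v b -> adj1 D v b -> adj1 (fun a => C a /\ D a) v b.
Proof.
move=> gC gD gF CF DF dv fr /adjoinP-/(_ (gsub0 gC))[N [c [nc ->]]].
move=> /adjoinP-/(_ (gsub0 gD))[M [d [nd e]]].
have F1 : nice_coefs (vodd v) F N c by case: nc => Cc c0; split=> // l; apply: CF.
have F2 : nice_coefs (vodd v) F M d by case: nd => Cc c0; split=> // l; apply: DF.
have cd := free_uniq gF fr F1 F2 e.
apply/adjoinP; first by split; apply: gsub0.
exists N, c; split=> //; case: nc nd => Cc c0 [Dd _]; split=> // l; split=> //.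
by rewrite cd.
Qed.

(** The variables are free over a common [F], so an element has one expansion, whose coefficients
    lie in [C] and in [D]. *)
Lemma spanL_cap C D F L b : gsub C -> gsub D -> gsub F -> (forall a, C a -> F a) ->
 (forall a, D a -> F a) -> dpsL L -> freeL F L ->
 spanL C L b -> spanL D L b -> spanL (fun a => C a /\ D a) L b.
Proof.
elim: L C D F => [|v L IH] C D F gC gD gF CF DF //= [dv dL] [f1 f2] h1 h2.
have := IH _ _ _ (adjoin_gsub gC dv) (adjoin_gsub gD dv) (adjoin_gsub gF dv) _ _ dL f2 h1 h2.
move=> /(_ (fun a => adjoin_mono CF) (fun a => adjoin_mono DF)).
apply: spanL_mono => a []; exact: (adj1_cap gC gD gF).
Qed.

Lemma spanL_sum C D L b : gsub C -> gsub D -> dpsL L ->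
 spanL (fun a => exists c d, [/\ C c, D d & a = c + d]) L b ->
 exists c d, [/\ spanL C L c, spanL D L d & b = c + d].
Proof.
elim: L C D => [|v L IH] C D gC gD //= [dv dL] h.
apply: (IH _ _ (adjoin_gsub gC dv) (adjoin_gsub gD dv) dL).
apply: spanL_mono h => a [N [c [/= hc ->]]].
have /choice[pq hpq] : forall l, exists pq : B * B, [/\ C pq.1, D pq.2 & c l = pq.1 + pq.2].
 by move=> l; have [p [q [? ? ?]]] := hc l; exists (p, q).
pose p l := (pq l).1; pose q l := (pq l).2.
exists (\sum_(l < N | dpow_ok (vodd v) l) p l * v.2 l).
exists (\sum_(l < N | dpow_ok (vodd v) l) q l * v.2 l); split.
- by exists N, p; split=> // l; case: (hpq l).
- by exists N, q; split=> // l; case: (hpq l).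
by rewrite -big_split; apply: eq_bigr => l _ /=; case: (hpq l) => _ _ ->; rewrite mulrDl.
Qed.

End One.

Section Maps.
Variables (A B : color_dga chi) (f : A -> B) (hf : is_dmap f).

Definition vmap (v : var A) : var B := (v.1, fun l => f (v.2 l)).
Definition image (C : A -> Prop) (b : B) : Prop := exists2 a, C a & b = f a.

Lemma image_gsub C : gsub C -> gsub (image C).
Proof.
move=> gC; split; first by exists 0; [apply: gsub0 | rewrite (dmap0 hf)].
 move=> c _ _ [a Ca ->] [b Cb ->]; exists (c *: a + b); first exact: gsubL.
 by rewrite (dmapL hf).
by move=> t _ [a Ca ->]; exists (prj t a); [apply: gsubP | rewrite (dmap_prj hf)].
Qed.
Lemma image_galg C : galg C -> galg (image C).
Proof.
move=> [gC C1 CM]; split; first exact: image_gsub; first by exists 1; rewrite ?(dmap1 hf).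
by move=> _ _ [a Ca ->] [b Cb ->]; exists (a * b); [apply: CM | rewrite (dmapM hf)].
Qed.

Lemma vmap_dps v : dps v.1 v.2 -> dps (vmap v).1 (vmap v).2.
Proof.
move=> hv; split=> /= [|l ol|h l ol|l ol|l ol].
- by rewrite (dps0 hv) (dmap1 hf).
- by apply: (dmap_hom hf); apply: (dps_hom hv).
- by rewrite -(dmapM hf) (dpsM hv) // -scaler_nat (dmapZ hf) scaler_nat.
- by rewrite -(dmap_dif hf) (dps_dif hv) // (dmapM hf) (dmap_dif hf).
- by rewrite (dps_out hv) // (dmap0 hf).
Qed.
Lemma vmap_dpsL L : dpsL L -> dpsL (map vmap L).
Proof. by elim: L => //= v L IH [/vmap_dps hv /IH]. Qed.

Lemma adj1_image C v b : C 0 -> adj1 (image C) (vmap v) b <-> image (adj1 C v) b.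
Proof.
move=> C0; split=> [[N [c [Cc ->]]]|[a [N [c [Cc ->]]] ->]].
 pose d l := s2val (cid2 (Cc l)).
 exists (\sum_(l < N | dpow_ok (vodd v) l) d l * v.2 l).
  by exists N, d; split=> // l; rewrite /d; case: cid2.
 rewrite (dmap_sum hf); apply: eq_bigr => l _; rewrite (dmapM hf) /=.
 by congr (_ * _); rewrite /d; case: cid2.
exists N, (fun l => f (c l)); split=> [l|]; first by exists (c l).
by rewrite (dmap_sum hf); apply: eq_bigr => l _; rewrite (dmapM hf).
Qed.

Lemma spanL_image C L b : gsub C -> dpsL L ->
 spanL (image C) (map vmap L) b <-> image (spanL C L) b.
Proof.
elim: L C b => [|v L IH] C b gC //= [dv dL].
rewrite -IH //; last exact: adjoin_gsub.
by apply: spanL_ext => a; apply: adj1_image; apply: gsub0.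
Qed.

Lemma free_image C v : gsub C -> injective f -> dpow_free (vodd v) C v.2 ->
 dpow_free (vodd v) (image C) (vmap v).2.
Proof.
move=> gC fi fr N c Cc s0 l lN ol.
pose d l := s2val (cid2 (Cc l)).
have fd m : c m = f (d m) by rewrite /d; case: cid2.
have Cd m : C (d m) by rewrite /d; case: cid2.
rewrite fd (fr N d) ?(dmap0 hf) //; apply: fi; rewrite (dmap0 hf) (dmap_sum hf) -[RHS]s0.
by apply: eq_bigr => m _; rewrite (dmapM hf) fd.
Qed.

Lemma freeL_image C L : gsub C -> dpsL L -> injective f -> freeL C L ->
 freeL (image C) (map vmap L).
Proof.
move=> + + fi; elim: L C => //= v L IH C gC [dv dL] [f1 f2]; split; first exact: free_image.
have gA : gsub (adj1 C v) by apply: adjoin_gsub.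
apply: freeL_mono (IH _ gA dL f2) => a /adj1_image; apply; exact: gsub0.
Qed.

(** Freeness of the image variables forces [f] to kill each coefficient separately. *)
Lemma spanL_ker C L b : gsub C -> dpsL L -> freeL (image C) (map vmap L) ->
 spanL C L b -> f b = 0 -> spanL (fun a => C a /\ f a = 0) L b.
Proof.
elim: L C b => [|v L IH] C b gC //= [dv dL] [f1 f2] hb fb0.
have gA : gsub (adj1 C v) by apply: adjoin_gsub.
have f2' : freeL (image (adj1 C v)) (map vmap L).
 by apply: freeL_mono f2 => a /adj1_image; apply; apply: gsub0.
have := IH _ _ gA dL f2' hb fb0; apply: spanL_mono => a [+ fa0].
move=> /adjoinP-/(_ (gsub0 gC))[N [c [[Cc c0] ea]]].
have fc : forall l, f (c l) = 0.
 apply: (freeP (B := B) (t := v.1) (x := fun l => f (v.2 l)) (c := fun l => f (c l)) (N := N) (image_gsub gC)) => //.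
  split=> [l|l hl]; first by exists (c l).
  by rewrite c0 // (dmap0 hf).
 by rewrite -[RHS]fa0 ea (dmap_sum hf); apply: eq_bigr => l _; rewrite (dmapM hf).
apply/adjoinP; first by split; [apply: gsub0 | rewrite (dmap0 hf)].
by exists N, c; split.
Qed.

End Maps.

End Adjoin.

End SpansOfDividedPowers.
Import SpansOfDividedPowers.

(** * Acyclic mapping cones: composition, Mayer-Vietoris, quotients, adjunction *)

Module MappingCones.

Section Cone.
Variables (k : fieldType) (G : zmodType) (chi : alt_bicharacter G k).
Notation T := (tridegree G).
Implicit Types A B : color_dga chi.

(* acyclicity of the mapping cone of [f : C -> D] *)
Definition cone A B (f : A -> B) (C : A -> Prop) (D : B -> Prop) : Prop :=
 forall z w, C z -> D w -> dif z = 0 -> f z = dif w ->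
 exists z' w', [/\ C z', D w', dif z' = z & w = f z' + dif w'].

Lemma cone_ext A B (f : A -> B) (C C' : A -> Prop) (D D' : B -> Prop) : (forall a, C a <-> C' a) ->
 (forall b, D b <-> D' b) -> cone f C D -> cone f C' D'.
Proof.
move=> eC eD cf z w /eC Cz /eD Dw dz fz.
by have [z' [w' [/eC Cz' /eD Dw' e1 e2]]] := cf z w Cz Dw dz fz; exists z', w'.
Qed.

Lemma cone_comp A B (D : color_dga chi) (f : A -> B) (g : B -> D) C1 C2 C3 : is_dmap f -> is_dmap g ->
 (forall a, C1 a -> C2 (f a)) -> gsub C3 -> (forall a, C2 a -> C3 (g a)) ->
 cone f C1 C2 -> cone g C2 C3 -> cone (g \o f) C1 C3.
Proof.
move=> hf hg f12 gC3 g23 cf cg z w Cz Cw dz gfz.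
have [||||b' [d' [Cb' Cd' eb ew]]] := cg (f z) w _ _ _ _ => //; first exact: f12.
 by rewrite -(dmap_dif hf) dz (dmap0 hf).
have [z' [b'' [Cz' Cb'' ez eb']]] := cf z b' Cz Cb' dz (esym eb).
exists z', (g b'' + d'); split=> //; first by apply: (gsubD gC3) => //; apply: g23.
by rewrite /= difD addrA -(dmap_dif hg) -(dmapD hg) -eb'.
Qed.

(** Two-out-of-three: a relative cycle is moved into [C0] and [D0] along the quasi-isomorphic
    inclusions, filled there, and the corrections are added back. *)
Lemma cone_retract A B (f : A -> B) C0 C D0 D : is_dmap f -> gsub C -> gsub D ->
 (forall a, C0 a -> C a) -> (forall a, D0 a -> D a) -> (forall a, C0 a -> D0 (f a)) ->
 (forall a, C a -> D (f a)) -> C0 0 ->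
 cone id C0 C -> cone id D0 D -> cone f C0 D0 -> cone f C D.
Proof.
move=> hf gC gD CC DD fD0 fD C00 ci cj c0 z w Cz Dw dz fz.
have [||||c [z2 [C0c Cz2 dc ez]]] := ci 0 z _ _ _ _ => //; rewrite ?dif0 //.
have [||||d [w2 [Dd Dw2 ed ew]]] := cj (f c) (w - f z2) _ _ _ _ => //.
- exact: fD0.
- by apply: (gsubB gD) => //; apply: fD.
- by rewrite -(dmap_dif hf) dc (dmap0 hf).
- by rewrite difB -fz -(dmap_dif hf) -(dmapB hf); congr f; rewrite ez addrK.
have [c' [d' [C0c' D0d' ec ed']]] := c0 c d C0c Dd dc (esym ed).
exists (c' + z2), (d' + w2); split.
- by apply: (gsubD gC) => //; apply: CC.
- by apply: (gsubD gD) => //; apply: DD.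
- by rewrite difD ec -ez.
- by rewrite -[w in LHS](subrK (f z2)) ew /= ed' (dmapD hf) difD -addrA [dif w2 + _]addrC addrACA.
Qed.

(** Write a relative cycle as (a + b, a' + b'). Then da = -db lies in both pieces, and so does f a -
    da'; filling this pair in the intersection turns each half into a relative cycle of its own
    piece. *)
Lemma cone_MV A B (f : A -> B) (C1 C2 : A -> Prop) (D1 D2 : B -> Prop) : is_dmap f ->
 gsub C1 -> gsub C2 -> gsub D1 -> gsub D2 ->
 (forall a, C1 a -> C1 (dif a)) -> (forall a, C2 a -> C2 (dif a)) ->
 (forall a, D1 a -> D1 (dif a)) -> (forall a, D2 a -> D2 (dif a)) ->
 (forall a, C1 a -> D1 (f a)) -> (forall a, C2 a -> D2 (f a)) ->
 cone f C1 D1 -> cone f C2 D2 ->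
 cone f (fun a => C1 a /\ C2 a) (fun a => D1 a /\ D2 a) ->
 cone f (fun a => exists c d, [/\ C1 c, C2 d & a = c + d])
    (fun a => exists c d, [/\ D1 c, D2 d & a = c + d]).
Proof.
move=> hf gC1 gC2 gD1 gD2 dC1 dC2 dD1 dD2 f1 f2 cf1 cf2 cf z w.
move=> [a [b [C1a C2b ->]]] [a' [b' [D1a D2b ->]]] dz fz.
have dab : dif a = - dif b by apply/eqP; rewrite -addr_eq0 -difD dz.
have fab : f a - dif a' = - (f b - dif b').
 apply/eqP; rewrite opprB subr_eq addrAC eq_sym subr_eq -(dmapD hf) fz difD addrC.
 by [].
have [|||| c' [d' [[C1c C2c] [D1d D2d] ec ed]]] := cf (dif a) (f a - dif a').
- by split; [apply: dC1 | rewrite dab; apply: (gsubN gC2); apply: dC2].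
- split; first by apply: (gsubB gD1); [apply: f1 | apply: dD1].
 by rewrite fab; apply: (gsubN gD2); apply: (gsubB gD2); [apply: f2 | apply: dD2].
- exact: difK.
- by rewrite difB difK subr0 (dmap_dif hf).
have [|||| a1 [a1' [C1a1 D1a1 ea1 ea1']]] := cf1 (a - c') (a' + d').
- exact: (gsubB gC1).
- exact: (gsubD gD1).
- by rewrite difB ec subrr.
- by rewrite (dmapB hf) difD; apply/eqP; rewrite subr_eq -addrA [dif d' + _]addrC -ed addrC subrK.
have [|||| b1 [b1' [C1b1 D1b1 eb1 eb1']]] := cf2 (b + c') (b' - d').
- exact: (gsubD gC2).
- exact: (gsubB gD2).
- by rewrite difD ec dab addrN.
- rewrite (dmapD hf) difB; apply/eqP; rewrite eq_sym subr_eq -addrA -ed fab.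
 by rewrite opprB addrCA subrr addr0.
exists (a1 + b1), (a1' + b1'); split.
- by exists a1, b1.
- by exists a1', b1'.
- by rewrite difD ea1 eb1 addrACA addNr addr0.
- by rewrite (dmapD hf) difD addrACA -ea1' -eb1' addrACA addrN addr0.
Qed.

(* the quotient of a cone-acyclic map by a cone-acyclic submap, pushed along
 surjections [p], [q] *)
Lemma cone_quot A B A' B' (f : A -> B) (p : A -> A') (q : B -> B') (f' : A' -> B')
  (C I : A -> Prop) (D J : B -> Prop) : is_dmap f -> is_dmap p -> is_dmap q -> is_dmap f' ->
 gsub C -> gsub D -> (forall a, I a -> C a) -> (forall b, J b -> D b) ->
 (forall a, C a -> C (dif a)) -> (forall b, D b -> D (dif b)) ->
 (forall a, C a -> D (f a)) ->
 (forall a, C a -> p a = 0 -> I a) -> (forall b, D b -> q b = 0 -> J b) ->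
 (forall a, I a -> p a = 0) -> (forall b, J b -> q b = 0) ->
 (forall a, C a -> q (f a) = f' (p a)) ->
 cone f C D -> cone f I J -> cone f' (image p C) (image q D).
Proof.
move=> hf hp hq hf' gC gD IC JD dC dD fD pI qJ Ip Jq sq cC cI _ _ [z Cz ->] [w Dw ->] dz fz.
have [|||| c' [d' [Ic Jd ec ed]]] := cI (dif z) (f z - dif w).
- by apply: pI; [apply: dC | rewrite (dmap_dif hp)].
- apply: qJ; first by apply: (gsubB gD); [apply: fD | apply: dD].
 by rewrite (dmapB hq) sq // fz (dmap_dif hq) subrr.
- exact: difK.
- by rewrite difB difK subr0 (dmap_dif hf).
have [|||| z1 [w1 [Cz1 Dw1 ez1 ew1]]] := cC (z - c') (w + d').
- by apply: (gsubB gC) => //; apply: IC.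
- by apply: (gsubD gD) => //; apply: JD.
- by rewrite difB ec subrr.
- by rewrite (dmapB hf) difD; apply/eqP; rewrite subr_eq -addrA [dif d' + _]addrC -ed addrC subrK.
exists (p z1), (q w1); split; [by exists z1 | by exists w1 | |].
 by rewrite -(dmap_dif hp) ez1 (dmapB hp) (Ip c') ?subr0.
rewrite -sq // -(dmap_dif hq) -(dmapD hq) -ew1 (dmapD hq) (Jq d') ?addr0 //.
Qed.

(** Induction on the number of divided powers in the expansion. The coefficients of the highest one
    form a relative cycle of [C] and [D]; once it is filled, only lower powers remain. *)
Lemma cone_adjoin A B (f : A -> B) (C : A -> Prop) (D : B -> Prop) (v : var A) :
 is_dmap f -> gsub C -> gsub D -> (forall a, C a -> D (f a)) ->
 (forall a, C a -> C (dif a)) -> (forall a, D a -> D (dif a)) ->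
 dps v.1 v.2 -> (forall a, C a -> C (a * dif (v.2 1))) ->
 (forall b, D b -> D (b * f (dif (v.2 1)))) ->
 dpow_free (vodd v) C v.2 -> dpow_free (vodd v) D (fun l => f (v.2 l)) ->
 cone f C D -> cone f (adj1 C v) (adj1 D (vmap f v)).
Proof.
move=> hf gC gD fD dC dD dv zC zD frC frD cf.
have dv' := vmap_dps hf dv.
have dif_coefs (E : color_dga chi) (u : var E) N c : dps u.1 u.2 -> (forall l, ~~ dpow_ok (vodd u) l -> c l = 0) ->
  (forall l, (N <= l)%N -> c l = 0) ->
  dif (\sum_(l < N) c l * u.2 l) = \sum_(l < N) (dif (c l) +
   (if dpow_ok (vodd u) l then tau (c l.+1) * dif (u.2 1) else 0)) * u.2 l.
 move=> du c0 cN; rewrite dif_sum.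
 under [RHS]eq_bigr do rewrite mulrDl; under [LHS]eq_bigr do rewrite difM.
 rewrite !big_split /=; congr (_ + _).
 case: N cN => [|N] cN; first by rewrite !big_ord0.
 rewrite big_ord_recl /= (dps0 du) dif1 mulr0 add0r [RHS]big_ord_recr /=.
 rewrite cN // /tau tw0 mul0r if_same mul0r addr0; apply: eq_bigr => l _.
 rewrite /bump /= add1n; case: (boolP (dpow_ok (vodd u) l.+1)) => ol; last first.
  by rewrite c0 // tw0 mul0r mul0r if_same mul0r.
 have ol' : dpow_ok (vodd u) l by move: ol; rewrite /dpow_ok; case: (vodd u) => //= /ltnW.
 rewrite ol' -mulrA; congr (_ * _).
 case/orP: (orbN (vodd u)) => ou; last by rewrite (dps_dif du).
 have -> : (l : nat) = 0%N by move: ol; rewrite /dpow_ok ou; case: (nat_of_ord l).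
 by rewrite (dps0 du) mulr1.
suff H N : forall z w c d, nice_coefs (vodd v) C N c -> z = \sum_(l < N) c l * v.2 l ->
  nice_coefs (vodd v) D N d -> w = \sum_(l < N) d l * f (v.2 l) ->
  dif z = 0 -> f z = dif w -> exists z' w', [/\ adj1 C v z', adj1 D (vmap f v) w',
   dif z' = z & w = f z' + dif w'].
 move=> z w /adjoinP-/(_ (gsub0 gC))[N [c [nc ez]]].
 move=> /adjoinP-/(_ (gsub0 gD))[M [d [nd ew]]].
 have le1 : (N <= maxn N M)%N by apply: leq_maxl.
 have le2 : (M <= maxn N M)%N by apply: leq_maxr.
 apply: (H (maxn N M) z w c d); rewrite ?(sum_widen _ le1 nc) //.
 - exact: nice_widen nc.
 - exact: nice_widen nd.
 - by rewrite (sum_widen (fun l => f (v.2 l)) le2 nd).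
have gA := adjoin_gsub gC dv; have gA' := adjoin_gsub gD dv'.
elim: N => [|N IH] z w c d nc ez nd ew dz fz.
 exists 0, 0; rewrite ez ew !big_ord0 dif0 (dmap0 hf) dif0 add0r.
 by split=> //; [exact: (gsub0 gA) | exact: (gsub0 gA')].
have [Cc c0] := nc; have [Dd d0] := nd.
(* In the coefficient of x^(N) of a boundary, the contribution of x^(N+1) is 0 because N is the
   highest power. *)
have dcN : dif (c N) = 0 /\ f (c N) = dif (d N).
 have hc l : ~~ dpow_ok (vodd v) l -> c l = 0 by move=> h; rewrite c0 ?h ?orbT.
 have hcN l : (N.+1 <= l)%N -> c l = 0 by move=> h; rewrite c0 ?h.
 have hd l : ~~ dpow_ok (vodd v) l -> d l = 0 by move=> h; rewrite d0 ?h ?orbT.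
 have hdN l : (N.+1 <= l)%N -> d l = 0 by move=> h; rewrite d0 ?h.
 split.
  have := dz; rewrite ez dif_coefs // => s0.
  have := @freeP _ _ _ A C v.1 v.2 N.+1 (fun l => dif (c l) + (if dpow_ok (vodd v) l then tau (c l.+1) * dif (v.2 1) else 0)) gC frC _ s0 N.
  rewrite (hcN N.+1) // /tau tw0 mul0r if_same addr0; apply.
  split=> l; first apply: (gsubD gC).
  - exact: dC.
  - by case: ifP => _; [apply: zC; apply: gsub_tw | apply: gsub0].
  case/orP=> hl; last by rewrite hc // dif0 (negbTE hl) addr0.
  by rewrite (hcN l) // (hcN l.+1) 1?leqW // dif0 /tau tw0 mul0r if_same addr0.
 have := fz; rewrite ez ew (dif_coefs B (vmap f v)) //= (dmap_sum hf) => /eqP.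
 rewrite -subr_eq0 -sumrB => /eqP s0.
 pose e l := f (c l) - (dif (d l) + (if dpow_ok (vodd v) l then tau (d l.+1) * dif (f (v.2 1)) else 0)).
 have := @freeP _ _ _ B D v.1 (fun l => f (v.2 l)) N.+1 e gD frD _ _ N.
 rewrite /e (hdN N.+1) // /tau tw0 mul0r if_same addr0 => H; apply/eqP; rewrite -subr_eq0.
 apply/eqP; apply: H.
  split=> l; first apply: (gsubB gD).
  - exact: fD.
  - apply: (gsubD gD); first exact: dD.
   case: ifP => _; last exact: gsub0.
   by rewrite -(dmap_dif hf); apply: zD; apply: gsub_tw.
  case/orP=> hl.
   by rewrite (hcN l) // (hdN l) // (hdN l.+1) 1?leqW // dif0 /tau tw0 mul0r if_same addr0 (dmap0 hf) subr0.
  by rewrite hc // hd // dif0 (negbTE hl) addr0 (dmap0 hf) subr0.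
 by rewrite -[RHS]s0; apply: eq_bigr => l _; rewrite mulrBl (dmapM hf).
have [dc fc] := dcN; have [z' [w' [Cz' Dw' ez' ew']]] := cf _ _ (Cc N) (Dd N) dc fc.
have [oN|nN] := boolP (dpow_ok (vodd v) N); last first.
 apply: (IH z w c d) => //.
 - split=> // l; case/orP=> hl; last by rewrite c0 ?hl ?orbT.
  by move: hl; rewrite leq_eqVlt => /orP[/eqP<-|hl]; rewrite c0 ?hl ?nN ?orbT.
 - by rewrite ez big_ord_recr /= c0 ?nN ?orbT // mul0r addr0.
 - split=> // l; case/orP=> hl; last by rewrite d0 ?hl ?orbT.
  by move: hl; rewrite leq_eqVlt => /orP[/eqP<-|hl]; rewrite d0 ?hl ?nN ?orbT.
 - by rewrite ew big_ord_recr /= d0 ?nN ?orbT // mul0r addr0.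
pose Z := z' * v.2 N; pose Y := w' * f (v.2 N).
have AZ : adj1 C v Z by apply: adjoin_mem => //; apply: gsub0.
have AY : adj1 D (vmap f v) Y by apply: (@adjoin_mem _ _ _ _ (vodd v) D (fun l => f (v.2 l))) => //; apply: gsub0.
(* The boundary of the filling z' x^(N) also produces tau(z') times the boundary of x^(N), which
   involves x^(N-1) only and so goes into the remainder. *)
have dxN (E : color_dga chi) (F : E -> Prop) (u : var E) (y : E) : gsub F -> dps u.1 u.2 -> F y ->
  (forall a, F a -> F (a * dif (u.2 1))) -> dpow_ok (vodd u) N ->
  exists e, nice_coefs (vodd u) F N e /\ tau y * dif (u.2 N) = \sum_(l < N) e l * u.2 l.
 move=> gF du Fy zF; case: N {IH nc ez nd ew c0 d0 dcN dc fc ez' ew' oN AZ AY Z Y} => [|n] on.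
  exists (fun=> 0); split; first by split=> // l; apply: gsub0.
  by rewrite big_ord0 (dps0 du) dif1 mulr0.
 exists (fun l => if l == n then tau y * dif (u.2 1) else 0); split.
  split=> [l|l hl]; first by case: eqP => _; [apply: zF; apply: gsub_tw | apply: gsub0].
  case: eqP hl => // ->; rewrite ltnn /= => /negP; case.
  by move: on; rewrite /dpow_ok; case: (vodd u) => //= /ltnW.
 rewrite big_ord_recr /= eqxx big1 ?add0r => [|m _]; last by rewrite ltn_eqF ?mul0r.
 rewrite -mulrA; congr (_ * _); case/orP: (orbN (vodd u)) => ou; last by rewrite (dps_dif du).
 have -> : n = 0%N by move: on; rewrite /dpow_ok ou; case: (n).
 by rewrite (dps0 du) mulr1.
have [e1 [ne1 se1]] := dxN A C v z' gC dv Cz' zC oN.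
have zD' b : D b -> D (b * dif ((vmap f v).2 1)) by move=> Db; rewrite /= -(dmap_dif hf); apply: zD.
have [e2 [ne2 se2]] := dxN B D (vmap f v) w' gD dv' Dw' zD' oN.
have nice_sub (E : color_dga chi) (F : E -> Prop) p (c1 c2 : nat -> E) : gsub F ->
  nice_coefs p F N c1 -> nice_coefs p F N c2 -> nice_coefs p F N (fun l => c1 l - c2 l).
 move=> gF [F1 z1] [F2 z2]; split=> [l|l hl]; first exact: (gsubB gF).
 by rewrite z1 ?z2 ?subr0.
have nice_cut (E : color_dga chi) (F : E -> Prop) p (c1 : nat -> E) : gsub F ->
  nice_coefs p F N.+1 c1 -> nice_coefs p F N (fun l => if (l < N)%N then c1 l else 0).
 move=> gF [F1 z1]; split=> [l|l]; first by case: ifP => // _; apply: gsub0.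
 by rewrite leqNgt; case: ltnP => //= lN hl; rewrite z1 // hl orbT.
have ncc := nice_cut _ _ _ _ gC nc; have ndd := nice_cut _ _ _ _ gD nd.
have ez1 : z - dif Z = \sum_(l < N) ((if (l < N)%N then c l else 0) - e1 l) * v.2 l.
 rewrite ez big_ord_recr /= difM ez' se1 addrKA; under [RHS]eq_bigr do rewrite mulrBl ltn_ord.
 by rewrite sumrB.
have ew1 : w - f Z - dif Y = \sum_(l < N) ((if (l < N)%N then d l else 0) - e2 l) * f (v.2 l).
 rewrite ew big_ord_recr /= ew' /Z /Y difM se2 (dmapM hf) mulrDl.
 under [RHS]eq_bigr do rewrite mulrBl ltn_ord.
 by rewrite sumrB [f z' * _ + _]addrC addrA addrK opprD addrA addrK.
have [||z2 [w2 [Az2 Aw2 ez2 ew2]]] := IH (z - dif Z) (w - f Z - dif Y) _ _ (nice_sub _ _ _ _ _ gC ncc ne1) ez1 (nice_sub _ _ _ _ _ gD ndd ne2) ew1.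
- by rewrite difB dz difK subrr.
- by rewrite (dmapB hf) fz (dmap_dif hf) !difB difK subr0.
exists (z2 + Z), (w2 + Y); split.
- exact: (gsubD gA).
- exact: (gsubD gA').
- by rewrite difD ez2 subrK.
rewrite (dmapD hf) difD addrACA -ew2 -addrA [f Z + _]addrC addrA.
by rewrite [w - f Z - dif Y + _]addrA ?subrK // addrAC -addrA subrK subrK.
Qed.

End Cone.

End MappingCones.
Import MappingCones.

(** * Skew polynomial rings modulo monomials, as twisted monoid algebras *)

Module SkewMonomials.

(** Each B j with j < i must move left past A i; all other pairs are already in order. *)
Lemma ordered_mul (k : fieldType) (R : algType k) n (A B : 'I_n -> R) (c : 'I_n -> 'I_n -> k) :
 (forall i j, A i * B j = c i j *: (B j * A i)) ->
 (\prod_(i < n) A i) * (\prod_(i < n) B i) =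
 (\prod_(i < n) \prod_(j < n | (j < i)%N) c i j) *: \prod_(i < n) (A i * B i).
Proof.
elim: n A B c => [|n IH] A B c AB; first by rewrite !big_ord0 mul1r scale1r.
pose w := widen_ord (leqnSn n).
have comm m (p : 'I_m -> 'I_n.+1) : A ord_max * \prod_(i < m) B (p i) =
  (\prod_(i < m) c ord_max (p i)) *: (\prod_(i < m) B (p i) * A ord_max).
 elim: m p => [|m IHm] p; first by rewrite !big_ord0 mulr1 mul1r scale1r.
 rewrite !big_ord_recr /= mulrA IHm -scalerAl -[_ * A ord_max * _]mulrA AB.
 by rewrite -scalerAr scalerA mulrA.
rewrite !big_ord_recr /= -/w -mulrA [A _ * _]mulrA (comm n w) -scalerAl -scalerAr.
rewrite -[_ * A ord_max * _]mulrA [X in _ *: X]mulrA (IH (fun i => A (w i)) (fun i => B (w i)) (fun i j => c (w i) (w j))) //.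
rewrite -!scalerAl scalerA mulrA; congr (_ *: _).
rewrite [LHS]mulrC; congr (_ * _).
 apply: eq_bigr => i _; rewrite big_mkcond [RHS]big_mkcond [RHS]big_ord_recr /=.
 by rewrite ltnNge ltnW ?mulr1 // ltn_ord.
rewrite [RHS]big_mkcond big_ord_recr /= ltnn mulr1; apply: eq_bigr => i _.
by rewrite ltn_ord.
Qed.

Lemma commXX (k : fieldType) (R : algType k) (x y : R) (c : k) a b :
 x * y = c *: (y * x) -> x ^+ a * y ^+ b = c ^+ (a * b) *: (y ^+ b * x ^+ a).
Proof.
move=> xy; have xyb m : x * y ^+ m = c ^+ m *: (y ^+ m * x).
 elim: m => [|m IH]; first by rewrite !expr0 mulr1 mul1r scale1r.
 by rewrite (exprS y) mulrA xy -scalerAl -[y * x * _]mulrA IH -scalerAr scalerA mulrA -(exprS c).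
elim: a => [|a IH]; first by rewrite mul0n !expr0 mul1r mulr1 scale1r.
rewrite (exprS x) -[x * _ * _]mulrA IH -scalerAr [x * (_ * _)]mulrA xyb.
by rewrite -scalerAl scalerA -mulrA -exprD mulSn addnC.
Qed.

Section MonomialMul.
Variables (k : fieldType) (R : algType k) (n : nat) (x : 'I_n -> R) (q : 'I_n -> 'I_n -> k).
Hypothesis xq : forall i j, x i * x j = q i j *: (x j * x i).

Definition reorder (a b : {ffun 'I_n -> nat}) : k :=
 \prod_(i < n) \prod_(j < n | (j < i)%N) q i j ^+ (a i * b j)%N.

Lemma monomialM a b : monomial x a * monomial x b = reorder a b *: monomial x (a + b).
Proof.
rewrite /monomial (@ordered_mul _ _ _ _ _ (fun i j => q i j ^+ (a i * b j)%N)) => [|i j].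
 by congr (_ *: _); apply: eq_bigr => i _; rewrite ffunE exprD.
exact: commXX.
Qed.

Lemma monomial0 : monomial x 0 = 1.
Proof. by rewrite /monomial big1 // => i _; rewrite ffunE. Qed.

End MonomialMul.

Section SkewMonomialAlgebra.
Variables (k : fieldType) (G : zmodType) (chi : alt_bicharacter G k).
Notation T := (tridegree G).
Variables (n : nat) (g : 'I_n -> G).
Notation M := {ffun 'I_n -> nat}.
Variable E : pred M.
Hypotheses (E0 : E 0) (E_down : forall a b, E (a + b) -> E a).

Notation td i := ((0, 0, g i) : T).
Notation q := (fun i j => chi (g i) (g j)).

(** Internal degrees are 0 here, to match closures whose internal degree has been forgotten. *)
Definition mdeg (a : M) : T := \sum_(i < n) td i *+ a i.

Lemma mdeg0 : mdeg 0 = 0. Proof. by rewrite /mdeg big1 // => i _; rewrite ffunE. Qed.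
Lemma mdegD a b : mdeg (a + b) = mdeg a + mdeg b.
Proof. by rewrite /mdeg -big_split; apply: eq_bigr => i _; rewrite ffunE mulrnDr. Qed.
Lemma mdeg_hom a : (mdeg a).1.1 = 0.
Proof.
rewrite /mdeg; elim/big_ind: _ => // [u v|i _]; last by rewrite tdegMn1 /= mul0rn.
by move=> e1 e2; rewrite /= e1 e2.
Qed.
Lemma mdeg_int a : (mdeg a).1.2 = 0.
Proof.
rewrite /mdeg; elim/big_ind: _ => // [u v|i _]; first by move=> e1 e2; rewrite /= e1 e2.
by elim: (a i) => // m IH; rewrite mulrS /= IH.
Qed.
Lemma mdeg_csign a b : csign chi (mdeg a) (mdeg b) = \prod_(i < n) \prod_(j < n) q i j ^+ (a i * b j)%N.
Proof.
have suml (F : 'I_n -> T) u : csign chi (\sum_(i < n) F i) u = \prod_(i < n) csign chi (F i) u.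
 apply: (big_morph (fun t => csign chi t u)) => [t t'|]; first exact: csignDl.
 exact: csign0l.
have sumr (F : 'I_n -> T) u : csign chi u (\sum_(i < n) F i) = \prod_(i < n) csign chi u (F i).
 apply: (big_morph (fun t => csign chi u t)) => [t t'|]; first exact: csignDr.
 exact: csign0r.
rewrite /mdeg suml; apply: eq_bigr => i _; rewrite sumr; apply: eq_bigr => j _.
by rewrite csignMn; congr (_ ^+ _); rewrite /csign /= mulr0 expr0z mul1r.
Qed.

Lemma reorder0l b : reorder q 0 b = 1.
Proof. by rewrite /reorder big1 // => i _; rewrite big1 // => j _; rewrite ffunE. Qed.
Lemma reorder0r b : reorder q b 0 = 1.
Proof. by rewrite /reorder big1 // => i _; rewrite big1 // => j _; rewrite ffunE muln0. Qed.
Lemma reorderDl a b c : reorder q (a + b) c = reorder q a c * reorder q b c.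
Proof.
rewrite /reorder -big_split; apply: eq_bigr => i _; rewrite -big_split.
by apply: eq_bigr => j _; rewrite ffunE mulnDl exprD.
Qed.
Lemma reorderDr a b c : reorder q a (b + c) = reorder q a b * reorder q a c.
Proof.
rewrite /reorder -big_split; apply: eq_bigr => i _; rewrite -big_split.
by apply: eq_bigr => j _; rewrite ffunE mulnDr exprD.
Qed.
Lemma reorder_neq0 a b : reorder q a b != 0.
Proof.
apply/prodf_neq0 => i _; apply/prodf_neq0 => j _; apply: expf_neq0.
exact: bichar_neq0.
Qed.

(** The commutation factor runs over all pairs (i, j): those with j < i give [reorder q a b], the
    diagonal gives 1, and those with i < j give the inverse of [reorder q b a]. *)
Lemma reorderC a b : reorder q a b = csign chi (mdeg a) (mdeg b) * reorder q b a.
Proof.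
rewrite mdeg_csign; pose F (i j : 'I_n) := q i j ^+ (a i * b j)%N.
have -> : \prod_(i < n) \prod_(j < n) q i j ^+ (a i * b j)%N =
  reorder q a b * \prod_(i < n) \prod_(j < n | (j < i)%N) F j i.
 have -> : \prod_(i < n) \prod_(j < n | (j < i)%N) F j i = \prod_(i < n) \prod_(j < n | (i < j)%N) F i j.
  by rewrite (exchange_big_dep xpredT).
 rewrite /reorder -big_split; apply: eq_bigr => i _ /=.
 rewrite (bigID (fun j : 'I_n => (j < i)%N)) /=; congr (_ * _).
 rewrite (bigD1 i) ?ltnn //= bichar_alt expr1n mul1r; apply: eq_bigl => j.
 by rewrite -leqNgt ltn_neqAle andbC eq_sym -val_eqE.
rewrite -mulrA -[LHS]mulr1; congr (_ * _); rewrite /reorder -big_split /=.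
rewrite big1 // => i _; rewrite -big_split big1 // => j _ /=.
by rewrite /F [(a j * _)%N]mulnC -exprMn bichar_swap expr1n.
Qed.

(** The constants [reorder] bring a product of two ordered monomials back into order; exponents
    outside [E] are the monomials of the ideal divided out. *)
Definition skew_twist : twist chi M.
Proof.
refine (@Twist k G chi M E (reorder q) mdeg E0 E_down reorder0l reorder0r _ _ mdeg0 mdegD _ _).
- by move=> u v w; rewrite reorderDl reorderDr; ring.
- by move=> u v _; apply: reorderC.
- by move=> u; rewrite mdeg_hom.
- by move=> u; rewrite mdeg_hom.
Defined.

Notation A := (twalg (base_dga chi) skew_twist).

Definition skew_dga : color_dga chi.
Proof.
refine (@ColorDGA k G chi A _ (fun=> 0) _).
apply: (twalg_dgaP (D := fun=> 0)) => //; first by move=> a b /=; rewrite addr0.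
 by move=> t a _; apply: homT0.
by move=> t a b _; rewrite mul0r mulr0 scaler0 addr0.
Defined.

Definition smono (a : M) : skew_dga := @mono k G chi (base_dga chi) M skew_twist a (1 : k^o).
Definition scoef (f : skew_dga) (a : M) : k := coef f a.

Lemma scoefP (f h : skew_dga) : (forall a, scoef f a = scoef h a) -> f = h.
Proof. exact: (@coefP _ _ _ (base_dga chi) _ skew_twist). Qed.
Lemma scoefL c (f h : skew_dga) a : scoef (c *: f + h) a = c * scoef f a + scoef h a.
Proof. by []. Qed.
Lemma scoef_smono a b : E a -> scoef (smono a) b = (b == a)%:R.
Proof. by move=> Ea; rewrite /scoef /smono coef_mono (_ : tE skew_twist a = true) ?andbT //; case: eqP. Qed.
Lemma smono_out a : ~~ E a -> smono a = 0. Proof. exact: (@mono_out _ _ _ (base_dga chi) _ skew_twist). Qed.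
Lemma smono0 : smono 0 = 1. Proof. by []. Qed.
Lemma smonoM a b : smono a * smono b = reorder q a b *: smono (a + b).
Proof.
rewrite [LHS]monoM /sgm tw1 ?mulr1 ?csign0r // monoZ.
by [].
Qed.
Lemma scoef_out (f : skew_dga) a : ~~ E a -> scoef f a = 0. Proof. exact: (@coefE _ _ _ (base_dga chi) _ skew_twist). Qed.
Lemma smono_hom a : hom (mdeg a) (smono a).
Proof. by have := @homT_mono _ _ _ (base_dga chi) _ skew_twist _ a _ (hom1 _); rewrite add0r. Qed.
Lemma skew_dif (f : skew_dga) : dif f = 0. Proof. by []. Qed.

Lemma skew_expand (f : skew_dga) : exists s : seq M, uniq s /\
 f = \sum_(a <- s) scoef f a *: smono a.
Proof.
exists (supp f); split; first exact: supp_uniq.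
rewrite [LHS](@mono_supp _ _ _ (base_dga chi) _ skew_twist f); apply: eq_bigr => a _.
by rewrite -[coef f a in LHS]mulr1 -[_ * 1]/(coef f a *: (1 : k^o)) monoZ.
Qed.

Lemma skew_ind (P : skew_dga -> Prop) : P 0 -> (forall f h, P f -> P h -> P (f + h)) ->
 (forall c a, E a -> P (c *: smono a)) -> forall f, P f.
Proof.
move=> P0 PD Pm f; have [s [_ ->]] := skew_expand f; elim/big_ind: _ => // a _.
case: (boolP (E a)) => Ea; first exact: Pm.
by rewrite scoef_out // scale0r.
Qed.

Section Lift.
Variables (B : color_dga chi) (x : 'I_n -> B).
Hypotheses (hx : forall i, hom (td i) (x i)) (xE : forall a, ~~ E a -> monomial x a = 0).

Lemma monomial_hom a : hom (mdeg a) (monomial x a).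
Proof.
rewrite /monomial /mdeg; elim/big_ind2: _ => //; first exact: hom1.
 by move=> t u b c; apply: homM.
move=> i _; elim: (a i) => [|m IH]; first by rewrite expr0; apply: hom1.
by rewrite mulrS exprS; apply: homM.
Qed.

Lemma monomial_mul a b : monomial x a * monomial x b = reorder q a b *: monomial x (a + b).
Proof.
apply: monomialM => i j; rewrite (commM (hx i) (hx j)).
by rewrite /csign /= mulr0 expr0z mul1r.
Qed.

Definition skew_lift (f : skew_dga) : B :=
 @tlift _ _ _ (base_dga chi) _ skew_twist _ (fun c => c *: 1) (monomial x) f.

Lemma skew_lift_dmap : (forall i, dif (x i) = 0) -> is_dmap skew_lift.
Proof.
move=> dx; have hb := base_dmap B.
have h1 u : tE skew_twist u -> hom (tdeg skew_twist u) (monomial x u) by move=> _; apply: monomial_hom.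
have h2 u v : tE skew_twist u -> tE skew_twist v -> monomial x u * monomial x v =
  if tE skew_twist (u + v) then tb skew_twist u v *: monomial x (u + v) else 0.
 move=> _ _; rewrite monomial_mul; case: ifPn => // nE; by rewrite xE // scaler0.
split.
- by move=> c a b; apply: tliftL.
- by move=> a b; apply: (tliftM hb h1 h2).
- rewrite [LHS](@tlift_incl _ _ _ (base_dga chi) _ skew_twist _ _ _ hb) ?scale1r //.
 exact: monomial0.
- by move=> t a ha; apply: (tlift_hom hb h1).
move=> a; rewrite skew_dif [LHS](@tlift0 _ _ _ (base_dga chi) _ skew_twist _ _ (monomial x) hb).
rewrite /skew_lift /tlift dif_sum big1 // => u _; rewrite -scalerAl mul1r difZ.
by rewrite (dif_hom0 _ (monomial_hom u)) ?scaler0 // mdeg_hom.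
Qed.

Lemma skew_lift_smono a : skew_lift (smono a) = monomial x a.
Proof.
rewrite [LHS](@tlift_mono _ _ _ (base_dga chi) _ skew_twist _ _ _ (base_dmap B)).
by case: ifPn => [_|/xE //]; rewrite scale1r mul1r.
Qed.

End Lift.

End SkewMonomialAlgebra.

End SkewMonomials.
Import SkewMonomials.

(** * Adjoining a list of variables over a fixed base *)

Module Towers.

Section Towers.
Variables (k : fieldType) (G : zmodType) (chi : alt_bicharacter G k).
Notation T := (tridegree G).
Implicit Types W B : color_dga chi.

Definition full W : W -> Prop := fun _ => True.
Arguments full : clear implicits.

Lemma full_galg W : galg (full W). Proof. by split; first by split. Qed.

Fixpoint cycles_ok W (zs : seq (T * W)) : Prop :=
 if zs is p :: zs' then
  [/\ 0 < p.1.1.1, hom (p.1 + (-1, 0, 0)) p.2, dif p.2 = 0 & cycles_ok zs']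
 else True.

Definition vbd W (v : var W) : T * W := (v.1, dif (v.2 1)).
Definition zmap W B (f : W -> B) (p : T * W) : T * B := (p.1, f p.2).

(** All the cycles to be killed lie in [W] itself, as for a Koszul complex or for the variables of a
    single degree in an acyclic closure. *)
Record tower W W' (i : W -> W') (zs : seq (T * W)) (L : seq (var W')) : Prop := {
 tw_dmap : is_dmap i;
 tw_inj : injective i;
 tw_dps : dpsL L;
 tw_bd : map (@vbd W') L = map (zmap i) zs;
 tw_free : freeL (image i (full W)) L;
 tw_gen : forall b, spanL (image i (full W)) L b;
 tw_univ : forall B (f : W -> B) (ys : seq (var B)), is_dmap f -> dpsL ys ->
  map (@vbd B) ys = map (zmap f) zs ->
  exists f' : W' -> B, [/\ is_dmap f', forall w, f' (i w) = f w & map (vmap f') L = ys] }.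

Lemma adj_var_free (t : T) (t0 : 0 < t.1.1) W (z : W) hz dz :
 dpow_free (odd `|t.1.1|%N) (image (@adj_incl _ _ _ t t0 W z hz dz) (full W)) (adj_var t0 hz dz).
Proof.
move=> N c Cc s0 l lN ol.
have /choice[d hd] : forall l, exists w, c l = adj_incl t0 hz dz w.
 by move=> m; have [w _ e] := Cc m; exists w.
have := congr1 (fun a => @coef _ _ _ W _ (adj_twist chi t0) a l) s0.
rewrite coef_sum coef0 (bigD1 (Ordinal lN)) //= big1 ?addr0; last first.
 move=> m /andP[om]; rewrite -val_eqE /= => ml; rewrite hd -mono_mul coef_mono.
 by rewrite eq_sym (negbTE ml).
rewrite hd -mono_mul coef_mono eqxx (_ : tE _ l = true) //= => ->.
by rewrite (dmap0 (adj_incl_dmap t0 hz dz)).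
Qed.

Lemma adj_var_gen (t : T) (t0 : 0 < t.1.1) W (z : W) hz dz b :
 adjoin (odd `|t.1.1|%N) (image (@adj_incl _ _ _ t t0 W z hz dz) (full W)) (adj_var t0 hz dz) b.
Proof.
have hi := adj_incl_dmap t0 hz dz; have gF := galg_sub (full_galg W).
have gA := adjoin_gsub (image_gsub hi gF) (adj_var_dps t0 hz dz).
elim/(@adj_ind _ _ _ t t0 W z hz dz): b => [|a b|w l ol]; first exact: (gsub0 gA).
 exact: (gsubD gA).
apply: adjoin_mem => //; first exact: (gsub0 (image_gsub hi gF)).
by exists w.
Qed.

(** The base grows with each variable, so the induction is on the length of the list, over all
    bases; the remaining cycles are pushed forward to the new base. *)
Lemma tower_ex W (zs : seq (T * W)) : cycles_ok zs ->
 exists W' (i : W -> W') L, tower i zs L.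
Proof.
move: zs; suff H n : forall W (zs : seq (T * W)), size zs = n -> cycles_ok zs ->
  exists W' (i : W -> W') L, tower i zs L by move=> zs; apply: H.
elim: n {W} => [|n IH] W [|[t z] zs] //= sz.
 move=> _; exists W, id, [::]; split=> // => [b|].
  by exists b.
 by move=> B f [|y ys] //= hf _ _; exists f.
move=> [t0 hz dz ok]; case: sz => sz; pose W1 := adj_dga t0 hz dz; pose j : W -> W1 := adj_incl t0 hz dz.
have hj : is_dmap j := adj_incl_dmap t0 hz dz.
have [||W' [i [L tw]]] := IH W1 (map (zmap j) zs); first by rewrite size_map.
 elim: zs ok {sz} => //= p zs IHz [p0 hp dp /IHz ok]; split=> //.
  exact: (dmap_hom hj).
 by rewrite -[LHS](dmap_dif hj) dp (dmap0 hj).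
have hi := tw_dmap tw; have gF := galg_sub (full_galg W); have gF1 := galg_sub (full_galg W1).
pose v : var W1 := (t, adj_var t0 hz dz).
have dv : dps v.1 v.2 := adj_var_dps t0 hz dz.
exists W', (i \o j), (vmap i v :: L).
have ext b : adj1 (image (i \o j) (full W)) (vmap i v) b <-> image i (full W1) b.
 have -> : image (i \o j) (full W) = image i (image j (full W)).
  apply/funext => c; apply/propext; split=> [[w _ ->]|[_ [w _ ->] ->]]; last by exists w.
  by exists (j w) => //; exists w.
 rewrite adj1_image //; last by exists 0; rewrite ?(dmap0 hj).
 split=> [[a _ ->]|[a _ ->]]; first by exists a.
 by exists a => //; apply: adj_var_gen.
split.
- exact: dmap_comp hj hi.
- by move=> a b /(tw_inj tw); apply: adj_incl_inj.
- by split; [apply: vmap_dps | exact: tw_dps tw].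
- rewrite /= (tw_bd tw) -map_comp; congr (_ :: _); rewrite /vbd /zmap /=.
 by congr (_, _); rewrite -(dmap_dif hi) adj_var_dif.
- split; last by apply: freeL_mono (tw_free tw) => b /ext.
 have -> : image (i \o j) (full W) = image i (image j (full W)).
  apply/funext => c; apply/propext; split=> [[w _ ->]|[_ [w _ ->] ->]]; last by exists w.
  by exists (j w) => //; exists w.
 apply: (free_image hi (v := v)) (tw_inj tw) _; first exact: image_gsub.
 exact: adj_var_free.
- by move=> b; apply: spanL_mono (tw_gen tw b) => a /ext.
move=> B f [|y ys] //= hf [dy dys] [ety edy eys].
have dy' : dps t y.2 by rewrite -ety.
have hF := adj_lift_dmap t0 hz dz hf dy' edy.
pose F : W1 -> B := adj_lift f y.2.
have Fj w : F (j w) = f w by apply: adj_lift_incl.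
have [|f' [hf' f'i f'L]] := tw_univ tw hF dys.
 by rewrite eys -map_comp; apply: eq_map => p; rewrite /zmap /= -/(F (j _)) Fj.
exists f'; split=> //; first by move=> w; rewrite /= f'i -/(F (j _)) Fj.
rewrite f'L; congr (_ :: _); rewrite [y]surjective_pairing /vmap /= ety; congr (_, _).
apply/funext => l; rewrite f'i.
case: (boolP (dpow_ok (odd `|t.1.1|%N) l)) => ol; first exact: adj_lift_var.
by rewrite (_ : adj_var t0 hz dz l = 0) ?(dmap0 hF) ?(dps_out dy') //; apply: (dps_out dv).
Qed.

Lemma spanL_gen_ind W (C : W -> Prop) (L : seq (var W)) (J : W -> Prop) : gsub C -> dpsL L ->
 gsub J -> (forall a b, J a -> J (a * b)) -> (forall a, C a -> J a) ->
 forall b, spanL C L b -> J b.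
Proof.
move=> + + gJ JM; elim: L C => [|v L IH] C gC //= [dv dL] CJ.
apply: IH => //; first exact: adjoin_gsub.
move=> a ha; elim/adj1_ind: ha => [||c l _ /CJ Jc]; [exact: (gsub0 gJ) | exact: (gsubD gJ) | exact: JM].
Qed.

Lemma dmap_eq_gen W B (f h : W -> B) (C : W -> Prop) L : is_dmap f -> is_dmap h ->
 (forall a, C a -> f a = h a) -> map (vmap f) L = map (vmap h) L ->
 forall b, spanL C L b -> f b = h b.
Proof.
move=> hf hh; elim: L C => [|v L IH] C Cfh /=; first by move=> _ b; apply: Cfh.
case=> vfh Lfh; apply: IH Lfh => _ [N [c [Cc ->]]].
rewrite (dmap_sum hf) (dmap_sum hh); apply: eq_bigr => l _.
rewrite (dmapM hf) (dmapM hh) Cfh //; congr (_ * _).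
exact: (congr1 (fun p : nat -> B => p l) vfh).
Qed.

Lemma adj1_mulr W (C F : W -> Prop) v a b : gsub C -> galg F -> dps v.1 v.2 ->
 (forall c d, C c -> F d -> C (c * d)) -> adj1 C v a -> adj1 F v b -> adj1 C v (a * b).
Proof.
move=> gC [gF F1 FM] dv CF ha hb.
have gA : gsub (adj1 C v) := adjoin_gsub gC dv; have C0 := gsub0 gC.
elim/adj1_ind: ha => [|a1 a2|c l ol Cc].
- by rewrite mul0r; apply: (gsub0 gA).
- by rewrite mulrDl; apply: (gsubD gA).
elim/adj1_ind: hb => [|b1 b2|d m om Fd].
- by rewrite mulr0; apply: (gsub0 gA).
- by rewrite mulrDr; apply: (gsubD gA).
rewrite -mulrA [v.2 l * _]mulrA (comm_tw _ (dps_hom dv ol)) -mulrA mulrA (dps_mul dv ol om).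
have Cct : C (c * tw (csign chi (v.1 *+ l)) d) by apply: CF => //; apply: (gsub_tw gF).
case: ifP => olm; last by rewrite mulr0; apply: (gsub0 gA).
rewrite mulrnAr; apply: (gsubMn gA); exact: adjoin_mem.
Qed.

Lemma spanL_mulr W (C F : W -> Prop) L a b : gsub C -> galg F -> dpsL L ->
 (forall c d, C c -> F d -> C (c * d)) -> spanL C L a -> spanL F L b -> spanL C L (a * b).
Proof.
elim: L C F => [|v L IH] C F gC gF /= => [_ CF|[dv dL] CF]; first exact: CF.
apply: IH => //; [exact: adjoin_gsub | exact: adjoin_galg |].
by move=> c d; apply: adj1_mulr.
Qed.

(** Moving b past a variable replaces it by a twist of b; the twist still stabilises [C] on the
    right because such b form a graded subspace. *)
Lemma rstable_gsub W (C : W -> Prop) : gsub C -> gsub (fun b => forall c, C c -> C (c * b)).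
Proof.
move=> gC; split=> [c Cc|e a b ha hb c Cc|t a ha c Cc]; first by rewrite mulr0; apply: gsub0.
 by rewrite mulrDr -scalerAr; apply: (gsubL gC); [apply: ha | apply: hb].
rewrite -(sum_prj_dsupp c) mulr_suml; apply: (gsub_sum gC) => s _.
have /ha/(gsubP gC (s + t)) := gsubP gC s Cc.
by rewrite (prj_mull _ _ (hom_prj s c)) [s + t]addrC addrK.
Qed.

Lemma cone_spanL W B (f : W -> B) (C : W -> Prop) (D : B -> Prop) L : is_dmap f ->
 gsub C -> gsub D -> (forall a, C a -> D (f a)) ->
 (forall a, C a -> C (dif a)) -> (forall a, D a -> D (dif a)) -> dpsL L ->
 allP L (fun v => forall a, C a -> C (a * dif (v.2 1))) ->
 allP L (fun v => forall b, D b -> D (b * f (dif (v.2 1)))) ->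
 freeL C L -> freeL D (map (vmap f) L) -> cone f C D ->
 cone f (spanL C L) (spanL D (map (vmap f) L)).
Proof.
move=> hf; elim: L C D => [|v L IH] C D //= gC gD fD dC dD [dv dL] [zC zCL] [zD zDL] [f1 f1L] [f2 f2L] cf.
have dv' := vmap_dps hf dv.
apply: (IH (adj1 C v) (adj1 D (vmap f v))) => //.
- exact: adjoin_gsub.
- exact: (adjoin_gsub gD dv').
- move=> a ha; elim/adj1_ind: ha => [|a1 a2|c l ol Cc].
 + by rewrite (dmap0 hf); apply: (gsub0 (adjoin_gsub gD dv')).
 + by rewrite (dmapD hf); apply: (gsubD (adjoin_gsub gD dv')).
 + rewrite (dmapM hf); apply: (@adjoin_mem _ _ _ _ _ _ (vmap f v).2) => //; first exact: gsub0.
  exact: fD.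
- by move=> a; apply: (adjoin_dif gC dv).
- move=> a; apply: (adjoin_dif gD dv') => // b /zD.
 by rewrite (dmap_dif hf).
- apply: allP_impl zCL => u zu a; apply: (adjoin_mulr gC dv) => //.
 exact: rstable_gsub.
- apply: allP_impl zDL => u zu a; apply: (adjoin_mulr gD dv') => //.
 exact: rstable_gsub.
- exact: cone_adjoin.
Qed.

(* If [C = C' (+) C x] with zero differential, then adjoining an odd variable
 with boundary [x] to [C] yields a complex quasi-isomorphic to [C']. *)
Lemma cone_regular W (C C' : W -> Prop) v : gsub C -> gsub C' -> dps v.1 v.2 -> vodd v ->
 (forall c, C' c -> C c) -> (forall c, C c -> dif c = 0) ->
 (forall c, C c -> exists c' c'', [/\ C' c', C c'' & c = c' + c'' * dif (v.2 1)]) ->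
 (forall c' c'', C' c' -> C c'' -> c' + c'' * dif (v.2 1) = 0 -> c' = 0 /\ c'' = 0) ->
 cone id C' (adj1 C v).
Proof.
move=> gC gC' dv ov CC dC dec uni z w C'z /adjoinP-/(_ (gsub0 gC))[N [c [nc ->]]] _.
have [Cc c0] := nc.
have -> : \sum_(l < N) c l * v.2 l = c 0 + c 1 * v.2 1.
 have le1 : (N <= maxn N 2)%N by apply: leq_maxl.
 rewrite -(sum_widen v.2 le1 nc).
 have nc2 : nice_coefs (vodd v) C 2 c.
  split=> // l; case/orP=> hl; last by rewrite c0 ?hl ?orbT.
  by rewrite c0 // /dpow_ok ov /= -leqNgt hl orbT.
 by rewrite (sum_widen v.2 (leq_maxr _ _) nc2) !big_ord_recr big_ord0 /= add0r (dps0 dv) mulr1.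
rewrite difD dC // add0r difM dC // mul0r add0r => ez.
have Ct1 : C (tau (c 1)) by apply: gsub_tw.
have [z0 t0] : z = 0 /\ - tau (c 1) = 0.
 by apply: uni => //; [apply: (gsubN gC) | rewrite ez mulNr subrr].
have c10 : c 1 = 0 by rewrite -[LHS]tauK -[tau (c 1)]opprK t0 oppr0 /tau tw0.
have [c' [c'' [C'c' Cc'' ec]]] := dec (c 0) (Cc 0%N).
exists c', (tau c'' * v.2 1); split=> //.
- apply: adjoin_mem; [exact: gsub0 | by rewrite /dpow_ok implybT | exact: gsub_tw].
- by rewrite z0 dC //; apply: CC.
by rewrite c10 mul0r addr0 difM dC ?mul0r ?add0r ?tauK //; apply: gsub_tw.
Qed.

End Towers.

End Towers.
Import Towers.

(** * The Koszul complex on a principal monomial submodule *)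

Module KoszulCycles.

Section MonomialSubspaces.
Variables (k : fieldType) (G : zmodType) (chi : alt_bicharacter G k).
Notation T := (tridegree G).
Variables (n : nat) (g : 'I_n -> G).
Notation M := {ffun 'I_n -> nat}.
Variable E : pred M.
Hypotheses (E0 : E 0) (E_down : forall a b, E (a + b) -> E a).
Notation q := (fun i j => chi (g i) (g j)).
Notation S := (@skew_dga k G chi n g E E0 E_down).
Notation smono := (@smono k G chi n g E E0 E_down).

Definition sset (U : M -> Prop) (f : S) : Prop := forall a, ~ U a -> scoef f a = 0.

Lemma scoef_prj t (f : S) a : scoef (prj t f) a = if mdeg g a == t then scoef f a else 0.
Proof.
elim/skew_ind: f => [|f h Hf Hh|c b Eb].
- by rewrite prj0; case: ifP.
- have := scoefL 1 (prj t f) (prj t h) a; have := scoefL 1 f h a.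
 rewrite !scale1r !mul1r prjD => -> ->; rewrite Hf Hh; case: ifP => // _.
 by rewrite addr0.
rewrite prjZ (prj_hom t (smono_hom chi g E0 E_down b)).
have := scoefL c (smono b) 0 a; rewrite !addr0 => ->; rewrite scoef_smono //.
case: (eqVneq a b) => [->|ab]; rewrite eq_sym.
 have := scoefL c (smono b) 0 b; rewrite !addr0 scoef_smono // eqxx => e.
 by case: eqP => // _; rewrite scaler0.
rewrite mulr0 if_same; case: eqP => _; last by rewrite scaler0.
by have := scoefL c (smono b) 0 a; rewrite !addr0 scoef_smono // (negbTE ab) mulr0.
Qed.

Lemma sset_gsub U : gsub (sset U).
Proof.
split=> // [c f h Uf Uh a Ua|t f Uf a Ua]; first by rewrite scoefL Uf ?Uh ?mulr0 ?addr0.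
by rewrite scoef_prj Uf // if_same.
Qed.

Lemma sset_smono (U : M -> Prop) c a : U a -> sset U (c *: smono a).
Proof.
move=> Ua b Ub; have := scoefL c (smono a) 0 b; rewrite !addr0 => ->.
case: (boolP (E a)) => Ea; last by rewrite smono_out // mulr0.
by rewrite scoef_smono //; case: eqP Ub => [->|]; rewrite ?mulr0.
Qed.

Lemma sset_ind U (P : S -> Prop) : P 0 -> (forall f h, P f -> P h -> P (f + h)) ->
 (forall c a, U a -> E a -> P (c *: smono a)) -> forall f, sset U f -> P f.
Proof.
move=> P0 PD Pm f Uf; have [s [_ ->]] := skew_expand f; elim/big_ind: _ => // a _.
case: (pselect (U a)) => Ua; last by rewrite Uf // scale0r.
case: (boolP (E a)) => Ea; first exact: Pm.
by rewrite scoef_out // scale0r.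
Qed.

Lemma sset_mulr (U : M -> Prop) e f : (forall a, U a -> U (a + e)) -> sset U f -> sset U (f * smono e).
Proof.
move=> Ue Uf; have gU := sset_gsub U; elim/sset_ind: Uf => [|f1 f2|c a Ua _].
- by rewrite mul0r; apply: gsub0.
- by rewrite mulrDl; apply: gsubD.
rewrite -scalerAl smonoM scalerA; apply: sset_smono; exact: Ue.
Qed.

Lemma sset_cap U V f : sset U f -> sset V f -> sset (fun a => U a /\ V a) f.
Proof.
move=> Uf Vf a UV; case: (pselect (U a)) => Ua; last exact: Uf.
by apply: Vf => Va; apply: UV.
Qed.

Lemma sset_sum U V f : sset (fun a => U a \/ V a) f ->
 exists f1 f2, [/\ sset U f1, sset V f2 & f = f1 + f2].
Proof.
move=> UVf; elim/sset_ind: UVf => [|f0 h [f1 [f2 [? ? ->]]] [h1 [h2 [? ? ->]]]|c a [Ua|Va] _].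
- by exists 0, 0; split; rewrite ?addr0 //; apply: gsub0; apply: sset_gsub.
- by exists (f1 + h1), (f2 + h2); split; [exact: (gsubD (sset_gsub U)) | exact: (gsubD (sset_gsub V)) | rewrite addrACA].
- by exists (c *: smono a), 0; split; [exact: sset_smono | apply: gsub0; apply: sset_gsub | rewrite addr0].
- by exists 0, (c *: smono a); split; [apply: gsub0; apply: sset_gsub | exact: sset_smono | rewrite add0r].
Qed.

Lemma sset_mono (U V : M -> Prop) f : (forall a, U a -> V a) -> sset U f -> sset V f.
Proof. by move=> UV Uf a Va; apply: Uf => /UV. Qed.

Definition dlt (i : 'I_n) : M := [ffun j => (j == i) : nat].

Lemma mdeg_dlt i : mdeg g (dlt i) = (0, 0, g i).
Proof.
rewrite /mdeg (bigD1 i) //= ffunE eqxx mulr1n big1 ?addr0 // => j ji.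
by rewrite ffunE (negbTE ji).
Qed.

Definition kos_cycles : seq (T * S) :=
 [seq (((1, 0, g i) : T), smono (dlt i)) | i <- enum 'I_n].

Lemma kos_cycles_ok : cycles_ok kos_cycles.
Proof.
rewrite /kos_cycles; elim: (enum _) => //= i s IH; split=> //.
have := smono_hom chi g E0 E_down (dlt i); rewrite mdeg_dlt.
by congr (hom _ _); congr (_, _, _); rewrite /= ?addr0.
Qed.

End MonomialSubspaces.

Section Principal.
Variables (k : fieldType) (G : zmodType) (chi : alt_bicharacter G k).
Notation T := (tridegree G).
Variables (n : nat) (g : 'I_n -> G).
Notation M := {ffun 'I_n -> nat}.
Notation q := (fun i j => chi (g i) (g j)).

Definition skew_poly : color_dga chi :=
 @skew_dga k G chi n g predT isT (fun _ _ _ => isT).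
Notation R := skew_poly.
Notation smonoR := (@smono k G chi n g predT isT (fun _ _ _ => isT)).
Notation ssetR := (@sset k G chi n g predT isT (fun _ _ _ => isT)).

Lemma scoef_mul (f : R) a e : scoef (f * smonoR e) (a + e) = reorder q a e * scoef f a.
Proof.
elim/skew_ind: f => [|f h Hf Hh|c b _].
- by rewrite mul0r mulr0.
- have := scoefL 1 (f * smonoR e) (h * smonoR e) (a + e); have := scoefL 1 f h a.
 by rewrite mulrDl !scale1r !mul1r => -> ->; rewrite Hf Hh mulrDr.
rewrite -scalerAl smonoM scalerA.
have := scoefL (c * reorder q b e) (smonoR (b + e)) 0 (a + e).
have := scoefL c (smonoR b) 0 a; rewrite !addr0 => -> ->.
rewrite !scoef_smono //.
have -> : (a + e == b + e) = (a == b).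
 apply/eqP/eqP => [e1|-> //]; apply/ffunP => i; move/ffunP: e1 => /(_ i).
 by rewrite !ffunE => /addIn.
case: eqP => [->|_]; last by rewrite !mulr0.
by rewrite !mulr1 mulrC.
Qed.

(** Exponents of the monomials in x^m k[x_j : j in r]. *)
Definition box (m : M) (r : seq 'I_n) (a : M) : Prop :=
 (forall j, (m j <= a j)%N) /\ (forall j, j \notin r -> a j = m j).

(** With [box_uniq] below: for i outside r, multiplication by x_i is injective on the span of box (i
    :: r), and the span of box r is a complement of its image. *)
Lemma box_dec m i r (f : R) : ssetR (box m (i :: r)) f ->
 exists f' f'', [/\ ssetR (box m r) f', ssetR (box m (i :: r)) f'' & f = f' + f'' * smonoR (dlt i)].
Proof.
move=> Uf; have g1 := @sset_gsub _ _ chi _ g _ isT (fun _ _ _ => isT) (box m r).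
have g2 := @sset_gsub _ _ chi _ g _ isT (fun _ _ _ => isT) (box m (i :: r)).
elim/sset_ind: Uf => [|f0 h [f1 [f2 [? ? ->]]] [h1 [h2 [? ? ->]]]|c a [ma am] _].
- by exists 0, 0; split; [exact: (gsub0 g1) | exact: (gsub0 g2) | rewrite mul0r addr0].
- exists (f1 + h1), (f2 + h2); split; [exact: (gsubD g1) | exact: (gsubD g2) |].
 by rewrite mulrDl addrACA.
case: (eqVneq (a i) (m i)) => ai.
 exists (c *: smonoR a), 0; split; [|exact: (gsub0 g2) | by rewrite mul0r addr0].
 apply: sset_smono; split=> // j jr; case: (eqVneq j i) => [->//|ji].
 by apply: am; rewrite inE negb_or ji.
pose b : M := [ffun j => (a j - dlt i j)%N].
have mai : (m i < a i)%N by have := ma i; rewrite leq_eqVlt eq_sym (negbTE ai).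
have ai0 : (0 < a i)%N by apply: leq_ltn_trans mai.
have ab : a = b + dlt i.
 apply/ffunP => j; rewrite !ffunE; case: (eqVneq j i) => [->|_] /=; last by rewrite subn0 [RHS]addn0.
 exact: (esym (subnK ai0)).
exists 0, ((c * (reorder q b (dlt i))^-1) *: smonoR b); split; first exact: (gsub0 g1).
 apply: sset_smono; split=> j; rewrite !ffunE; case: (eqVneq j i) => [->|ji] /=; rewrite ?subn0 //.
 - by rewrite subn1 -ltnS prednK.
 - by rewrite inE eqxx.
 - by move/am.
by rewrite add0r -scalerAl smonoM -ab scalerA mulfVK // reorder_neq0.
Qed.

Lemma box_uniq m i r (f' f'' : R) : i \notin r -> ssetR (box m r) f' -> ssetR (box m (i :: r)) f'' ->
 f' + f'' * smonoR (dlt i) = 0 -> f' = 0 /\ f'' = 0.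
Proof.
move=> ir U' U'' e.
have f''0 : f'' = 0.
 apply: scoefP => a; case: (pselect (box m (i :: r) a)) => [[ma am]|]; last by move/U'' ->.
 have := congr1 (fun f => scoef f (a + dlt i)) e.
 have := scoefL 1 f' (f'' * smonoR (dlt i)) (a + dlt i); rewrite scale1r mul1r => ->.
 rewrite U' ?add0r ?scoef_mul.
  by move/eqP; rewrite mulf_eq0 (negbTE (reorder_neq0 _ _ _ _)) => /eqP.
 case=> _ /(_ i ir); rewrite !ffunE eqxx => e1; have := ma i.
 by rewrite -e1 => le1; have : (a i + 1 <= a i)%N := le1; rewrite addn1 ltnn.
by move: e; rewrite f''0 mul0r addr0.
Qed.

Section InTower.
Variables (K : color_dga chi) (i : R -> K) (hi : is_dmap i) (i_inj : injective i).

Lemma vmap_id (A : color_dga chi) (L : seq (var A)) : map (vmap id) L = L.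
Proof. by rewrite -[RHS]map_id; apply: eq_map; case. Qed.

(** The indeterminates of r form a regular sequence on x^m k[x_j : j in r]; each exterior variable
    removes one of them, until the line of x^m is left. *)
Lemma cone_principal m r (L : seq (var K)) : uniq r -> dpsL L ->
 map (@vbd _ _ _ K) L = [seq (((1, 0, g j) : T), i (smonoR (dlt j))) | j <- r] ->
 freeL (image i (@full _ _ chi R)) L ->
 cone id (image i (ssetR (box m [::]))) (spanL (image i (ssetR (box m r))) L).
Proof.
have gI U : gsub (image i (ssetR U)) by apply: image_gsub => //; apply: sset_gsub.
have d0 U a : image i (ssetR U) a -> dif a = 0.
 by case=> f _ ->; rewrite -(dmap_dif hi) skew_dif (dmap0 hi).
elim: r L => [|j r IH] [|v L] //=.
 move=> _ _ _ _ z w Cz [f Uf ->] dz ez; exists (i f), 0.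
 by split; [exists f | exact: (gsub0 (gI _)) | rewrite -ez | rewrite dif0 addr0].
case/andP=> jr ur [dv dL] [e1 e2 eL] [fv fL].
have e1' : v.2 1 = v.2 1 by [].
have ov : vodd v by rewrite /vodd e1.
set C := image i (ssetR (box m (j :: r))); set C' := image i (ssetR (box m r)).
have gC : gsub C := gI _. have gC' : gsub C' := gI _.
have CF U a : image i (ssetR U) a -> image i (@full _ _ chi R) a by case=> f _ ->; exists f.
have gF : gsub (image i (@full _ _ chi R)) by apply: image_gsub => //; apply: (galg_sub (full_galg _)).
have C'C a : C' a -> C a.
 case=> f Uf ->; exists f => //; apply: sset_mono Uf => b [mb bm]; split=> // l.
 by rewrite inE negb_or => /andP[_]; apply: bm.
(* [step1] removes x_j before any other variable is adjoined, [step2] adjoins the remaining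
   variables on both sides, and the induction hypothesis does the rest. *)
have step1 : cone id C' (adj1 C v).
 apply: cone_regular => //.
 - by move=> c; apply: d0.
 - move=> _ [f Uf ->]; have [f' [f'' [U' U'' ef]]] := box_dec Uf.
  exists (i f'), (i f''); split; [by exists f' | by exists f'' |].
  by rewrite e2 -(dmapM hi) -(dmapD hi) ef.
 - move=> _ _ [f' U' ->] [f'' U'' ->]; rewrite e2 -(dmapM hi) -(dmapD hi) -(dmap0 hi).
  by move=> /i_inj /(box_uniq jr U' U'') [-> ->].
have fL' : freeL (image i (@full _ _ chi R)) L.
 by apply: freeL_mono fL => a; apply: adjoin_incl.
have st U : (forall a l, U a -> l \in r -> U (a + dlt l)) ->
  allP L (fun u => forall a, image i (ssetR U) a -> image i (ssetR U) (a * dif (u.2 1))).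
 move=> Ul; elim: (L) (r) eL Ul => [|u L1 IH1] [|l r1] //= [_ eu eL1] Ul; split.
  move=> _ [f Uf ->]; rewrite eu -(dmapM hi); exists (f * smonoR (dlt l)) => //.
  by apply: sset_mulr Uf => a Ua; apply: Ul => //; rewrite mem_head.
 by apply: IH1 eL1 _ => a l1 Ua l1r; apply: Ul => //; rewrite inE l1r orbT.
have boxS r1 a l : box m r1 a -> l \in r1 -> box m r1 (a + dlt l).
 move=> [ma am] lr; split=> j1; rewrite !ffunE.
  by apply: (leq_trans (ma j1)); apply: leq_addr.
 move=> jr1; have -> : (j1 == l) = false by apply: contraNF jr1 => /eqP ->.
 by rewrite am //; apply: addn0.
have dadj a : adj1 C v a -> adj1 C v (dif a).
 apply: (adjoin_dif gC dv) => [c /d0 ->|c [f Uf ->]]; first exact: gsub0.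
 rewrite e2 -(dmapM hi); exists (f * smonoR (dlt j)) => //.
 by apply: sset_mulr Uf => b Ub; apply: boxS => //; rewrite mem_head.
have step2 : cone id (spanL C' L) (spanL (adj1 C v) L).
 rewrite -{2}(vmap_id L); apply: cone_spanL => //.
 - exact: adjoin_gsub.
 - by move=> a /C'C; apply: adjoin_incl.
 - by move=> a /d0 ->; apply: gsub0.
 - by apply: st => a l; apply: boxS.
 - have := st (box m (j :: r)) (fun a l Ua lr => boxS _ _ _ Ua (mem_behead (s := j :: r) lr)).
  apply: allP_impl => u zu b; apply: (adjoin_mulr gC dv) => //; exact: rstable_gsub.
 - by apply: freeL_mono fL' => a; apply: CF.
 - by rewrite vmap_id; apply: freeL_mono fL => a; apply: adjoin_mono => b; apply: CF.
have step3 := IH L ur dL eL fL'.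
apply: (cone_comp (f := id) (g := id) (C2 := spanL C' L)) => //; try exact: dmap_id.
- move=> a [f Uf ->]; apply: spanL_incl => //; exists f => //; apply: sset_mono Uf => b [mb bm].
 by split=> // l _; apply: bm.
- by apply: spanL_gsub => //; apply: adjoin_gsub.
- by move=> a; apply: spanL_mono => b /C'C; apply: adjoin_incl.
Qed.

End InTower.
End Principal.

End KoszulCycles.
Import KoszulCycles.

(** * Koszul complexes with coefficients in monomial ideals, and their comparison *)

Module MonomialSpans.

Section Generation.
Variables (k : fieldType) (G : zmodType) (chi : alt_bicharacter G k).
Notation T := (tridegree G).
Variables (n : nat) (g : 'I_n -> G).
Notation M := {ffun 'I_n -> nat}.
Variable E : pred M.
Hypotheses (E0 : E 0) (E_down : forall a b, E (a + b) -> E a).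
Notation S := (@skew_dga k G chi n g E E0 E_down).
Notation smono := (@smono k G chi n g E E0 E_down).

(** [smono a] is a basis vector rather than a product of indeterminates; the scalar collects the
    reordering constants. *)
Lemma smono_monomial a : exists2 c, c != 0 & monomial (fun j => smono (dlt j)) a = c *: smono a.
Proof.
pose P (b : S) (u : M) := exists2 c, c != 0 & b = c *: smono u.
have PM b u b' u' : P b u -> P b' u' -> P (b * b') (u + u').
 move=> [c c0 ->] [c' c0' ->]; exists (c * c' * reorder (fun i j => chi (g i) (g j)) u u').
  by rewrite !mulf_neq0 ?reorder_neq0.
 by rewrite -scalerAl -scalerAr smonoM !scalerA.
have P1 : P 1 0 by exists 1; rewrite ?oner_neq0 ?scale1r.
have ea : \sum_(j < n) dlt j *+ a j = a.
 apply/ffunP => i; rewrite sum_ffunE (bigD1 i) //= big1 => [|j ji].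
  have -> : (dlt i *+ a i) i = a i.
   by elim: (a i) => [|m IH]; rewrite ?mulr0n ?mulrS ffunE // IH ffunE eqxx.
  by rewrite [LHS]addr0.
 by elim: (a j) => [|m IH]; rewrite ?mulr0n ?mulrS ffunE // IH ffunE eq_sym (negbTE ji).
have : P (monomial (fun j => smono (dlt j)) a) (\sum_(j < n) dlt j *+ a j).
 apply: (big_ind2 P) => // j _; elim: (a j) => [|m IH]; first by rewrite expr0 mulr0n.
 by rewrite exprS mulrS; apply: PM => //; exists 1; rewrite ?oner_neq0 ?scale1r.
by rewrite ea.
Qed.

Lemma dmap_monomial (B : color_dga chi) (f : S -> B) a : is_dmap f ->
 f (monomial (fun j => smono (dlt j)) a) = monomial (fun j => f (smono (dlt j))) a.
Proof.
move=> hf; rewrite /monomial.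
rewrite (big_morph f (dmapM hf) (dmap1 hf)); apply: eq_bigr => j _.
by elim: (a j) => [|m IH]; rewrite ?expr0 ?(dmap1 hf) // !exprS (dmapM hf) IH.
Qed.

Lemma skew_dmap_smono (B : color_dga chi) (f : S -> B) a : is_dmap f ->
 exists2 c, c != 0 & f (smono a) = c *: monomial (fun j => f (smono (dlt j))) a.
Proof.
move=> hf; have [c c0 e] := smono_monomial a; exists c^-1; first by rewrite invr_eq0.
by rewrite -dmap_monomial // e (dmapZ hf) scalerA mulVf // scale1r.
Qed.

Lemma skew_dmap_eq (B : color_dga chi) (f h : S -> B) : is_dmap f -> is_dmap h ->
 (forall j, f (smono (dlt j)) = h (smono (dlt j))) -> forall a, f a = h a.
Proof.
move=> hf hh fh; elim/skew_ind => [|a b Ha Hb|c a _].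
- by rewrite (dmap0 hf) (dmap0 hh).
- by rewrite (dmapD hf) (dmapD hh) Ha Hb.
rewrite (dmapZ hf) (dmapZ hh); congr (_ *: _).
have [d d0 e] := smono_monomial a.
apply: (scalerI d0); rewrite -(dmapZ hf) -(dmapZ hh) -e !dmap_monomial //.
by rewrite /monomial; apply: eq_bigr => j _; rewrite fh.
Qed.

Lemma monomial_dlt (B : pzRingType) (x : 'I_n -> B) j : monomial x (dlt j) = x j.
Proof.
rewrite /monomial; pose F i := if i == j then x j else 1.
have -> : \prod_(i < n) x i ^+ dlt j i = \prod_(i < n) F i.
 by apply: eq_bigr => i _; rewrite ffunE /F; case: eqP => [->|_]; rewrite ?expr1 ?expr0.
have H (r : seq 'I_n) : uniq r -> \prod_(i <- r) F i = if j \in r then x j else 1.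
 elim: r => [|i r IH] /=; first by rewrite big_nil.
 case/andP=> ir ur; rewrite big_cons IH // inE /F eq_sym.
 by case: eqP ir => [->/negbTE -> /=|_ _ /=]; rewrite ?mulr1 ?mul1r.
by rewrite H ?index_enum_uniq // mem_index_enum.
Qed.

Lemma skew_univ (B : color_dga chi) (x : 'I_n -> B) : (forall i, hom (0, 0, g i) (x i)) ->
 (forall a, ~~ E a -> monomial x a = 0) ->
 exists f : S -> B, is_dmap f /\ forall j, f (smono (dlt j)) = x j.
Proof.
move=> hx xE; exists (@skew_lift k G chi n g E E0 E_down B x); split.
 by apply: skew_lift_dmap => // i; apply: dif_hom0 (hx i).
by move=> j; rewrite skew_lift_smono // monomial_dlt.
Qed.

End Generation.

Section Ideals.
Variables (k : fieldType) (G : zmodType) (chi : alt_bicharacter G k).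
Notation T := (tridegree G).
Notation mon n := {ffun 'I_n -> nat}.

Definition mle n (m a : mon n) : Prop := forall j, (m j <= a j)%N.

Lemma mleD n (m a e : mon n) : mle m a -> mle m (a + e).
Proof. by move=> ma j; rewrite ffunE; apply: (leq_trans (ma j)); apply: leq_addr. Qed.

Section OneTower.
Variables (n : nat) (g : 'I_n -> G) (K : color_dga chi) (i : skew_poly chi g -> K)
 (L : seq (var K)).
Notation R := (skew_poly chi g).
Notation smono := (@smono k G chi n g predT isT (fun _ _ _ => isT)).
Notation sset := (@sset k G chi n g predT isT (fun _ _ _ => isT)).
Hypothesis tw : tower i (@kos_cycles k G chi n g predT isT (fun _ _ _ => isT)) L.

Let hi := tw_dmap tw.
Let i_inj := tw_inj tw.
Let dL := tw_dps tw.

(** The part of the Koszul complex with coefficients in the span of the monomials of [U]: the tensor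
    product of that span with the exterior algebra. It is a subcomplex when [U] is closed under
    multiples. *)
Definition kspan (U : mon n -> Prop) : K -> Prop := spanL (image i (sset U)) L.

Lemma isset_gsub U : gsub (image i (sset U)).
Proof. by apply: image_gsub => //; apply: sset_gsub. Qed.

Lemma kspan_gsub U : gsub (kspan U).
Proof. by apply: spanL_gsub => //; apply: isset_gsub. Qed.

Lemma kspan_mono (U V : mon n -> Prop) b : (forall a, U a -> V a) -> kspan U b -> kspan V b.
Proof. by move=> UV; apply: spanL_mono => _ [f Uf ->]; exists f => //; apply: sset_mono Uf. Qed.

Lemma kspan_mulr (U : mon n -> Prop) a b : (forall c e, U c -> U (c + e)) ->
 kspan U a -> kspan U (a * b).
Proof.
move=> Ue Ua; apply: (spanL_mulr (F := image i (@full _ _ chi R))) (tw_gen tw b) => //.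
- exact: isset_gsub.
- by apply: image_galg => //; apply: full_galg.
move=> _ _ [f Uf ->] [h _ ->]; rewrite -(dmapM hi); exists (f * h) => //.
have gU : gsub (sset U) by apply: sset_gsub.
have [s [_ ->]] := skew_expand h; rewrite mulr_sumr.
apply: (gsub_sum gU) => c _; rewrite -scalerAr.
by apply: (gsubZ gU); apply: sset_mulr Uf => d; apply: Ue.
Qed.

Lemma allP_kos (P : var K -> Prop) :
 (forall v j, v.1 = (1, 0, g j) -> dif (v.2 1) = i (smono (dlt j)) -> P v) -> allP L P.
Proof.
move=> H; have := tw_bd tw; rewrite /kos_cycles -map_comp.
by elim: (L) (enum _) => [|v L1 IH] [|j r] //= [e1 e2 /IH]; split=> //; apply: H e1 e2.
Qed.

Lemma spanL_dif_gen (C : K -> Prop) L1 : gsub C -> dpsL L1 ->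
 (forall a, C a -> C (dif a)) -> allP L1 (fun v => forall a, C a -> C (a * dif (v.2 1))) ->
 forall a, spanL C L1 a -> spanL C L1 (dif a).
Proof.
elim: L1 C => [|v L1 IH] C gC //= [dv dL1] dC [zC zL1]; apply: IH => //.
- exact: adjoin_gsub.
- by move=> a; apply: (adjoin_dif gC dv).
- apply: allP_impl zL1 => u zu a; apply: (adjoin_mulr gC dv) => //; exact: rstable_gsub.
Qed.

Lemma kspan_dif (U : mon n -> Prop) a : (forall c e, U c -> U (c + e)) -> kspan U a -> kspan U (dif a).
Proof.
move=> Ue; apply: spanL_dif_gen => //; first exact: isset_gsub.
 by move=> _ [f Uf ->]; rewrite -(dmap_dif hi) skew_dif (dmap0 hi); apply: gsub0 (isset_gsub U).
apply: allP_kos => v j _ -> _ [f Uf ->]; rewrite -(dmapM hi); exists (f * smono (dlt j)) => //.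
by apply: sset_mulr Uf => c; apply: Ue.
Qed.

Lemma kspan_cap U V b : kspan U b -> kspan V b -> kspan (fun a => U a /\ V a) b.
Proof.
move=> Ub Vb; have gF : gsub (image i (@full _ _ chi R)).
 by apply: image_gsub => //; apply: galg_sub (full_galg _).
have := @spanL_cap _ _ _ K (image i (sset U)) (image i (sset V)) _ L b
 (isset_gsub U) (isset_gsub V) gF _ _ dL (tw_free tw) Ub Vb.
move=> H; apply: spanL_mono (H _ _) => [a [[f Uf ->] [h Vh e]]|a [f _ ->]|a [f _ ->]]; [|by exists f..].
by move/i_inj: e => e; rewrite -e in Vh; exists f => //; apply: sset_cap.
Qed.

Lemma kspan_sum U V b : kspan (fun a => U a \/ V a) b <->
 exists c d, [/\ kspan U c, kspan V d & b = c + d].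
Proof.
split=> [UVb|[c [d [Uc Vd ->]]]]; last first.
 apply: (gsubD (kspan_gsub _)); [apply: kspan_mono Uc | apply: kspan_mono Vd] => a; by [left | right].
apply: spanL_sum => //; [exact: isset_gsub | exact: isset_gsub |].
apply: spanL_mono UVb => _ [f UVf ->]; have [f1 [f2 [U1 V2 ->]]] := sset_sum UVf.
by exists (i f1), (i f2); split; [exists f1 | exists f2 | rewrite (dmapD hi)].
Qed.

Lemma kspan_false b : kspan (fun _ => False) b -> b = 0.
Proof.
apply: (spanL_gen_ind (J := fun b => b = 0)) => //; first exact: isset_gsub.
- split=> // [c a1 a2 -> ->|t a ->]; first by rewrite scaler0 addr0.
 exact: prj0.
- by move=> a1 a2 ->; rewrite mul0r.
move=> _ [f Uf ->]; rewrite (_ : f = 0) ?(dmap0 hi) //; apply: scoefP => a.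
by rewrite Uf //.
Qed.

Lemma kspan_principal m : cone id (image i (sset (fun a => a = m))) (kspan (mle m)).
Proof.
have -> : (fun a => a = m) = box m [::].
 apply/funext => a; apply/propext; split=> [->|[_ am]]; first by split=> // j.
 by apply/ffunP => j; apply: am.
have -> : mle m = box m (enum 'I_n).
 apply/funext => a; apply/propext; split=> [ma|[ma _] //]; split=> // j.
 by rewrite mem_enum.
apply: cone_principal (tw_free tw) => //; first exact: enum_uniq.
by rewrite (tw_bd tw) /kos_cycles -map_comp.
Qed.

End OneTower.
Section TwoTowers.
Variables (n n' : nat) (g : 'I_n -> G) (g' : 'I_n' -> G) (K K' : color_dga chi).
Variables (i : skew_poly chi g -> K) (i' : skew_poly chi g' -> K').
Variables (L : seq (var K)) (L' : seq (var K')).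
Notation smonoR m h := (@smono k G chi m h predT isT (fun _ _ _ => isT)).
Notation ssetR m h := (@sset k G chi m h predT isT (fun _ _ _ => isT)).
Hypothesis tw : tower i (@kos_cycles k G chi n g predT isT (fun _ _ _ => isT)) L.
Hypothesis tw' : tower i' (@kos_cycles k G chi n' g' predT isT (fun _ _ _ => isT)) L'.
Variables (F : K -> K') (hF : is_dmap F).
Notation KS U := (kspan i L U).
Notation KS' U := (kspan i' L' U).
Let hi := tw_dmap tw.
Let hi' := tw_dmap tw'.

Lemma kspan_map U U' : (forall c e, U' c -> U' (c + e)) ->
 (forall a, U a -> KS' U' (F (i (smonoR n g a)))) -> forall b, KS U b -> KS' U' (F b).
Proof.
move=> Ue UU'; have gS' := kspan_gsub tw' U'.
apply: (spanL_gen_ind (J := fun b => KS' U' (F b))) => //.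
- exact: isset_gsub tw U.
- exact: tw_dps tw.
- split; first by rewrite (dmap0 hF); apply: gsub0.
  by move=> c a b ha hb; rewrite (dmapL hF); apply: gsubL.
 by move=> t a ha; rewrite (dmap_prj hF); apply: gsubP.
- by move=> a b ha; rewrite (dmapM hF); apply: (kspan_mulr tw').
move=> _ [f Uf ->]; elim/sset_ind: Uf => [|f0 h|c a Ua _].
- by rewrite (dmap0 hi) (dmap0 hF); apply: gsub0.
- by rewrite (dmapD hi) (dmapD hF); apply: gsubD.
- by rewrite (dmapZ hi) (dmapZ hF); apply: gsubZ => //; apply: UU'.
Qed.

(** Each complex shrinks to the line of its generator, and [F] maps generator to generator up to a
    nonzero scalar. Beyond this, [F] is only asked to respect the two principal submodules. *)
Lemma cone_principal2 m m' : (forall a, mle m a -> KS' (mle m') (F (i (smonoR n g a)))) ->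
 (exists2 c : k, c != 0 & F (i (smonoR n g m)) = c *: i' (smonoR n' g' m')) ->
 cone F (KS (mle m)) (KS' (mle m')).
Proof.
move=> hm [c c0 ec].
have line (q : nat) (h : 'I_q -> G) (f : skew_poly chi h) p :
  ssetR q h (fun a => a = p) f ->
  exists e, f = e *: smonoR q h p.
 move=> Uf; elim/sset_ind: Uf => [|f1 f2 [e1 ->] [e2 ->]|e a -> _]; last by exists e.
  by exists 0; rewrite scale0r.
 by exists (e1 + e2); rewrite scalerDl.
apply: (cone_retract (C0 := image i (ssetR n g (fun a => a = m)))
 (D0 := image i' (ssetR n' g' (fun a => a = m')))) => //.
- exact: kspan_gsub tw _.
- exact: kspan_gsub tw' _.
- move=> _ [f Uf ->]; apply: spanL_incl; [exact: isset_gsub tw _ | exact: tw_dps tw |].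
 by exists f => //; apply: sset_mono Uf => a ->.
- move=> _ [f Uf ->]; apply: spanL_incl; [exact: isset_gsub tw' _ | exact: tw_dps tw' |].
 by exists f => //; apply: sset_mono Uf => a ->.
- move=> _ [f /line[e ->] ->]; rewrite (dmapZ hi) (dmapZ hF) ec scalerA -(dmapZ hi').
 by exists ((e * c) *: smonoR n' g' m') => //; apply: sset_smono.
- by apply: kspan_map => // a e; apply: mleD.
- exact: gsub0 (isset_gsub tw _).
- exact: kspan_principal tw _.
- exact: kspan_principal tw' _.
move=> _ _ [f /line[e ->] ->] [f' /line[e' ->] ->] _.
rewrite -(dmap_dif hi') skew_dif (dmap0 hi') (dmapZ hi) (dmapZ hF) ec scalerA => /eqP.
rewrite -(dmapZ hi') -(dmap0 hi') => /eqP/(tw_inj tw')/(congr1 (fun f => scoef f m')).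
have := scoefL (e * c) (smonoR n' g' m') 0 m'; rewrite !addr0 scoef_smono // eqxx mulr1 => ->.
move=> /eqP; rewrite mulf_eq0 (negbTE c0) orbF => /eqP ->.
exists (i ((e' / c) *: smonoR n g m)), 0; split.
- by exists ((e' / c) *: smonoR n g m) => //; apply: sset_smono.
- exact: gsub0 (isset_gsub tw' _).
- by rewrite -(dmap_dif hi) skew_dif (dmap0 hi) scale0r.
- by rewrite dif0 addr0 (dmapZ hi) (dmapZ hF) ec scalerA divfK // (dmapZ hi').
Qed.

Section LcmClosed.
Variables (X : Type) (jn : X -> X -> X) (p : X -> mon n) (p' : X -> mon n').
Hypotheses (pj : forall x y a, mle (p (jn x y)) a <-> mle (p x) a /\ mle (p y) a)
 (pj' : forall x y a, mle (p' (jn x y)) a <-> mle (p' x) a /\ mle (p' y) a).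
Hypotheses (Fle : forall x a, mle (p x) a -> KS' (mle (p' x)) (F (i (smonoR n g a))))
 (Fp : forall x, exists2 c : k, c != 0 & F (i (smonoR n g (p x))) = c *: i' (smonoR n' g' (p' x))).

Definition upset (m : nat) (r : X -> mon m) (xs : seq X) (a : mon m) : Prop :=
 foldr (fun x Q => mle (r x) a \/ Q) False xs.

Lemma upsetD m (r : X -> mon m) xs c e : upset r xs c -> upset r xs (c + e).
Proof. by elim: xs => //= x xs IH [h|/IH]; [left; apply: mleD | right]. Qed.

Lemma upset_map m (r : X -> mon m) x xs a :
 (forall x y a, mle (r (jn x y)) a <-> mle (r x) a /\ mle (r y) a) ->
 upset r (map (jn x) xs) a <-> mle (r x) a /\ upset r xs a.
Proof.
move=> rj; elim: xs => [|y xs IH] /=; first by split=> // -[].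
rewrite IH rj; split=> [[[? ?]|[? ?]]|[? [?|?]]]; split || idtac; by [|left|right|split; left|split; right|left; split|right; split].
Qed.

Lemma kspan_iff m (h : 'I_m -> G) (K0 : color_dga chi) (i0 : skew_poly chi h -> K0) L0 U V :
 (forall a, U a <-> V a) -> kspan i0 L0 U = kspan i0 L0 V.
Proof. by move=> UV; congr kspan; apply/funext => a; apply/propext. Qed.

(** The ideal of x :: ys is the sum of (x) and (ys), and these intersect in the ideal of the lcms of
    x with the members of ys. That ideal has again the shape of an upset, with one generator less,
    because the family is closed under the join [jn] on both sides. Only the principal case is left
    for Mayer-Vietoris. *)
Lemma cone_upset xs : cone F (KS (upset p xs)) (KS' (upset p' xs)).
Proof.
(* Induction on the length: the hypothesis is used both for [ys] and for [map (jn x) ys]. *)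
elim: (size xs).+1 {-2}xs (ltnSn (size xs)) => // N IH [|x ys] /= sz.
 move=> z w /(kspan_false tw) -> /(kspan_false tw') -> _ _; exists 0, 0.
 by rewrite !dif0 (dmap0 hF) addr0; split=> //; apply: gsub0; [apply: kspan_gsub tw _ | apply: kspan_gsub tw' _].
have eC b : KS (upset p (x :: ys)) b <-> exists c d, [/\ KS (mle (p x)) c, KS (upset p ys) d & b = c + d].
 exact: kspan_sum tw _ _ _.
have eD b : KS' (upset p' (x :: ys)) b <-> exists c d, [/\ KS' (mle (p' x)) c, KS' (upset p' ys) d & b = c + d].
 exact: kspan_sum tw' _ _ _.
apply: (cone_ext (fun b => iff_sym (eC b)) (fun b => iff_sym (eD b))).
have FU zs b : KS (upset p zs) b -> KS' (upset p' zs) (F b).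
 apply: kspan_map => [c e|a]; first exact: upsetD.
 elim: zs => //= y zs IHz [/Fle|/IHz]; move=> h; apply: kspan_mono h => c; by [left|right].
apply: cone_MV => //.
- exact: kspan_gsub tw _.
- exact: kspan_gsub tw _.
- exact: kspan_gsub tw' _.
- exact: kspan_gsub tw' _.
- by move=> a; apply: (kspan_dif tw) => c e; apply: mleD.
- by move=> a; apply: (kspan_dif tw) => c e; apply: upsetD.
- by move=> a; apply: (kspan_dif tw') => c e; apply: mleD.
- by move=> a; apply: (kspan_dif tw') => c e; apply: upsetD.
- by apply: kspan_map => [c e|a]; [apply: mleD | apply: Fle].
- exact: FU.
- by apply: cone_principal2 => [a|]; [apply: Fle | apply: Fp].
- exact: IH.
have := IH (map (jn x) ys); rewrite size_map => /(_ sz).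
apply: cone_ext => b.
 rewrite (kspan_iff i L (fun a => upset_map x ys a pj)); split=> [h|[h1 h2]]; last exact: kspan_cap tw _ _ _ h1 h2.
 by split; apply: kspan_mono h => a [].
rewrite (kspan_iff i' L' (fun a => upset_map x ys a pj')); split=> [h|[h1 h2]]; last exact: kspan_cap tw' _ _ _ h1 h2.
by split; apply: kspan_mono h => a [].
Qed.

End LcmClosed.
End TwoTowers.
End Ideals.

End MonomialSpans.
Import MonomialSpans.

(** * From the polynomial rings to the quotients by the monomial ideals *)

Module KoszulComparison.

Section KoszulQuotient.
Variables (k : fieldType) (G : zmodType) (chi : alt_bicharacter G k).
Notation T := (tridegree G).
Notation mon n := {ffun 'I_n -> nat}.
Variables (n n' : nat) (g : 'I_n -> G) (g' : 'I_n' -> G) (K K' Ku B : color_dga chi).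
Variables (i : skew_poly chi g -> K) (i' : skew_poly chi g' -> K').
Variables (L : seq (var K)) (L' : seq (var K')).
Notation smonoR m h := (@smono k G chi m h predT isT (fun _ _ _ => isT)).
Notation ssetR m h := (@sset k G chi m h predT isT (fun _ _ _ => isT)).
Hypothesis tw : tower i (@kos_cycles k G chi n g predT isT (fun _ _ _ => isT)) L.
Hypothesis tw' : tower i' (@kos_cycles k G chi n' g' predT isT (fun _ _ _ => isT)) L'.
Variables (F : K -> K') (hF : is_dmap F).
Variables (X : Type) (jn : X -> X -> X) (p : X -> mon n) (p' : X -> mon n') (xs : seq X).
Hypotheses (pj : forall x y a, mle (p (jn x y)) a <-> mle (p x) a /\ mle (p y) a)
 (pj' : forall x y a, mle (p' (jn x y)) a <-> mle (p' x) a /\ mle (p' y) a).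
Hypotheses (Fle : forall x a, mle (p x) a -> kspan i' L' (mle (p' x)) (F (i (smonoR n g a))))
 (Fp : forall x, exists2 c : k, c != 0 & F (i (smonoR n g (p x))) = c *: i' (smonoR n' g' (p' x))).
Variable E : pred (mon n).
Hypotheses (E0 : E 0) (E_down : forall a b, E (a + b) -> E a).
Hypothesis hE : forall a, ~~ E a <-> upset p xs a.
Notation S := (@skew_dga k G chi n g E E0 E_down).
Notation smonoE := (@smono k G chi n g E E0 E_down).
Variables (iu : S -> Ku) (Lu : seq (var Ku)).
Hypothesis twu : tower iu (@kos_cycles k G chi n g E E0 E_down) Lu.
Variables (q : K' -> B) (hq : is_dmap q).
Hypotheses (kerq : forall f, q (i' f) = 0 -> ssetR n' g' (upset p' xs) f)
 (qU : forall a, upset p' xs a -> q (i' (smonoR n' g' a)) = 0)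
 (freeq : freeL (image q (image i' (@full _ _ chi _))) (map (vmap q) L')).

Let hi := tw_dmap tw.
Let hi' := tw_dmap tw'.
Let hiu := tw_dmap twu.
Notation fullR := (@full k G chi _).

(** The whole ring is the principal ideal of 1, whose exponent is 0. *)
Lemma cone_koszul_full : cone F fullR fullR.
Proof.
have e0 m (a : mon m) : mle 0 a by move=> j; rewrite ffunE.
have KS0 : kspan i L (mle 0) = fullR.
 apply/funext => b; apply/propext; split=> // _; apply: spanL_mono (tw_gen tw b) => _ [f _ ->].
 by exists f => // a; case; apply: e0.
have KS0' b : kspan i' L' (mle 0) b.
 apply: spanL_mono (tw_gen tw' b) => _ [f _ ->].
 by exists f => // a; case; apply: e0.
have -> : fullR = kspan i' L' (mle 0).
 by apply/funext => b; apply/propext; split.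
rewrite -KS0; apply: (cone_principal2 tw tw' hF) => // .
exists 1; first exact: oner_neq0.
by rewrite !smono0 (dmap1 hi) (dmap1 hi') (dmap1 hF) scale1r.
Qed.

Lemma F_upset b : kspan i L (upset p xs) b -> kspan i' L' (upset p' xs) (F b).
Proof.
apply: (kspan_map tw tw' hF) => [c e|a]; first exact: upsetD.
by elim: (xs) => //= y zs IHz [/Fle|/IHz] h; apply: kspan_mono h => c; [left|right].
Qed.

Lemma q_upset b : kspan i' L' (upset p' xs) b -> q b = 0.
Proof.
apply: (spanL_gen_ind (J := fun b => q b = 0)) => //.
- exact: isset_gsub tw' _.
- exact: tw_dps tw'.
- split=> [|c a1 a2 e1 e2|t a e1]; first exact: dmap0.
  by rewrite (dmapL hq) e1 e2 scaler0 addr0.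
 by rewrite (dmap_prj hq) e1 prj0.
- by move=> a1 a2 e1; rewrite (dmapM hq) e1 mul0r.
move=> _ [f Uf ->]; elim/sset_ind: Uf => [|f1 f2|c a Ua _].
- by rewrite (dmap0 hi') (dmap0 hq).
- by rewrite (dmapD hi') (dmapD hq) => -> ->; rewrite addr0.
- by rewrite (dmapZ hi') (dmapZ hq) qU // scaler0.
Qed.

Lemma smono_dlt_hom (E' : pred (mon n)) E0' Ed' j :
 hom (0, 0, g j) (@smono k G chi n g E' E0' Ed' (dlt j)).
Proof. by rewrite -mdeg_dlt; apply: smono_hom. Qed.

Lemma koszul_proj : exists pu : K -> Ku, [/\ is_dmap pu, map (vmap pu) L = Lu,
 forall j, pu (i (smonoR n g (dlt j))) = iu (smonoE (dlt j)) & forall a, exists2 c : k, c != 0 & pu (i (smonoR n g a)) = c *: iu (smonoE a)].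
Proof.
have [pi [hpi pid]] := @skew_univ k G chi n g predT isT (fun _ _ _ => isT) S
 (fun j => smonoE (dlt j)) (@smono_dlt_hom E E0 E_down) (fun a na => False_ind _ (negP na isT)).
have [||pu [hpu pui puL]] := tw_univ tw (dmap_comp hpi hiu) (ys := Lu).
- exact: tw_dps twu.
- rewrite (tw_bd twu) /kos_cycles -!map_comp; apply: eq_map => j.
 by rewrite /zmap /= pid.
exists pu; split=> // [j|a]; first by rewrite pui /= pid.
have [c c0 e] := skew_dmap_smono a hpi.
have [d d0 e'] := @smono_monomial k G chi n g E E0 E_down a.
exists (c * d); first by rewrite mulf_neq0.
rewrite pui /= e -scalerA -!(dmapZ hiu); congr (iu (_ *: _)); rewrite -e'.
by rewrite /monomial; apply: eq_bigr => j _; rewrite pid.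
Qed.

(** [F] is a quasi-isomorphism between the Koszul complexes of the two polynomial rings and between
    their subcomplexes over the two ideals. These subcomplexes are the kernels of the projections
    [pu] and [q], so [F] descends to a quasi-isomorphism [psi] of the quotients. *)
Theorem koszul_cone : exists psi : Ku -> B, is_dmap psi /\
 cone psi fullR (spanL (image q (image i' fullR)) (map (vmap q) L')).
Proof.
have [pu [hpu puL pud pus]] := koszul_proj.
have hx j : hom (0, 0, g j) (q (F (i (smonoR n g (dlt j))))).
 by apply: (dmap_hom hq); apply: (dmap_hom hF); apply: (dmap_hom hi); apply: smono_dlt_hom.
have hqFi : is_dmap (q \o (F \o i)) by apply: dmap_comp hq; apply: dmap_comp hF.
have FiU a : upset p xs a -> q (F (i (smonoR n g a))) = 0.
 move=> Ua; apply: q_upset; apply: F_upset; apply: spanL_incl.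
 - exact: isset_gsub tw _.
 - exact: tw_dps tw.
 - exists (smonoR n g a) => //.
  by have := @sset_smono k G chi n g predT isT (fun _ _ _ => isT) (upset p xs) 1 a Ua; rewrite scale1r.
have xE a : ~~ E a -> monomial (fun j => q (F (i (smonoR n g (dlt j))))) a = 0.
 move/hE => Ua; have [c c0 e] := skew_dmap_smono a hqFi.
 by apply: (scalerI c0); rewrite -[LHS]e /= FiU // scaler0.
have [f [hf fd]] := @skew_univ k G chi n g E E0 E_down B _ hx xE.
have hqF : is_dmap (q \o F) by apply: dmap_comp hq.
have [||psi [hpsi psii psiL]] := tw_univ twu hf (ys := map (vmap (q \o F)) L).
- by apply: vmap_dpsL => //; apply: tw_dps tw.
- rewrite -map_comp; transitivity (map (zmap (q \o F)) (map (@vbd _ _ _ K) L)).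
  by rewrite -map_comp; apply: eq_map => v; rewrite /vbd /zmap /= (dmap_dif hF) (dmap_dif hq).
 rewrite (tw_bd tw) /kos_cycles -!map_comp; apply: eq_map => j.
 by rewrite /zmap /= fd.
exists psi; split=> //.
have sq b : q (F b) = psi (pu b).
 apply: (dmap_eq_gen hqF (dmap_comp hpu hpsi) (C := image i fullR)) (tw_gen tw b).
  move=> _ [a _ ->]; apply: (skew_dmap_eq hqFi (dmap_comp hi (dmap_comp hpu hpsi))) => j.
  by rewrite /= pud psii fd.
 rewrite -psiL -puL -map_comp; by apply: eq_map.
have gF (A : color_dga chi) : gsub (@full k G chi A) by apply: galg_sub (full_galg _).
have gI : gsub (image i fullR) by apply: image_gsub.
have dL := tw_dps tw; have dL' := tw_dps tw'.
have gI' : gsub (image i' fullR) by apply: image_gsub.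
(* Freeness of [Lu] reduces the kernel to its coefficients, and on coefficients [pu] rescales each
   monomial outside the ideal by a nonzero constant. *)
have kerpu b : pu b = 0 -> kspan i L (upset p xs) b.
 move=> pb0; have fr : freeL (image pu (image i fullR)) (map (vmap pu) L).
  rewrite puL; apply: freeL_mono (tw_free twu) => _ [_ [a _ ->] ->].
  elim/skew_ind: a => [|a1 a2 [b1 _ e1] [b2 _ e2]|c a _].
  - by exists 0; rewrite // (dmap0 hi) (dmap0 hpu) (dmap0 hiu).
  - by exists (b1 + b2); rewrite // (dmapD hi) (dmapD hpu) e1 e2 (dmapD hiu).
  - have [d d0 e] := pus a; exists (c *: (d *: smonoE a)) => //.
   by rewrite (dmapZ hi) (dmapZ hpu) e -!(dmapZ hiu).
 apply: spanL_mono (spanL_ker hpu gI dL fr (tw_gen tw b) pb0) => _ [[a _ ->] pa0].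
 exists a => // m nm; have Em : E m by apply: contra_notT nm => /hE.
 have [c c0 ec] := pus m.
 have H : exists2 w : S, pu (i a) = iu w & scoef w m = c * scoef a m.
  elim/skew_ind: a {pa0} => [|a1 a2 [b1 e1 f1] [b2 e2 f2]|d a _].
  - by exists 0; [rewrite (dmap0 hi) (dmap0 hpu) (dmap0 hiu) | rewrite mulr0].
  - exists (b1 + b2); first by rewrite (dmapD hi) (dmapD hpu) e1 e2 (dmapD hiu).
   have := scoefL 1 b1 b2 m; have := scoefL 1 a1 a2 m; rewrite !scale1r !mul1r => -> ->.
   by rewrite f1 f2 mulrDr.
  have [c' c0' e] := pus a; exists (d *: (c' *: smonoE a)).
   by rewrite (dmapZ hi) (dmapZ hpu) e -!(dmapZ hiu).
  have := scoefL d (smonoR n g a) 0 m; have := scoefL (d * c') (smonoE a) 0 m.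
  have eR : scoef (smonoR n g a) m = (m == a)%:R by apply: scoef_smono.
  rewrite !addr0 scalerA => -> ->; rewrite eR.
  have [Ea|Ea] := boolP (E a); last first.
   have -> : scoef (smonoE a) m = 0 by rewrite smono_out.
   by case: eqP Ea => [<-|_]; rewrite ?Em // !mulr0.
  rewrite scoef_smono //; case: eqP => [ma|_]; last by rewrite !mulr0.
  have : c *: iu (smonoE m) = c' *: iu (smonoE m) by rewrite -ec ma e.
  rewrite -!(dmapZ hiu) => /(tw_inj twu)/(congr1 (fun f => scoef f m)).
  have := scoefL c (smonoE m) 0 m; have := scoefL c' (smonoE m) 0 m.
  by rewrite !addr0 scoef_smono // eqxx !mulr1 => -> -> ->; rewrite mulrC.
 have [w e1 e2] := H; move: pa0; rewrite e1 -(dmap0 hiu) => /(tw_inj twu) w0.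
 by move: e2; rewrite w0 => /esym/eqP; rewrite mulf_eq0 (negbTE c0) => /eqP.
have kerq' b : q b = 0 -> kspan i' L' (upset p' xs) b.
 move=> qb0; apply: spanL_mono (spanL_ker hq gI' dL' freeq (tw_gen tw' b) qb0) => _ [[a _ ->] qa0].
 by exists a => //; apply: kerq.
have puU b : kspan i L (upset p xs) b -> pu b = 0.
 apply: (spanL_gen_ind (J := fun b => pu b = 0)) => //.
 - exact: isset_gsub tw _.
 - split=> [|c a1 a2 e1 e2|t a e1]; first exact: dmap0.
   by rewrite (dmapL hpu) e1 e2 scaler0 addr0.
  by rewrite (dmap_prj hpu) e1 prj0.
 - by move=> a1 a2 e1; rewrite (dmapM hpu) e1 mul0r.
 move=> _ [a Ua ->]; elim/sset_ind: Ua => [|f1 f2|c a0 /hE Ea _].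
 - by rewrite (dmap0 hi) (dmap0 hpu).
 - by rewrite (dmapD hi) (dmapD hpu) => -> ->; rewrite addr0.
 - have [d d0 e] := pus a0.
  by rewrite (dmapZ hi) (dmapZ hpu) e smono_out // (dmap0 hiu) !scaler0.
have := cone_quot hF hpu hq hpsi (gF K) (gF K') (fun a _ => I) (fun b _ => I)
 (fun a _ => I) (fun b _ => I) (fun a _ => I) (fun a _ => @kerpu a) (fun b _ => @kerq' b)
 puU q_upset (fun a _ => sq a) cone_koszul_full
 (cone_upset tw tw' hF pj pj' Fle Fp (xs := xs)).
apply: cone_ext => b; last first.
 rewrite (spanL_image hq b gI' dL'); split=> [[a _ ->]|[a _ ->]]; last by exists a.
 by exists a => //; apply: tw_gen tw' a.
split=> // _; have : image pu (spanL (image i fullR) L) b.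
 rewrite -(spanL_image hpu b gI dL) puL; apply: spanL_mono (tw_gen twu b) => _ [a _ ->].
 elim/skew_ind: a => [|a1 a2 [_ [b1 _ ->] e1] [_ [b2 _ ->] e2]|c a _].
 - by exists (i 0); [exists 0 | rewrite (dmap0 hi) (dmap0 hpu) (dmap0 hiu)].
 - exists (i (b1 + b2)); first by exists (b1 + b2).
  by rewrite (dmapD hiu) e1 e2 (dmapD hi) (dmapD hpu).
 - have [d d0 e] := pus a; exists (i ((c / d) *: smonoR n g a)); first by eexists.
  by rewrite (dmapZ hi) (dmapZ hpu) e scalerA divfK // (dmapZ hiu).
by case=> a _ ->; exists a.
Qed.

End KoszulQuotient.

End KoszulComparison.
Import KoszulComparison.

(** * Operations on divided powers *)

Module DividedPowers.

Section DividedPowerSystems.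
Variables (k : fieldType) (G : zmodType) (chi : alt_bicharacter G k).
Notation T := (tridegree G).
Variable B : color_dga chi.
Implicit Types (t : T) (x y w : nat -> B).

Definition even_deg t : bool := ~~ odd `|t.1.1|%N.

Lemma csign_even_self t : even_deg t -> csign chi t t = 1.
Proof. by rewrite csign_self /even_deg => /negbTE ->; rewrite expr0. Qed.

Lemma even_dpow_ok t l : even_deg t -> dpow_ok (odd `|t.1.1|%N) l.
Proof. by rewrite /even_deg /dpow_ok => /negbTE ->. Qed.

Lemma dps_even t x : even_deg t -> x 0 = 1 -> (forall l, hom (t *+ l) (x l)) ->
 (forall h l, x h * x l = x (h + l)%N *+ 'C(h + l, h)) ->
 (forall l, dif (x l.+1) = dif (x 1) * x l) -> dps t x.
Proof. by move=> et x0 xh xM xd; split=> // l; rewrite even_dpow_ok. Qed.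

Definition odd_var (b : B) (l : nat) : B :=
 match l with 0 => 1 | 1 => b | _ => 0 end.

Lemma odd_var_dps t b : ~~ even_deg t -> hom t b -> dps t (odd_var b).
Proof.
rewrite /even_deg negbK => ot hb; split; rewrite ?ot //.
 by case=> [|[|l]] //= _; rewrite ?mulr1n ?mulr0n //; apply: hom1.
by case=> [|[|l]].
Qed.

Definition zero_dps (l : nat) : B := (l == 0%N)%:R.

Lemma zero_dpsP t : even_deg t -> dps t zero_dps.
Proof.
move=> et; apply: dps_even => //.
- by case=> [|l]; [rewrite mulr0n; apply: hom1 | apply: hom0].
- move=> [|h] [|l]; rewrite /zero_dps /= ?addn0 ?mulr1 ?mul1r ?mul0r ?mulr0 ?mul0rn ?bin0 ?binn ?mulr1n //.
- by move=> l; rewrite /zero_dps /= dif0 mul0r.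
Qed.

(** Divided powers of a sum: (x + w)^(l) is the sum of the x^(a) w^(l-a). *)
Definition star x w (l : nat) : B := \sum_(a < l.+1) x a * w (l - a)%N.

Lemma star1 t x w : dps t x -> dps t w -> star x w 1 = w 1 + x 1.
Proof.
move=> hx hw; rewrite /star big_ord_recr big_ord_recr big_ord0 /= (dps0 hx) (dps0 hw).
by rewrite mul1r mulr1 add0r.
Qed.

(** For l > 0, the number (l n)! / (l!^n n!) of partitions of l n points into n blocks of size l,
    which is the constant in (x^(l))^(n) = dpc l n x^(l n). The recursion chooses the block of the
    last point and thus stays within nat. *)
Fixpoint dpc (l n : nat) : nat :=
 if n is m.+1 then (dpc l m * 'C(l * m + l.-1, l.-1))%N else 1%N.

Lemma csignMn1 (t r : T) n : csign chi (t *+ n) r = csign chi t r ^+ n.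
Proof. by rewrite -{1}[r]mulr1n csignMn muln1. Qed.

Lemma homX e (c : B) n : hom e c -> hom (e *+ n) (c ^+ n).
Proof.
by move=> hc; elim: n => [|n IH]; rewrite ?expr0 ?mulr0n; [exact: hom1 | rewrite exprS mulrS; apply: homM].
Qed.

Section SignedDerivation.
Variables (u : T) (D : B -> B).
Hypotheses (DL : forall c a b, D (c *: a + b) = c *: D a + D b)
 (Dh : forall t a, hom t a -> hom (t + u) (D a))
 (DM : forall t a b, hom t a -> D (a * b) = D a * b + csign chi u t *: (a * D b)).
Notation good x := (forall l, D (x l.+1) = D (x 1) * x l).

Lemma sder0 : D 0 = 0. Proof. by have := DL (-1) 0 0; rewrite scaler0 addr0 scaleN1r addNr. Qed.
Lemma sderD a b : D (a + b) = D a + D b. Proof. by have := DL 1 a b; rewrite !scale1r. Qed.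
Lemma sderZ c a : D (c *: a) = c *: D a. Proof. by have := DL c a 0; rewrite !addr0 sder0 addr0. Qed.
Lemma sderMn a n : D (a *+ n) = D a *+ n. Proof. by rewrite -!scaler_nat sderZ. Qed.
Lemma sder1 : D 1 = 0.
Proof.
have := DM 1 (hom1 B); rewrite !mulr1 csign0r scale1r mul1r => /eqP.
by rewrite -subr_eq subrr eq_sym => /eqP.
Qed.
Lemma sder_sum (I : Type) (r : seq I) (F : I -> B) : D (\sum_(i <- r) F i) = \sum_(i <- r) D (F i).
Proof. by elim: r => [|i r IH]; rewrite ?big_nil ?sder0 // !big_cons sderD IH. Qed.

Lemma sder_comm (t r : T) (a z : B) : hom t a -> hom (r + u) z -> csign chi u t *: (a * z) = csign chi t r *: (z * a).
Proof. by move=> ha hz; rewrite (commM ha hz) scalerA csignDr mulrCA csign_swap mulr1. Qed.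

(** Stated, like the next lemmas, for any signed derivation, so as to serve both for the
    differential and for the color derivations of A<X>. *)
Lemma star_der t x w : even_deg t -> dps t x -> dps t w -> good x -> good w -> good (star x w).
Proof.
move=> et hx hw gx gw l; have ok m := even_dpow_ok m et.
rewrite (star1 hx hw) sderD mulrDl.
have sE m : star x w m = \sum_(0 <= a < m.+1) x a * w (m - a)%N by rewrite /star big_mkord.
have cm a b : csign chi u (t *+ a) *: (x a * D (w b.+1)) = D (w 1) * (x a * w b).
 rewrite gw mulrA scalerAl (sder_comm (r := t) (dps_hom hx (ok a)) (Dh (dps_hom1 hw))).
 by rewrite csignMn1 csign_even_self // expr1n scale1r mulrA.
rewrite sE sder_sum.
under eq_bigr do rewrite (DM _ (dps_hom hx (ok _))).
rewrite big_split /= addrC; congr (_ + _).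
 rewrite big_nat_recr //= subnn (dps0 hw) sder1 mulr0 scaler0 addr0 sE mulr_sumr.
 by apply: eq_big_nat => a /andP[_ al]; rewrite subSn // cm.
rewrite big_nat_recl // (dps0 hx) sder1 mul0r add0r sE mulr_sumr.
by apply: eq_bigr => a _; rewrite gx mulrA subSS.
Qed.

(** Bringing (c Y)^n into the form c^n Y^n interchanges one Y with one c for each pair of factors,
    hence the exponent n choose 2 of the commutation factor. *)
Lemma scale_der e r (c : B) Y : even_deg e -> even_deg r -> hom e c -> dps r Y -> good Y ->
 good (fun n => csign chi r e ^+ 'C(n, 2) *: (c ^+ n * Y n)).
Proof.
move=> ee er hc hY gY l; have ok m := even_dpow_ok m er; set s := csign chi r e.
have Yc n m : Y n * c ^+ m = s ^+ (n * m) *: (c ^+ m * Y n).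
 by rewrite (commM (dps_hom hY (ok n)) (homX m hc)) csignMn.
have bin2S n : ('C(n.+1, 2) = 'C(n, 2) + n)%N by rewrite binS bin1 addnC.
have dcn n : D (c ^+ n.+1) = (D c * c ^+ n) *+ n.+1.
 elim: n => [|n IH]; first by rewrite expr1 expr0 mulr1.
 rewrite exprSr (DM _ (homX _ hc)) IH (sder_comm (r := e) (homX _ hc) (Dh hc)).
 rewrite csignMn1 csign_even_self // expr1n scale1r mulrnAl -mulrA -exprSr.
 by rewrite [RHS]mulrSr.
have dY a m : csign chi u (e *+ m) *: (c ^+ m * (D (Y 1) * a)) = csign chi e r ^+ m *: (D (Y 1) * (c ^+ m * a)).
 by rewrite mulrA scalerAl (sder_comm (r := r) (homX m hc) (Dh (dps_hom1 hY))) csignMn1 -scalerAl -mulrA.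
rewrite (_ : 'C(1, 2) = 0%N) // expr0 scale1r expr1 sderZ (DM _ (homX _ hc)) gY.
rewrite dY dcn bin2S exprD -scalerA -scalerAr; congr (_ *: _).
rewrite (DM _ hc) scalerDr mulrDl; congr (_ + _).
 rewrite -[D c * Y 1 * _]mulrA (mulrA (Y 1)).
 have := Yc 1%N l; rewrite mul1n => ->; rewrite -scalerAl -scalerAr; congr (_ *: _).
 by rewrite -[c ^+ l * Y 1 * _]mulrA (dpsM hY) // bin1 add1n !mulrnAr mulrnAl mulrA.
have := dY 1 1%N; rewrite !mulr1 !expr1 => ->.
rewrite -!scalerAl scalerA -mulrA [c * (_ * _)]mulrA -exprS; congr (_ *: _).
by rewrite exprS mulrCA -exprMn csign_swap expr1n mulr1.
Qed.

Lemma pow_der t x l : even_deg t -> (0 < l)%N -> dps t x -> good x -> good (fun n => x (l * n)%N *+ dpc l n).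
Proof.
move=> et l0 hx gx m /=; rewrite muln1 muln0 add0n binn ?muln1 ?mul1n ?mulr1n.
have -> : (l * m.+1 = (l * m + l.-1).+1)%N by case: (l) l0 => // l' _; rewrite mulnS; lia.
rewrite sderMn gx; have -> : x l = x l.-1.+1 by rewrite prednK.
rewrite gx mulrnAr -mulrA (dpsM hx) // mulrnAr -mulrnA.
by rewrite [(l.-1 + _)%N]addnC; congr (_ *+ _); exact: mulnC.
Qed.

(** What has to be seen is D(c b) c b = 0: each of its terms contains c twice or b twice. *)
Lemma odd_mul_der e r (c b : B) : ~~ even_deg e -> ~~ even_deg r -> hom e c -> hom r b -> good (odd_var (c * b)).
Proof.
move=> oe or hc hb [|[|l]] /=; rewrite ?mulr1 ?mulr0 ?sder0 //.
have c2 := odd_sq hc (negbNE oe); have b2 := odd_sq hb (negbNE or).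
rewrite (DM _ hc) mulrDl -[D c * b * _]mulrA [b * _]mulrA (commM hb hc) -!scalerAl -!scalerAr.
rewrite -[c * b * b]mulrA b2 !mulr0 scaler0 add0r.
rewrite -mulrA [D b * _]mulrA (commM (Dh hb) hc) -!scalerAl -!scalerAr -!mulrA (mulrA c) c2.
by rewrite !mul0r !scaler0.
Qed.
End SignedDerivation.

Lemma dif_sderL c (a b : B) : dif (c *: a + b) = c *: dif a + dif b. Proof. by rewrite difD difZ. Qed.
Lemma dif_sderM t (a b : B) : hom t a -> dif (a * b) = dif a * b + csign chi (-1, 0, 0) t *: (a * dif b).
Proof.
move=> ha; rewrite difM /tau (tw_hom _ ha) -scalerAl; congr (_ + _ *: _).
have s2 : sg k t * sg k t = 1 by rewrite /sg signz_absz -signr_addb addbb.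
have := csign_swap chi (-1, 0, 0) t; rewrite csign_downr => e.
by rewrite -[LHS]mul1r -e -mulrA s2 mulr1.
Qed.

Lemma star_dps t x w : even_deg t -> dps t x -> dps t w -> dps t (star x w).
Proof.
move=> et hx hw; have ok l := even_dpow_ok l et.
have cmm a b : x a * w b = w b * x a.
 rewrite (commM (dps_hom hx (ok a)) (dps_hom hw (ok b))) csignMn csign_even_self //.
 by rewrite expr1n scale1r.
have eo : ~~ odd `|t.1.1|%N := et.
apply: dps_even => //.
- by rewrite /star big_ord_recr big_ord0 /= add0r (dps0 hx) (dps0 hw) mulr1.
- move=> l; apply: hom_sum => a _.
 have -> : t *+ l = t *+ a + t *+ (l - a) by rewrite -mulrnDr subnKC // -ltnS.
 by apply: homM; [apply: (dps_hom hx) | apply: (dps_hom hw)].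
- move=> h l; rewrite /star mulr_suml.
 pose F (A : nat) := x A * w (h + l - A)%N.
 transitivity (\sum_(a < h.+1) \sum_(a' < l.+1) F (a + a')%N *+ ('C(a + a', a) * 'C(h + l - (a + a'), h - a))).
  apply: eq_bigr => a _; rewrite mulr_sumr; apply: eq_bigr => a' _.
  have la : (a <= h)%N by rewrite -ltnS. have la' : (a' <= l)%N by rewrite -ltnS.
  rewrite -mulrA [w _ * _]mulrA -cmm -[x a' * _ * _]mulrA (dpsM hw) // mulrA (dpsM hx) //.
  have -> : (h - a + (l - a') = h + l - (a + a'))%N by lia.
  by rewrite mulrnAl mulrnAr -mulrnA mulnC.
 (* Reindexing by the total power A of x: for fixed A the products of binomial coefficients add up
    by Vandermonde's identity. *)
 transitivity (\sum_(a < h.+1) \sum_(A < (h + l).+1 | (a <= A <= a + l)%N)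
   F A *+ ('C(A, a) * 'C(h + l - A, h - a))).
  apply: eq_bigr => a _; have la : (a <= h)%N by rewrite -ltnS.
  rewrite -(big_mkord (fun A => (a <= A <= a + l)%N) (fun A => F A *+ ('C(A, a) * 'C(h + l - A, h - a)))).
  rewrite (@big_cat_nat _ _ _ a) //=; last by lia.
  rewrite [X in _ = X + _]big_nat_cond [X in _ = X + _]big1 ?add0r; last by move=> A hA; exfalso; move: hA; lia.
  rewrite (@big_cat_nat _ _ _ (a + l).+1) //=; [|lia|lia].
  rewrite [X in _ = _ + X]big_nat_cond [X in _ = _ + X]big1 ?addr0; last by move=> A hA; exfalso; move: hA; lia.
  rewrite -[X in _ = \big[_/_]_(X <= _ < _ | _) _]add0n big_addn -addnS addKn big_mkord.
  rewrite [RHS](eq_bigl xpredT) => [|A]; last by have := ltn_ord A; lia.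
  by apply: eq_bigr => A _; rewrite addnC.
 under eq_bigr do rewrite big_mkcond.
 rewrite exchange_big /= -sumrMnl; apply: eq_bigr => A _.
 have lA : (A <= h + l)%N by rewrite -ltnS.
 transitivity (\sum_(a < h.+1) F A *+ ('C(A, a) * 'C(h + l - A, h - a))).
  apply: eq_bigr => a _; case: ifP => // nA; have la : (a <= h)%N by rewrite -ltnS.
  case: (ltnP A a) => Aa; first by rewrite bin_small // mul0n.
  by rewrite [X in (_ * X)%N]bin_small ?muln0 //; move: nA; rewrite Aa /=; lia.
 by rewrite sumrMnr binomial.Vandermonde subnKC.
- exact: (star_der dif_sderL (@hom_dif _ _ _ B) dif_sderM et hx hw (fun l => dps_dif hx l eo) (fun l => dps_dif hw l eo)).
Qed.

Lemma scale_dps e r (c : B) Y : even_deg e -> even_deg r -> hom e c -> dps r Y ->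
 dps (e + r) (fun n => csign chi r e ^+ 'C(n, 2) *: (c ^+ n * Y n)).
Proof.
set s := csign chi r e => ee er hc hY; have ok l := even_dpow_ok l er.
have eor : ~~ odd `|r.1.1|%N := er.
have hcn n := homX n hc.
have Yc n m : Y n * c ^+ m = s ^+ (n * m) *: (c ^+ m * Y n).
 by rewrite (commM (dps_hom hY (ok n)) (hcn m)) csignMn.
have bin2S n : ('C(n.+1, 2) = 'C(n, 2) + n)%N by rewrite binS bin1 addnC.
have bin2D h l : ('C(h, 2) + 'C(l, 2) + h * l = 'C(h + l, 2))%N.
 elim: l => [|l IH]; first by rewrite muln0 !addn0.
 by rewrite addnS !bin2S -IH mulnS; lia.
apply: dps_even.
- move: ee er; rewrite /even_deg; case: (e) (r) => [[a ?] ?] [[a' ?] ?] /=.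
 by rewrite odd_abszD; do 2!case: odd.
- by rewrite !expr0 scale1r (dps0 hY) mulr1.
- move=> l; rewrite mulrnDl; apply: homZ; apply: homM; [exact: hcn | exact: (dps_hom hY)].
- move=> h l; rewrite -scalerAl -scalerAr scalerA -mulrA [Y h * _]mulrA Yc.
 rewrite -scalerAl -scalerAr scalerA -[_ * Y h * _]mulrA (dpsM hY) // mulrA -exprD.
 by rewrite mulrnAr -scalerMnr -!exprD bin2D.
exact: (scale_der dif_sderL (@hom_dif _ _ _ B) dif_sderM ee er hc hY (fun l => dps_dif hY l eor)).
Qed.

Lemma dpcE l n : (0 < l)%N -> (dpc l n * (l`! ^ n * n`!) = (l * n)`!)%N.
Proof.
case: l => // l _; elim: n => [|n IH] /=; first by rewrite muln0.
have bf := @bin_fact (l.+1 * n + l) l (leq_addl _ _).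
rewrite addnK in bf.
have -> : (l.+1 * n.+1 = (l.+1 * n + l).+1)%N by lia.
rewrite [RHS]factS -bf -IH expnS [n.+1`!]factS {1}[l.+1`!]factS.
have -> : ((l.+1 * n + l).+1 = l.+1 * n.+1)%N by lia.
ring.
Qed.

Lemma pow_dps t x l : even_deg t -> (0 < l)%N -> dps t x ->
 dps (t *+ l) (fun n => x (l * n)%N *+ dpc l n).
Proof.
move=> et l0 hx; have ok m := even_dpow_ok m et; have eo : ~~ odd `|t.1.1|%N := et.
apply: dps_even => [|||h m|m].
- by rewrite /even_deg odd_tdegMn (negbTE eo).
- by rewrite muln0 (dps0 hx).
- by move=> n; rewrite -mulrnA; apply: homMn; apply: (dps_hom hx).
- rewrite mulrnAl mulrnAr -!mulrnA (dpsM hx) // -!mulrnA -mulnDr; congr (_ *+ _).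
 have p0 : (0 < (l`! ^ h * h`!) * (l`! ^ m * m`!))%N by rewrite !muln_gt0 !expn_gt0 !fact_gt0.
 apply/eqP; rewrite -(eqn_pmul2r p0); apply/eqP.
 have bh : ('C(l * h + l * m, l * h) * ((l * h)`! * (l * m)`!) = (l * (h + m))`!)%N.
  by rewrite mulnDr -(@bin_fact (l * h + l * m) (l * h)) ?leq_addr // addKn.
 have bm : ('C(h + m, h) * (h`! * m`!) = (h + m)`!)%N.
  by rewrite -(@bin_fact (h + m) h) ?leq_addr // addKn.
 transitivity ((l * (h + m))`!).
  by rewrite -bh -!dpcE // mulnDr; ring.
 by rewrite -(dpcE _ l0) -bm expnD; ring.
exact: (pow_der dif_sderL et l0 hx (fun q => dps_dif hx q eo) m).
Qed.

Lemma odd_mul_dps e r (c b : B) : ~~ even_deg e -> ~~ even_deg r -> hom e c -> hom r b ->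
 dps (e + r) (odd_var (c * b)).
Proof.
rewrite /even_deg !negbK => oe or hc hb.
have c2 := odd_sq hc oe; have b2 := odd_sq hb or.
have cb2 : c * b * (c * b) = 0.
 rewrite -mulrA [b * _]mulrA (commM hb hc) -scalerAl -scalerAr -[c * b * b]mulrA b2.
 by rewrite !mulr0 scaler0.
have ev : even_deg (e + r).
 rewrite /even_deg; move: oe or; case: (e) (r) => [[a ?] ?] [[a' ?] ?] /=.
 by rewrite odd_abszD => -> ->.
apply: dps_even => //.
- case=> [|[|l]] /=; [exact: hom1 | by rewrite mulr1n; apply: homM | exact: hom0].
- move=> [|[|h]] [|[|l]] /=; rewrite ?mul1r ?mulr1 ?mulr0 ?mul0r ?cb2 ?mul0rn ?addn0 ?bin0 ?binn //.
apply: (odd_mul_der dif_sderL (@hom_dif _ _ _ B) dif_sderM _ _ hc hb); by rewrite /even_deg negbK.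
Qed.

(* A property of divided power sequences that survives their algebraic operations; it will be the
 compatibility with all derivations of the closure. *)
Record dpfam (Ok : T -> (nat -> B) -> Prop) : Prop := {
 ok_zero : forall t, even_deg t -> Ok t zero_dps;
 ok_star : forall t x w, even_deg t -> dps t x -> dps t w -> Ok t x -> Ok t w -> Ok t (star x w);
 ok_scale : forall e r (c : B) Y, even_deg e -> even_deg r -> hom e c -> dps r Y -> Ok r Y ->
  Ok (e + r) (fun n => csign chi r e ^+ 'C(n, 2) *: (c ^+ n * Y n));
 ok_scal : forall t x (c : k), even_deg t -> dps t x -> Ok t x -> Ok t (fun n => c ^+ n *: x n);
 ok_pow : forall t x l, even_deg t -> (0 < l)%N -> dps t x -> Ok t x -> Ok (t *+ l) (fun n => x (l * n)%N *+ dpc l n);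
 ok_odd : forall e r (c b : B), ~~ even_deg e -> ~~ even_deg r -> hom e c -> hom r b ->
  Ok (e + r) (odd_var (c * b));
 ok_var : forall t b, ~~ even_deg t -> hom t b -> Ok t (odd_var b) }.

Lemma dpfamT : dpfam (fun _ _ => True).
Proof. by []. Qed.

Variables (Ok : T -> (nat -> B) -> Prop) (fOk : dpfam Ok).

(** What a change of even variables requires in positive characteristic: divided powers inside [V]
    for its even elements of positive degree. *)
Definition dpclosed (V : B -> Prop) : Prop := forall t (b : B), even_deg t -> V b -> hom t b ->
 0 < t.1.1 -> exists W, [/\ dps t W, W 1 = b, forall l, V (W l) & Ok t W].

Lemma star_closed V t x w : galg V -> (forall l, V (x l)) -> (forall l, V (w l)) ->
 forall l, V (star x w l).
Proof.
by move=> [gV _ VM] Vx Vw l; apply: (gsub_sum gV) => a _; apply: VM.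
Qed.

(** An even element is a sum of terms c x^(l), and [star] adds their divided powers. The constant
    term belongs to [V]. If x is odd, c x is a product of two odd elements. If x is even and l > 0,
    then (c x^(l))^(n) is a multiple of c^n x^(l n); it uses ordinary powers of c only, so c may
    well have degree 0. *)
Lemma dpclosed_adj1 V (v : var B) : galg V -> dps v.1 v.2 -> 0 < v.1.1.1 -> Ok v.1 v.2 -> dpclosed V ->
 dpclosed (adj1 V v).
Proof.
move=> gV dv v0 okv dV t b et hVb hb t0; have g := galg_sub gV.
have gA : galg (adj1 V v) := adjoin_galg gV dv.
have [N [c [[Vc c0] hc eb]]] := adjoin_hom_coefs g dv hVb hb.
have Vv l : adj1 V v (v.2 l).
 case: (boolP (dpow_ok (vodd v) l)) => ol; last first.
  by rewrite (dps_out dv) //; apply: (gsub0 (galg_sub gA)).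
 by rewrite -[v.2 l]mul1r; apply: adjoin_mem (gsub0 g) ol (galg1 gV).
have VA a : V a -> adj1 V v a by apply: (adjoin_incl g dv).
have AM := galgM gA.
have VX a n : adj1 V v a -> adj1 V v (a ^+ n).
 by move=> Va; elim: n => [|n IH]; rewrite ?expr0 ?exprS; [exact: (galg1 gA) | exact: AM].
rewrite {}eb; elim: N {c0 hVb hb b} => [|N [W [dW W1 VW oW]]].
 rewrite big_ord0; exists (zero_dps); split; [exact: zero_dpsP | by [] | | exact: ok_zero].
 move=> [|l]; rewrite /zero_dps /=; [exact: (galg1 gA) | exact: (gsub0 (galg_sub gA))].
suff [Y [[dY Y1 VY] oY]] : exists Y, [/\ dps t Y, Y 1 = c N * v.2 N & forall l, adj1 V v (Y l)] /\ Ok t Y.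
 exists (star Y W); split; first exact: star_dps.
  by rewrite (star1 dY dW) W1 Y1 big_ord_recr.
  exact: (star_closed t gA).
 exact: (ok_star fOk).
case: N {W dW W1 VW oW} => [|N].
 have hc0 : hom t (c 0%N) by have := hc 0%N; rewrite mulr0n subr0.
 have [Y [dY Y1 VY oY]] := dV _ _ et (Vc 0%N) hc0 t0.
 by exists Y; split=> //; split=> //; [rewrite (dps0 dv) mulr1 | move=> l; apply: VA].
have := hc N.+1; set e := t - _ => hcN; have et' : t = e + v.1 *+ N.+1 by rewrite subrK.
case: (boolP (vodd v)) => ov.
 case: N @e hcN et' => [|N] e hcN et'; last first.
  exists (zero_dps); split; last exact: ok_zero.
  split; first exact: zero_dpsP.
   by rewrite (dps_out dv) ?mulr0 // -/(vodd v) ov.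
  move=> [|l]; rewrite /zero_dps /=; [exact: (galg1 gA) | exact: (gsub0 (galg_sub gA))].
 have oe : ~~ even_deg e.
  move: et; rewrite et' mulr1n /even_deg; move: ov; rewrite /vodd.
  case: (e) (v.1) => [[a ?] ?] [[a' ?] ?] /=; rewrite odd_abszD => ->.
  by case: odd.
 have ov' : ~~ even_deg v.1 by rewrite /even_deg negbK.
 exists (odd_var (c 1%N * v.2 1%N)); split; last first.
  rewrite et' mulr1n; apply: (ok_odd fOk) => //; exact: dps_hom1.
 split=> //.
  rewrite et' mulr1n; apply: odd_mul_dps => //; exact: dps_hom1.
 move=> [|[|l]] /=; [exact: (galg1 gA) | by apply: AM => //; apply: VA | exact: (gsub0 (galg_sub gA))].
have er : even_deg (v.1 *+ N.+1) by rewrite /even_deg odd_tdegMn -/(vodd v) (negbTE ov).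
have ee : even_deg e.
 move: et er; rewrite et' /even_deg; case: (e) (v.1 *+ _) => [[a ?] ?] [[a' ?] ?] /=.
 by rewrite odd_abszD; do 2!case: odd.
have dY := pow_dps (l := N.+1) ov isT dv.
have oY := ok_pow fOk (l := N.+1) ov isT dv okv.
eexists; split; last by rewrite et'; exact: (ok_scale fOk ee er hcN dY oY).
split; [rewrite et'; exact: (scale_dps ee er hcN dY) | |].
 rewrite /= (_ : 'C(1, 2) = 0%N) // expr0 scale1r expr1 muln1 muln0 add0n binn mul1n mulr1n. by [].
move=> l /=; apply: (gsubZ (galg_sub gA)); apply: AM; first exact/VX/VA.
exact: (gsubMn (galg_sub gA)).
Qed.

Lemma dpclosed_spanL V (L : seq (var B)) : galg V -> dpsL L -> allP L (fun v => 0 < v.1.1.1) ->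
 allP L (fun v => Ok v.1 v.2) -> dpclosed V -> dpclosed (spanL V L).
Proof.
elim: L V => //= v L IH V gV [dv dL] [v0 L0] [ov oL] dV; apply: IH => //; first exact: adjoin_galg.
exact: dpclosed_adj1.
Qed.

End DividedPowerSystems.

End DividedPowers.
Import DividedPowers.

(** * Changes of variables and the exchange argument *)

Module Exchange.

Section Exchange.
Variables (k : fieldType) (G : zmodType) (chi : alt_bicharacter G k).
Notation T := (tridegree G).
Variable B : color_dga chi.
Implicit Types (t : T) (V C : B -> Prop) (u v : var B) (L : seq (var B)).

Lemma var_comm u v l m : dps u.1 u.2 -> dps v.1 v.2 -> dpow_ok (vodd u) l -> dpow_ok (vodd v) m ->
 u.2 l * v.2 m = csign chi (u.1 *+ l) (v.1 *+ m) *: (v.2 m * u.2 l).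
Proof. by move=> du dv ol om; rewrite (commM (dps_hom du ol) (dps_hom dv om)). Qed.

Lemma csign_unit (t s : T) : csign chi t s * csign chi s t = 1.
Proof. exact: csign_swap. Qed.

Lemma csign_neq0 (t s : T) : csign chi t s != 0.
Proof. by apply/eqP => e; have := csign_unit t s; rewrite e mul0r => /eqP; rewrite eq_sym oner_eq0. Qed.

Lemma adj1_swap_incl C u v b : gsub C -> dps u.1 u.2 -> dps v.1 v.2 ->
 adj1 (adj1 C u) v b -> adj1 (adj1 C v) u b.
Proof.
move=> gC du dv; have gv := adjoin_gsub gC dv; have gvu := adjoin_gsub gv du.
elim/adj1_ind => [||c m om hc]; [exact: (gsub0 gvu) | exact: (gsubD gvu) |].
elim/adj1_ind: hc => [||c' l ol Cc].
- by rewrite mul0r; apply: (gsub0 gvu).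
- by move=> a a' ha ha'; rewrite mulrDl; apply: (gsubD gvu).
rewrite -mulrA (var_comm du dv ol om) -scalerAr mulrA; apply: (gsubZ gvu).
by apply: adjoin_mem (gsub0 gv) ol _; apply: adjoin_mem (gsub0 gC) om _.
Qed.

Lemma adj1_swap C u v : gsub C -> dps u.1 u.2 -> dps v.1 v.2 ->
 adj1 (adj1 C u) v = adj1 (adj1 C v) u.
Proof.
move=> gC du dv; apply/funext => b; apply/propext.
by split; apply: adj1_swap_incl.
Qed.

(** Regroup a relation by the powers of v: freeness of v over C<u> kills each coefficient, and
    freeness of u over C then kills the coefficients of those. *)
Lemma free_swap C u v : gsub C -> dps u.1 u.2 -> dps v.1 v.2 ->
 dpow_free (vodd u) C u.2 -> dpow_free (vodd v) (adj1 C u) v.2 ->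
 dpow_free (vodd u) (adj1 C v) u.2.
Proof.
move=> gC du dv fu fv N d hd s0 l0 l0N ol0.
have C0 := gsub0 gC.
have /choice[p hp] : forall l, exists p : nat * (nat -> B),
  nice_coefs (vodd v) C p.1 p.2 /\ d l = \sum_(m < p.1) p.2 m * v.2 m.
 by move=> l; have /adjoinP-/(_ C0)[M [c [h1 h2]]] := hd l; exists (M, c).
pose M := (\max_(l < N) (p l).1)%N.
have leM l : (l < N)%N -> ((p l).1 <= M)%N.
 by move=> lN; apply: (leq_bigmax (F := fun l : 'I_N => (p l).1) (Ordinal lN)).
pose c l m := if (l < N)%N && dpow_ok (vodd u) l && dpow_ok (vodd v) m then (p l).2 m else 0.
have Cc l m : C (c l m) by rewrite /c; case: ifP => // _; case: (hp l) => -[].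
have dE l : (l < N)%N -> dpow_ok (vodd u) l -> d l = \sum_(m < M | dpow_ok (vodd v) m) c l m * v.2 m.
 move=> lN ol; have [nc ->] := hp l; rewrite -(sum_widen v.2 (leM l lN) nc) [RHS]big_mkcond /=.
 apply: eq_bigr => m _; rewrite /c lN ol /=; case: ifPn => [->//|om].
 by case: nc => _ ->; rewrite ?mul0r // om orbT.
pose e m l := csign chi (v.1 *+ m) (u.1 *+ l) *: c l m.
have eq0 : \sum_(m < M | dpow_ok (vodd v) m) (\sum_(l < N | dpow_ok (vodd u) l) e m l * u.2 l) * v.2 m = 0.
 rewrite -[RHS]s0; under eq_bigr do rewrite mulr_suml.
 rewrite exchange_big /=; apply: eq_bigr => l ol.
 rewrite dE // mulr_suml; apply: eq_bigr => m om.
 by rewrite -!mulrA (var_comm dv du om ol) /e -scalerAl -scalerAr.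
have h m : (m < M)%N -> dpow_ok (vodd v) m -> \sum_(l < N | dpow_ok (vodd u) l) e m l * u.2 l = 0.
 move=> mM om.
 apply: (fv M (fun m => \sum_(l < N | dpow_ok (vodd u) l) e m l * u.2 l) _ eq0 m mM om) => m'.
 by exists N, (e m'); split=> // l; apply: (gsubZ gC).
rewrite dE // big1 // => m om.
have : e m l0 = 0 by apply: (fu N (e m) _ (h m (ltn_ord m) om)) => // l; apply: (gsubZ gC).
move=> /eqP; rewrite scaler_eq0 (negbTE (csign_neq0 _ _)) /= => /eqP ->.
by rewrite mul0r.
Qed.

Lemma move_last C L1 v L2 : gsub C -> dpsL L1 -> dps v.1 v.2 -> dpsL L2 ->
 spanL C (L1 ++ v :: L2) = spanL C (L1 ++ rcons L2 v) /\
 (freeL C (L1 ++ v :: L2) -> freeL C (L1 ++ rcons L2 v)).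
Proof.
move=> gC d1 dv; rewrite !spanL_cat !freeL_cat => d2.
have := spanL_gsub gC d1; move: (spanL C L1) => D gD.
suff [-> h] : spanL D (v :: L2) = spanL D (rcons L2 v) /\
  (freeL D (v :: L2) -> freeL D (rcons L2 v)) by split=> // -[? /h].
elim: L2 D gD d2 {L1 d1} => //= u L2 IH D gD [du d2].
have [e h] := IH _ (adjoin_gsub gD du) d2.
split; first by rewrite -e /= adj1_swap.
move=> [fv [fu f2]]; split; first by apply: dpow_free_mono fu => a; apply: (adjoin_incl gD dv).
by apply: h; split; [exact: free_swap fv fu | rewrite adj1_swap].
Qed.

(** The E l arise from the x a by a triangular matrix whose diagonal entries are invertible
    scalars. *)
Lemma replace_adj1 C t (x E : nat -> B) (D : nat -> nat -> B) (c : nat -> k) : galg C ->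
 dps t x -> dps t E ->
 (forall l, dpow_ok (odd `|t.1.1|%N) l -> E l = \sum_(a < l.+1) D l a * x a) ->
 (forall l a, C (D l a)) -> (forall l, c l != 0) -> (forall l, D l l = c l *: 1) ->
 adj1 C (t, E) = adj1 C (t, x) /\
 (dpow_free (odd `|t.1.1|%N) C x -> dpow_free (odd `|t.1.1|%N) C E).
Proof.
move=> [gC C1 CM] dx dE hE hD cn0 hDl; set o := odd _ in hE *.
have gE := adjoin_gsub gC dE; have gx := adjoin_gsub gC dx; rewrite -/o in gE gx.
have C0 := gsub0 gC.
have okle a l : (a <= l)%N -> dpow_ok o l -> dpow_ok o a.
 by move=> al /implyP h; apply/implyP => /h; apply: leq_ltn_trans.
split.
 apply/funext => b; apply/propext; split.
  elim/adj1_ind => [||d l ol Cd]; [exact: (gsub0 gx) | exact: (gsubD gx) |].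
  rewrite /= hE // mulr_sumr; apply: (gsub_sum gx) => a _; rewrite mulrA.
  by apply: adjoin_mem => //; [apply: okle ol; rewrite -ltnS | apply: CM].
 have xE l : dpow_ok o l -> forall d, C d -> adjoin o C E (d * x l).
  elim/ltn_ind: l => l IH ol d Cd.
  have -> : x l = (c l)^-1 *: (E l - \sum_(a < l) D l a * x a).
   by rewrite hE // big_ord_recr /= addrAC subrr add0r hDl -scalerAl mul1r scalerA mulVf // scale1r.
  rewrite -scalerAr mulrBr; apply: (gsubZ gE); apply: (gsubB gE); first exact: adjoin_mem.
  rewrite mulr_sumr; apply: (gsub_sum gE) => a _; rewrite mulrA; apply: IH => //.
   by apply: okle ol; apply: ltnW.
  exact: CM.
 by elim/adj1_ind => [||d l ol Cd]; [exact: (gsub0 gE) | exact: (gsubD gE) | exact: xE].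
move=> fx; elim=> [//|N IH] d Cd; rewrite big_mkcond big_ord_recr -big_mkcond /=.
move=> s0.
have dN : dpow_ok o N -> d N = 0.
 move=> oN; move: s0; rewrite oN => s0.
 pose F l a := if (a <= l)%N && dpow_ok o l then d l * D l a else 0.
 have s2 : \sum_(a < N.+1 | dpow_ok o a) (\sum_(l < N.+1) F l a) * x a = 0.
  rewrite -[RHS]s0.
  transitivity (\sum_(a < N.+1 | dpow_ok o a) \sum_(l < N.+1) F l a * x a).
   by apply: eq_bigr => a _; rewrite mulr_suml.
  rewrite exchange_big /= big_ord_recr /= [in RHS]big_mkcond /=; congr (_ + _).
   apply: eq_bigr => l _; rewrite /F; case: ifP => ol; last first.
    by rewrite big1 // => a _; rewrite andbF mul0r.
   rewrite hE // mulr_sumr (big_ord_widen N.+1 (fun a => d l * (D l a * x a))); last by have := ltn_ord l; lia.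
   rewrite [LHS]big_mkcond [RHS]big_mkcond /=; apply: eq_bigr => a _.
   rewrite ltnS andbT; case: (boolP (a <= l)%N) => al /=; last by rewrite mul0r if_same.
   by rewrite (okle _ _ al ol) mulrA.
  rewrite hE // mulr_sumr [LHS]big_mkcond /=; apply: eq_bigr => a _.
  have aN : (a <= N)%N by rewrite -ltnS.
  by rewrite (okle _ _ aN oN) /F oN aN mulrA.
 have : \sum_(l < N.+1) F l N = 0.
  apply: (fx N.+1 (fun a => \sum_(l < N.+1) F l a) _ s2 N (ltnSn N) oN) => a.
  by apply: (gsub_sum gC) => l _; rewrite /F; case: ifP => // _; apply: CM.
 rewrite big_ord_recr big1 /= => [|l _]; last by rewrite /F leqNgt ltn_ord.
 rewrite add0r /F leqnn oN /= hDl -scalerAr mulr1 => /eqP.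
 by rewrite scaler_eq0 (negbTE (cn0 N)) /= => /eqP.
move: s0; have -> : (if dpow_ok o N then d N * E N else 0) = 0.
 by case: ifP => // /dN ->; rewrite mul0r.
rewrite addr0 => /(IH d Cd) h l; rewrite ltnS leq_eqVlt => /predU1P[->|]; [exact: dN | exact: h].
Qed.

Variables (Ok : T -> (nat -> B) -> Prop) (fOk : dpfam Ok).

(** For even x, the divided powers of e = c x + w are the [star] of those of c x and those of w,
    which [dpclosed] supplies; they are triangular in the powers of x. For odd x only the powers 0
    and 1 exist. *)
Lemma replace_var C (v : var B) e (c : k) (w : B) : galg C -> dpclosed Ok C -> Ok v.1 v.2 -> dps v.1 v.2 -> 0 < v.1.1.1 ->
 c != 0 -> C w -> hom v.1 e -> e = c *: v.2 1 + w ->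
 exists E, [/\ dps v.1 E, E 1 = e, adj1 C (v.1, E) = adj1 C v,
  dpow_free (vodd v) C v.2 -> dpow_free (vodd v) C E & Ok v.1 E].
Proof.
case: v => t x /= gC dC ox dx t0 c0 Cw he ee; have [g C1 CM] := gC.
have hw : hom t w.
 have -> : w = e - c *: x 1 by rewrite ee addrC addKr.
 by apply: homB => //; apply: homZ; apply: dps_hom1.
case: (boolP (even_deg t)) => et; last first.
 have ot : odd `|t.1.1|%N by move: et; rewrite /even_deg negbK.
 have dE := odd_var_dps et he.
 pose D (l a : nat) : B := match l, a with
  0, 0 => 1 | 1, 0 => w | 1, 1 => c *: 1 | l, a => (l == a)%:R end.
 have [|||| h1 h2] := @replace_adj1 C t x (odd_var e) D (fun l => if l == 1%N then c else 1) gC dx dE.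
 - rewrite ot; case=> [|[|l]] // _; rewrite !big_ord_recr big_ord0 /= add0r (dps0 dx) ?mulr1 //.
  by rewrite ee -scalerAl mul1r addrC.
 - move=> [|[|l]] [|[|a]] //=; rewrite ?(gsub0 g) //; try exact: (gsub0 g).
   exact: (gsubZ g).
  by case: eqP; rewrite ?(gsub0 g) //; move=> _; apply: (gsub0 g).
 - by move=> l; case: (l == 1%N); rewrite ?oner_eq0.
 - by move=> [|[|l]] //=; rewrite ?eqxx ?scale1r.
 by exists (odd_var e); split=> //; apply: (ok_var fOk).
have [W [dW W1 CW oW]] := dC t w et Cw hw t0.
have dcx : dps t (fun l => c ^+ l *: x l).
 have eo : ~~ odd `|t.1.1|%N := et.
 apply: dps_even => //.
 - by rewrite expr0 scale1r (dps0 dx).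
 - by move=> l; apply: homZ; apply: (dps_hom dx); apply: even_dpow_ok.
 - by move=> h l; rewrite -scalerAl -scalerAr scalerA -exprD (dpsM dx) // scalerMnr.
 - by move=> l; rewrite expr1 !difZ (dps_dif dx) // -scalerAl -scalerAr scalerA -exprS.
have dE := star_dps et dcx dW.
have e1 : star (fun l => c ^+ l *: x l) W 1 = e by rewrite (star1 dcx dW) W1 expr1 addrC ee.
have [|||| h1 h2] := @replace_adj1 C t x _ (fun l a => c ^+ a *: W (l - a)%N) (fun l => c ^+ l) gC dx dE.
- move=> l _; apply: eq_bigr => a _; rewrite -!scalerAl.
 rewrite (commM (dps_hom dx (even_dpow_ok a et)) (dps_hom dW (even_dpow_ok (l - a) et))) csignMn.
 by rewrite csign_even_self // expr1n scale1r.
- by move=> l a; apply: (gsubZ g).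
- by move=> l; rewrite expf_neq0.
- by move=> l; rewrite subnn (dps0 dW).
by exists (star (fun l => c ^+ l *: x l) W); split=> //; apply: (ok_star fOk) => //; apply: (ok_scal fOk).
Qed.

Lemma zmod_identity2 (V : zmodType) (p y5 y y6 E y1 y2 : V) :
 p - (y5 + y + y6) - (E - (y1 + y + y2)) = p - (- y1 + y5 + (- y2 + y6) + E).
Proof.
rewrite -addrA -opprD; congr (_ - _); apply: (addIr (y1 + y + y2)).
rewrite -[LHS]addrA subrK [RHS](AC ((2*2*1)*3) ((1*6)*((3*8)*(2*7*4*5)))) /=.
by rewrite !addNr !add0r.
Qed.

(** Coefficients are indexed by nat rather than by ordinals, so that lists can be cut, joined and
    shifted without casts. *)
Fixpoint lcB (us : seq B) (c : nat -> B) : B :=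
 if us is u :: us' then c 0 * u + lcB us' (fun i => c i.+1) else 0.

Lemma lcB_ext (us : seq B) (c d : nat -> B) : (forall i, (i < size us)%N -> c i = d i) -> lcB us c = lcB us d.
Proof.
elim: us c d => //= u us IH c d cd; rewrite cd //; congr (_ + _).
by apply: IH => i iu; apply: cd.
Qed.
Lemma lcB_cat (us vs : seq B) (c : nat -> B) : lcB (us ++ vs) c = lcB us c + lcB vs (fun i => c (size us + i)%N).
Proof. by elim: us c => [|u us IH] c /=; rewrite ?add0r // IH addrA. Qed.
Lemma lcB_rcons (us : seq B) (v : B) (c : nat -> B) : lcB (rcons us v) c = lcB us c + c (size us) * v.
Proof. by rewrite -cats1 lcB_cat /= addr0 addn0. Qed.
Lemma lcB_lin (us : seq B) (x : B) (c d : nat -> B) : lcB us (fun i => x * c i + d i) = x * lcB us c + lcB us d.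
Proof.
elim: us c d => [|u us IH] c d /=; first by rewrite mulr0 addr0.
by rewrite IH mulrDl mulrDr mulrA addrACA.
Qed.
Lemma lcB0 (us : seq B) : lcB us (fun=> 0) = 0.
Proof. by elim: us => //= u us ->; rewrite mul0r addr0. Qed.

Definition one (v : var B) : B := v.2 1.
Definition ones (L : seq (var B)) : seq B := map one L.
Definition scal (a : nat -> k) (i : nat) : B := a i *: 1.
Definition indep (J : B -> Prop) (us : seq B) : Prop :=
 forall a, J (lcB us (scal a)) -> forall i, (i < size us)%N -> a i = 0.

Section Steinitz.
Variables (V C0 J : B -> Prop) (gV : galg V) (dV : dpclosed Ok V).
Hypotheses (gC0 : galg C0) (C0V : forall b, C0 b -> V b)
 (C0s : forall c, C0 c -> hom 0 c -> exists a : k, c = a *: 1).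
Hypotheses (gJ : gsub J) (VJ : forall b, V b -> J b).

Definition dec (L : seq (var B)) (b : B) : Prop :=
 exists c, (forall i, C0 (c i)) /\ V (b - lcB (ones L) c).

Definition absorbed (b : B) : Prop := forall s c, s != 0 -> C0 c -> hom s c -> J (c * b).

Lemma prj_lcB (L : seq (var B)) t c : dpsL L ->
 prj t (lcB (ones L) c) = lcB (ones L) (fun i => prj (t - nth 0 (map fst L) i) (c i)).
Proof.
elim: L c => [|v L IH] c /=; first by rewrite prj0.
by move=> [dv dL]; rewrite prjD IH // (prj_mulr _ _ (dps_hom1 dv)).
Qed.

Lemma lcB_mem K (L : seq (var B)) c : galg K -> (forall i, K (c i)) -> allP L (fun v => K (one v)) ->
 K (lcB (ones L) c).
Proof.
move=> gK; elim: L c => [|v L IH] c Kc /=; first by move=> _; apply: (gsub0 (galg_sub gK)).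
by move=> [Kv KL]; apply: (gsubD (galg_sub gK)); [apply: (galgM gK) | apply: IH].
Qed.

Lemma spanL_one (L : seq (var B)) : dpsL L -> allP L (fun v => spanL V L (one v)).
Proof.
elim/last_ind: L => [//|L v IH]; rewrite /dpsL -cats1 !allP_cat => -[dL [dv _]].
have gL := spanL_gsub (galg_sub gV) dL; rewrite spanL_cat /=; split.
 by apply: allP_impl (IH dL) => u; apply: (adjoin_incl gL dv).
split=> //; rewrite -[one v]mul1r; apply: adjoin_mem; first exact: (gsub0 gL).
 by rewrite /dpow_ok implybT.
exact: (galg1 (spanL_galg gV dL)).
Qed.

(** Only the component of c i in the degree complementary to its variable contributes. If that
    degree is 0 it is a scalar by [C0s]; otherwise its product with the variable is absorbed in
    [J]. *)
Lemma dec_scal (L : seq (var B)) t e : dpsL L -> allP L (fun v => absorbed (one v)) ->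
 hom t e -> dec L e -> exists c a, [/\ forall i, C0 (c i), V (e - lcB (ones L) c),
  forall i, (i < size L)%N -> a i != 0 -> c i = a i *: 1 /\ nth 0 (map fst L) i = t &
  J (e - lcB (ones L) (scal a))].
Proof.
move=> dL aL he [c [Cc Vc]].
pose d i := nth 0 (map fst L) i; pose c' i := prj (t - d i) (c i).
have Cc' i : C0 (c' i) by apply: (gsubP (galg_sub gC0)).
have Ve : V (e - lcB (ones L) c').
 by rewrite -(prj_lcB _ _ dL) -(prj_id he) -prjB; apply: (gsubP (galg_sub gV)).
have /choice[a ha] : forall i, exists ai : k, if t == d i then c' i = ai *: 1 else ai = 0.
 move=> i; case: eqP => [ti|_]; last by exists 0.
 apply: C0s => //; have := hom_prj (t - d i) (c i); by rewrite {1}ti subrr.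
exists c', a; split=> //.
 move=> i iL ai; have := ha i; case: eqP => [ti ->|_ ai0]; first by split.
 by rewrite ai0 eqxx in ai.
have -> : e - lcB (ones L) (scal a) = (e - lcB (ones L) c') + (lcB (ones L) c' - lcB (ones L) (scal a)).
 by rewrite addrA subrK.
apply: (gsubD gJ); first exact: VJ.
have hc' i : hom (t - d i) (c' i) by apply: hom_prj.
have hac i : t = d i -> c' i = a i *: 1 by move=> ti; have := ha i; rewrite ti eqxx.
have ha0 i : t != d i -> a i = 0 by move=> ti; have := ha i; rewrite (negbTE ti).
rewrite {Vc Ve ha}/scal; move: (c') Cc' a hac ha0 hc'; rewrite {c' c Cc}/d.
elim: {dL he} (L) aL => [|v L' IH] /=; first by rewrite subrr => _ *; apply: (gsub0 gJ).
move=> [av aL] c Cc a hac ha0 hc; rewrite opprD addrACA; apply: (gsubD gJ).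
 case: (eqVneq t v.1) => tv; first by rewrite (hac 0%N tv) subrr; apply: (gsub0 gJ).
 rewrite (ha0 0%N tv) scale0r mul0r subr0; apply: av (hc 0%N) => //; first by rewrite subr_eq0.
by apply: (IH aL (fun i => c i.+1) _ (fun i => a i.+1)) => i; [exact: Cc | exact: (hac i.+1) |
 exact: (ha0 i.+1) | exact: (hc i.+1)].
Qed.

(* Coefficients lie in [C0], and those of nonzero degree do not matter modulo [J], so that exchange
 happens over the field k. *)
Lemma steinitz (es : seq (T * B)) (R D : seq (var B)) : dpsL (R ++ D) -> freeL V (R ++ D) ->
 allP (R ++ D) (fun v => 0 < v.1.1.1) -> allP (R ++ D) (fun v => Ok v.1 v.2) ->
 allP (R ++ D) (fun v => absorbed (one v)) ->
 indep J (ones (R ++ D)) -> indep J (ones D ++ map snd es) ->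
 (forall p, p \in es -> [/\ hom p.1 p.2, dec (R ++ D) p.2, absorbed p.2 & 0 < p.1.1.1]) ->
 exists R' E, [/\ dpsL (R' ++ D ++ E), freeL V (R' ++ D ++ E),
  spanL V (R' ++ D ++ E) = spanL V (R ++ D), indep J (ones (R' ++ D ++ E)) &
  [seq (v.1, one v) | v <- E] = es /\ ((forall P, allP R P -> allP R' P) /\ allP E (fun v => Ok v.1 v.2))].
Proof.
elim: es R D => [|[t e] es IH] R D dL fL pL oL aL iL iE hes.
 by exists R, [::]; rewrite cats0; split.
have [he de ae t0] := hes _ (mem_head _ _).
have [c [a [Cc Ve ha Ja]]] := dec_scal dL aL he de.
(* If no variable of R occurred in e, then e would be a combination of D modulo J, against the
   independence of D and es. *)
have [i0 [i0R ai0]] : exists i, (i < size R)%N /\ a i != 0.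
 apply: contrapT => nex.
 have a0 i : (i < size R)%N -> a i = 0.
  by move=> iR; apply: contrapT => /eqP ai; apply: nex; exists i.
 pose a' i := if (i < size D)%N then - a (size R + i)%N else (i == size D)%:R.
 have : J (lcB (ones D ++ map snd ((t, e) :: es)) (scal a')).
  rewrite lcB_cat /= size_map {2}/scal /a' addn0 ltnn eqxx scale1r mul1r.
  rewrite (@lcB_ext (map snd es) _ (fun=> 0)) => [|i _]; last first.
   rewrite /scal (_ : (size D + i.+1 < size D)%N = false); last by lia.
   by rewrite (_ : (size D + i.+1 == size D)%N = false) ?scale0r //; lia.
  rewrite lcB0 addr0 addrC; move: Ja; rewrite /ones map_cat lcB_cat size_map opprD addrA.
  rewrite (@lcB_ext (map one R) (scal a) (fun=> 0)) => [|i]; last first.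
   by rewrite size_map => /a0; rewrite /scal => ->; rewrite scale0r.
  rewrite lcB0 subr0; congr (J (_ + _)).
  rewrite (@lcB_ext (map one D) (scal a') (fun i => (-1) * scal a (size R + i)%N + 0)).
   by rewrite lcB_lin mulN1r lcB0 addr0.
  by move=> i; rewrite size_map /scal /a' => ->; rewrite mulN1r addr0 scaleNr.
 move=> /iE-/(_ (size D)); rewrite /a' ltnn eqxx /ones size_cat !size_map /= => h.
 have /eqP := h ltac:(lia); by rewrite oner_eq0.
have [v0 _] : exists v0 : var B, True by exists (0, fun=> 0).
have [R1 [v [R2 [eR sR1]]]] : exists R1 v R2, R = R1 ++ v :: R2 /\ size R1 = i0.
 exists (take i0 R), (nth v0 R i0), (drop i0.+1 R); split; last by rewrite size_takel // ltnW.
 by rewrite -drop_nth // cat_take_drop.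
have [ci0 ti0] : c i0 = a i0 *: 1 /\ v.1 = t.
 have [|-> /= tt] := ha i0 _ ai0; first by rewrite size_cat ltn_addr.
 by split=> //; rewrite -tt eR -catA map_cat nth_cat size_map sR1 ltnn subnn.
subst R; set L2 := R2 ++ D.
have e12 : (R1 ++ v :: R2) ++ D = R1 ++ v :: L2 by rewrite -catA.
rewrite e12 in dL fL pL oL aL iL Ve Ja *.
have := dL; rewrite /dpsL allP_cat /= => -[d1 [dv d2]].
have := pL; rewrite allP_cat /= => -[p1 [pv p2]].
have := oL; rewrite allP_cat /= => -[o1' [ov o2']].
have := aL; rewrite allP_cat /= => -[a1 [av a2]].
have d12 : dpsL (R1 ++ L2) by rewrite /dpsL allP_cat.
have [es1 fs1] := move_last (galg_sub gV) d1 dv d2.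
have := fs1 fL; rewrite -cats1 catA freeL_cat /= => -[f12 [fv _]].
rewrite -cats1 catA spanL_cat /= in es1.
have gL := spanL_galg gV d12.
have dcL : dpclosed Ok (spanL V (R1 ++ L2)).
 by apply: dpclosed_spanL => //; rewrite allP_cat.
pose w := e - a i0 *: one v.
have lc3 x : lcB (ones (R1 ++ v :: L2)) x =
  lcB (ones R1) x + x i0 * one v + lcB (ones L2) (fun i => x (i0.+1 + i)%N).
 rewrite /ones map_cat lcB_cat /= size_map sR1 addn0 addrA; congr (_ + _).
 by apply: lcB_ext => i _; rewrite addnS.
have cv : c i0 * one v = a i0 *: one v by rewrite ci0 -scalerAl mul1r.
have ones_in L' : dpsL L' -> allP L' (fun u => spanL V L' (one u)) by apply: spanL_one.
have sub12 := allP_cat R1 L2; have [o1 o2] := (iffLR (sub12 _)) (ones_in _ d12).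
have VL b : V b -> spanL V (R1 ++ L2) b by apply: spanL_incl => //; apply: galg_sub.
have wL : spanL V (R1 ++ L2) w.
 have -> : w = lcB (ones R1) c + lcB (ones L2) (fun i => c (i0.+1 + i)%N) +
  (e - lcB (ones (R1 ++ v :: L2)) c).
  rewrite lc3 cv; set x1 := lcB _ _; set x2 := lcB _ _; set y := _ *: _.
  by rewrite [x1 + y + x2]addrAC opprD addrCA addNKr.
 have gs := galg_sub gL; apply: (gsubD gs); last exact: VL.
 by apply: (gsubD gs); apply: (lcB_mem gL) => // i; apply/VL/C0V.
have [E [dE E1 eqE fE oE]] : exists E, [/\ dps v.1 E, E 1 = e,
  adj1 (spanL V (R1 ++ L2)) (v.1, E) = adj1 (spanL V (R1 ++ L2)) v,
  dpow_free (vodd v) (spanL V (R1 ++ L2)) v.2 -> dpow_free (vodd v) (spanL V (R1 ++ L2)) E & Ok v.1 E].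
 apply: (replace_var gL dcL ov dv pv ai0 wL); first by rewrite ti0.
 by rewrite /w addrC subrK.
have eN : (R1 ++ R2) ++ rcons D (v.1, E) = rcons (R1 ++ L2) (v.1, E).
 by rewrite /L2 -!rcons_cat catA.
have dN : dpsL (rcons (R1 ++ L2) (v.1, E)) by rewrite -cats1 /dpsL allP_cat; split.
have [||||||||R' [E' [h1 h2 h3 h4 [h5 [h6 h7]]]]] := IH (R1 ++ R2) (rcons D (v.1, E)).
- by rewrite eN.
- by rewrite eN -cats1 freeL_cat /=; split=> //; split=> //; apply: fE.
- by rewrite eN -cats1; apply/allP_cat; split; [apply/allP_cat; split | split=> //].
- by rewrite eN -cats1; apply/allP_cat; split; [apply/allP_cat; split | split=> //].
- rewrite eN -cats1; apply/allP_cat; split; first by apply/allP_cat; split.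
 by split=> //; rewrite /one /= E1.
- rewrite eN /ones map_rcons => b; rewrite lcB_rcons size_map {2}/scal.
 set n := size (R1 ++ L2); rewrite {1}/one /= E1 -scalerAl mul1r => Jb.
 (* A relation b among the new variables becomes a relation b' among the old ones: e is replaced by
    its expansion with coefficients a, at the cost of a multiple of an element of [J]. *)
 pose b' i := if (i < i0)%N then b i + b n * a i else if i == i0 then b n * a i0
  else b i.-1 + b n * a i.
 have nE : n = (i0 + size L2)%N by rewrite /n size_cat sR1.
 have : J (lcB (ones (R1 ++ v :: L2)) (scal b')).
  have -> : lcB (ones (R1 ++ v :: L2)) (scal b') = (lcB (map one (R1 ++ L2)) (scal b) + b n *: e)
   - b n *: (e - lcB (ones (R1 ++ v :: L2)) (scal a)).
   rewrite !lc3 {1}/ones map_cat lcB_cat size_map sR1.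
   rewrite (@lcB_ext (ones R1) (scal b') (fun i => (b n *: 1) * scal a i + scal b i)); last first.
    move=> i; rewrite size_map sR1 => ii; rewrite /scal /b' ii.
    by rewrite -scalerAl mul1r scalerA -scalerDl addrC.
   rewrite (@lcB_ext (ones L2) (fun i => scal b' (i0.+1 + i)%N)
    (fun i => (b n *: 1) * scal a (i0.+1 + i)%N + scal b (i0 + i)%N)); last first.
    move=> i _; rewrite /scal /b' (_ : (i0.+1 + i < i0)%N = false); last by lia.
    rewrite (_ : (i0.+1 + i == i0)%N = false); last by lia.
    by rewrite -scalerAl mul1r scalerA -scalerDl addrC.
   rewrite !lcB_lin -!scalerAl !mul1r /b' ltnn eqxx.
   rewrite scalerBr !scalerDr scalerA.
   set z1 := lcB _ _; set z2 := lcB _ _; set z3 := _ *: _; set z4 := _ *: _; set z5 := _ *: _.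
   set z6 := _ *: _; set z7 := lcB _ _.
   by rewrite opprB [RHS]addrC [z2 + z7 + z6]addrC addrA subrK [RHS](AC (3*2) ((1*4*2)*(3*5))).
  by apply: (gsubB gJ) => //; apply: (gsubZ gJ).
 move=> /iL iL'.
 have sL : size (ones (R1 ++ v :: L2)) = n.+1 by rewrite size_map size_cat /= sR1 nE addnS.
 have bn : b n = 0.
  have : b' i0 = 0 by apply: iL'; rewrite sL nE ltnS leq_addr.
  rewrite /b' ltnn eqxx => /eqP; by rewrite mulf_eq0 (negbTE ai0) orbF => /eqP.
 move=> i; rewrite size_rcons size_map ltnS leq_eqVlt => /predU1P[->//|iN].
 case: (ltnP i i0) => ii.
  by have := iL' i; rewrite sL ltnS ltnW // /b' ii bn mul0r addr0; apply.
 have := iL' i.+1; rewrite sL ltnS iN /b' ltnNge leqW //= gtn_eqF ?ltnS //.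
 by rewrite bn mul0r addr0; apply.
- by rewrite /ones map_rcons cat_rcons {1}/one /= E1.
- move=> p pes; have [hp [c' [Cc' Vc']] ap p0] := hes _ (mem_behead (s := (t, e) :: es) pes).
 split=> //; rewrite e12 in Vc'; rewrite eN.
 (* z times the expansion of e has the same coefficient at v as the expansion of p.2; subtracting it
    eliminates v, and z becomes the coefficient of the new variable. *)
 pose z := c' i0 * ((a i0)^-1 *: 1).
 have gC := galg_sub gC0; have Cz : C0 z by apply: (galgM gC0) => //; apply: (gsubZ gC); apply: (galg1 gC0).
 exists (fun i => if (i < i0)%N then - z * c i + c' i
  else if (i < i0 + size L2)%N then - z * c i.+1 + c' i.+1 else z); split.
  move=> i; case: ifP => _; last case: ifP => _ //.
   by apply: (gsubD gC) => //; apply: (galgM gC0) => //; apply: (gsubN gC).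
  by apply: (gsubD gC) => //; apply: (galgM gC0) => //; apply: (gsubN gC).
 rewrite /ones map_rcons lcB_rcons map_cat lcB_cat size_cat !size_map sR1.
 rewrite (_ : one (v.1, E) = e) //= ltnn (_ : (i0 + size L2 < i0)%N = false); last by lia.
 rewrite (@lcB_ext (map one R1) _ (fun i => - z * c i + c' i)); last first.
  by move=> i; rewrite size_map sR1 => ->.
 rewrite (@lcB_ext (map one L2) _ (fun i => - z * c (i0.+1 + i)%N + c' (i0.+1 + i)%N)); last first.
  by move=> i; rewrite size_map => ii; rewrite ltnNge leq_addr /= ltn_add2l ii.
 rewrite !lcB_lin.
 have : V ((p.2 - lcB (ones (R1 ++ v :: L2)) c') - z * (e - lcB (ones (R1 ++ v :: L2)) c)).
  have gs := galg_sub gV; apply: (gsubB gs) => //; apply: (galgM gV) => //; exact: C0V.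
 congr V; rewrite !lc3 cv.
 have -> : c' i0 * one v = z * (a i0 *: one v).
  by rewrite /z -mulrA -scalerAl mul1r scalerA mulVf // scale1r.
 rewrite !mulrBr !mulrDr !mulNr.
 exact: zmod_identity2.
exists R', (( v.1, E) :: E'); rewrite cat_rcons in h1 h2 h3 h4; split=> //.
- by rewrite h3 eN -cats1 spanL_cat /= eqE [in RHS]spanL_cat /= es1 [RHS]spanL_cat.
by split; [rewrite /= h5 ti0 /one /= E1 | split=> // P; rewrite allP_cat /= => -[? [??]]; apply: h6; rewrite allP_cat].
Qed.

End Steinitz.
End Exchange.

End Exchange.
Import Exchange.

(** * Forgetting internal degrees; the augmentation, acyclicity and minimality of a closure *)

Module AcyclicClosures.

Section Collapse.
Variables (k : fieldType) (G : zmodType) (chi : alt_bicharacter G k).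
Notation T := (tridegree G).
Variable B : color_dga chi.
Implicit Types (t u v w : T) (a b : B).

Definition flat t : T := (t.1.1, 0, t.2).
(** Components in several internal degrees are allowed, as long as the homological degree and the
    color agree with t. *)
Definition chom t b : Prop := forall u, flat u <> t -> prj u b = 0.

Lemma chom_hom u b : hom u b -> chom (flat u) b.
Proof. by move=> hb v vu; rewrite (prj_hom _ hb); case: eqP => // e; case: vu; rewrite e. Qed.
Lemma chom0 t : chom t 0. Proof. by move=> u _; rewrite prj0. Qed.
Lemma chomL t c a b : chom t a -> chom t b -> chom t (c *: a + b).
Proof. by move=> ha hb u tu; rewrite prjP ha ?hb // scaler0 addr0. Qed.
Lemma chomD t a b : chom t a -> chom t b -> chom t (a + b).
Proof. by move=> ha hb; rewrite -[a]scale1r; apply: chomL. Qed.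

Lemma chom_ind t (P : B -> Prop) : P 0 -> (forall a b, P a -> P b -> P (a + b)) ->
 (forall u a, flat u = t -> hom u a -> P a) -> forall a, chom t a -> P a.
Proof.
move=> P0 PD Ph a ha; rewrite -(sum_prj_dsupp a); elim/big_ind: _ => // u _.
case: (pselect (flat u = t)) => [e|/ha ->//]; exact: (Ph u) (hom_prj u a).
Qed.

Lemma flatD u v : flat (u + v) = flat u + flat v.
Proof. by case: u v => [[a b] c] [[a' b'] c']. Qed.

Lemma chom_sum t (I : Type) (r : seq I) (P : pred I) (F : I -> B) :
 (forall i, P i -> chom t (F i)) -> chom t (\sum_(i <- r | P i) F i).
Proof. by move=> h; elim/big_ind: _ => //; [exact: chom0 | exact: chomD]. Qed.

Lemma csign_flat u v : csign chi (flat u) (flat v) = csign chi u v.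
Proof. by []. Qed.

Lemma chomM t u a b : chom t a -> chom u b -> chom (t + u) (a * b).
Proof.
move=> ha hb; elim/chom_ind: ha => [|a1 a2 h1 h2|v a' <- ha]; first by rewrite mul0r; apply: chom0.
 by rewrite mulrDl; apply: chomD.
elim/chom_ind: hb => [|b1 b2 h1 h2|w b' <- hb]; first by rewrite mulr0; apply: chom0.
 by rewrite mulrDr; apply: chomD.
by rewrite -flatD; apply: chom_hom; apply: homM.
Qed.

Lemma chom_comm t u a b : chom t a -> chom u b -> a * b = csign chi t u *: (b * a).
Proof.
move=> ha hb; elim/chom_ind: ha => [|a1 a2 h1 h2|v a' <- ha]; first by rewrite mul0r mulr0 scaler0.
 by rewrite mulrDl mulrDr scalerDr h1 h2.
elim/chom_ind: hb => [|b1 b2 h1 h2|w b' <- hb]; first by rewrite mul0r mulr0 scaler0.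
 by rewrite mulrDl mulrDr scalerDr h1 h2.
by rewrite csign_flat; apply: commM.
Qed.

Lemma collapse_dgaP : is_color_dga chi chom (dif (c := B)).
Proof.
split.
- exact: chom0.
- exact: chomL.
- move=> a; pose c t := \sum_(u <- dsupp a | flat u == t) prj u a.
 exists (undup [seq flat u | u <- dsupp a]), c; split.
  by move=> t; apply: chom_sum => u /eqP <-; apply: chom_hom; apply: hom_prj.
 rewrite -[LHS]sum_prj_dsupp /c (exchange_big_dep xpredT) //=; apply: eq_big_seq => u ud.
 rewrite -big_filter (_ : [seq i <- _ | _] = [:: flat u]) ?big_seq1 //.
 have un := undup_uniq [seq flat v | v <- dsupp a].
 have -> : [seq i <- undup [seq flat v | v <- dsupp a] | flat u == i] =
  [seq i <- undup [seq flat v | v <- dsupp a] | pred1 (flat u) i].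
  by apply: eq_filter => i /=; rewrite eq_sym.
 by rewrite filter_pred1_uniq // mem_undup map_f.
- move=> r c ur hc s0 t tr; apply: prj_inj => u; rewrite prj0.
 case: (pselect (flat u = t)) => [e|/(hc t)//].
 have := congr1 (prj u) s0; rewrite prj_sum prj0 (bigD1_seq t) //= big1 ?addr0 // => v vt.
 by apply: hc => e'; case/eqP: vt; rewrite -e'.
- move=> t a t0 ha; apply: prj_inj => u; rewrite prj0.
 case: (pselect (flat u = t)) => [e|/ha//].
 by apply: (hom_neg _ (hom_prj u a)); rewrite -e in t0.
- by have := chom_hom (hom1 B).
- exact: chomM.
- exact: difD.
- move=> t a ha; elim/chom_ind: ha => [|a1 a2 h1 h2|v a' <- ha]; first by rewrite dif0; apply: chom0.
  by rewrite difD; apply: chomD.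
 have -> : flat v + (-1, 0, 0) = flat (v + (-1, 0, 0)) by rewrite flatD.
 by apply: chom_hom; apply: hom_dif.
- exact: difK.
- move=> t a b ha; elim/chom_ind: ha => [|a1 a2 h1 h2|v a' <- ha].
 + by rewrite !mul0r dif0 !mul0r scaler0 addr0.
 + by rewrite difD !mulrDl difD h1 h2 scalerDr addrACA.
 + exact: (dif_homM b ha).
- exact: chom_comm.
- move=> t a ha ot; suff [] : a * a = 0 /\ chom t a by [].
 elim/chom_ind: ha => [|a1 a2 [h1 c1] [h2 c2]|v a' e ha].
 + by rewrite mul0r; split=> //; apply: chom0.
 + split; last exact: chomD.
  rewrite mulrDl !mulrDr h1 h2 addr0 add0r (chom_comm c1 c2) csign_odd // scaleN1r.
  by rewrite addNr.
 + split; last by rewrite -e; apply: chom_hom.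
  by apply: (odd_sq ha); rewrite -e in ot.
Qed.

(* The internal degrees of the variables depend on the quotient, so closures are only compared through
 their homological degrees and colors: the internal degree is reset to 0. *)
Definition collapse : color_dga chi := ColorDGA collapse_dgaP.

Lemma dps_collapse t (x : nat -> B) : dps t x -> @dps _ _ _ collapse (flat t) x.
Proof.
move=> hx; split; rewrite /=; [exact: (dps0 hx) | | exact: (dpsM hx) | exact: (dps_dif hx) | exact: (dps_out hx)].
move=> l ol; have -> : flat t *+ l = flat (t *+ l).
 by elim: l {ol} => // l IH; rewrite !mulrS flatD -IH.
exact/chom_hom/(dps_hom hx).
Qed.

Lemma cprj t b : prj (A := collapse) t b = \sum_(u <- dsupp b | flat u == t) prj u b.
Proof.
rewrite -[X in prj _ X](sum_prj_dsupp b) prj_sum [RHS]big_mkcond /=; apply: eq_bigr => u _.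
by rewrite (@prj_hom _ _ _ collapse t (flat u) _ (chom_hom (hom_prj u b))) eq_sym.
Qed.

Lemma gsub_collapse (C : B -> Prop) : gsub C -> @gsub _ _ _ collapse C.
Proof.
move=> gC; split; [exact: (gsub0 gC) | exact: (gsubL gC) |].
by move=> t a Ca; rewrite cprj; apply: (gsub_sum gC) => u _; apply: (gsubP gC).
Qed.

Lemma galg_collapse (C : B -> Prop) : galg C -> @galg _ _ _ collapse C.
Proof. by move=> [gC C1 CM]; split=> //; apply: gsub_collapse. Qed.

End Collapse.

Section Closure.
Variables (k : fieldType) (G : zmodType) (chi : alt_bicharacter G k).
Notation T := (tridegree G).
Variables (S : algType k) (n : nat) (y : 'I_n -> S) (d : 'I_n -> nat) (g : 'I_n -> G).
Variable B : acyclic_closure_of chi y d g.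
Hypothesis d0 : forall i, (0 < d i)%N.
Hypothesis S_span : forall s : S, exists (r : seq {ffun 'I_n -> nat}) (c : {ffun 'I_n -> nat} -> k),
 s = \sum_(a <- r) c a *: monomial y a.
Notation iota' := (ac_incl B).

Definition base (b : B) : Prop := exists s, b = iota' s.
(** [ac_var] is unconstrained at the powers that an odd variable lacks; they are reset to 0, as
    [dps] requires. *)
Definition cvar (i m : nat) : var B :=
 (ac_deg B i m, fun l => if dpow_ok (odd i.+1) l then ac_var B i m l else 0).
Definition cvars (i : nat) : seq (var B) := [seq cvar i m | m <- iota 0 (ac_num B i)].
Fixpoint lev (A : color_dga chi) (C : A -> Prop) (L : nat -> seq (var A)) (i : nat) : A -> Prop :=
 if i is j.+1 then spanL (lev C L j) (L j) else C.
Notation Lev := (lev base cvars).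

(** The unit, or an element of positive internal degree: a property stable under products and true
    of all monomials, because every d i is positive. It makes the closure connected. *)
Definition posQ (b : B) : Prop :=
 exists t : T, [/\ hom t b, t.1.1 = 0 & (b = 1 /\ t = 0) \/ 0 < t.1.2].

Lemma posQM a b : posQ a -> posQ b -> posQ (a * b).
Proof.
move=> [t [ha t0 qa]] [u [hb u0 qb]]; exists (t + u); split; first exact: homM.
 by rewrite /= t0 u0.
case: qa qb => [[-> ->]|ta] [[-> ->]|ub]; rewrite ?mul1r ?mulr1 ?add0r ?addr0; [left|right|right|right] => //=.
exact: addr_gt0.
Qed.

Lemma monomial_hom (a : {ffun 'I_n -> nat}) : posQ (iota' (monomial y a)).
Proof.
have Q1 : posQ 1 by exists 0; split=> //; [exact: hom1 | left].
rewrite /monomial rmorph_prod; elim/big_ind: _ => //; first exact: posQM.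
move=> i _; rewrite rmorphXn; elim: (a i) => [//|l IH]; rewrite exprS; apply: posQM => //.
by exists (0, (d i)%:Z, g i); split=> //; [apply: ac_incl_hom | right; rewrite /= ltz_nat].
Qed.

Lemma prj_iotaZ t c (s : S) : prj t (iota' (c *: s)) = c *: prj t (iota' s).
Proof. by rewrite -prjZ; congr prj; exact: linearZ. Qed.

Lemma base_ind (P : B -> Prop) : P 0 -> (forall a b, P a -> P b -> P (a + b)) ->
 (forall c a, P (c *: iota' (monomial y a))) -> forall s, P (iota' s).
Proof.
move=> P0 PD Pm s; have [r [c ->]] := S_span s; rewrite rmorph_sum.
elim/big_ind: _ => // a _; have := Pm (c a) a; congr P; symmetry; exact: linearZ.
Qed.

Lemma base_galg : galg base.
Proof.
have hm a : exists t, hom t (iota' (monomial y a)).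
 by have [t [ht _ _]] := monomial_hom a; exists t.
split; [split | |].
- by exists 0; rewrite rmorph0.
- by move=> c _ _ [a ->] [b ->]; exists (c *: a + b); rewrite linearP.
- move=> t _ [s ->]; have [r [c ->]] := S_span s; rewrite rmorph_sum prj_sum.
 elim/big_ind: _ => [|_ _ [u ->] [v ->]|a _]; first by exists 0; rewrite rmorph0.
  by exists (u + v); rewrite rmorphD.
 rewrite prj_iotaZ; have [u hu] := hm a; rewrite (prj_hom _ hu); case: eqP => _.
  by exists (c a *: monomial y a); rewrite linearZ.
 by exists 0; rewrite rmorph0 scaler0.
- by exists 1; rewrite rmorph1.
- by move=> _ _ [a ->] [b ->]; exists (a * b); rewrite rmorphM.
Qed.

Lemma cvar_odd i m : (m < ac_num B i)%N -> odd `|(ac_deg B i m).1.1|%N = odd i.+1.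
Proof. by move=> mi; rewrite (ac_deg1 mi). Qed.

Lemma cvar_dps i m : (m < ac_num B i)%N -> dps (cvar i m).1 (cvar i m).2.
Proof.
move=> mi; have ov := cvar_odd mi.
have ok1 l : (l < 2)%N -> dpow_ok (odd i.+1) l by move=> l2; rewrite /dpow_ok l2 implybT.
have okE l : ~~ odd i.+1 -> dpow_ok (odd i.+1) l by rewrite /dpow_ok => /negbTE ->.
split; rewrite ?ov /= ?ov.
- by rewrite ok1 // (ac_var0 mi).
- by move=> l ol; rewrite ol; apply: (ac_var_hom mi).
- by move=> h l ei; rewrite !okE //; apply: (ac_varM h l mi).
- by move=> l ei; rewrite !okE //; apply: (ac_var_dif l mi).
- by move=> l /negbTE ->.
Qed.

Lemma cvars_allP i (P : var B -> Prop) : (forall m, (m < ac_num B i)%N -> P (cvar i m)) -> allP (cvars i) P.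
Proof.
move=> h; rewrite /cvars; have : forall m, m \in iota 0 (ac_num B i) -> P (cvar i m).
 by move=> m; rewrite mem_iota => /andP[_ /h].
elim: (iota _ _) => //= m s IH hs; split; first by apply: hs; rewrite mem_head.
by apply: IH => m' m's; apply: hs; rewrite in_cons m's orbT.
Qed.

Lemma cvars_dps i : dpsL (cvars i).
Proof. by apply: cvars_allP => m; apply: cvar_dps. Qed.

Lemma cvars_deg i : allP (cvars i) (fun v => v.1.1.1 = i.+1%:Z).
Proof. by apply: cvars_allP => m; apply: ac_deg1. Qed.

Lemma adjoin_firstE C i m : (m <= ac_num B i)%N ->
 adjoin_first (ac_var B) C i m = spanL C [seq cvar i j | j <- iota 0 m].
Proof.
elim: m => // m IH mi; rewrite -addn1 iotaD map_cat spanL_cat -IH; last exact: ltnW.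
rewrite /= add0n addn1 /= /adj1 /vodd /= (cvar_odd mi); apply/funext => b; apply/propext.
by split=> -[N [c [Cc ->]]]; exists N, c; split=> //; apply: eq_bigr => l ->.
Qed.

Lemma levelE i : level (ac_incl B) (ac_num B) (ac_var B) i = Lev i.
Proof. by elim: i => //= i ->; rewrite adjoin_firstE. Qed.

Lemma lev_galg i : galg (Lev i).
Proof. by elim: i => [|i IH] /=; [exact: base_galg | apply: spanL_galg => //; exact: cvars_dps]. Qed.

Lemma lev_free i : freeL (Lev i) (cvars i).
Proof.
suff h m : (m <= ac_num B i)%N -> freeL (Lev i) [seq cvar i j | j <- iota 0 m] by exact: h.
elim: m => // m IH mi; rewrite -addn1 iotaD map_cat freeL_cat; split; first exact/IH/ltnW.
rewrite /= add0n; split=> //; rewrite -adjoin_firstE -?levelE; last exact: ltnW.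
have := ac_var_free mi; rewrite /vodd /= (cvar_odd mi) => fr N c Cc s0; apply: fr => //.
by rewrite -[RHS]s0; apply: eq_bigr => l /= ->.
Qed.

Lemma cvar1 i m : (cvar i m).2 1 = ac_var B i m 1.
Proof. by rewrite /= /dpow_ok implybT. Qed.

Lemma lev_le i j b : (i <= j)%N -> Lev i b -> Lev j b.
Proof.
move=> /subnK <-; elim: (j - i)%N => // m IH /IH; apply: spanL_incl; first exact: galg_sub (lev_galg _).
exact: cvars_dps.
Qed.

Lemma lev_incl i s : Lev i (iota' s).
Proof. by apply: (@lev_le 0) => //; exists s. Qed.

Lemma cvars_bd i : allP (cvars i) (fun v => Lev i (dif (v.2 1))).
Proof.
apply: cvars_allP => m mi; rewrite cvar1 -levelE; have := ac_var_kill mi.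
by case: (i) => [|j] /=; [case=> a _ ->; exists a | case].
Qed.

Lemma nth_deg (A : color_dga chi) (L : seq (var A)) (e : int) i : allP L (fun v => v.1.1.1 = e) ->
 (i < size L)%N -> (nth 0 (map fst L) i).1.1 = e.
Proof. by elim: L i => //= v L IH [|i] [ve eL] //= iL; apply: IH. Qed.

(** In degree at most e > 0 an expansion is affine in the variables of degree e, since a product of
    two of them already has a larger degree and coefficients have degree at least 0. *)
Lemma spanL_low (A : color_dga chi) (C : A -> Prop) (L : seq (var A)) (e : int) t a : gsub C ->
 dpsL L -> 0 < e -> allP L (fun v => v.1.1.1 = e) -> hom t a -> t.1.1 <= e -> spanL C L a ->
 exists c w, [/\ forall i, C (c i), forall i, (i < size L)%N -> hom (t - nth 0 (map fst L) i) (c i),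
  C w, hom t w & a = lcB (ones L) c + w].
Proof.
move=> + + e0 + ha te; elim: L C a ha => [|v L IH] C a ha gC /=.
 by move=> _ _ Ca; exists (fun=> 0), a; split=> //; [move=> i; exact: (gsub0 gC) | rewrite add0r].
move=> [dv dL] [ve eL] hC; have gA := adjoin_gsub gC dv.
have [c [w [Cc hc Aw hw ->]]] := IH _ _ ha gA dL eL hC.
have low b s : adj1 C v b -> hom s b -> s.1.1 < e -> C b.
 move=> Ab hb se; have [N [q [[Cq q0] hq ->]]] := adjoin_hom_coefs gC dv Ab hb.
 apply: (gsub_sum gC) => -[[|l] lN] _ /=; first by rewrite (dps0 dv) mulr1.
 rewrite (hom_neg _ (hq l.+1)) ?mul0r; first exact: (gsub0 gC).
 have -> : (s - v.1 *+ l.+1).1.1 = s.1.1 - v.1.1.1 *+ l.+1 by rewrite -tdegMn1.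
 rewrite ve subr_lt0; apply: lt_le_trans se _; rewrite mulrS lerDl mulrn_wge0 //; exact: ltW.
pose c' i := if (i < size L)%N then c i else 0.
have Cc' i : C (c' i).
 rewrite /c'; case: ifP => iL; last exact: (gsub0 gC).
 apply: low (Cc i) (hc i iL) _; have -> : (t - nth 0 (map fst L) i).1.1 = t.1.1 - e.
  by rewrite -(nth_deg eL iL).
 by rewrite ltrBlDr; apply: le_lt_trans te _; rewrite ltrDr.
have [N [q [nq hq ew]]] := adjoin_hom_coefs gC dv Aw hw.
have [Cq q0] := nq.
exists (fun i => if i is j.+1 then c' j else q 1%N), (q 0%N); split=> //.
- by case=> [|i] //=.
- case=> [|i] /= iL; first by have := hq 1%N; rewrite mulr1n.
 by rewrite /c' -ltnS iL; apply: hc.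
- by have := hq 0%N; rewrite mulr0n subr0.
rewrite /= (@lcB_ext _ _ _ _ _ c' c) => [|i]; last by rewrite size_map /c' => ->.
have le2 : (N <= maxn N 2)%N by apply: leq_maxl.
rewrite ew -(sum_widen v.2 le2 nq) -(subnKC (leq_maxr N 2)) big_split_ord /= [X in _ + (_ + X)]big1.
 rewrite addr0 !big_ord_recr big_ord0 /= add0r (dps0 dv) mulr1.
 by rewrite [LHS]addrC [RHS]addrC addrA.
move=> l _; rewrite (hom_neg _ (hq (2 + l)%N)) ?mul0r //.
have -> : (t - v.1 *+ (2 + l)).1.1 = t.1.1 - v.1.1.1 *+ (2 + l) by rewrite -tdegMn1.
rewrite ve subr_lt0; apply: le_lt_trans te _; rewrite !mulrS ltrDl.
have : 0 <= e *+ l by rewrite mulrn_wge0 // ltW.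
by move: e0; move: (e *+ l) => f; lia.
Qed.

Lemma spanL_lt (A : color_dga chi) (C : A -> Prop) (L : seq (var A)) (e : int) t a : gsub C ->
 dpsL L -> 0 < e -> allP L (fun v => v.1.1.1 = e) -> hom t a -> t.1.1 < e -> spanL C L a -> C a.
Proof.
move=> gC dL e0 eL ha te hC.
have [c [w [Cc hc Cw hw ->]]] := spanL_low gC dL e0 eL ha (ltW te) hC.
rewrite (@lcB_ext _ _ _ _ _ c (fun=> 0)) ?lcB0 ?add0r // => i; rewrite size_map => iL.
by apply: hom_neg (hc i iL); rewrite /= (nth_deg eL iL) subr_lt0.
Qed.

Lemma lev_hom i j t b : t.1.1 = i%:Z -> hom t b -> Lev j b -> Lev i b.
Proof.
move=> ti hb; elim: j => [|j IH]; first exact: lev_le.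
case: (leqP j.+1 i) => ji; first exact: lev_le.
move=> h; apply: IH; apply: spanL_lt (galg_sub (lev_galg j)) (cvars_dps j) _ (cvars_deg j) hb _ h => //.
by rewrite ti ltz_nat.
Qed.

Lemma lev_all b : exists i, Lev i b.
Proof. by have [i] := ac_union b; rewrite levelE => h; exists i. Qed.

Lemma hom_lev i t b : t.1.1 = i%:Z -> hom t b -> Lev i b.
Proof. by move=> ti hb; have [j] := lev_all b; apply: lev_hom hb. Qed.

Lemma base_hom t s : hom t (iota' s : B) -> iota' s = 0 :> B \/ (t.1.1 = 0 /\ 0 <= t.1.2).
Proof.
have [r [c ->]] := S_span s; rewrite rmorph_sum => h; rewrite -[LHS](prj_id h) prj_sum.
elim: r {h} => [|a r IH]; first by left; rewrite big_nil.
rewrite big_cons; case: IH => [->|IH]; last by right.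
rewrite addr0 prj_iotaZ; have [u [hu u0 qu]] := monomial_hom a; rewrite (prj_hom _ hu).
case: eqP => [->|_]; last by left; rewrite scaler0.
by right; split=> //; case: qu => [[_ ->]|/ltW].
Qed.

Lemma base_hom0 (b : B) t : hom t b -> t.1.1 = 0 -> t.1.2 = 0 -> exists c : k, b = c *: (1 : B) /\ (c != 0 -> t = 0).
Proof.
move=> hb t1 t2; have [s es] : Lev 0 b by apply: hom_lev hb.
move: hb; rewrite es {b es}; have [r [c ->]] := S_span s; rewrite rmorph_sum => h; rewrite -(prj_id h) prj_sum.
elim: r {h} => [|a r IH]; first by exists 0; rewrite big_nil scale0r eqxx.
rewrite big_cons; have [e [-> e0]] := IH.
rewrite prj_iotaZ; have [u [hu u0 qu]] := monomial_hom a; rewrite (prj_hom _ hu).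
case: eqP => [tu|_]; last by exists e; rewrite scaler0 add0r.
case: qu => [[-> ut]|]; last by rewrite -tu t2 ltxx.
by exists (c a + e); rewrite scalerDl; split=> // _; rewrite tu.
Qed.

Lemma eps_ex (b : B) : exists c : k, prj 0 b = c *: 1.
Proof. by have [c [-> _]] := base_hom0 (hom_prj 0 b) erefl erefl; exists c. Qed.
(** The component of degree 0 is a scalar because all internal degrees of the indeterminates are
    positive; the augmentation reads it off. *)
Definition eps (b : B) : k := projT1 (cid (eps_ex b)).
Lemma epsE (b : B) : prj 0 b = eps b *: 1. Proof. by rewrite /eps; case: cid. Qed.

Lemma eps_uniq (b : B) c : prj 0 b = c *: 1 -> eps b = c.
Proof.
rewrite epsE => /eqP; rewrite -subr_eq0 -scalerBl scaler_eq0 oner_eq0 orbF subr_eq0.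
by move/eqP.
Qed.
Lemma epsL c a b : eps (c *: a + b) = c * eps a + eps b.
Proof. by apply: eps_uniq; rewrite prjP !epsE scalerA -scalerDl. Qed.
Lemma eps1 : eps 1 = 1.
Proof. by apply: eps_uniq; rewrite (prj_id (hom1 B)) scale1r. Qed.
Lemma eps0 : eps 0 = 0. Proof. by apply: eps_uniq; rewrite prj0 scale0r. Qed.
Lemma epsD a b : eps (a + b) = eps a + eps b.
Proof. by rewrite -[a]scale1r epsL mul1r scale1r. Qed.
Lemma epsN a : eps (- a) = - eps a.
Proof. by rewrite -[- a]addr0 -scaleN1r epsL eps0 addr0 mulN1r. Qed.
Lemma eps_hom t (b : B) : hom t b -> t <> 0 -> eps b = 0.
Proof.
by move=> hb t0; apply: eps_uniq; rewrite (prj_hom _ hb) scale0r; case: eqP => // e; case: t0.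
Qed.

Lemma epsM a b : eps (a * b) = eps a * eps b.
Proof.
elim/dga_ind: a => [|a1 a2 h1 h2|t a ha]; first by rewrite mul0r eps0 mul0r.
 by rewrite mulrDl !epsD h1 h2 mulrDl.
elim/dga_ind: b => [|b1 b2 h1 h2|u b hb]; first by rewrite mulr0 eps0 mulr0.
 by rewrite mulrDr !epsD h1 h2 mulrDr.
case: (eqVneq t 0) => [t0|tn].
 move: ha; rewrite t0 => ha; rewrite -(prj_id ha) epsE -scalerAl mul1r -[_ *: b]addr0.
 by rewrite epsL eps0 addr0 -[X in eps X * _]addr0 epsL eps1 eps0 addr0 mulr1.
rewrite (eps_hom ha) ?mul0r; last exact/eqP.
case: (eqVneq (t + u) 0) => [tu|tun]; last by apply: (eps_hom (homM ha hb)); apply/eqP.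
case: (pselect (a = 0)) => [->|a0]; first by rewrite mul0r eps0.
case: (pselect (b = 0)) => [->|b0]; first by rewrite mulr0 eps0.
(* Here t + u = 0. Homological degrees are nonnegative, and so are internal degrees on the base;
   hence t has homological and internal degree 0, the element a is a scalar, and t = 0. *)
have t1 : 0 <= t.1.1 by rewrite leNgt; apply/negP => /hom_neg/(_ ha).
have u1 : 0 <= u.1.1 by rewrite leNgt; apply/negP => /hom_neg/(_ hb).
have tu1 : t.1.1 + u.1.1 = 0 by rewrite -[LHS]/((t + u).1.1) tu.
have tu2 : t.1.2 + u.1.2 = 0 by rewrite -[LHS]/((t + u).1.2) tu.
have t10 : t.1.1 = 0 by apply/eqP; rewrite -[_ == _]andbT; move: tu1 t1 u1; lia.
have u10 : u.1.1 = 0 by rewrite t10 add0r in tu1.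
have [s es] : Lev 0 a by apply: hom_lev ha.
have [s' es'] : Lev 0 b by apply: hom_lev hb.
have [t2 u2] : 0 <= t.1.2 /\ 0 <= u.1.2.
 rewrite es in ha a0; rewrite es' in hb b0.
 by case: (base_hom ha) => [//|[_ ->]]; case: (base_hom hb) => [//|[_ ->]].
have t20 : t.1.2 = 0 by move: tu2 t2 u2; lia.
have [c [ec c0]] := base_hom0 ha t10 t20.
case: (eqVneq c 0) => [c00|/c0 t0]; first by case: a0; rewrite ec c00 scale0r.
by rewrite t0 eqxx in tn.
Qed.

Lemma eps_y i : eps (iota' (y i)) = 0.
Proof. by apply: (eps_hom (ac_incl_hom B i)) => -[di]; have := d0 i; rewrite di. Qed.

Lemma eps_ideal a : ideal_gen (fun b => exists j, b = y j) a -> eps (iota' a) = 0.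
Proof.
move=> [N [a1 [u [b1 [hu ->]]]]]; rewrite rmorph_sum; elim/big_ind: _ => [|a2 a3 h1 h2|l _]; first exact: eps0.
 by rewrite epsD h1 h2 addr0.
by have [j ->] := hu l; rewrite !rmorphM !epsM eps_y mulr0 mul0r.
Qed.

Lemma eps_ker_base s : eps (iota' s) = 0 -> ideal_gen (fun b => exists j, b = y j) s.
Proof.
have [r [c ->]] := S_span s.
have IG0 : ideal_gen (fun b => exists j, b = y j) 0.
 by exists 0%N, (fun=> 0), (fun=> 0), (fun=> 0); split; [case | rewrite big_ord0].
have IGD a b : ideal_gen (fun b => exists j, b = y j) a -> ideal_gen (fun b => exists j, b = y j) b ->
  ideal_gen (fun b => exists j, b = y j) (a + b).
 move=> [N [a1 [u [b1 [hu ->]]]]] [M [a2 [v [b2 [hv ->]]]]].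
 exists (N + M)%N, (fun i => match fintype.split i with inl l => a1 l | inr l => a2 l end),
  (fun i => match fintype.split i with inl l => u l | inr l => v l end),
  (fun i => match fintype.split i with inl l => b1 l | inr l => b2 l end); split.
  by move=> l; case: (fintype.split l).
 rewrite big_split_ord /=; congr (_ + _); apply: eq_bigr => l _.
  by rewrite (unsplitK (inl l)).
 by rewrite (unsplitK (inr l)).
have IGZ e a : ideal_gen (fun b => exists j, b = y j) a -> ideal_gen (fun b => exists j, b = y j) (e * a).
 move=> [N [a1 [u [b1 [hu ->]]]]]; exists N, (fun l => e * a1 l), u, b1; split=> //.
 by rewrite mulr_sumr; apply: eq_bigr => l _; rewrite !mulrA.
have dec s' : exists2 e : k, eps (iota' s') = e & ideal_gen (fun b => exists j, b = y j) (s' - e *: 1).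
 have [r' [c' ->]] := S_span s'; elim: r' => [|a r' [e e1 e2]].
  by exists 0; rewrite big_nil ?rmorph0 ?eps0 // scale0r subrr.
 have Ha : exists2 e : k, eps (iota' (monomial y a)) = e & ideal_gen (fun b => exists j, b = y j) (monomial y a - e *: 1).
  rewrite /monomial; elim: (index_enum _) => [|i l [f f1 f2]].
   by exists 1; rewrite big_nil ?rmorph1 ?eps1 // scale1r subrr.
  rewrite big_cons; case: (a i) => [|m]; first by exists f; rewrite expr0 mul1r.
  exists 0; first by rewrite exprS !rmorphM !epsM eps_y !mul0r.
  rewrite scale0r subr0; exists 1%N, (fun=> 1), (fun=> y i), (fun=> y i ^+ m * \prod_(j <- l) y j ^+ a j).
  by split; [move=> _; exists i | rewrite big_ord1 mul1r exprS mulrA].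
 have [f f1 f2] := Ha; exists (c' a * f + e).
  rewrite big_cons rmorphD epsD e1; congr (_ + _).
  have := epsL (c' a) (iota' (monomial y a)) 0; rewrite addr0 eps0 addr0 f1 => <-; congr eps; exact: linearZ.
 rewrite big_cons scalerDl opprD addrACA; apply: IGD => //.
 have := IGZ (c' a *: 1) _ f2; congr ideal_gen.
 by rewrite mulrBr -!scalerAl !mul1r scalerA.
by move=> h; have [e he] := dec (\sum_(a <- r) c a *: monomial y a); rewrite -he h scale0r subr0.
Qed.

Lemma tau_base (s : S) : tau (iota' s : B) = iota' s.
Proof.
apply: (base_ind (P := fun b => tau b = b)) => [|a b ha hb|c a]; first by rewrite /tau tw0.
 by rewrite /tau twD -[tw _ a]/(tau a) -[tw _ b]/(tau b) ha hb.
have [u [hu u0 _]] := monomial_hom a.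
by rewrite /tau twZ (tw_hom _ hu) /sg u0 expr0z scale1r.
Qed.

(** Such a cycle of degree m is among those that the variables of degree m + 1 have to kill, and
    [ac_var_min] for the set of all these variables says that they do. *)
Lemma acyclic_hom t (b : B) : hom t b -> dif b = 0 -> eps b = 0 -> exists b' : B, dif b' = b.
Proof.
move=> hb db eb; case: (ltP t.1.1 0) => [/hom_neg/(_ hb)->|]; first by exists 0; rewrite dif0.
case tm: t.1.1 => [m|//] _; have hk : to_kill y (ac_incl B) (ac_num B) (ac_var B) m b.
 case: m tm => [|m] tm /=.
  by have [s es] : Lev 0 b by [apply: hom_lev hb]; exists s => //; apply: eps_ker_base; rewrite -es.
 split=> //; first by have := levelE m.+1; rewrite /= => ->; apply: (hom_lev (i := m.+1)) hb.
 by exists 1%N, (fun=> t), (fun=> b); rewrite big_ord1.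
have [c [w [_ _ ->]]] := (ac_var_min [set: 'I_(ac_num B m)]).2 erefl b hk.
exists (\sum_(i in [set: 'I_(ac_num B m)]) iota' (c i) * ac_var B m i 1 + w).
rewrite difD dif_sum; congr (_ + _); apply: eq_bigr => i _.
rewrite difM ac_incl_dif mul0r add0r; congr (_ * _).
exact: tau_base.
Qed.

Lemma dif_base (s : S) (b : B) : dif (iota' s * b) = iota' s * dif b.
Proof. by rewrite difM ac_incl_dif mul0r add0r tau_base. Qed.

Lemma closure_acyclic (b : B) : dif b = 0 -> eps b = 0 -> exists b' : B, dif b' = b.
Proof.
move=> db eb; have /choice[f hf] : forall t, exists b', dif b' = prj t b.
 move=> t; apply: (acyclic_hom (hom_prj t b)).
  rewrite -(addrK (-1, 0, 0) t) in db *; have := prj_dif (t + (-1, 0, 0)) b.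
  by rewrite db prj0 -addrA tdown_up addr0 addrK => <-.
 case: (eqVneq t 0) => [->|/eqP t0]; last exact: eps_hom (hom_prj t b) t0.
 by rewrite epsE eb scale0r eps0.
exists (\sum_(t <- dsupp b) f t); rewrite dif_sum -[RHS]sum_prj_dsupp.
by apply: eq_bigr => t _.
Qed.

Lemma hom_degP i (b : B) : hom_deg i b <-> forall t, t.1.1 <> i%:Z -> prj t b = 0.
Proof.
split=> [[N [t [c [hc ->]]]] u ui|h].
 rewrite prj_sum big1 // => l _; have [tl hl] := hc l; rewrite (prj_hom _ hl).
 by case: eqP => // e; case: ui; rewrite e.
pose r := [seq t <- dsupp b | t.1.1 == i%:Z].
have hr l : (l < size r)%N -> (nth 0 r l).1.1 = i%:Z.
 by move=> lr; have := mem_nth 0 lr; rewrite mem_filter => /andP[/eqP].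
exists (size r), (fun l => nth 0 r l), (fun l => prj (nth 0 r l) b); split.
 by move=> l; split; [apply: hr | apply: hom_prj].
rewrite -(big_mkord xpredT (fun l => prj (nth 0 r l) b)) -(big_nth 0 xpredT (fun t => prj t b)).
rewrite /r big_filter [RHS]big_mkcond -[LHS]sum_prj_dsupp; apply: eq_bigr => t _.
by case: eqP => // ti; apply: h.
Qed.

Lemma hom_deg_base i s (b : B) : hom_deg i b -> hom_deg i (iota' s * b).
Proof.
move=> /hom_degP hb; apply/hom_degP => t ti.
apply: (base_ind (P := fun a => prj t (a * b) = 0)) => [|a1 a2 h1 h2|c a]; first by rewrite mul0r prj0.
 by rewrite mulrDl prjD h1 h2 addr0.
have [u [hu u0 _]] := monomial_hom a.
by rewrite -scalerAl prjZ (prj_mull _ _ hu) hb ?mulr0 ?scaler0 //= u0 subr0.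
Qed.

Lemma lcB_iota (f : nat -> B) a m c :
 lcB [seq f j | j <- iota a m] c = \sum_(i < m) c i * f (a + i)%N.
Proof.
elim: m a c => [|m IH] a c /=; first by rewrite big_ord0.
by rewrite big_ord_recl addn0 IH; congr (_ + _); apply: eq_bigr => i _; rewrite addSnnS.
Qed.

Lemma lcB_cvars m c : lcB (ones (cvars m)) c = \sum_(i < ac_num B m) c i * ac_var B m i 1.
Proof.
rewrite /ones /cvars -map_comp lcB_iota; apply: eq_bigr => i _; congr (_ * _).
exact: cvar1.
Qed.

(** If some c i had nonzero augmentation, the relation could be solved for the boundary of the i-th
    variable; the other variables would then suffice, against minimality. *)
Lemma lev_min m (c : nat -> B) w : (forall i, base (c i)) -> Lev m w ->
 dif (lcB (ones (cvars m)) c + w) = 0 -> forall i, (i < ac_num B m)%N -> eps (c i) = 0.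
Proof.
move=> Cc Lw; have /choice[s hs] := Cc; rewrite lcB_cvars difD dif_sum.
under eq_bigr do rewrite hs dif_base.
move=> rel i im; apply: contrapT => ei; pose i0 := Ordinal im.
have vh (j : 'I_(ac_num B m)) : hom (ac_deg B m j + (-1, 0, 0)) (dif (ac_var B m j 1)).
 by apply: hom_dif; have := dps_hom1 (cvar_dps (ltn_ord j)); rewrite cvar1.
pose t0 := ac_deg B m i0 + (-1, 0, 0).
(* The relation is projected to the degree of the boundary of the i-th variable, where the
   coefficient of that boundary is the scalar [eps (c i)]. *)
have [p [w0 [Bp Lw0 hw0 rel0]]] : exists (p : 'I_(ac_num B m) -> S) w0,
  [/\ True, Lev m w0, hom (ac_deg B m i0) w0 &
  dif (ac_var B m i0 1) = \sum_(j | j != i0) iota' (p j) * dif (ac_var B m j 1) + dif w0].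
 have /choice[p hp] : forall j : 'I_(ac_num B m), exists q,
   prj (t0 - (ac_deg B m j + (-1, 0, 0))) (iota' (s j) : B) = iota' q.
  by move=> j; apply: (gsubP (galg_sub base_galg)); exists (s j).
 exists (fun j => (- (eps (c i))^-1) *: p j), ((- (eps (c i))^-1) *: prj (ac_deg B m i0) w); split=> //.
 - by apply: (gsubZ (galg_sub (lev_galg m))); apply: (gsubP (galg_sub (lev_galg m))).
 - by apply: homZ; apply: hom_prj.
 have := congr1 (prj t0) rel; rewrite prj0 prjD prj_sum prj_dif (bigD1 i0) //=.
 rewrite (prj_mulr _ _ (vh i0)) subrr -[iota' (s i)]hs epsE -scalerAl mul1r.
 have -> : t0 + (1, 0, 0) = ac_deg B m i0 by rewrite /t0 -addrA tdown_up addr0.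
 move=> /eqP; rewrite -addrA addr_eq0 => /eqP/(congr1 (fun z => (eps (c i))^-1 *: z)).
 rewrite scalerA mulVf; last exact/eqP.
 rewrite scale1r => ->; rewrite -scaleN1r scalerA mulrN1 scalerDr difZ; congr (_ + _).
 rewrite scaler_sumr; apply: eq_bigr => j _; rewrite (prj_mulr _ _ (vh j)) hp scalerAl.
 by congr (_ * _); symmetry; exact: linearZ.
have kP : kills y (ac_incl B) (ac_var B) ([set: 'I_(ac_num B m)] :\ i0).
 move=> z /((ac_var_min [set: 'I_(ac_num B m)]).2 erefl)[c' [w' [Lw' dw' ->]]].
 exists (fun j => c' j + c' i0 * p j), (w' + iota' (c' i0) * w0); split.
 - rewrite levelE in Lw' *; have [g1 _ gM] := lev_galg m; apply: (gsubD g1) => //; apply: gM => //.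
  exact: lev_incl.
 - have hw : hom_deg m.+1 w0.
   by exists 1%N, (fun=> ac_deg B m i0), (fun=> w0); rewrite big_ord1; split=> // _; rewrite (ac_deg1 im).
  have hd := hom_deg_base (c' i0) hw.
  by apply/hom_degP => t ti; rewrite prjD (proj1 (hom_degP _ _) dw') // (proj1 (hom_degP _ _) hd) ?addr0.
 have e1 : \sum_(j in [set: 'I_(ac_num B m)] :\ i0) iota' (c' j + c' i0 * p j) * dif (ac_var B m j 1) =
  \sum_(j | j != i0) iota' (c' j) * dif (ac_var B m j 1) +
  \sum_(j | j != i0) iota' (c' i0) * (iota' (p j) * dif (ac_var B m j 1)) :> B.
  rewrite -big_split; apply: eq_big => [j|j _]; first by rewrite in_setD1 in_setT andbT.
  by rewrite rmorphD rmorphM mulrDl mulrA.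
 rewrite difD dif_base e1 (bigD1 i0) ?in_setT //= rel0 mulrDr mulr_sumr.
 rewrite [X in _ + X + dif w'](eq_bigl (fun j => j != i0)) => [|j]; last by rewrite in_setT.
 by rewrite [LHS](AC (2*1*1) ((3*1)*(4*2))).
have := (ac_var_min ([set: 'I_(ac_num B m)] :\ i0)).1 kP => /setP/(_ i0); by rewrite !inE eqxx.
Qed.

End Closure.

End AcyclicClosures.
Import AcyclicClosures.

(** * Extending derivations variable by variable with a prescribed boundary *)

Module DerivationLifting.

Lemma comm_mid (k : fieldType) (R : algType k) (X F Y Z : R) (c p s : k) : F * Y = s *: (Y * F) ->
 c * s = p -> X * (c *: F) * (Y * Z) = p *: (X * Y * (F * Z)).
Proof.
move=> FY <-; rewrite -scalerAr -scalerAl -scalerA; congr (_ *: _).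
by rewrite -[LHS]mulrA (mulrA F) FY -scalerAl -scalerAr !mulrA.
Qed.

Section FDer.
Variables (k : fieldType) (G : zmodType) (chi : alt_bicharacter G k).
Notation T := (tridegree G).
Variables (A B : color_dga chi) (f : A -> B) (hf : is_dmap f).
Implicit Types (C : A -> Prop) (u t s : T) (h : A -> B) (v : var A).

Definition ctw (D : color_dga chi) u : D -> D := tw (csign chi u).

(** A color derivation along f, defined on [C] only, so that it can be extended one variable at a
    time. The twist [ctw] carries the sign for inhomogeneous a. *)
Record fder C u h : Prop := {
 fd_lin : forall c a b, C a -> C b -> h (c *: a + b) = c *: h a + h b;
 fd_hom : forall t a, C a -> hom t a -> hom (t + u) (h a);
 fd_mul : forall a b, C a -> C b -> h (a * b) = h a * f b + f (ctw u a) * h b }.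

Definition fdpow h v : Prop := forall l, dpow_ok (vodd v) l.+1 -> h (v.2 l.+1) = h (v.2 1) * f (v.2 l).

Lemma fd0 C u h : gsub C -> fder C u h -> h 0 = 0.
Proof.
move=> gC hh; have C0 := gsub0 gC; have := fd_lin hh 1 C0 C0; rewrite !scale1r addr0.
by move/eqP; rewrite -subr_eq0 opprD addNKr oppr_eq0 => /eqP.
Qed.

Lemma fder_mono C C' u h : (forall a, C a -> C' a) -> fder C' u h -> fder C u h.
Proof.
by move=> CC hh; split; [move=> c a b /CC ? /CC; apply: (fd_lin hh) | move=> t a /CC; apply: (fd_hom hh)
| move=> a b /CC ? /CC; apply: (fd_mul hh)].
Qed.

Lemma fdZ C u h c a : gsub C -> fder C u h -> C a -> h (c *: a) = c *: h a.
Proof. by move=> gC hh Ca; rewrite -[c *: a]addr0 (fd_lin hh) ?(fd0 gC hh) ?addr0 //; apply: gsub0. Qed.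

Lemma fdD C u h a b : fder C u h -> C a -> C b -> h (a + b) = h a + h b.
Proof. by move=> hh Ca Cb; have := fd_lin hh 1 Ca Cb; rewrite !scale1r. Qed.

Lemma ctw_hom (D : color_dga chi) u t (a : D) : hom t a -> ctw u a = csign chi u t *: a.
Proof. exact: tw_hom. Qed.

Lemma ctwM (D : color_dga chi) u (a b : D) : ctw u (a * b) = ctw u a * ctw u b.
Proof. by apply: tw_mul => t s; rewrite csignDr. Qed.

Lemma adj1_hom_ind C v (P : A -> Prop) : gsub C -> P 0 -> (forall a b, P a -> P b -> P (a + b)) ->
 (forall c l s, dpow_ok (vodd v) l -> C c -> hom s c -> P (c * v.2 l)) -> forall a, adj1 C v a -> P a.
Proof.
move=> gC P0 PD Pm a; elim/adj1_ind => // c l ol Cc; rewrite -(sum_prj_dsupp c) mulr_suml.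
by elim/big_ind: _ => // s _; apply: Pm (hom_prj s c) => //; apply: gsubP.
Qed.

Section Ext.
Variables (C : A -> Prop) (gC : galg C) (u : T) (h0 : A -> B) (v : var A) (b : B).
Hypotheses (hh0 : fder C u h0) (dv : dps v.1 v.2) (fv : dpow_free (vodd v) C v.2).
Hypothesis hb : hom (v.1 + u) b.
Let g := galg_sub gC.
Notation t := v.1.
Let gA : gsub (adj1 C v) := adjoin_gsub g dv.

(** The value at x^(l) that the value b at x forces: b f(x^(l-1)). *)
Definition ebf (l : nat) : B := if l is m.+1 then b * f (v.2 m) else 0.
Definition Hm (c : A) (l : nat) : B := h0 c * f (v.2 l) + f (ctw u c) * ebf l.

Lemma Hm_lin e c d l : C c -> C d -> Hm (e *: c + d) l = e *: Hm c l + Hm d l.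
Proof.
move=> Cc Cd; rewrite /Hm (fd_lin hh0) // /ctw twP (dmapL hf) !mulrDl -!scalerAl scalerDr.
by rewrite addrACA.
Qed.
Lemma Hm0 l : Hm 0 l = 0.
Proof. by rewrite /Hm (fd0 g hh0) /ctw tw0 (dmap0 hf) !mul0r addr0. Qed.

Lemma ext_ex a : exists z : B, adj1 C v a ->
 exists N c, [/\ nice_coefs (vodd v) C N c, a = \sum_(l < N) c l * v.2 l & z = \sum_(l < N) Hm (c l) l].
Proof.
case: (pselect (adj1 C v a)) => [ha|]; last by exists 0.
have /adjoinP-/(_ (gsub0 g))[N [c [nc ->]]] := ha.
by exists (\sum_(l < N) Hm (c l) l) => _; exists N, c.
Qed.
(** Computed on a chosen expansion; freeness makes the result independent of it ([exthE]). *)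
Definition exth a : B := projT1 (cid (ext_ex a)).

Lemma sum_Hm_widen N N' c : (N <= N')%N -> nice_coefs (vodd v) C N c ->
 \sum_(l < N') Hm (c l) l = \sum_(l < N) Hm (c l) l.
Proof.
move=> NN [Cc c0]; rewrite -(subnKC NN) big_split_ord /= [X in _ + X]big1 ?addr0 //.
by move=> l _; rewrite c0 ?Hm0 // leq_addr.
Qed.

Lemma exthE N c : nice_coefs (vodd v) C N c ->
 exth (\sum_(l < N) c l * v.2 l) = \sum_(l < N) Hm (c l) l.
Proof.
move=> nc; rewrite /exth; case: cid => z /= [].
 by apply/adjoinP; [exact: (gsub0 g) | exists N, c].
move=> M [d [nd e ->]]; have cd := free_uniq g fv nc nd e.
have l1 : (N <= maxn N M)%N by apply: leq_maxl.
have l2 : (M <= maxn N M)%N by apply: leq_maxr.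
rewrite -(sum_Hm_widen l1 nc) -(sum_Hm_widen l2 nd).
by apply: eq_bigr => l _; rewrite cd.
Qed.

Lemma exth_mono c l : dpow_ok (vodd v) l -> C c -> exth (c * v.2 l) = Hm c l.
Proof.
move=> ol Cc; pose e m := if m == l then c else 0.
have ne : nice_coefs (vodd v) C l.+1 e.
 split=> m; rewrite /e; first by case: eqP => // _; exact: (gsub0 g).
 by case: eqP => // ->; rewrite ltnn ol.
have := exthE ne; rewrite !big_ord_recr /= /e eqxx !big1 ?add0r //.
 by move=> m _; rewrite ltn_eqF ?Hm0.
by move=> m _; rewrite ltn_eqF ?mul0r.
Qed.

Lemma exth_lin e a a' : adj1 C v a -> adj1 C v a' -> exth (e *: a + a') = e *: exth a + exth a'.
Proof.
move=> /adjoinP-/(_ (gsub0 g))[N [c [nc ->]]] /adjoinP-/(_ (gsub0 g))[M [c' [nc' ->]]].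
have l1 : (N <= maxn N M)%N by apply: leq_maxl.
have l2 : (M <= maxn N M)%N by apply: leq_maxr.
have [[Cc c0] [Cd d0]] := (nice_widen l1 nc, nice_widen l2 nc').
have ns : nice_coefs (vodd v) C (maxn N M) (fun l => e *: c l + c' l).
 by split=> [l|l hl]; [apply: (gsubL g) | rewrite c0 // d0 // scaler0 addr0].
have -> : e *: (\sum_(l < N) c l * v.2 l) + \sum_(l < M) c' l * v.2 l =
  \sum_(l < maxn N M) (e *: c l + c' l) * v.2 l.
 rewrite -(sum_widen v.2 l1 nc) -(sum_widen v.2 l2 nc') scaler_sumr -big_split /=.
 by apply: eq_bigr => l _; rewrite mulrDl scalerAl.
rewrite (exthE ns) (exthE nc) (exthE nc') -(sum_Hm_widen l1 nc) -(sum_Hm_widen l2 nc').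
rewrite scaler_sumr -big_split /=; apply: eq_bigr => l _; exact: Hm_lin.
Qed.

Lemma ebf_hom l : dpow_ok (vodd v) l -> hom (t *+ l + u) (ebf l).
Proof.
case: l => [|l] ol; first exact: hom0.
have -> : t *+ l.+1 + u = (t + u) + t *+ l by rewrite mulrS addrAC.
apply: homM => //; apply: (dmap_hom hf); apply: (dps_hom dv).
by move: ol; rewrite /dpow_ok /vodd => /implyP h; apply/implyP => /h /ltnW.
Qed.

Lemma exth_hom s a : adj1 C v a -> hom s a -> hom (s + u) (exth a).
Proof.
move=> ha hs; have [N [c [nc hc ->]]] := adjoin_hom_coefs g dv ha hs.
rewrite (exthE nc); apply: hom_sum => l _; have [Cc c0] := nc.
case: (boolP (dpow_ok (vodd v) l)) => ol; last first.
 by rewrite c0 ?Hm0 ?ol ?orbT //; apply: hom0.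
apply: homD.
 have -> : s + u = (s - t *+ l + u) + t *+ l by rewrite addrAC subrK.
 by apply: homM; [apply: (fd_hom hh0) | apply: (dmap_hom hf); apply: (dps_hom dv)].
have -> : s + u = (s - t *+ l) + (t *+ l + u) by rewrite addrA subrK.
by apply: homM; [apply: (dmap_hom hf); apply: hom_tw | apply: ebf_hom].
Qed.

(** The Leibniz rule for x^(l) x^(m): Pascal's rule if x is even; if x is odd, the two terms for x x
    cancel by sign. *)
Lemma pascal l m : dpow_ok (vodd v) l -> dpow_ok (vodd v) m ->
 ebf l * f (v.2 m) + csign chi (t *+ l) t *: (if m is m'.+1 then b * f (v.2 l * v.2 m') else 0) =
 if dpow_ok (vodd v) (l + m) then ebf (l + m) *+ 'C(l + m, l) else 0.
Proof.
move=> ol om; have cE : csign chi (t *+ l) t = (-1) ^+ (vodd v && odd l).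
 rewrite -{2}[t]mulr1n csignMn muln1 csign_self -/(vodd v) -exprM; case: (vodd v) => /=.
  by rewrite mul1n signr_odd.
 by rewrite mul0n expr0.
case ov: (vodd v) ol om cE => ol om cE.
 case: l m ol om cE => [|[|l]] [|[|m]] //= _ _ cE; rewrite /ebf /= ?mul0r ?add0r ?addr0 ?scaler0 //.
 - by rewrite cE (dps0 dv) mul1r scale1r bin0 mulr1n.
 - by rewrite (dps0 dv) (dmap1 hf) !mulr1 addr0 mulr1n.
 - by rewrite cE (dps0 dv) mulr1 (dmap1 hf) mulr1 expr1 scaleN1r subrr.
rewrite cE /= expr0 scale1r /dpow_ok /=.
have eo : ~~ odd `|t.1.1|%N by rewrite -/(vodd v) ov.
case: l m {ol om cE} => [|l] [|m] /=.
- by rewrite mul0r addr0 mul0rn.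
- by rewrite mul0r add0r (dps0 dv) mul1r bin0 mulr1n.
- by rewrite !addn0 (dps0 dv) (dmap1 hf) mulr1 addr0 binn mulr1n.
have fMn x n : f (x *+ n) = f x *+ n by rewrite -scaler_nat (dmapZ hf) scaler_nat.
rewrite -mulrA -(dmapM hf) !(dpsM dv) // !fMn !mulrnAr addSnnS -mulrnDr addnC.
by congr (_ *+ _); rewrite (_ : (l.+1 + m.+1 = (m.+1 + l).+1)%N); [rewrite binS addnC | lia].
Qed.

Lemma exth_mul a a' : adj1 C v a -> adj1 C v a' -> exth (a * a') = exth a * f a' + f (ctw u a) * exth a'.
Proof.
have gAA := adjoin_galg gC dv.
have AM (a1 a2 : A) : adj1 C v a1 -> adj1 C v a2 -> adj1 C v (a1 * a2) by apply: (galgM gAA).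
have e0 : exth 0 = 0.
 by have := exth_lin (-1) (gsub0 gA) (gsub0 gA); rewrite scaler0 addr0 scaleN1r addNr.
have eD x y : adj1 C v x -> adj1 C v y -> exth (x + y) = exth x + exth y.
 by move=> hx hy; have := exth_lin 1 hx hy; rewrite !scale1r.
have eZ c x : adj1 C v x -> exth (c *: x) = c *: exth x.
 by move=> hx; have := exth_lin c hx (gsub0 gA); rewrite e0 !addr0.
move=> ha ha'; suff [] : adj1 C v a /\ exth (a * a') = exth a * f a' + f (ctw u a) * exth a' by [].
apply: (adj1_hom_ind (C := C) (v := v) (P := fun a => adj1 C v a /\ exth (a * a') = exth a * f a' + f (ctw u a) * exth a') g _ _ _ ha) => {a ha} [|a1 a2 [A1 h1] [A2 h2]|c l s ol Cc hc].
- split; first exact: (gsub0 gA).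
 by rewrite mul0r e0 /ctw tw0 (dmap0 hf) !mul0r addr0.
- split; first exact: (gsubD gA).
 rewrite mulrDl (eD _ _ (AM _ _ A1 ha') (AM _ _ A2 ha')).
 by rewrite h1 h2 eD // /ctw twD (dmapD hf) !mulrDl addrACA.
have Acl : adj1 C v (c * v.2 l) by apply: adjoin_mem (gsub0 g) ol Cc.
split=> //.
suff [] : adj1 C v a' /\ exth (c * v.2 l * a') = exth (c * v.2 l) * f a' + f (ctw u (c * v.2 l)) * exth a' by [].
apply: (adj1_hom_ind (C := C) (v := v) (P := fun a' => adj1 C v a' /\ exth (c * v.2 l * a') = exth (c * v.2 l) * f a' + f (ctw u (c * v.2 l)) * exth a') g _ _ _ ha') => {a' ha'} [|a1 a2 [A1 h1] [A2 h2]|d m r om Cd hd].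
- split; first exact: (gsub0 gA).
 by rewrite mulr0 e0 (dmap0 hf) !mulr0 addr0.
- split; first exact: (gsubD gA).
 rewrite mulrDr (eD _ _ (AM _ _ Acl A1) (AM _ _ Acl A2)).
 by rewrite h1 h2 eD // (dmapD hf) !mulrDr addrACA.
split; first by apply: adjoin_mem (gsub0 g) om Cd.
have fMn x n : f (x *+ n) = f x *+ n by rewrite -scaler_nat (dmapZ hf) scaler_nat.
have hvl := dps_hom dv ol; have hvm := dps_hom dv om.
set p := csign chi (t *+ l) r; set q := csign chi u r.
have vd : v.2 l * d = p *: (d * v.2 l) by rewrite (commM hvl hd).
have eL : exth (c * v.2 l * (d * v.2 m)) =
  p *: (h0 c * f d * (f (v.2 l) * f (v.2 m)) + f (ctw u c) * h0 d * (f (v.2 l) * f (v.2 m)) +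
  q *: (f (ctw u c) * f d * (if dpow_ok (vodd v) (l + m) then ebf (l + m) *+ 'C(l + m, l) else 0))).
 have -> : c * v.2 l * (d * v.2 m) = p *: (c * d * (v.2 l * v.2 m)).
  by rewrite -mulrA [v.2 l * _]mulrA vd -!scalerAl -scalerAr !mulrA.
 have Ccd : C (c * d) by apply: (galgM gC).
 rewrite -(dmapM hf) (dps_mul dv ol om) eZ; last first.
  case: ifP => olm; last by rewrite mulr0; exact: (gsub0 gA).
  by rewrite mulrnAr; apply: (gsubMn gA); apply: adjoin_mem (gsub0 g) olm Ccd.
 congr (_ *: _); case: ifP => olm; last first.
  by rewrite mulr0 e0 (dmap0 hf) !mulr0 scaler0 !addr0.
 have eMn x n : adj1 C v x -> exth (x *+ n) = exth x *+ n by move=> hx; rewrite -scaler_nat eZ // scaler_nat.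
 rewrite mulrnAr eMn; last exact: adjoin_mem (gsub0 g) olm Ccd.
 rewrite exth_mono // /Hm (fd_mul hh0) // ctwM (dmapM hf) (ctw_hom u hd) (dmapZ hf) -/q.
 rewrite mulrDl mulrnDl fMn; congr (_ + _); first by rewrite mulrnDl !mulrnAr.
 by rewrite -scalerAr -scalerAl scalerMnr mulrnAr.
rewrite eL !exth_mono // /Hm !(dmapM hf) ctwM (ctw_hom u hvl) (dmapM hf) (dmapZ hf) (ctw_hom u hd) (dmapZ hf) -/q.
(* [T1] and [T3] differentiate the coefficients, [T2] and [T4] the divided powers; [pascal] splits
   the latter contribution in two. *)
rewrite -(pascal ol om) !scalerDr mulrDl !mulrDr.
have fvd : f (v.2 l) * f d = p *: (f d * f (v.2 l)) by rewrite -!(dmapM hf) vd (dmapZ hf).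
have T1 : h0 c * f (v.2 l) * (f d * f (v.2 m)) = p *: (h0 c * f d * (f (v.2 l) * f (v.2 m))).
 by rewrite -mulrA (mulrA (f (v.2 l))) fvd -!scalerAl -scalerAr !mulrA.
have hfvl := dmap_hom hf hvl.
have T3 : f (ctw u c) * (csign chi u (t *+ l) *: f (v.2 l)) * (h0 d * f (v.2 m)) =
  p *: (f (ctw u c) * h0 d * (f (v.2 l) * f (v.2 m))).
 apply: (comm_mid _ _ (commM hfvl (fd_hom hh0 Cd hd))).
 by rewrite csignDr mulrCA csign_swap mulr1.
have T2 : f (ctw u c) * ebf l * (f d * f (v.2 m)) = p *: (q *: (f (ctw u c) * f d * (ebf l * f (v.2 m)))).
 have := comm_mid (c := 1) (f (ctw u c)) (f (v.2 m)) (commM (ebf_hom ol) (dmap_hom hf hd)) erefl.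
 by rewrite scale1r mul1r csignDl scalerA.
have T4 : f (ctw u c) * (csign chi u (t *+ l) *: f (v.2 l)) * (q *: f d * ebf m) =
 p *: (q *: (f (ctw u c) * f d * (csign chi (t *+ l) t *: (if m is m'.+1 then b * f (v.2 l * v.2 m') else 0)))).
 case: (m) => [|m']; first by rewrite /= !mulr0 !scaler0 mulr0 !scaler0.
 rewrite /= (dmapM hf) -[q *: f d * _]scalerAl -scalerAr (comm_mid _ _ fvd erefl) (mulrA (f (v.2 l))).
 rewrite (commM hfvl hb) csignDr; have := csign_swap chi u (t *+ l).
 move: {T1 T3 T2 eL} (csign chi u (t *+ l)) (csign chi (t *+ l) u) (csign chi (t *+ l) t) => x1 x2 x3 x12.
 clearbody p q; rewrite -!scalerAl -!scalerAr !scalerA !mulrA; congr (_ *: _).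
 by transitivity (q * p * x3 * (x1 * x2)); [ring | rewrite x12; ring].
rewrite T1 T2 T3 T4 -!scalerDr; congr (_ *: _).
by rewrite scalerDr [LHS](AC (2*2) ((1*3)*(2*4))).
Qed.

Lemma exth_fder : fder (adj1 C v) u exth.
Proof. split; [exact: exth_lin | exact: exth_hom | exact: exth_mul]. Qed.

Lemma fder_ext : exists h, [/\ fder (adj1 C v) u h, forall a, C a -> h a = h0 a, h (v.2 1) = b & fdpow h v].
Proof.
exists exth; have C1 := galg1 gC.
have ok0 : dpow_ok (vodd v) 0 by rewrite /dpow_ok implybT.
have ok1 : dpow_ok (vodd v) 1 by rewrite /dpow_ok implybT.
have h01 : h0 1 = 0.
 have := fd_mul hh0 C1 C1; rewrite mulr1 (dmap1 hf) mulr1 /ctw tw1 ?csign0r // (dmap1 hf) mul1r.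
 by move/eqP; rewrite -subr_eq0 opprD addNKr oppr_eq0 => /eqP.
have Hm1 l : Hm 1 l = ebf l by rewrite /Hm h01 mul0r add0r /ctw tw1 ?csign0r // (dmap1 hf) mul1r.
have e l : dpow_ok (vodd v) l -> exth (v.2 l) = ebf l.
 by move=> ol; rewrite -[v.2 l]mul1r exth_mono // Hm1.
have e1 : exth (v.2 1) = b by rewrite e //= (dps0 dv) (dmap1 hf) mulr1.
split=> //; first exact: exth_fder.
 move=> a Ca; rewrite -[a]mulr1 -(dps0 dv) exth_mono // /Hm /= mulr0 addr0 (dps0 dv) (dmap1 hf).
 by rewrite !mulr1.
by move=> l ol; rewrite e // e1.
Qed.

End Ext.

Section Solve.
Variables (u : T) (D : A -> B).

(** D is the boundary of h among the derivations along f: for D = 0, h commutes with the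
    differentials up to sign; for D a difference of two derivations, h is a homotopy. *)
Definition solves C h : Prop := forall a, C a -> dif (h a) = D a + sg k u *: h (dif a).

Lemma sg_csign t : csign chi u (t + (-1, 0, 0)) = csign chi u t * sg k u.
Proof. by rewrite csignDr csign_downr. Qed.

Hypothesis (hD : fder (fun _ => True) (u + (-1, 0, 0)) D).

(** Both sides of the equation obey the same Leibniz rule, so it spreads from C and x to divided
    powers and products. *)
Lemma solves_adj1 C v h : galg C -> dps v.1 v.2 -> fder (adj1 C v) u h -> fdpow h v -> fdpow D v ->
 (forall a, C a -> C (dif a)) -> C (dif (v.2 1)) -> solves C h ->
 dif (h (v.2 1)) = D (v.2 1) + sg k u *: h (dif (v.2 1)) -> solves (adj1 C v) h.
Proof.
move=> gC dv hh ph pD dC zC sC s1; have g := galg_sub gC; have gAA := adjoin_galg gC dv.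
have gA := galg_sub gAA; have AM := galgM gAA.
have dA a : adj1 C v a -> adj1 C v (dif a).
 by apply: (adjoin_dif g dv) => // c Cc; apply: (galgM gC).
have CA a : C a -> adj1 C v a by apply: (adjoin_incl g dv).
pose K a := adj1 C v a /\ dif (h a) = D a + sg k u *: h (dif a).
have KM t a b : K a -> hom t a -> K b -> K (a * b).
 move=> [Aa Ka] ha [Ab Kb]; split; first exact: AM.
 have hab := fd_hom hh Aa ha; have fha := dmap_hom hf ha.
 rewrite (fd_mul hh Aa Ab) (fd_mul hD I I) !(ctw_hom _ ha) !(dmapZ hf) difD -!scalerAl difZ.
 rewrite (dif_homM _ hab) (dif_homM _ fha) -!(dmap_dif hf) Ka Kb (dif_homM _ ha).
 rewrite [h (_ + _)](fdD hh); [|exact: AM (dA _ Aa) Ab|apply: (gsubZ gA); exact: AM Aa (dA _ Ab)].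
 rewrite (fdZ _ gA hh); last exact: AM Aa (dA _ Ab).
 rewrite (fd_mul hh (dA _ Aa) Ab) (fd_mul hh Aa (dA _ Ab)).
 rewrite (ctw_hom _ (hom_dif ha)) (ctw_hom _ ha) !(dmapZ hf) -!scalerAl sg_csign csignDl.
 have -> : csign chi (-1, 0, 0) t = sg k t.
  by rewrite /csign /= bichar0l mulr1 mulN1r /sg !signz_absz abszN.
 rewrite !mulrDl !mulrDr !scalerDr -!scalerAl -!scalerAr !scalerA.
 have -> : (-1) ^ (t + u).1.1 = sg k t * sg k u :> k by exact: sgD.
 have -> : (-1) ^ t.1.1 = sg k t :> k by [].
 set P1 := D a * f b; set P2 := h (dif a) * f b; set P3 := h a * f (dif b); set P4 := f (dif a) * h b.
 set P5 := f a * D b; set P6 := f a * h (dif b).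
 set x := sg k t; set z := sg k u; set y := csign chi u t.
 have zz : z * z = 1 by exact: sgK.
 have -> : z * (y * z) = y by rewrite mulrCA zz mulr1.
 rewrite [LHS](AC (3*(1*2)) ((1*5)*((2*4)*(3*6)))) /=.
 by congr (_ + _ + (_ + _ + (_ *: _ + _ *: _))); ring.
have KZ c a : K a -> K (c *: a).
 move=> [Aa Ka]; split; first exact: (gsubZ gA).
 rewrite (fdZ _ gA hh) // (fdZ _ _ hD) // !difZ Ka (fdZ _ gA hh); last exact: dA.
 by rewrite scalerDr !scalerA mulrC.
have K0 : K 0.
 by split; [exact: (gsub0 gA) | rewrite (dif0 A) !(fd0 gA hh) (fd0 _ hD) // dif0 scaler0 addr0].
have KD a b : K a -> K b -> K (a + b).
 move=> [Aa Ka] [Ab Kb]; split; first exact: (gsubD gA).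
 rewrite (fdD hh) // difD (fdD hD) // Ka Kb difD (fdD hh); [|exact: dA|exact: dA].
 by rewrite scalerDr addrACA.
have Kv l : dpow_ok (vodd v) l -> K (v.2 l).
 move=> ol; have Al m : dpow_ok (vodd v) m -> adj1 C v (v.2 m).
  by move=> om; rewrite -[v.2 m]mul1r; apply: adjoin_mem (gsub0 g) om (galg1 gC).
 split; first exact: Al.
 have ok0 : dpow_ok (vodd v) 0 by rewrite /dpow_ok implybT.
 have one0 w d : fder (adj1 C v) w d -> d 1 = 0.
  move=> hd; have A1 := galg1 gAA.
  have := fd_mul hd A1 A1; rewrite mulr1 (dmap1 hf) mulr1 /ctw tw1 ?csign0r // (dmap1 hf) mul1r.
  by move/eqP; rewrite -subr_eq0 opprD addNKr oppr_eq0 => /eqP.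
 case: l ol => [|[|l]] ol.
 - rewrite (dps0 dv) (one0 _ _ hh) dif1 dif0 (fd0 gA hh) scaler0 addr0.
  by rewrite (one0 _ _ (fder_mono _ hD)).
 - exact: s1.
 have ev : ~~ odd `|v.1.1.1|%N by move: ol; rewrite /dpow_ok /vodd; case: (odd _).
 have okE m : dpow_ok (vodd v) m by rewrite /dpow_ok /vodd (negbTE ev).
 have hv1 := dps_hom1 dv; have hhv := fd_hom hh (Al 1%N (okE _)) hv1.
 have hfd := dmap_hom hf (hom_dif hv1).
 have d1 : dif (v.2 l.+2) = dif (v.2 1) * v.2 l.+1 by apply: (dps_dif dv).
 have d2 : dif (v.2 l.+1) = dif (v.2 1) * v.2 l by apply: (dps_dif dv).
 rewrite (ph l.+1 ol) (dif_homM _ hhv) s1 (pD l.+1 ol) -(dmap_dif hf) d1 d2 (dmapM hf).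
 rewrite (fd_mul hh (CA _ zC) (Al _ (okE _))) (ctw_hom _ (hom_dif hv1)) (dmapZ hf) (ph l (okE l.+1)).
 have c1 : csign chi u (v.1 + (-1, 0, 0)) * csign chi (v.1 + (-1, 0, 0)) (v.1 + u) = sg k v.1.
  rewrite [csign chi (v.1 + _) (v.1 + u)]csignDr mulrCA csign_swap mulr1 csignDl (csign_even_self _ ev) mul1r.
  by rewrite /csign /= bichar0l mulr1 mulN1r /sg !signz_absz abszN.
 have := comm_mid 1 (f (v.2 l)) (commM hfd hhv) c1; rewrite !mul1r.
 move=> ->.
 rewrite mulrDl -!scalerAl scalerDr scalerA addrA; congr (_ + _ *: _).
 by rewrite mulrC; exact: sgD.
suff KA a : adj1 C v a -> K a by move=> a /KA[].
apply: (adj1_hom_ind (P := K) g) => // c l s ol Cc hc; apply: (KM s) => //; last exact: Kv.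
by split; [exact: CA | exact: sC].
Qed.

(** The boundaries of the variables lie in [C], so the values can be chosen independently of each
    other; [Q] records a further demand on them. *)
Lemma solve_list C L h (Q : var A -> B -> Prop) : galg C -> dpsL L -> freeL C L -> fder C u h ->
 (forall a, C a -> C (dif a)) -> allP L (fun v => C (dif (v.2 1))) -> solves C h ->
 allP L (fdpow D) ->
 allP L (fun v => exists b, [/\ hom (v.1 + u) b, Q v b & dif b = D (v.2 1) + sg k u *: h (dif (v.2 1))]) ->
 exists h', [/\ fder (spanL C L) u h', forall a, C a -> h' a = h a, solves (spanL C L) h' &
  allP L (fun v => Q v (h' (v.2 1)) /\ fdpow h' v)].
Proof.
elim: L C h => [|v L IH] C h gC /=; first by move=> _ _ hh _ _ sC _ _; exists h.
move=> [dv dL] [fv fL] hh dC [zv zL] sC [pv pL] [[b [hb Qb eb]] bL]; have g := galg_sub gC.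
have [h1 [hh1 e1 ev p1]] := fder_ext gC hh dv fv hb.
have gA := adjoin_galg gC dv; have CA a : C a -> adj1 C v a by apply: (adjoin_incl g dv).
have s1 : solves (adj1 C v) h1.
 apply: solves_adj1 => //; first by move=> a Ca; rewrite !e1 ?sC //; apply: dC.
 by rewrite ev eb e1.
have dA a : adj1 C v a -> adj1 C v (dif a).
 by apply: (adjoin_dif g dv) => // c Cc; apply: (galgM gC).
have [||h2 [hh2 e2 s2 Q2]] := IH (adj1 C v) h1 gA dL fL hh1 dA _ s1 pL.
- by apply: allP_impl zL => w; apply: CA.
- move: bL zL; elim: (L) => //= w L' IH' [[b' [? ? eb']] /IH' bL] [zw /bL zL]; split=> //.
 by exists b'; split=> //; rewrite e1.
have A1 l : dpow_ok (vodd v) l -> adj1 C v (v.2 l).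
 by move=> ol; rewrite -[v.2 l]mul1r; apply: adjoin_mem (gsub0 g) ol (galg1 gC).
have ok1 : dpow_ok (vodd v) 1 by rewrite /dpow_ok implybT.
exists h2; split=> //; first by move=> a Ca; rewrite e2 ?e1 //; apply: CA.
split=> //; split; first by rewrite e2 ?ev //; apply: A1.
by move=> l ol; rewrite (e2 _ (A1 _ ol)) (e2 _ (A1 _ ok1)) (p1 l ol).
Qed.

End Solve.

End FDer.

Section Augmentation.
Variables (k : fieldType) (G : zmodType) (chi : alt_bicharacter G k).
Notation T := (tridegree G).

Record augm (A : color_dga chi) (e : A -> k) : Prop := {
 au_lin : forall c a b, e (c *: a + b) = c * e a + e b;
 au_mul : forall a b, e (a * b) = e a * e b;
 au_one : e 1 = 1;
 au_hom : forall t a, hom t a -> t <> 0 -> e a = 0 }.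

Section Theory.
Variables (A : color_dga chi) (e : A -> k) (ha : augm e).

Lemma au0 : e 0 = 0.
Proof.
have := au_lin ha 1 0 0; rewrite scale1r addr0 mul1r => /eqP.
by rewrite -subr_eq0 opprD addNKr oppr_eq0 => /eqP.
Qed.
Lemma auD a b : e (a + b) = e a + e b.
Proof. by have := au_lin ha 1 a b; rewrite scale1r mul1r. Qed.
Lemma auZ c a : e (c *: a) = c * e a.
Proof. by have := au_lin ha c a 0; rewrite au0 !addr0. Qed.
Lemma au_sum (I : Type) (r : seq I) (P : pred I) (F : I -> A) :
 e (\sum_(i <- r | P i) F i) = \sum_(i <- r | P i) e (F i).
Proof. by apply: (big_morph e auD au0). Qed.
Lemma au_tw g a : g 0 = 1 -> e (tw g a) = e a.
Proof.
move=> g0; elim/dga_ind: a => [|a b h1 h2|t a hta]; first by rewrite tw0.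
 by rewrite twD !auD h1 h2.
rewrite (tw_hom _ hta) auZ; case: (eqVneq t 0) => [->|/eqP t0]; first by rewrite g0 mul1r.
by rewrite (au_hom ha hta t0) mulr0.
Qed.

(** The Leibniz rule has no sign: e a is nonzero only in degree 0, where commutation factors are
    1. *)
Record eder (C : A -> Prop) (d : A -> k) : Prop := {
 ed_lin : forall c a b, C a -> C b -> d (c *: a + b) = c * d a + d b;
 ed_mul : forall a b, C a -> C b -> d (a * b) = d a * e b + e a * d b }.

Definition edpow (d : A -> k) (v : var A) : Prop := forall l, dpow_ok (vodd v) l.+2 -> d (v.2 l.+2) = 0.

Lemma ed_mono C C' d : (forall a, C a -> C' a) -> eder C' d -> eder C d.
Proof.
by move=> CC hd; split; [move=> c a b /CC ? /CC; apply: (ed_lin hd) | move=> a b /CC ? /CC; apply: (ed_mul hd)].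
Qed.

Lemma ed0 C d : C 0 -> eder C d -> d 0 = 0.
Proof.
move=> C0 hd; have := ed_lin hd 1 C0 C0; rewrite scale1r addr0 mul1r => /eqP.
by rewrite -subr_eq0 opprD addNKr oppr_eq0 => /eqP.
Qed.
Lemma edD C d a b : eder C d -> C a -> C b -> d (a + b) = d a + d b.
Proof. by move=> hd Ca Cb; have := ed_lin hd 1 Ca Cb; rewrite scale1r mul1r. Qed.

Lemma ed_eq0 C L d : galg C -> dpsL L -> eder (spanL C L) d -> (forall a, C a -> d a = 0) ->
 allP L (fun v => d (v.2 1) = 0 /\ edpow d v) -> forall a, spanL C L a -> d a = 0.
Proof.
elim: L C => [|v L IH] C gC //= [dv dL] hh hC0 [[v0 pv] L0].
have g := galg_sub gC; have gA := adjoin_galg gC dv.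
have sA a : adj1 C v a -> spanL (adj1 C v) L a by apply: spanL_incl (galg_sub gA) dL.
have hA := ed_mono sA hh; have C0 := gsub0 g.
apply: IH => // a [N [c [Cc ->]]].
have Am l : dpow_ok (vodd v) l -> adj1 C v (c l * v.2 l) by move=> ol; apply: adjoin_mem.
suff [] : adj1 C v (\sum_(l < N | dpow_ok (vodd v) l) c l * v.2 l) /\
 d (\sum_(l < N | dpow_ok (vodd v) l) c l * v.2 l) = 0 by [].
elim/big_ind: _ => [|x y [Ax dx] [Ay dy]|l ol].
- by split; [exact: (gsub0 (galg_sub gA)) | apply: ed0 hA; exact: (gsub0 (galg_sub gA))].
- by split; [exact: (gsubD (galg_sub gA)) | rewrite (edD hA) // dx dy addr0].
split; first exact: Am.
have Ac : adj1 C v (c l) by apply: (adjoin_incl g dv).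
have Al : adj1 C v (v.2 l) by rewrite -[v.2 l]mul1r; apply: adjoin_mem ol (galg1 gC).
rewrite (ed_mul hA Ac Al) hC0 // mul0r add0r; case: (nat_of_ord l) ol Al => [|[|m]] ol Al.
- by rewrite (dps0 dv) hC0 ?mulr0 //; apply: (galg1 gC).
- by rewrite v0 mulr0.
by rewrite pv ?mulr0.
Qed.

End Theory.

(** What a closure, its version without internal degrees and the common models share. [fl_min]
    expresses minimality: in a relation among boundaries of variables all coefficients have
    augmentation 0. *)
Record filt (A : color_dga chi) (F0 : A -> Prop) (L : nat -> seq (var A)) (e : A -> k) : Prop := {
 fl_galg : galg F0;
 fl_dif0 : forall a, F0 a -> F0 (dif a);
 fl_dps : forall i, dpsL (L i);
 fl_deg : forall i, allP (L i) (fun v => v.1.1.1 = i.+1%:Z);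
 fl_free : forall i, freeL (lev F0 L i) (L i);
 fl_bd : forall i, allP (L i) (fun v => lev F0 L i (dif (v.2 1)));
 fl_all : forall b, exists i, lev F0 L i b;
 fl_aug : augm e;
 fl_min : forall m c w, (forall i, F0 (c i)) ->
  (forall i, (i < size (L m))%N -> exists s : T, s.1.1 = 0 /\ hom s (c i)) -> lev F0 L m w ->
  dif (lcB (ones (L m)) c + w) = 0 -> forall i, (i < size (L m))%N -> e (c i) = 0 }.

Section Filt.
Variables (A : color_dga chi) (F0 : A -> Prop) (L : nat -> seq (var A)) (e : A -> k).
Hypothesis fl : filt F0 L e.
Notation Lev := (lev F0 L).

Lemma flev_galg i : galg (Lev i).
Proof. by elim: i => [|i IH]; [exact: fl_galg fl | apply: spanL_galg IH (fl_dps fl i)]. Qed.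

Lemma spanL_dif (C : A -> Prop) (L' : seq (var A)) : galg C -> dpsL L' ->
 (forall a, C a -> C (dif a)) -> allP L' (fun v => C (dif (v.2 1))) ->
 forall a, spanL C L' a -> spanL C L' (dif a).
Proof.
elim: L' C => //= v L' IH C gC [dv dL] dC [zv zL]; have g := galg_sub gC.
apply: IH => //; first exact: adjoin_galg.
 by move=> a; apply: (adjoin_dif g dv) => // c Cc; apply: (galgM gC).
by apply: allP_impl zL => w; apply: (adjoin_incl g dv).
Qed.

Lemma flev_dif i a : Lev i a -> Lev i (dif a).
Proof.
elim: i a => [|i IH] a; first exact: (fl_dif0 fl).
exact: spanL_dif (flev_galg i) (fl_dps fl i) IH (fl_bd fl i) a.
Qed.

Lemma flev_le i j a : (i <= j)%N -> Lev i a -> Lev j a.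
Proof.
move=> /subnK <-; elim: (j - i)%N => // m IH /IH.
exact: spanL_incl (galg_sub (flev_galg _)) (fl_dps fl _).
Qed.

Lemma flev_hom i j t b : t.1.1 <= i%:Z -> hom t b -> Lev j b -> Lev i b.
Proof.
move=> ti hb; elim: j => [|j IH]; first exact: flev_le.
case: (leqP j.+1 i) => ji; first exact: flev_le.
move=> h; apply: IH; apply: spanL_lt (galg_sub (flev_galg j)) (fl_dps fl j) _ (fl_deg fl j) hb _ h => //.
by apply: le_lt_trans ti _; rewrite ltz_nat.
Qed.

Lemma ones_lev i : allP (L i) (fun v => Lev i.+1 (v.2 1)).
Proof. exact: spanL_one (flev_galg i) _ (fl_dps fl i). Qed.

Lemma spanL_vars (V : A -> Prop) (L' : seq (var A)) : galg V -> dpsL L' ->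
 allP L' (fun v => forall l, dpow_ok (vodd v) l -> spanL V L' (v.2 l)).
Proof.
move=> gV; elim/last_ind: L' => [//|L' v IH]; rewrite /dpsL -cats1 !allP_cat => -[dL [dv _]].
have gL := spanL_galg gV dL; rewrite spanL_cat /=; split.
 by apply: allP_impl (IH dL) => u hu l ol; apply: (adjoin_incl (galg_sub gL) dv); apply: hu.
split=> // l ol; rewrite -[v.2 l]mul1r; apply: adjoin_mem (gsub0 (galg_sub gL)) ol (galg1 gL).
Qed.

Lemma vars_lev i : allP (L i) (fun v => forall l, dpow_ok (vodd v) l -> Lev i.+1 (v.2 l)).
Proof. exact: spanL_vars (flev_galg i) (fl_dps fl i). Qed.

(* An augmentation-derivation of degree -(m+1) trivial on the base only sees the linear part of an
 element of degree m+1, and by minimality cycles have none. *)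
Lemma eder_cycle m d z t : eder e (Lev m.+1) d -> (forall a, F0 a -> d a = 0) ->
 (forall i, (i < m)%N -> allP (L i) (edpow d)) ->
 (forall s a, Lev m.+1 a -> hom s a -> s.1.1 <> m.+1%:Z -> d a = 0) ->
 Lev m.+1 z -> hom t z -> dif z = 0 -> d z = 0.
Proof.
move=> hd d0 dp dg Lz hz dz; case: (pselect (t.1.1 = m.+1%:Z)) => tm; last exact: dg tm.
have au := fl_aug fl; have gm := flev_galg m.
have dlow i : (i <= m)%N -> forall a, Lev i a -> d a = 0.
 elim: i => [|i IH] im; first exact: d0.
 have sub b : Lev i.+1 b -> Lev m.+1 b by apply: flev_le; exact: leqW.
 apply: (ed_eq0 (flev_galg i) (fl_dps fl i) (ed_mono sub hd)) => [b|].
  by apply: IH; exact: ltnW.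
 move: (fl_deg fl i) (dp i im) (fl_dps fl i) (ones_lev i).
 elim: (L i) => //= v L' IH' [vd Ld] [pv pL] [dv dL] [ov oL]; split; last exact: IH'.
 split=> //; apply: (dg v.1); [exact: sub | exact: dps_hom1 |].
 by rewrite vd => -[]; lia.
have tm' : t.1.1 <= m.+1%:Z by rewrite tm.
have [|c [w [Cc hc Lw hw ez]]] := spanL_low (galg_sub gm) (fl_dps fl m) _ (fl_deg fl m) hz tm' Lz; first by [].
have cs i : (i < size (L m))%N -> (t - nth 0 (map fst (L m)) i).1.1 = 0.
 by move=> im; rewrite /= (nth_deg (fl_deg fl m) im) tm subrr.
pose c' i := if (i < size (L m))%N then c i else 0.
have c'0 i : F0 (c' i).
 rewrite /c'; case: ifP => im; last exact: (gsub0 (galg_sub (fl_galg fl))).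
 by apply: (@flev_hom 0 m _ _ _ (hc i im)) (Cc i); rewrite cs.
have ec' : lcB (ones (L m)) c = lcB (ones (L m)) c'.
 by apply: lcB_ext => i; rewrite size_map /c' => ->.
have e0 : forall i, (i < size (L m))%N -> e (c' i) = 0.
 apply: (fl_min fl (w := w)) => //; last by rewrite -ec' -ez.
 by move=> i im; exists (t - nth 0 (map fst (L m)) i); split; [exact: cs | rewrite /c' im; exact: hc].
have sub b : Lev m b -> Lev m.+1 b by apply: flev_le.
have gm1 := flev_galg m.+1; have g1 := galg_sub gm1.
rewrite ez ec'; suff [Ll d_l] : Lev m.+1 (lcB (ones (L m)) c') /\ d (lcB (ones (L m)) c') = 0.
 by rewrite (edD hd Ll (sub _ Lw)) d_l (dlow m (leqnn m) _ Lw) addr0.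
have oL := ones_lev m; have gd := fl_deg fl m; have dL := fl_dps fl m.
move: e0 c'0; rewrite {ec' hc cs}; move: c'; elim: (L m) oL gd dL => [|v L' IH] /=.
 by move=> *; split; [exact: (gsub0 g1) | apply: ed0 hd; exact: (gsub0 g1)].
move=> [ov oL] [vd Ld] [dv dL] c' e0 c0.
have [||Ll dl] := IH oL Ld dL (fun i => c' i.+1); first by move=> i; apply: (e0 i.+1).
 by move=> i; apply: c0.
have Lc : Lev m.+1 (c' 0%N) by apply: (@flev_le 0).
split; first by apply: (gsubD g1) => //; apply: (galgM gm1).
rewrite (edD hd) //; last exact: (galgM gm1).
by rewrite dl addr0 (ed_mul hd) // d0 // mul0r add0r e0 // mul0r.
Qed.

Lemma eder_cycles m d t z : eder e (fun _ => True) d -> (forall a, F0 a -> d a = 0) ->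
 (forall i, allP (L i) (edpow d)) -> (forall s a, hom s a -> s.1.1 <> m.+1%:Z -> d a = 0) ->
 hom t z -> dif z = 0 -> d z = 0.
Proof.
move=> hd d0 dp dg hz dz; case: (pselect (t.1.1 = m.+1%:Z)) => tm; last exact: dg tm.
have [j Lj] := fl_all fl z; have Lm : Lev m.+1 z by apply: flev_hom hz Lj; rewrite tm.
apply: eder_cycle Lm hz dz => //; first exact: ed_mono hd.
by move=> s a _; apply: dg.
Qed.

Lemma eder_dif m d a : eder e (fun _ => True) d -> (forall a, F0 a -> d a = 0) ->
 (forall i, allP (L i) (edpow d)) -> (forall s a, hom s a -> s.1.1 <> m.+1%:Z -> d a = 0) ->
 d (dif a) = 0.
Proof.
move=> hd d0 dp dg; elim/dga_ind: a => [|a b h1 h2|t a ha].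
- by rewrite dif0; apply: ed0 hd.
- by rewrite difD (edD hd) // h1 h2 addr0.
exact: eder_cycles hd d0 dp dg (hom_dif ha) (difK a).
Qed.

End Filt.

Section SolveFilt.
Variables (A B : color_dga chi) (f : A -> B) (hf : is_dmap f).
Variables (F0 : A -> Prop) (L : nat -> seq (var A)) (eB : B -> k).
Hypotheses (fl : filt F0 L (eB \o f)) (aB : augm eB).
Notation Lev := (lev F0 L).

Lemma fder_eder (C : A -> Prop) u h : fder f C u h -> eder (eB \o f) C (eB \o h).
Proof.
move=> hh; split=> [c a b Ca Cb|a b Ca Cb] /=; first by rewrite (fd_lin hh) // (au_lin aB).
rewrite (fd_mul hh) // (auD aB) !(au_mul aB); congr (_ + _ * _).
by rewrite /ctw (dmap_tw hf) (au_tw aB) // csign0r.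
Qed.

Lemma fdpow_edpow h v : dps v.1 v.2 -> 0 < v.1.1.1 -> fdpow f h v -> edpow (eB \o h) v.
Proof.
move=> dv v0 ph l ol; rewrite /= (ph l.+1 ol) (au_mul aB).
have ol1 : dpow_ok (vodd v) l.+1 by move: ol; rewrite /dpow_ok; case: (vodd v).
rewrite [X in _ * X](au_hom aB (dmap_hom hf (dps_hom dv ol1))) ?mulr0 //.
move=> /(congr1 (fun t : T => t.1.1)); rewrite tdegMn1 => /eqP.
by rewrite mulrn_eq0 /= (gt_eqF v0).
Qed.

Variables (u : T) (m : nat) (D : A -> B) (Q : var A -> B -> Prop).
Hypotheses (um : u.1.1 = - m.+1%:Z) (hD : fder f (fun _ => True) (u + (-1, 0, 0)) D)
 (cD : forall a, dif (D a) = - (sg k u *: D (dif a))) (D0 : forall a, F0 a -> D a = 0)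
 (pD : forall i, allP (L i) (fdpow f D))
 (eD : allP (L m.+1) (fun v => eB (D (v.2 1)) = 0))
 (Hb : allP (L m) (fun v => exists b, hom (v.1 + u) b /\ Q v b))
 (Hac : forall i, (m < i)%N -> allP (L i) (fun v => forall z, hom (v.1 + u + (-1, 0, 0)) z ->
  dif z = 0 -> eB z = 0 -> exists b, hom (v.1 + u) b /\ dif b = z)).

Definition partial (i : nat) (h : A -> B) : Prop :=
 [/\ fder f (Lev i) u h, forall a, F0 a -> h a = 0, solves u D (Lev i) h,
  forall i', (i' < i)%N -> allP (L i') (fdpow f h) &
  (m < i)%N -> allP (L m) (fun v => Q v (h (v.2 1)))].

Lemma allP_and (X : color_dga chi) (L' : seq (var X)) (P P' : var X -> Prop) : allP L' P -> allP L' P' ->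
 allP L' (fun v => P v /\ P' v).
Proof. by elim: L' => //= v L' IH [? /IH h] [? /h]. Qed.

(** On a variable of degree i + 1 the value has degree i - m. For i < m it must be 0. For i = m it
    has degree 0, the equation lives in negative degree, and [Q] can be met. For i > m the
    right-hand side is a cycle, and [Hac] fills it once its augmentation is known to be 0. *)
Lemma partial_step i h : partial i h -> exists h', partial i.+1 h' /\ forall a, Lev i a -> h' a = h a.
Proof.
move=> [hh h0 sh ph Qh]; have gi := flev_galg fl i; have g := galg_sub gi.
pose Q' := if i == m then Q else fun _ _ => True.
have dLi a : Lev i a -> Lev i (dif a) by apply: (flev_dif fl).
have [|h' [hh' e' s' Q2]] := @solve_list _ _ _ _ _ f hf u D hD (Lev i) (L i) h Q' gi (fl_dps fl i)
  (fl_free fl i) hh dLi (fl_bd fl i) sh (pD i).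
 have hz v : dps v.1 v.2 -> Lev i (dif (v.2 1)) ->
  hom (v.1 + u + (-1, 0, 0)) (D (v.2 1) + sg k u *: h (dif (v.2 1))).
  move=> dv Lz; apply: homD.
   by rewrite -addrA; apply: (fd_hom hD) => //; apply: dps_hom1.
  apply: homZ; rewrite addrAC; apply: (fd_hom hh) => //; apply: hom_dif; exact: dps_hom1.
 have base := allP_and (allP_and (fl_dps fl i) (fl_deg fl i)) (fl_bd fl i).
 case: (ltngtP i m) => im.
 - apply: allP_impl base => v [[dv vi] Lz]; exists 0; split; first exact: hom0.
   by rewrite /Q' ltn_eqF.
  rewrite dif0 (hom_neg _ (hz v dv Lz)) //= vi um; lia.
 - have base2 := allP_and base (Hac im).
  (* Degree reasons settle every i except i = m + 1; there [eD] takes care of D, and minimality,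
     through [eder_cycle], of h. *)
  have ez : allP (L i) (fun v => eB (D (v.2 1) + sg k u *: h (dif (v.2 1))) = 0).
   case: (ltngtP i m.+1) => [|im1|im1]; first by lia.
    apply: allP_impl base => v [[dv vi] Lz]; apply: (au_hom aB (hz v dv Lz)).
    by move=> /(congr1 (fun t : T => t.1.1)) /=; rewrite vi um; lia.
   move: base eD; rewrite -im1 => base eDi; apply: allP_impl (allP_and base eDi) => v [[[dv vi] Lz] Dv].
   rewrite (auD aB) (auZ aB) Dv add0r.
   have -> : eB (h (dif (v.2 1))) = 0; last by rewrite mulr0.
   move: hh Lz ph; rewrite im1 => hh Lz ph.
   apply: (eder_cycle fl (fder_eder hh) _ _ _ Lz (hom_dif (dps_hom1 dv)) (difK _)).
   + by move=> a Fa; rewrite /= h0 // (au0 aB).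
   + move=> i' i'm; apply: allP_impl (allP_and (allP_and (fl_dps fl i') (fl_deg fl i')) (ph i' (ltnW i'm))).
    by move=> w [[dw wi] pw]; apply: fdpow_edpow pw => //; rewrite wi.
   move=> s a La hs sm; apply: (au_hom aB (fd_hom hh La hs)) => /(congr1 (fun t : T => t.1.1)) /=.
   by rewrite um => /eqP; rewrite subr_eq0 => /eqP.
  apply: allP_impl (allP_and base2 ez) => v [[[[dv vi] Lz] ac] ev].
  have [|b [hb eb]] := ac _ (hz v dv Lz) _ ev.
   rewrite difD cD difZ sh // difK (fd0 g hh) scaler0 addr0; exact: addNr.
  by exists b; split=> //; rewrite /Q' gtn_eqF.
 - subst i; apply: allP_impl (allP_and base Hb) => v [[[dv vi] Lz] [b [hb Qb]]].
  exists b; split=> //; first by rewrite /Q' eqxx.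
  rewrite (hom_neg _ (hz v dv Lz)); last by rewrite /= vi um; lia.
  by rewrite (hom_neg _ (hom_dif hb)) //= vi um; lia.
exists h'; split=> //; split=> //.
- by move=> a Fa; rewrite e' ?h0 //; apply: (flev_le fl (leq0n i)).
- move=> i'; rewrite ltnS leq_eqVlt => /predU1P[->|ii].
  by apply: allP_impl Q2 => v [].
 apply: allP_impl (allP_and (vars_lev fl i') (ph i' ii)) => v [Lv pv] l ol.
 have Al l' : dpow_ok (vodd v) l' -> Lev i (v.2 l') by move/Lv; apply: (flev_le fl ii).
 have ok1 : dpow_ok (vodd v) 1 by rewrite /dpow_ok implybT.
 by rewrite (e' _ (Al _ ol)) (e' _ (Al _ ok1)) (pv l ol).
rewrite ltnS leq_eqVlt => /predU1P[mi|mi].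
 by move: Q2; rewrite /Q' mi eqxx; apply: allP_impl => v [].
apply: allP_impl (allP_and (ones_lev fl m) (Qh mi)) => v [Lv Qv].
by rewrite e' //; apply: (flev_le fl mi).
Qed.

(** Successive partial solutions extend each other, and every element lies in some level, so they
    glue to a solution on the whole algebra. *)
Lemma solve_filt : exists h, [/\ fder f (fun _ => True) u h, forall a, F0 a -> h a = 0,
 forall i, allP (L i) (fdpow f h), forall a, dif (h a) = D a + sg k u *: h (dif a) &
 allP (L m) (fun v => Q v (h (v.2 1)))].
Proof.
have p0 : partial 0 (fun=> 0).
 have g0 := fl_galg fl; split=> //.
 - split=> [c a b _ _|t a _ _|a b _ _]; first by rewrite scaler0 addr0.
   exact: hom0.
  by rewrite mul0r mulr0 addr0.
 - by move=> a Fa; rewrite dif0 D0 // scaler0 addr0.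
have /choice[F hF] : forall p : nat * (A -> B), exists h', partial p.1 p.2 ->
  partial p.1.+1 h' /\ forall a, Lev p.1 a -> h' a = p.2 a.
 move=> [i h]; case: (pselect (partial i h)) => [/partial_step[h' ?]|]; last by exists h.
 by exists h'.
pose H := nat_rect (fun=> A -> B) (fun=> 0) (fun i h => F (i, h)).
have HP i : partial i (H i) by elim: i => [|i IH]; [exact: p0 | case: (hF (i, H i) IH)].
have HS i a : Lev i a -> H i.+1 a = H i a by case: (hF (i, H i) (HP i)) => _; apply.
have HE i j a : (i <= j)%N -> Lev i a -> H j a = H i a.
 move=> /subnK <- La; elim: (j - i)%N => // l IH; rewrite addSn HS ?IH //.
 by apply: (flev_le fl) La; apply: leq_addl.
have /choice[ix hix] := fl_all fl.
pose h a := H (ix a) a.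
have hE i a : Lev i a -> h a = H i a.
 move=> La; have := leq_total i (ix a) => /orP[le|le]; first by rewrite /h (HE i).
 by rewrite /h -(HE (ix a) i).
have two a b : exists i, Lev i a /\ Lev i b.
 exists (maxn (ix a) (ix b)); split; apply: (flev_le fl) (hix _); [exact: leq_maxl | exact: leq_maxr].
exists h; split.
- split=> [c a b _ _|t a _ ha|a b _ _].
 + have [i [La Lb]] := two a b; have [hi _ _ _ _] := HP i.
  rewrite !(hE i) ?(fd_lin hi) //; exact: (gsubL (galg_sub (flev_galg fl i))).
 + by have [hi _ _ _ _] := HP (ix a); apply: (fd_hom hi).
 + have [i [La Lb]] := two a b; have [hi _ _ _ _] := HP i.
  rewrite !(hE i) ?(fd_mul hi) //; exact: (galgM (flev_galg fl i)).
- by move=> a Fa; have [_ h0 _ _ _] := HP 0%N; rewrite (hE 0%N).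
- move=> i; have [_ _ _ ph _] := HP i.+1.
 apply: allP_impl (allP_and (vars_lev fl i) (ph i (ltnSn i))) => v [Lv pv] l ol.
 have ok1 : dpow_ok (vodd v) 1 by rewrite /dpow_ok implybT.
 by rewrite (hE _ _ (Lv _ ol)) (hE _ _ (Lv _ ok1)) (pv l ol).
- move=> a; have [_ _ s _ _] := HP (ix a).
 by rewrite /h s // -(hE (ix a)) //; apply: (flev_dif fl).
have [_ _ _ _ Qh] := HP m.+1.
apply: allP_impl (allP_and (ones_lev fl m) (Qh (ltnSn m))) => v [Lv Qv].
by rewrite (hE m.+1).
Qed.

End SolveFilt.
End Augmentation.

End DerivationLifting.
Import DerivationLifting.

(** * Variables of degree 1 whose boundaries are the indeterminates *)

Module LevelOne.

Section LevelOne.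
Variables (k : fieldType) (G : zmodType) (chi : alt_bicharacter G k).
Notation T := (tridegree G).
Variables (S : algType k) (n : nat) (y : 'I_n -> S) (d : 'I_n -> nat) (g : 'I_n -> G).
Variable B : acyclic_closure_of chi y d g.
Hypothesis d0 : forall i, (0 < d i)%N.
Hypothesis S_span : forall s : S, exists (r : seq {ffun 'I_n -> nat}) (c : {ffun 'I_n -> nat} -> k),
 s = \sum_(a <- r) c a *: monomial y a.
Hypothesis yC : forall i j, y i * y j = chi (g i) (g j) *: (y j * y i).
Notation mon := {ffun 'I_n -> nat}.
Variable U : mon -> Prop.
Definition msum (p : seq (k * mon)) : S := \sum_(z <- p) z.1 *: monomial y z.2.
Hypothesis kerU : forall p, msum p = 0 -> forall a, ~ U a -> \sum_(z <- p | z.2 == a) z.1 = 0.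
Hypothesis U2 : forall a, U a -> (2 <= \sum_i a i)%N.
Notation iota' := (ac_incl B).
Notation base := (@base _ _ _ _ _ _ _ _ B).
Notation Lev := (lev base (@cvars _ _ _ _ _ _ _ _ B)).
Notation eps := (eps d0 S_span).

Lemma iotaD (a b : S) : iota' (a + b) = iota' a + iota' b :> B. Proof. exact: rmorphD. Qed.
Lemma iotaM (a b : S) : iota' (a * b) = iota' a * iota' b :> B. Proof. exact: rmorphM. Qed.
Lemma iotaZ c (a : S) : iota' (c *: a) = c *: iota' a :> B. Proof. exact: linearZ. Qed.

Definition mabs (a : mon) : nat := \sum_i a i.
Lemma mabsD a b : mabs (a + b) = (mabs a + mabs b)%N.
Proof. by rewrite /mabs -big_split; apply: eq_bigr => i _; rewrite ffunE. Qed.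
Lemma mabs_dlt i : mabs (dlt i) = 1%N.
Proof. by rewrite /mabs (bigD1 i) //= ffunE eqxx big1 ?addn0 // => j /negbTE; rewrite ffunE => ->. Qed.

(** The e-th power of the augmentation ideal m of S, as the span of the monomials of total degree at
    least e. *)
Definition mspan (e : nat) (s : S) : Prop := exists p, all (fun z : k * mon => e <= mabs z.2)%N p /\ s = msum p.

Lemma mspan0 e : mspan e 0. Proof. by exists [::]; rewrite /msum big_nil. Qed.
Lemma mspanD e s s' : mspan e s -> mspan e s' -> mspan e (s + s').
Proof.
by move=> [p [hp ->]] [q [hq ->]]; exists (p ++ q); rewrite all_cat hp hq /msum big_cat.
Qed.
Lemma mspan_sum e (I : Type) (r : seq I) (F : I -> S) : (forall i, mspan e (F i)) -> mspan e (\sum_(i <- r) F i).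
Proof. by move=> h; elim/big_ind: _ => // *; [exact: mspan0 | exact: mspanD]. Qed.
Lemma mspanZ e c s : mspan e s -> mspan e (c *: s).
Proof.
move=> [p [hp ->]]; exists [seq (c * z.1, z.2) | z <- p]; split; first by rewrite all_map.
by rewrite /msum big_map scaler_sumr; apply: eq_bigr => z _; rewrite scalerA.
Qed.
Lemma mspan_mono e a : (e <= mabs a)%N -> mspan e (monomial y a).
Proof. by move=> ea; exists [:: (1, a)]; rewrite /= ea /msum big_seq1 scale1r. Qed.
Lemma ymonoM a b : monomial y a * monomial y b =
 reorder (fun i j => chi (g i) (g j)) a b *: monomial y (a + b).
Proof. by apply: monomialM => i j; apply: yC. Qed.
Lemma mspanM e e' s s' : mspan e s -> mspan e' s' -> mspan (e + e') (s * s').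
Proof.
move=> [p [hp ->]] [q [hq ->]]; rewrite /msum mulr_suml; move: hp; elim: p => [|z p IH] /=.
 by rewrite big_nil => _; apply: mspan0.
move=> /andP[hz hp]; rewrite big_cons; apply: mspanD; last exact: IH.
rewrite mulr_sumr {IH}; elim: q hq => [|w q IHq] /=; first by rewrite big_nil => _; apply: mspan0.
move=> /andP[hw hq]; rewrite big_cons; apply: mspanD; last exact: IHq.
rewrite -scalerAl -scalerAr ymonoM !scalerA; apply/mspanZ/mspan_mono.
by rewrite mabsD leq_add.
Qed.
Lemma mspan_all s : mspan 0 s.
Proof.
have [r [c ->]] := S_span s; apply: mspan_sum => a; exact/mspanZ/mspan_mono.
Qed.
Lemma mspan_y i : mspan 1 (y i).
Proof. by rewrite -[y i](monomial_dlt y); apply: mspan_mono; rewrite mabs_dlt. Qed.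
Lemma ideal_mspan s : ideal_gen (fun b => exists j, b = y j) s -> mspan 1 s.
Proof.
move=> [N [a [u [b [hu ->]]]]]; apply: mspan_sum => l; have [j ->] := hu l.
have := mspanM (mspanM (mspan_all (a l)) (mspan_y j)) (mspan_all (b l)); exact.
Qed.
Lemma eps0_mspan s : eps (iota' s) = 0 -> mspan 1 s.
Proof. by move/eps_ker_base/ideal_mspan. Qed.

Lemma iota_mono_hom a : exists t, hom t (iota' (monomial y a)).
Proof. by have [t [ht _ _]] := monomial_hom B d0 a; exists t. Qed.

Lemma eps_dif (b : B) : eps (dif b) = 0.
Proof.
elim/dga_ind: b => [|a b h1 h2|t b hb]; first by rewrite dif0 (eps0 B d0 S_span).
 by rewrite difD (epsD d0 S_span) h1 h2 addr0.
case: (pselect (t.1.1 = 1)) => t1; last first.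
 apply: (eps_hom d0 S_span (hom_dif hb)) => /(congr1 (fun t : T => t.1.1)) /= e; apply: t1.
 by move: e; lia.
have [|c [w [Cc _ [s ->] _ ->]]] := spanL_low (galg_sub (base_galg B d0 S_span)) (cvars_dps B 0) (isT : 0 < 1%:Z)
  (cvars_deg B 0) hb _ (hom_lev d0 S_span (i := 1) t1 hb); first by rewrite t1.
rewrite difD ac_incl_dif addr0 lcB_cvars dif_sum; elim/big_ind: _ => [|x z h1 h2|i _].
- exact: (eps0 B d0 S_span).
- by rewrite (epsD d0 S_span) h1 h2 addr0.
have [s' ->] := Cc i; rewrite (dif_base d0 S_span) (epsM d0 S_span).
have [a ia ->] := ac_var_kill (ltn_ord i); by rewrite (eps_ideal B d0 S_span ia) mulr0.
Qed.

(** Modulo [Jm], an element with boundary in m is seen through the class of that boundary in m /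
    m^2. *)
Definition Jm (b : B) : Prop := exists2 s, mspan 2 s & dif b = iota' s.

Lemma mspan_prj e t s : mspan e s -> exists2 s', mspan e s' & prj t (iota' s : B) = iota' s'.
Proof.
move=> [p [hp ->]]; rewrite /msum; elim: p hp => [|z p IH] /=.
 by exists 0; [exact: mspan0 | rewrite big_nil rmorph0 prj0].
move=> /andP[hz /IH[s' hs es]]; rewrite big_cons.
have [u hu] := iota_mono_hom z.2; have hh := prj_hom t hu.
exists (z.1 *: (if t == u then monomial y z.2 else 0) + s').
 by apply: mspanD => //; apply: mspanZ; case: ifP => _; [exact: mspan_mono | exact: mspan0].
rewrite !rmorphD prjD es; congr (_ + _); rewrite prj_iotaZ hh.
case: ifP => _; first by symmetry; exact: linearZ.
by rewrite !scaler0 rmorph0.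
Qed.

Lemma Jm_gsub : gsub Jm.
Proof.
split.
- by exists 0; [exact: mspan0 | rewrite dif0 rmorph0].
- move=> c a b [s hs es] [s' hs' es']; exists (c *: s + s'); first exact/mspanD/hs'/mspanZ.
 by rewrite difD difZ es es'; symmetry; exact: linearP.
- move=> t a [s hs es]; have [s' hs' es'] := mspan_prj (t + (-1, 0, 0)) hs; exists s' => //.
 by rewrite -es' -es prj_dif -addrA tdown_up addr0.
Qed.

Lemma base_dpclosed Ok : dpfam (B := B) Ok -> dpclosed Ok base.
Proof.
move=> fOk t b et [s ->] hb t0; have [e|[t1 _]] := base_hom d0 S_span hb; last by rewrite t1 in t0.
exists (@zero_dps _ _ _ B); split; [exact: zero_dpsP | by rewrite e | | exact: (ok_zero fOk)].
by move=> [|l]; [exists 1; rewrite rmorph1 | exists 0; rewrite rmorph0].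
Qed.

Lemma absorbed_dif (b : B) s : dif b = iota' s -> mspan 1 s -> absorbed base Jm b.
Proof.
move=> db hs t c t0 [s' ->] hc; exists (s' * s); last by rewrite (dif_base d0 S_span) db rmorphM.
apply: (@mspanM 1 1) => //; apply: eps0_mspan; apply: eps_hom hc _; exact/eqP.
Qed.

Lemma y_kill i : exists c : 'I_(ac_num B 0) -> S,
 iota' (y i) = \sum_(m < ac_num B 0) iota' (c m) * dif (ac_var B 0 m 1) :> B.
Proof.
have hk : to_kill y (ac_incl B) (ac_num B) (ac_var B) 0 (iota' (y i)).
 exists (y i) => //; exists 1%N, (fun=> 1), (fun=> y i), (fun=> 1).
 by split; [move=> _; exists i | rewrite big_ord1 mul1r mulr1].
have [c [w [[s ->] _ ->]]] := (ac_var_min [set: 'I_(ac_num B 0)]).2 erefl _ hk.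
by exists c; rewrite ac_incl_dif addr0; apply: eq_bigl => m; rewrite in_setT.
Qed.

Lemma mon_pred (a : mon) i : (0 < a i)%N -> exists b : mon, a = b + dlt i.
Proof.
move=> ai; exists [ffun j => (a j - dlt i j)%N]; apply/ffunP => j.
by rewrite !ffunE -[RHS]/(addn _ _); case: (j =P i) => [->|_]; rewrite ?subnK // subn0 addn0.
Qed.

(** A monomial of degree at least 2 is, up to a scalar, a monomial of m times some y_i, and y_i is a
    combination of the boundaries of the variables. *)
Lemma mspan2_kill s : mspan 2 s -> exists c : 'I_(ac_num B 0) -> S, (forall m, eps (iota' (c m)) = 0) /\
 iota' s = \sum_(m < ac_num B 0) iota' (c m) * dif (ac_var B 0 m 1) :> B.
Proof.
have eps_i0 : eps (iota' 0) = 0 by rewrite rmorph0 (eps0 B d0 S_span).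
move=> [p [hp ->]]; rewrite /msum; elim: p hp => [|z p IH] /=.
 exists (fun=> 0); split=> //; rewrite big_nil rmorph0 big1 // => m _.
 by rewrite mul0r.
move=> /andP[hz /IH[c [c0 ec]]]; rewrite big_cons.
have [i zi] : exists i, (0 < z.2 i)%N.
 apply: contrapT => no; move: hz; rewrite /mabs big1 // => i _; apply/eqP; rewrite -leqn0 leqNgt.
 by apply/negP => zi; apply: no; exists i.
have [b zb] := mon_pred zi.
have [e [e0 ez]] : exists e : k, e != 0 /\ monomial y z.2 = e *: (monomial y b * y i).
 exists (reorder (fun i j => chi (g i) (g j)) b (dlt i))^-1; rewrite invr_eq0 reorder_neq0; split=> //.
 rewrite -[y i in RHS](monomial_dlt y) ymonoM scalerA mulVf ?reorder_neq0 // scale1r -zb //.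
have eb : eps (iota' (monomial y b)) = 0.
 have [t [ht t1 [[_ tt]|t2]]] := monomial_hom B d0 b; last first.
  by apply: (eps_hom d0 S_span ht) => t0; rewrite t0 in t2.
 have [j bj] : exists j, (0 < b j)%N.
  apply: contrapT => no; move: hz; rewrite zb mabsD mabs_dlt /mabs big1 // => j _; apply/eqP.
  by rewrite -leqn0 leqNgt; apply/negP => bj; apply: no; exists j.
 apply: (eps_ideal B d0 S_span); have [b' bb] := mon_pred bj.
 exists 1%N, (fun=> (reorder (fun i j => chi (g i) (g j)) b' (dlt j))^-1 *: monomial y b'), (fun=> y j), (fun=> 1).
 split; first by move=> _; exists j.
 rewrite big_ord1 mulr1 -scalerAl -[y j in RHS](monomial_dlt y) ymonoM scalerA mulVf ?reorder_neq0 //.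
 by rewrite scale1r -bb.
have [cy ey] := y_kill i.
exists (fun m => (z.1 * e) *: (monomial y b * cy m) + c m); split.
 move=> m; rewrite iotaD (epsD d0 S_span) c0 addr0 iotaZ -[_ *: _]addr0 (epsL d0 S_span).
 by rewrite iotaM (epsM d0 S_span) eb mul0r mulr0 (eps0 B d0 S_span) addr0.
rewrite iotaD ec; under [RHS]eq_bigr do rewrite iotaD mulrDl.
rewrite big_split /=; congr (_ + _); rewrite ez scalerA iotaZ iotaM ey mulr_sumr scaler_sumr.
by apply: eq_bigr => m _; rewrite iotaZ iotaM -scalerAl mulrA.
Qed.

(** [mspan2_kill] turns a relation modulo m^2 into an exact one without changing the augmentations
    of its coefficients; then [lev_min] applies. *)
Lemma indep_cvars : indep Jm (ones (cvars B 0)).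
Proof.
move=> a [s hs]; rewrite lcB_cvars dif_sum => es i; rewrite size_map size_map size_iota => im.
have [c [c0 ec]] := mspan2_kill hs.
pose cc j : S := if insub j is Some m then a j *: 1 - c m else 0.
have := lev_min d0 S_span (m := 0) (c := fun j => iota' (cc j)) (w := 0) _ _ _ im.
have -> : iota' (cc i) = a i *: 1 - iota' (c (Ordinal im)) :> B.
 rewrite /cc insubT rmorphB; congr (_ - _); rewrite -[1 in RHS](rmorph1 iota'); exact: linearZ.
move=> h; suff : eps (a i *: 1 - iota' (c (Ordinal im))) = 0.
 by rewrite -[- _]addr0 (epsL d0 S_span) (eps1 B d0 S_span) addr0 (epsN d0 S_span) c0 oppr0 addr0 mulr1.
apply: h; [by move=> j; exists (cc j) | by exists 0; rewrite rmorph0 |].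
rewrite addr0 lcB_cvars dif_sum.
have : \sum_(j < ac_num B 0) (dif (scal B a j * ac_var B 0 j 1) - iota' (c j) * dif (ac_var B 0 j 1)) = 0.
 by rewrite sumrB es ec subrr.
move=> h0; rewrite -[RHS]h0; apply: eq_bigr => j _; rewrite (dif_base d0 S_span) /cc valK rmorphB mulrBl; congr (_ - _).
rewrite /scal -scalerAl mul1r difZ.
transitivity ((a j *: (1 : B)) * dif (ac_var B 0 j 1)); last by rewrite -scalerAl mul1r.
congr (_ * _); rewrite -(rmorph1 iota'); exact: linearZ.
Qed.

Lemma xi_ex j : exists x : B, hom (1, (d j)%:Z, g j) x /\ dif x = iota' (y j).
Proof.
have hy := ac_incl_hom B j; have [b eb] := acyclic_hom hy (ac_incl_dif B _) (eps_y B d0 S_span j).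
exists (prj (1, (d j)%:Z, g j) b); split; first exact: hom_prj.
have -> : (1, (d j)%:Z, g j) = (0, (d j)%:Z, g j) + (1, 0, 0) :> T by congr (_, _, _); rewrite /= ?addr0 ?add0r.
by rewrite -prj_dif eb prj_id.
Qed.

Lemma mspan_coef e s : mspan e s -> exists2 p, s = msum p & forall a, (mabs a < e)%N -> \sum_(z <- p | z.2 == a) z.1 = 0.
Proof.
move=> [p [/seq.allP hp ->]]; exists p => // b be; rewrite big_seq_cond big1 // => z /andP[/hp hz /eqP zb].
by move: be; rewrite -zb ltnNge hz.
Qed.

(** The relations of S are supported on monomials of [U], all of degree at least 2, so they impose
    nothing on linear terms. *)
Lemma indep_y (a : 'I_n -> k) : mspan 2 (\sum_j a j *: y j) -> forall j, a j = 0.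
Proof.
move=> /mspan_coef[p ep hp] j.
pose q : seq (k * mon) := [seq (a i, dlt i) | i <- index_enum 'I_n].
have : msum (q ++ [seq (- z.1, z.2) | z <- p]) = 0.
 rewrite /msum /q big_cat !big_map /=.
 under eq_bigr do rewrite monomial_dlt.
 rewrite ep; under [X in _ + X]eq_bigr do rewrite scaleNr.
 by rewrite sumrN subrr.
move=> /kerU-/(_ (dlt j)); rewrite /q big_cat !big_map /= sumrN hp ?mabs_dlt // subr0.
rewrite (bigD1 j) //= big1 => [|i /andP[/eqP e ij]]; last first.
 by move: (congr1 (fun f : mon => f i) e); rewrite !ffunE eqxx (negbTE ij).
by rewrite addr0; apply; move/U2; rewrite -/(mabs _) mabs_dlt.
Qed.

(** The variables are exchanged for elements x_j with boundary y_j; both families are bases modulo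
    [Jm], so no old variable survives. *)
Theorem level_one : exists E : seq (var B), [/\ dpsL E, freeL base E, spanL base E = Lev 1,
 map fst E = [seq (1, (d j)%:Z, g j) | j <- enum 'I_n] &
 [seq dif (v.2 1) | v <- E] = [seq iota' (y j) | j <- enum 'I_n]].
Proof.
have /choice[x hx] := xi_ex.
pose es : seq (T * B) := [seq ((1, (d j)%:Z, g j), x j) | j <- enum 'I_n].
have gb := base_galg B d0 S_span.
have difx i : (i < ac_num B 0)%N -> exists2 s, mspan 1 s & dif (ac_var B 0 i 1) = iota' s.
 by move=> im; have [s Is ->] := ac_var_kill im; exists s => //; apply: ideal_mspan.
have absX : allP (cvars B 0) (fun v => absorbed base Jm (one v)).
 by apply: cvars_allP => i im; have [s hs es'] := difx i im; apply: absorbed_dif hs; rewrite /one cvar1.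
have indY : indep Jm (map snd es).
 move=> a [s hs]; rewrite /es -map_comp /=.
 have -> : lcB [seq x j | j <- enum 'I_n] (scal B a) = \sum_(j < n) a j *: x j.
  have -> : [seq x j | j <- enum 'I_n] = [seq (if insub j is Some m then x m else 0) | j <- iota 0 n].
   rewrite -val_enum_ord -map_comp; apply: eq_map => j /=; by rewrite valK.
  by rewrite lcB_iota; apply: eq_bigr => j _; rewrite add0n valK /scal -scalerAl mul1r.
 rewrite dif_sum => e i; rewrite size_map size_enum_ord => im.
 have : mspan 2 (\sum_(j < n) a j *: y j).
  have -> // : \sum_(j < n) a j *: y j = s; apply: (ac_incl_inj (a0 := B)); rewrite -e rmorph_sum.
  by apply: eq_bigr => j _; rewrite difZ (hx j).2; exact: linearZ.
 by move=> /indep_y/(_ (Ordinal im)).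
have pos : allP (cvars B 0) (fun v => 0 < v.1.1.1).
 by apply: allP_impl (cvars_deg B 0) => v ->.
have hes p : p \in es -> [/\ hom p.1 p.2, dec base base (cvars B 0) p.2, absorbed base Jm p.2 & 0 < p.1.1.1].
 move=> /mapP[j _ ->] /=; have [hj dj] := hx j; split=> //.
  have [c [w [Cc _ Cw _ ew]]] := spanL_low (galg_sub gb) (cvars_dps B 0) (isT : 0 < 1%:Z)
   (cvars_deg B 0) hj isT (hom_lev d0 S_span (i := 1) (t := (1, (d j)%:Z, g j)) erefl hj).
  by exists c; split=> //; rewrite ew addrAC subrr add0r.
 exact: absorbed_dif dj (mspan_y j).
have C0s (c : B) : base c -> hom 0 c -> exists a : k, c = a *: 1.
 by move=> _ hc; have [a [-> _]] := base_hom0 d0 S_span hc erefl erefl; exists a.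
have VJ (b : B) : base b -> Jm b by move=> [s ->]; exists 0; [exact: mspan0 | rewrite ac_incl_dif rmorph0].
have := @steinitz _ _ _ B _ (dpfamT B) base base Jm gb (base_dpclosed (dpfamT B)) gb (fun _ h => h) C0s Jm_gsub VJ es (cvars B 0) [::].
rewrite !cats0 => st.
have [R' [E [/= h1 h2 h3 h4 [h5 [h6 _]]]]] := st (cvars_dps B 0) (lev_free B 0) pos (allP_impl (fun _ _ => I) pos) absX indep_cvars indY hes.
have eE : ones E = [seq x j | j <- enum 'I_n].
 have := congr1 (map snd) h5; rewrite -!map_comp => e; rewrite -[RHS]e; by apply: eq_map.
case: R' h1 h2 h3 h4 h6 => [|v R'] h1 h2 h3 h4 h6.
 exists E; split=> //.
  by have := congr1 (map fst) h5; rewrite -!map_comp => e; rewrite -[RHS]e; apply: eq_map.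
 have -> : [seq dif (v.2 1) | v <- E] = map (dif (c := B)) (ones E) by rewrite /ones -map_comp.
 by rewrite eE -map_comp; apply: eq_map => j /=; rewrite (hx j).2.
(* The boundary of a leftover variable is congruent modulo m^2 to a combination of the y_j, so the
   variable depends on the x_j modulo [Jm]. *)
exfalso; have [i [im ev]] : exists i, (i < ac_num B 0)%N /\ one v = ac_var B 0 i 1.
 have hP : allP (cvars B 0) (fun v => exists i, (i < ac_num B 0)%N /\ one v = ac_var B 0 i 1).
  by apply: cvars_allP => i im; exists i; split=> //; rewrite /one cvar1.
 by case: (h6 _ hP).
have [s [p [hp es']] ds] := difx i im.
have [a [r [hr er]]] : exists (a : 'I_n -> k) r, mspan 2 r /\ s = \sum_j a j *: y j + r.
 rewrite es' /msum; elim: p hp {es'} => [|z p IH] /=.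
  exists (fun=> 0), 0; split; first exact: mspan0.
  by rewrite big_nil addr0 big1 // => j _; rewrite scale0r.
 move=> /andP[hz /IH[a [r [hr er]]]]; rewrite big_cons er.
 case: (ltnP (mabs z.2) 2) => z2; last first.
  exists a, (z.1 *: monomial y z.2 + r); split; last by rewrite addrCA.
  by apply: mspanD hr; apply/mspanZ/mspan_mono.
 have [j zj] : exists j, z.2 = dlt j.
  have [j zj] : exists j, (0 < z.2 j)%N.
   apply: contrapT => no; move: hz; rewrite /mabs big1 // => l _; apply/eqP; rewrite -leqn0 leqNgt.
   by apply/negP => zl; apply: no; exists l.
  exists j; apply/ffunP => l; rewrite ffunE; move: z2; rewrite /mabs (bigD1 j) //=.
  case: (eqVneq l j) => [->|lj]; first by move: zj; lia.
  by rewrite (bigD1 l) //=; move: zj; lia.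
 exists (fun l => a l + z.1 * (l == j)%:R), r; split=> //.
 rewrite addrA; congr (_ + _); under [RHS]eq_bigr do rewrite scalerDl.
 rewrite big_split /= addrC; congr (_ + _); rewrite (bigD1 j) //= eqxx mulr1 big1 ?addr0 => [|l /negbTE->].
  by rewrite zj monomial_dlt.
 by rewrite mulr0 scale0r.
pose c (l : nat) : k := if l is m.+1 then
 (if (m < size R')%N then 0 else if insub (m - size R')%N is Some j then - a j else 0) else 1.
have : Jm (lcB (ones (v :: R' ++ E)) (scal B c)).
 rewrite /= /ones map_cat lcB_cat -/(ones E) eE size_map.
 rewrite (@lcB_ext _ _ _ _ [seq one v0 | v0 <- R'] _ (fun=> 0)) => [|l]; last first.
  by rewrite size_map /scal /c => ->; rewrite scale0r.
 rewrite lcB0 add0r {1}/scal /c scale1r mul1r ev.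
 have -> : lcB [seq x j | j <- enum 'I_n] (fun l => scal B c (size R' + l).+1) = \sum_(j < n) (- a j) *: x j.
  have -> : [seq x j | j <- enum 'I_n] = [seq (if insub j is Some m then x m else 0) | j <- iota 0 n].
   rewrite -val_enum_ord -map_comp; apply: eq_map => j /=; by rewrite valK.
  rewrite lcB_iota; apply: eq_bigr => j _; rewrite add0n valK /scal /c ltnNge leq_addr /= addKn valK.
  by rewrite -scalerAl mul1r.
 exists r => //; rewrite difD ds er rmorphD rmorph_sum dif_sum addrAC -big_split /= big1 ?add0r // => j _.
 rewrite difZ (hx j).2 scaleNr.
 have -> : iota' (a j *: y j) = a j *: iota' (y j) :> B by exact: linearZ.
 by rewrite subrr.
by move=> /h4-/(_ 0%N isT)/eqP; rewrite /c oner_eq0.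
Qed.

End LevelOne.

End LevelOne.
Import LevelOne.

(** * The sets A, the monomials w_A and the substitution on Koszul complexes *)

Module IncidenceInvariant.

Section MonomialIdeal.
Variables (k : fieldType) (G : zmodType) (chi : alt_bicharacter G k) (n : nat) (g : 'I_n -> G).
Variables (R : algType k) (x : 'I_n -> R).
Hypothesis xC : forall i j, x i * x j = chi (g i) (g j) *: (x j * x i).
Notation mon := {ffun 'I_n -> nat}.
Hypothesis x_span : forall f : R, exists (r : seq mon) (c : mon -> k), f = \sum_(a <- r) c a *: monomial x a.
Hypothesis x_free : forall (r : seq mon) (c : mon -> k), uniq r ->
 \sum_(a <- r) c a *: monomial x a = 0 -> forall a, a \in r -> c a = 0.
Variables (s : nat) (m : 'I_s -> mon).
Definition mup (a : mon) : Prop := exists l, mle (m l) a.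
Definition msumR (p : seq (k * mon)) : R := \sum_(z <- p) z.1 *: monomial x z.2.

Lemma msumR_coef p : msumR p = 0 -> forall a, \sum_(z <- p | z.2 == a) z.1 = 0.
Proof.
move=> p0 a; pose c b := \sum_(z <- p | z.2 == b) z.1.
have e : \sum_(b <- undup (map snd p)) c b *: monomial x b = 0.
 rewrite -[RHS]p0 /msumR /c; under eq_bigr do rewrite scaler_suml.
 rewrite (exchange_big_dep xpredT) //=; apply: eq_big_seq => z zp.
 rewrite -big_filter (_ : [seq i <- _ | _] = [:: z.2]) ?big_seq1 //.
 have -> : [seq b <- undup (map snd p) | z.2 == b] = [seq b <- undup (map snd p) | pred1 z.2 b].
  by apply: eq_filter => b /=; rewrite eq_sym.
 by rewrite filter_pred1_uniq ?undup_uniq // mem_undup map_f.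
case: (boolP (a \in undup (map snd p))) => ap; first exact: (x_free (undup_uniq _) e).
rewrite big_seq_cond big1 // => z /andP[zp /eqP za].
by case/negP: ap; rewrite mem_undup -za map_f.
Qed.

Definition uspan (f : R) : Prop := exists p, (forall z, z \in p -> mup z.2) /\ f = msumR p.
Lemma uspanD f h : uspan f -> uspan h -> uspan (f + h).
Proof.
move=> [p [hp ->]] [q [hq ->]]; exists (p ++ q); rewrite /msumR big_cat; split=> // z.
by rewrite mem_cat => /orP[/hp|/hq].
Qed.
Lemma uspan0 : uspan 0. Proof. by exists [::]; rewrite /msumR big_nil. Qed.
Lemma uspanZ c f : uspan f -> uspan (c *: f).
Proof.
move=> [p [hp ->]]; exists [seq (c * z.1, z.2) | z <- p]; split; first by move=> z /mapP[w /hp hw ->].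
by rewrite /msumR big_map scaler_sumr; apply: eq_bigr => z _; rewrite scalerA.
Qed.
Lemma xmonoM a b : monomial x a * monomial x b =
 reorder (fun i j => chi (g i) (g j)) a b *: monomial x (a + b).
Proof. by apply: monomialM => i j; apply: xC. Qed.
Lemma uspan_mono a : mup a -> uspan (monomial x a).
Proof. by move=> ua; exists [:: (1, a)]; rewrite /msumR big_seq1 scale1r; split=> // z /[!inE]/eqP->. Qed.
Lemma mupD a b : mup a -> mup (a + b). Proof. by move=> [l ml]; exists l; apply: mleD. Qed.
Lemma uspanMr f h : uspan f -> uspan (f * h).
Proof.
move=> [p [hp ->]]; have [r [c ->]] := x_span h; rewrite /msumR mulr_suml.
elim: p hp => [|z p IH] hp; first by rewrite big_nil; apply: uspan0.
rewrite big_cons; apply: uspanD; last by apply: IH => w wp; apply: hp; rewrite in_cons wp orbT.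
rewrite mulr_sumr; elim/big_ind: _ => [||a _]; [exact: uspan0 | exact: uspanD |].
rewrite -scalerAl -scalerAr xmonoM !scalerA; apply/uspanZ/uspan_mono/mupD/hp; exact: mem_head.
Qed.
Lemma uspanMl f h : uspan f -> uspan (h * f).
Proof.
move=> [p [hp ->]]; have [r [c ->]] := x_span h; rewrite /msumR mulr_sumr.
elim: p hp => [|z p IH] hp; first by rewrite big_nil; apply: uspan0.
rewrite big_cons; apply: uspanD; last by apply: IH => w wp; apply: hp; rewrite in_cons wp orbT.
rewrite mulr_suml; elim/big_ind: _ => [||a _]; [exact: uspan0 | exact: uspanD |].
rewrite -scalerAl -scalerAr xmonoM !scalerA addrC; apply/uspanZ/uspan_mono/mupD/hp; exact: mem_head.
Qed.

Lemma ideal_uspan f : ideal_gen (fun u => exists2 l, l \in [set: 'I_s] & u = monomial x (m l)) f -> uspan f.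
Proof.
move=> [N [a [u [b [hu ->]]]]]; elim/big_ind: _ => [||l _]; [exact: uspan0 | exact: uspanD |].
apply: uspanMr; apply: uspanMl; have [l' _ ->] := hu l; apply: uspan_mono; by exists l'.
Qed.

Lemma uspan_coef p : uspan (msumR p) -> forall a, ~ mup a -> \sum_(z <- p | z.2 == a) z.1 = 0.
Proof.
move=> [q [hq e]] a na.
have : msumR (p ++ [seq (- z.1, z.2) | z <- q]) = 0.
 rewrite /msumR big_cat big_map /= -/(msumR p) e /msumR -big_split big1 //= => z _.
 by rewrite scaleNr subrr.
move=> /msumR_coef/(_ a); rewrite big_cat big_map /= sumrN.
rewrite [X in _ - X]big_seq_cond [X in _ - X]big1 ?subr0 // => z /andP[/hq uz /eqP za].
by case: na; rewrite -za.
Qed.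

Lemma mle_split (a b : mon) : mle a b -> exists c, b = a + c.
Proof.
move=> ab; exists [ffun j => (b j - a j)%N]; apply/ffunP => j; rewrite !ffunE.
by rewrite -[RHS]/(addn _ _) subnKC.
Qed.

End MonomialIdeal.

Section Incidence.
Variables (s n : nat) (m : 'I_s -> {ffun 'I_n -> nat}).
Notation mon := {ffun 'I_n -> nat}.
Implicit Types (A x : {set 'I_s}).

Definition mbound : nat := (\sum_l \sum_j m l j)%N.
(* [m l] is the sum of the [einc A] over the [A] containing [l]: the power of x_j with exponent level t
 is attributed to the set of all [l] with t < m l j. *)
Definition einc A : mon :=
 [ffun j => if A == set0 then 0%N else (\sum_(t < mbound) ([set l | t < m l j] == A))%N].
Definition Dinc : {set {set 'I_s}} := [set A | [exists j, (0 < einc A j)%N]].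
(** The exponent of the lcm of the m l with l in x. *)
Definition maxexp x : mon := [ffun j => \max_(l in x) m l j].

Lemma m_bound l j : (m l j <= mbound)%N.
Proof. by rewrite /mbound (bigD1 l) //= (bigD1 j) //=; lia. Qed.

Lemma sum_lt M N : (\sum_(t < M) (t < N) = minn M N)%N.
Proof. by elim: M => [|M IH]; rewrite ?big_ord0 ?min0n // big_ord_recr /= IH; lia. Qed.

(** The lcm over x is the product of the w_A with A meeting x. Exponents are counted by levels:
    level t of x_j belongs to a single set A, and that set meets x exactly when some l in x has
    exponent above t at j. *)
Lemma maxexpE x j : (\sum_(A | A :&: x != set0) einc A j = maxexp x j)%N.
Proof.
have -> : maxexp x j = (\sum_(t < mbound) (t < maxexp x j))%N.
 rewrite sum_lt; have : (maxexp x j <= mbound)%N; last by lia.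
 by rewrite ffunE; apply/bigmax_leqP => l _; apply: m_bound.
have -> : (\sum_(A | A :&: x != set0) einc A j =
  \sum_(A | A :&: x != set0) \sum_(t < mbound) ([set l | (t < m l j)%N] == A))%N.
 apply: eq_bigr => A Ax; rewrite ffunE; case: eqP => // A0.
 by rewrite A0 set0I eqxx in Ax.
rewrite exchange_big /=; apply: eq_bigr => t _; set L := [set l | _].
have Lx : (L :&: x != set0) = (t < maxexp x j)%N.
 apply/set0Pn/idP => [[l /setIP[/[!inE] tl lx]]|]; rewrite ffunE.
  by apply: leq_trans tl _; rewrite (bigD1 l) //= leq_maxl //.
 move=> tM; apply: contrapT => no; move: tM; rewrite ltnNge => /negP; apply.
 apply/bigmax_leqP => l lx; rewrite leqNgt; apply/negP => tl; apply: no; exists l.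
 by rewrite !inE tl.
rewrite -Lx big_mkcond (bigD1 L) //= big1 ?addn0; last first.
 by move=> A AL; rewrite [L == A]eq_sym (negbTE AL) if_same.
by rewrite eqxx; case: ifP.
Qed.

Lemma maxexp1 l : maxexp [set l] = m l.
Proof. by apply/ffunP => j; rewrite ffunE big_set1. Qed.
Lemma mle_maxexpU x x' a : mle (maxexp (x :|: x')) a <-> mle (maxexp x) a /\ mle (maxexp x') a.
Proof.
split=> [h|[h h'] j].
 by split=> j; apply: leq_trans (h j); rewrite !ffunE; apply/bigmax_leqP => l lx;
  rewrite (bigD1 l) ?inE ?lx ?orbT //= leq_maxl.
rewrite ffunE; apply/bigmax_leqP => l /setUP[lx|lx].
 by apply: leq_trans (h j); rewrite ffunE (bigD1 l) //= leq_maxl.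
by apply: leq_trans (h' j); rewrite ffunE (bigD1 l) //= leq_maxl.
Qed.
End Incidence.

Section Indicator.
Variables (s : nat) (D : {set {set 'I_s}}).
Notation nA := #|{set 'I_s}|.
Notation mon := {ffun 'I_nA -> nat}.
(** The product of the y_A with A in D meeting x, which is the lcm of the squarefree generators with
    index in x: the counterpart of [maxexp] under [maxexpE]. *)
Definition pind (x : {set 'I_s}) : mon := [ffun i => ((enum_val i \in D) && (enum_val i :&: x != set0) : nat)].
Definition Eind (a : mon) : bool := ~~ [exists l, [forall i, (pind [set l] i <= a i)%N]].
Definition singles : seq {set 'I_s} := [seq [set l] | l <- enum 'I_s].

Lemma upset_singles N (r : {set 'I_s} -> {ffun 'I_N -> nat}) a : upset r singles a <-> exists l, mle (r [set l]) a.
Proof.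
rewrite /singles; split.
 by elim: (enum _) => //= l r' IH [h|/IH]; [exists l|].
move=> [l h]; have : l \in enum 'I_s by rewrite mem_enum.
by elim: (enum _) => //= l' r' IH; rewrite in_cons => /predU1P[<-|/IH]; [left|right].
Qed.

Lemma Eind_upset a : ~~ Eind a <-> upset pind singles a.
Proof.
rewrite upset_singles /Eind negbK; split=> [/existsP[l /forallP h]|[l h]]; first by exists l.
by apply/existsP; exists l; apply/forallP.
Qed.
Lemma Eind_down a b : Eind (a + b) -> Eind a.
Proof.
apply: contra => /existsP[l /forallP h]; apply/existsP; exists l; apply/forallP => i.
rewrite [(a + b) i]ffunE; apply: leq_trans (h i) _; exact: leq_addr.
Qed.
Lemma pindU x x' a : mle (pind (x :|: x')) a <-> mle (pind x) a /\ mle (pind x') a.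
Proof.
have e i : (enum_val i :&: (x :|: x') != set0) = (enum_val i :&: x != set0) || (enum_val i :&: x' != set0).
 by rewrite setIUr setU_eq0 negb_and.
split=> [h|[h h'] i].
 by split=> i; apply: leq_trans (h i); rewrite !ffunE e; case: (_ \in _) => //=; do 2!case: (_ != _).
have := h i; have := h' i; rewrite !ffunE e; case: (_ \in _) => //=; by do 2!case: (_ != _).
Qed.
End Indicator.

Section Base.
Variables (k : fieldType) (G : zmodType) (chi : alt_bicharacter G k) (s : nat).
Notation T := (tridegree G).
Notation nA := #|{set 'I_s}|.
Variables (D : {set {set 'I_s}}) (h : {ffun {set 'I_s} -> G}) (E0 : Eind D 0).
Definition gA (i : 'I_nA) : G := h (enum_val i).
Notation Edown := (@Eind_down s D).
Notation Su := (@skew_dga k G chi nA gA (Eind D) E0 Edown).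
Notation cycU := (@kos_cycles k G chi nA gA (Eind D) E0 Edown).

Lemma vbd_ex (I : eqType) (K : color_dga chi) (L : seq (var K)) (F : I -> T * K) (r : seq I) : dpsL L ->
 map (@vbd _ _ _ K) L = map F r -> forall j, j \in r -> exists x, hom (F j).1 x /\ dif x = (F j).2.
Proof.
elim: L r => [|v L IH] [|i r] //= [dv dL] [e1 /IH IH'] j; rewrite in_cons => /predU1P[->|]; last exact: IH'.
by rewrite -e1; exists (v.2 1); split=> //; apply: dps_hom1.
Qed.

(** In the Koszul complex the indeterminates are boundaries and the adjoined variables have positive
    degree, so a map to k sends all of them to 0. *)
Lemma eps_base_eq (Ku : color_dga chi) (iu : Su -> Ku) Lu (e e' : Ku -> base_dga chi) :
 tower iu cycU Lu -> allP Lu (fun v => 0 < v.1.1.1) -> is_dmap e -> is_dmap e' -> forall b, e b = e' b.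
Proof.
move=> tw pos he he'; have hi := tw_dmap tw.
have kill (f : Ku -> base_dga chi) : is_dmap f -> forall j, f (iu (smono chi gA E0 Edown (dlt j))) = 0.
 move=> hf j; have := tw_bd tw; rewrite /kos_cycles -map_comp => /vbd_ex-/(_ (tw_dps tw) j).
 case=> [|x [_ /= <-]]; first by rewrite mem_enum.
 by rewrite (dmap_dif hf).
move=> b; apply: (dmap_eq_gen he he' (C := image iu (@full _ _ _ Su)) (L := Lu)) (tw_gen tw b).
 move=> _ [f _ ->]; apply: (skew_dmap_eq (dmap_comp hi he) (dmap_comp hi he')) => j /=.
 by rewrite !kill.
elim: (Lu) (tw_dps tw) pos => //= v L IH [dv dL] [v0 pL]; congr (_ :: _); last exact: IH.
have z (f : Ku -> base_dga chi) l : is_dmap f -> f (v.2 l) = if l == 0%N then 1 else 0.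
 move=> hf; case: (boolP (dpow_ok (vodd v) l)) => ol; last first.
  by rewrite (dps_out dv) // (dmap0 hf); case: l ol => //; rewrite /dpow_ok implybT.
 case: l ol => [|l] ol; first by rewrite (dps0 dv) (dmap1 hf).
 have [e0|//] := dmap_hom hf (dps_hom dv ol); exfalso.
 move: (congr1 (fun t : T => t.1.1) e0); rewrite tdegMn1 => /eqP.
 by rewrite mulrn_eq0 /= (gt_eqF v0).
by rewrite /vmap; congr (_, _); apply/funext => l; rewrite !z.
Qed.

Section Map.
Variables (n' : nat) (g' : 'I_n' -> G) (m : 'I_s -> {ffun 'I_n' -> nat}).
Notation mon' := {ffun 'I_n' -> nat}.
Notation sm := (@smono k G chi n' g' predT isT (fun _ _ _ => isT)).
Notation smA := (@smono k G chi nA gA predT isT (fun _ _ _ => isT)).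
Notation SP := (skew_poly chi g').
Notation cyc' := (@kos_cycles k G chi n' g' predT isT (fun _ _ _ => isT)).
Notation cycA := (@kos_cycles k G chi nA gA predT isT (fun _ _ _ => isT)).
Hypotheses (mD : D = Dinc m) (mh : forall A, A \in D -> h A = \sum_j g' j *+ einc m A j).
Variables (K' : color_dga chi) (i' : SP -> K') (L' : seq (var K')) (tw' : tower i' cyc' L').
Variables (K : color_dga chi) (i : skew_poly chi gA -> K) (L : seq (var K)) (tw : tower i cycA L).
Notation ev j := (enum_val j : {set 'I_s}).

(** The source ring has one indeterminate for every set A; those outside D occur in no generator and
    go to 0. *)
Definition wA (j : 'I_nA) : K' := if ev j \in D then i' (sm (einc m (ev j))) else 0.

Lemma mdeg_einc A : A \in D -> mdeg g' (einc m A) = (0, 0, h A).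
Proof.
move=> AD; rewrite (mh AD) [mdeg _ _]surjective_pairing [(mdeg _ _).1]surjective_pairing.
rewrite mdeg_hom mdeg_int; congr (_, _); rewrite /mdeg.
by elim/big_rec2: _ => //= l a b _ <-; congr (_ + _); elim: (einc m A l) => // q IH; rewrite !mulrS /= IH.
Qed.

Lemma wA_hom j : hom (0, 0, gA j) (wA j).
Proof.
rewrite /wA; case: ifP => jD; last exact: hom0.
rewrite -(mdeg_einc jD); apply: (dmap_hom (tw_dmap tw')); exact: smono_hom.
Qed.

(** For A in D some x_l divides w_A, and w_A is the boundary of a multiple of (w_A / x_l) times the
    Koszul variable of x_l. *)
Lemma wA_bd j : exists b, hom (1, 0, gA j) b /\ dif b = wA j.
Proof.
rewrite /wA; case: ifP => jD; last by exists 0; split; [exact: hom0 | rewrite dif0].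
have hi' := tw_dmap tw'.
have [l el] : exists l, (0 < einc m (ev j) l)%N by apply/existsP; move: jD; rewrite mD inE.
have [e0 ee] := mon_pred el.
have := tw_bd tw'; rewrite /kos_cycles -map_comp => /vbd_ex-/(_ (tw_dps tw') l).
case=> [|x [hx dx]]; first by rewrite mem_enum.
rewrite /= in hx dx; set r := reorder (fun i j => chi (g' i) (g' j)) e0 (dlt l).
have r0 : r != 0 by apply: reorder_neq0.
have he0 := dmap_hom hi' (smono_hom chi g' isT (fun _ _ _ => isT) e0).
exists (r^-1 *: (i' (sm e0) * x)); split.
 apply: homZ; have := homM he0 hx; congr hom.
 have := mdeg_einc jD; rewrite ee mdegD mdeg_dlt => /(congr1 (fun t : T => t + (1, 0, 0))).
 move=> e; transitivity ((0, 0, h (ev j)) + (1, 0, 0) : T); last by rewrite /GRing.add /= /add_pair /= !add0r addr0.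
 rewrite -e -addrA; congr (_ + _); by rewrite /GRing.add /= /add_pair /= !add0r addr0.
have e00 : (mdeg g' e0).1.1 = 0 by apply: mdeg_hom.
rewrite difZ (dif_homM _ he0) (dif_hom0 _ he0) // mul0r add0r e00 expr0z scale1r.
by rewrite dx -(dmapM hi') smonoM -ee (dmapZ hi') scalerA mulVf // scale1r.
Qed.

(** The exponent obtained by substituting the w_A for the y_A in the monomial with exponent a. *)
Definition evm (a : {ffun 'I_nA -> nat}) : mon' := [ffun l => (\sum_j a j * einc m (ev j) l)%N].

Lemma wA_monomial a : (monomial wA a = 0 /\ exists j, (0 < a j)%N /\ ev j \notin D) \/
 (forall j, (0 < a j)%N -> ev j \in D) /\ exists2 c : k, c != 0 & monomial wA a = c *: i' (sm (evm a)).
Proof.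
have hi' := tw_dmap tw'.
pose ev' (r : seq 'I_nA) : mon' := [ffun l => (\sum_(j <- r) a j * einc m (ev j) l)%N].
suff H : forall r : seq 'I_nA, (\prod_(j <- r) wA j ^+ a j = 0 /\ exists j, (0 < a j)%N /\ ev j \notin D) \/
 (forall j, j \in r -> (0 < a j)%N -> ev j \in D) /\
 exists2 c : k, c != 0 & \prod_(j <- r) wA j ^+ a j = c *: i' (sm (ev' r)).
 case: (H (index_enum _)) => [|[aD ex]]; [by left | right; split=> // j; exact: aD (mem_index_enum j)].
move=> r; elim: r => [|j r IH].
 right; split=> //; exists 1; rewrite ?oner_neq0 // big_nil scale1r.
 have -> : ev' [::] = 0 by apply/ffunP => l; rewrite !ffunE big_nil.
 by rewrite smono0 (dmap1 hi').
have pw q : exists2 c : k, c != 0 & i' (sm (einc m (ev j))) ^+ q =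
  c *: i' (sm [ffun l => (q * einc m (ev j) l)%N]).
 elim: q => [|q [c c0 IHq]].
  exists 1; rewrite ?oner_neq0 // expr0 scale1r.
  have -> : [ffun l => (0 * einc m (ev j) l)%N] = 0 :> mon' by apply/ffunP => l; rewrite !ffunE mul0n.
  by rewrite smono0 (dmap1 hi').
 eexists; last first.
  rewrite exprS IHq -scalerAr -(dmapM hi') smonoM (dmapZ hi') scalerA; congr (_ *: i' (sm _)).
  by apply/ffunP => l; rewrite !ffunE -[LHS]/(addn _ _) mulSn.
 by rewrite mulf_neq0 ?reorder_neq0.
rewrite big_cons; case: IH => [[-> ex]|[aD [c c0 ->]]]; first by left; rewrite mulr0.
case: (boolP (ev j \in D)) => jD; last first.
 case: (posnP (a j)) => aj; last first.
  by left; split; [rewrite /wA (negbTE jD) expr0n gtn_eqF // mul0r | exists j].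
 right; split; first by move=> j'; rewrite in_cons => /predU1P[->|/aD//]; rewrite aj.
 exists c => //; rewrite aj expr0 mul1r; congr (_ *: i' (sm _)).
 by apply/ffunP => l; rewrite !ffunE big_cons aj mul0n.
right; split; first by move=> j'; rewrite in_cons => /predU1P[->|/aD].
rewrite /wA jD; have [c' c'0 ->] := pw (a j); eexists; last first.
 rewrite -scalerAl -scalerAr scalerA -(dmapM hi') smonoM (dmapZ hi') scalerA; congr (_ *: i' (sm _)).
 apply/ffunP => l; rewrite [RHS]ffunE big_cons [LHS]ffunE [X in X + _]ffunE; congr (_ + _)%N; by rewrite [LHS]ffunE.
by rewrite !mulf_neq0 ?reorder_neq0.
Qed.

Lemma mle_evm x (a : {ffun 'I_nA -> nat}) : (forall j, (0 < a j)%N -> ev j \in D) -> mle (pind D x) a -> mle (maxexp m x) (evm a).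
Proof.
move=> aD ha l; rewrite -maxexpE ffunE (reindex_onto enum_val enum_rank) /=; last first.
 by move=> A _; rewrite enum_rankK.
rewrite big_mkcond; apply: leq_sum => j _; rewrite enum_valK eqxx andbT; case: ifP => // jx.
case: (boolP (ev j \in D)) => jD.
 by have := ha j; rewrite ffunE jD jx /=; case: (a j) => // q _; rewrite mulSn leq_addr.
have -> // : einc m (ev j) l = 0%N; apply/eqP; rewrite -leqn0 leqNgt; apply: contra jD => el.
by rewrite mD inE; apply/existsP; exists l.
Qed.

Lemma evm_pind x : evm (pind D x) = maxexp m x.
Proof.
apply/ffunP => l; rewrite -maxexpE ffunE [RHS](reindex_onto enum_val enum_rank) /=; last first.
 by move=> A _; rewrite enum_rankK.
rewrite [RHS]big_mkcond; apply: eq_bigr => j _; rewrite enum_valK eqxx andbT ffunE.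
case: (boolP (ev j \in D)) => jD /=; first by case: ifP; rewrite ?mul1n ?mul0n.
have -> : einc m (ev j) l = 0%N; last by rewrite muln0 if_same.
apply/eqP; rewrite -leqn0 leqNgt; apply: contra jD => el.
by rewrite mD inE; apply/existsP; exists l.
Qed.

(** Induced by y_A -> w_A. By [evm_pind] lcms go to lcms, and by [mle_evm] multiples go to multiples
    or to 0: the two conditions of [cone_upset]. *)
Lemma F_ex : exists F : K -> K', [/\ is_dmap F,
 forall x a, mle (pind D x) a -> kspan i' L' (mle (maxexp m x)) (F (i (smA a))) &
 forall x, exists2 c : k, c != 0 & F (i (smA (pind D x))) = c *: i' (sm (maxexp m x))].
Proof.
have [f [hf fE]] := @skew_univ k G chi nA gA predT isT (fun _ _ _ => isT) K' wA wA_hom (fun _ h => False_ind _ (notF h)).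
have /choice[b hb] := wA_bd.
pose ys : seq (var K') := [seq ((1, 0, gA j), odd_var (b j)) | j <- enum 'I_nA].
have dys : dpsL ys.
 rewrite /ys; elim: (enum _) => //= j r IH; split=> //; apply: odd_var_dps => //; exact: (hb j).1.
have [|F [hF Fi FL]] := tw_univ tw hf dys.
 by rewrite /ys /kos_cycles -!map_comp; apply: eq_map => j /=; rewrite /vbd /zmap /= (hb j).2 fE.
have fa a : exists2 c : k, c != 0 & F (i (smA a)) = c *: monomial wA a.
 have [c c0 e] := skew_dmap_smono a hf; exists c => //; rewrite Fi e; congr (_ *: monomial _ a).
 by apply/funext => j; rewrite fE.
exists F; split=> // [x a xa|x].
 have [c _ ->] := fa a; have gk := kspan_gsub tw' (mle (maxexp m x)); apply: (gsubZ gk).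
 have [[-> _]|[aD [c' _ e]]] := wA_monomial a; first exact: (gsub0 gk).
 rewrite e; apply: (gsubZ gk); apply: spanL_incl; [exact: isset_gsub tw' _ | exact: tw_dps tw' |].
 exists (sm (evm a)) => //; rewrite -[sm _]scale1r; apply: sset_smono; exact: mle_evm.
have [c c0 ->] := fa (pind D x).
have [[_ [j [aj jD]]]|[_ [c' c'0 ->]]] := wA_monomial (pind D x).
 by move: aj; rewrite ffunE (negbTE jD).
by exists (c * c'); rewrite ?mulf_neq0 // scalerA evm_pind.
Qed.
End Map.
End Base.

End IncidenceInvariant.
Import IncidenceInvariant.

(** * Divided powers respected by a class of derivations *)

Module CompatibleDerivations.

Section Good.
Variables (k : fieldType) (G : zmodType) (chi : alt_bicharacter G k).
Notation T := (tridegree G).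
Variable B : color_dga chi.
Notation fullB := (@full _ _ _ B).
Variable DS : T -> (B -> B) -> Prop.
Hypothesis DSf : forall u D, DS u D -> fder (id : B -> B) fullB u D.

Definition good (t : T) (x : nat -> B) : Prop := even_deg t -> forall u D, DS u D ->
 forall l, D (x l.+1) = D (x 1) * x l.

Lemma gsub_full : gsub fullB. Proof. exact: galg_sub (full_galg _). Qed.

Section OneDer.
Variables (u : T) (D : B -> B) (hD : fder (id : B -> B) fullB u D).
Lemma gD_L c a b : D (c *: a + b) = c *: D a + D b. Proof. exact: (fd_lin hD). Qed.
Lemma gD_M t a b : hom t a -> D (a * b) = D a * b + csign chi u t *: (a * D b).
Proof. by move=> ha; rewrite (fd_mul hD) //= (ctw_hom u ha) scalerAl. Qed.
Lemma gD_hom t a : hom t a -> hom (t + u) (D a). Proof. exact: (fd_hom hD I). Qed.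
Lemma gD_1 : D 1 = 0. Proof. exact: (sder1 gD_M). Qed.
End OneDer.

(** The operations that produce the divided powers of exchanged variables preserve this
    compatibility, so derivations respect the new variables as they do the old ones. *)
Lemma dpfam_good : dpfam good.
Proof.
split=> [t et _|t x w et hx hw gx gw _|e r c Y ee er hc hY gY _|t x c et hx gx _|t x l et l0 hx gx _|e r c b oe or hc hb _|t b ot _ et] u D dsD q;
 last (by rewrite et in ot); have hD := DSf dsD.
- by rewrite /zero_dps /= (sder0 (gD_L hD)) mul0r.
- exact: (star_der (gD_L hD) (gD_hom hD) (gD_M hD) et hx hw (gx et _ _ dsD) (gw et _ _ dsD) q).
- exact: (scale_der (gD_L hD) (gD_hom hD) (gD_M hD) ee er hc hY (gY er _ _ dsD) q).
- by rewrite expr1 !(sderZ (gD_L hD)) (gx et _ _ dsD) -scalerAl -scalerAr scalerA exprS.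
- exact: (pow_der (gD_L hD) et l0 hx (gx et _ _ dsD) q).
exact: (odd_mul_der (gD_L hD) (gD_hom hD) (gD_M hD) oe or hc hb q).
Qed.
End Good.

End CompatibleDerivations.
Import CompatibleDerivations.

(** * Level 1 of a closure and the Koszul complex of the invariant *)

Module KoszulModel.

Section Flatten.
Variables (k : fieldType) (G : zmodType) (chi : alt_bicharacter G k) (X : color_dga chi).
Definition fl (v : var X) : var (collapse X) := (flat v.1, v.2).
Lemma spanL_fl C (L : seq (var X)) : spanL (B := collapse X) C (map fl L) = spanL (B := X) C L.
Proof. by elim: L C => //= v L IH C; rewrite IH. Qed.
Lemma freeL_fl C (L : seq (var X)) : freeL C L -> freeL (B := collapse X) C (map fl L).
Proof. by elim: L C => //= v L IH C [h1 h2]; split=> //; apply: IH. Qed.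
Lemma dpsL_fl (L : seq (var X)) : dpsL L -> dpsL (B := collapse X) (map fl L).
Proof. by elim: L => //= v L IH [h1 h2]; split; [apply: dps_collapse | apply: IH]. Qed.
End Flatten.

Section KoszulBase.
Variables (k : fieldType) (s : nat) (G : zmodType) (chi : alt_bicharacter G k).
Notation T := (tridegree G).
Variable Q : monomial_quotient s chi.
Notation n := (mq_n Q).
Notation x := (@mq_x _ _ _ _ Q).
Notation g := (@mq_g _ _ _ _ Q).
Notation d := (@mq_d _ _ _ _ Q).
Notation y := (fun i => mq_proj Q (x i)).
Notation mon := {ffun 'I_n -> nat}.

Lemma mono_proj a : mq_proj Q (monomial x a) = monomial y a.
Proof. by rewrite /monomial rmorph_prod; apply: eq_bigr => i _; rewrite rmorphXn. Qed.

Lemma mqZ c f : mq_proj Q (c *: f) = c *: mq_proj Q f. Proof. exact: linearZ. Qed.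
Lemma mq_sum (I : Type) (r : seq I) (F : I -> mq_R Q) : mq_proj Q (\sum_(i <- r) F i) = \sum_(i <- r) mq_proj Q (F i).
Proof. exact: raddf_sum. Qed.
Lemma mqM a b : mq_proj Q (a * b) = mq_proj Q a * mq_proj Q b. Proof. exact: rmorphM. Qed.

Lemma mq_span (f : mq_S Q) : exists (r : seq mon) (c : mon -> k), f = \sum_(a <- r) c a *: monomial y a.
Proof.
have [h ->] := mq_proj_surj f; have [r [c ->]] := skew_span (mq_poly Q) h; exists r, c.
by rewrite mq_sum; apply: eq_bigr => a _; rewrite mqZ mono_proj.
Qed.

Lemma mq_xC i j : x i * x j = chi (g i) (g j) *: (x j * x i).
Proof. by rewrite (skew_comm (mq_poly Q)) (color_bichar (mq_colors Q)). Qed.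

Lemma mq_yC i j : y i * y j = chi (g i) (g j) *: (y j * y i).
Proof. by rewrite /= -!mqM mq_xC mqZ. Qed.

Definition min_exponents (m : 'I_s -> mon) : Prop := (forall l, (2 <= \sum_i m l i)%N) /\
 forall r, mq_I r <-> ideal_gen (fun u => exists2 l, l \in [set: 'I_s] & u = monomial x (m l)) r.

Lemma min_exponents_ex : exists m, min_exponents m.
Proof. by have [m [m2 mg]] := mq_min_gen Q; exists m; split=> //; exact: (iffRL (mg _) erefl). Qed.

Variables (m : 'I_s -> mon) (hm : min_exponents m).

Lemma mq_kerU (p : seq (k * mon)) : msum y p = 0 -> forall a, ~ mup m a -> \sum_(z <- p | z.2 == a) z.1 = 0.
Proof.
move=> p0; apply: (uspan_coef (skew_free (mq_poly Q)) (x := x) (m := m)).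
apply: (ideal_uspan mq_xC (skew_span (mq_poly Q))); apply/hm.2/mq_proj_ker.
rewrite -[RHS]p0 /msum /msumR mq_sum; apply: eq_bigr => z _.
by rewrite mqZ mono_proj.
Qed.

Lemma mq_U2 a : mup m a -> (2 <= \sum_i a i)%N.
Proof. by move=> [l ml]; apply: leq_trans (hm.1 l) _; apply: leq_sum => i _; apply: ml. Qed.

Lemma mq_mup0 a : mup m a -> monomial y a = 0.
Proof.
move=> [l /mle_split[b ->]]; rewrite -mono_proj; apply/mq_proj_ker/hm.2.
exists 1%N, (fun=> 1), (fun=> monomial x (m l)),
 (fun=> (reorder (fun i j => chi (g i) (g j)) (m l) b)^-1 *: monomial x b).
split; first by move=> _; exists l.
rewrite big_ord1 mul1r -scalerAr (monomialM (q := fun i j => chi (g i) (g j))) ?scalerA ?mulVf ?scale1r //; last exact: mq_xC.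
exact: reorder_neq0.
Qed.

Variables (X : acyclic_closure Q).
Notation Lev := (lev (@base _ _ _ _ _ _ _ _ X) (@cvars _ _ _ _ _ _ _ _ X)).
Notation iota' := (ac_incl X).
Variables (D : {set {set 'I_s}}) (h : {ffun {set 'I_s} -> G}) (E0 : Eind D 0).
Hypotheses (mD : D = Dinc m) (mh : forall A, A \in D -> h A = \sum_j g j *+ einc m A j).
Notation Su := (@skew_dga k G chi _ (gA h) (Eind D) E0 (@Eind_down s D)).
Variables (Ku : color_dga chi) (iu : Su -> Ku) (Lu : seq (var Ku)).
Hypothesis twu : tower iu (@kos_cycles k G chi _ (gA h) (Eind D) E0 (@Eind_down s D)) Lu.
Notation smg := (@smono k G chi _ g predT isT (fun _ _ _ => isT)).

Theorem koszul_base : exists psi : Ku -> collapse X, is_dmap psi /\ cone psi (@full _ _ _ Ku) (Lev 1).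
Proof.
have [K' [i' [L' tw']]] := tower_ex (@kos_cycles_ok k G chi _ g predT isT (fun _ _ _ => isT)).
have [K [i [L tw]]] := tower_ex (@kos_cycles_ok k G chi _ (gA h) predT isT (fun _ _ _ => isT)).
have [F [hF Fle Fp]] := F_ex mD mh tw' tw.
have d0 := @mq_d_gt0 _ _ _ _ Q.
have [E [dE fE sE E1 Ed]] := level_one X d0 mq_span mq_yC mq_kerU mq_U2.
have [f0 [hf0 f0E]] := @skew_univ k G chi _ g predT isT (fun _ _ _ => isT) (collapse X)
 (fun j => iota' (y j)) (fun j => chom_hom (ac_incl_hom X j)) (fun _ h => False_ind _ (notF h)).
(* With the variables E, level 1 is the image of the Koszul complex of the polynomial ring; q sends
   each monomial to a nonzero multiple of its class in S. *)
have [||q [hq qi qL]] := tw_univ tw' hf0 (ys := map (@fl _ _ _ X) E).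
- exact: dpsL_fl.
- have eE : [seq (v.1, dif (v.2 1)) | v <- E] = [seq ((1, (d j)%:Z, g j), iota' (y j)) | j <- enum 'I_n].
  elim: (E) (enum _) E1 Ed => [|v E' IH] [|j r] //= [-> e1] [-> e2]; congr (_ :: _); exact: IH.
 transitivity [seq (flat z.1, z.2) | z <- [seq (v.1, dif (v.2 1)) | v <- E]]; first by rewrite -!map_comp.
 rewrite eE /kos_cycles -!map_comp; apply: eq_map => j; by rewrite /zmap /= f0E.
have /choice[cc hcc] : forall a, exists c : k, c != 0 /\ q (i' (smg a)) = c *: iota' (monomial y a).
 move=> a; have [c c0 e] := skew_dmap_smono a hf0; exists c; split=> //; rewrite qi e; congr (_ *: _).
 have -> : (fun j => f0 (smg (dlt j))) = (fun j => iota' (y j) : collapse X) by apply/funext => j; rewrite f0E.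
 by rewrite /monomial rmorph_prod; apply: eq_bigr => j _; rewrite rmorphXn.
have H f : exists p : seq (k * mon), q (i' f) = iota' (msum y p) /\
  forall a, \sum_(z <- p | z.2 == a) z.1 = cc a * scoef f a.
 elim/skew_ind: f => [|f1 f2 [p1 [e1 h1]] [p2 [e2 h2]]|c a _].
 - exists [::]; split; first by rewrite (dmap0 (tw_dmap tw')) (dmap0 hq) /msum big_nil rmorph0.
  move=> a; rewrite big_nil; have := scoefL (-1) (0 : skew_poly chi g) 0 a.
  by rewrite scaler0 addr0 mulN1r addNr => ->; rewrite mulr0.
 - exists (p1 ++ p2); split.
   rewrite (dmapD (tw_dmap tw')) (dmapD hq) e1 e2 -[RHS]/(iota' _ : X) /msum big_cat; by rewrite [RHS]rmorphD.
  by move=> a; rewrite big_cat /= h1 h2 -mulrDr; have := scoefL 1 f1 f2 a; rewrite !scale1r !mul1r => e3; congr (_ * _); exact: esym e3.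
 exists [:: (c * cc a, a)]; split.
  rewrite (dmapZ (tw_dmap tw')) (dmapZ hq) (hcc a).2 /msum big_seq1 scalerA.
  by symmetry; apply: linearZ.
 move=> b; rewrite big_cons big_nil.
 have s0 : scoef (0 : skew_poly chi g) b = 0.
  by have := scoefL (-1) (0 : skew_poly chi g) 0 b; rewrite scaler0 addr0 mulN1r addNr.
 have e4 : scoef (c *: smg a) b = c * (b == a)%:R.
  have := scoefL c (smg a) 0 b; rewrite addr0 s0 addr0 => ->; congr (_ * _); exact: scoef_smono.
 transitivity (cc b * (c * (b == a)%:R)); last by rewrite -e4.
 by rewrite /= eq_sym; case: eqP => [->|_]; rewrite ?mulr1 ?mulr0 ?addr0 // mulrC.
have eb : image q (image i' (@full _ _ _ _)) = @base _ _ _ _ _ _ _ _ X.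
 apply/funext => b; apply/propext; split=> [[_ [f _ ->] ->]|[t ->]].
  by have [p [-> _]] := H f; exists (msum y p).
 have gI : gsub (image q (image i' (@full _ _ _ _))).
  apply: image_gsub => //; apply: image_gsub; [exact: tw_dmap tw' | exact: galg_sub (full_galg _)].
 have [r [c ->]] := mq_span t; rewrite -[iota' _]/(iota' _ : collapse X).
 have -> : iota' (\sum_(a <- r) c a *: monomial y a) = \sum_(a <- r) c a *: iota' (monomial y a) :> collapse X.
  rewrite -[LHS]/(iota' _ : X) raddf_sum; apply: eq_bigr => a _; exact: linearZ.
 apply: (gsub_sum gI) => a _; apply: (gsubZ gI); have [c0 e] := hcc a.
 have -> : iota' (monomial y a) = (cc a)^-1 *: q (i' (smg a)) :> collapse X.
  by rewrite e scalerA mulVf // scale1r.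
 by apply: (gsubZ gI); exists (i' (smg a)) => //; exists (smg a).
have ups a : upset (maxexp m) (singles s) a <-> mup m a.
 by rewrite upset_singles; split=> -[l hl]; exists l; move: hl; rewrite maxexp1.
have := @koszul_cone k G chi _ _ (gA h) g K K' Ku (collapse X) i i' L L' tw tw' F hF
 _ (@setU _) (pind D) (maxexp m) (singles s) (@pindU s D) (@mle_maxexpU s n m) Fle Fp
 (Eind D) E0 (@Eind_down s D) (@Eind_upset s D) iu Lu twu q hq.
rewrite eb qL spanL_fl sE; apply.
- move=> f q0 a /ups ua; have [p [e hp]] := H f.
 have p0 : msum y p = 0 by apply: (ac_incl_inj (a0 := X)); rewrite rmorph0 -[LHS]e q0.
 by have := hp a; rewrite (mq_kerU p0 ua) => /esym/eqP; rewrite mulf_eq0 (negbTE (hcc a).1) => /eqP.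
- by move=> a /ups ua; rewrite (hcc a).2 mq_mup0 // rmorph0 scaler0.
- exact: freeL_fl.
Qed.

(** If x_j divides m_l, the set of all generators divisible by x_j is in D and contains l; hence the
    squarefree generator of index l is not 1. *)
Lemma Eind_base : D = Dinc m -> Eind D 0.
Proof.
move=> ->; apply/negP => /existsP[l /forallP hl].
have [j mj] : exists j, (0 < m l j)%N.
 apply: contrapT => no; have := hm.1 l; rewrite big1 // => j _; apply/eqP; rewrite -leqn0 leqNgt.
 by apply/negP => mj; apply: no; exists j.
pose A := [set l' | (0 < m l' j)%N]; have lA : l \in A by rewrite inE.
have AD : A \in Dinc m.
 rewrite inE; apply/existsP; exists j; rewrite ffunE; case: eqP => [A0|_].
  by rewrite A0 inE in lA.
 have b0 : (0 < mbound m)%N by apply: leq_trans mj (m_bound m l j).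
 by rewrite (bigD1 (Ordinal b0)) //= -/A eqxx.
have := hl (enum_rank A); rewrite !ffunE enum_rankK AD /=.
have -> // : A :&: [set l] != set0 by apply/set0Pn; exists l; apply/setIP; split; rewrite // inE.
Qed.
End KoszulBase.

End KoszulModel.
Import KoszulModel.

(** * One degree of a closure, rebuilt from a basis of homology of a model *)

Module AbstractClosures.

Section AbstractClosure.
Variables (k : fieldType) (G : zmodType) (chi : alt_bicharacter G k).
Notation T := (tridegree G).

(** True of a closure with its own grading, used to solve equations for derivations of a given
    internal degree, and of its version without internal degrees, used for comparisons. *)
Record aclo (X : color_dga chi) (F0 : X -> Prop) (L : nat -> seq (var X)) (e : X -> k) : Prop := {
 acl_fl : filt F0 L e;
 acl_acyclic : forall b, dif b = 0 -> e b = 0 -> exists b', dif b' = b;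
 acl_dif : forall b, e (dif b) = 0;
 acl_deg0 : forall t b, F0 b -> hom t b -> 0 < t.1.1 -> b = 0 }.

Lemma dnup (t : T) : t + (-1, 0, 0) + (1, 0, 0) = t.
Proof. by case: t => -[a b] c; congr (_, _, _); rewrite /= ?addr0 // subrK. Qed.
Lemma updn (t : T) : t + (1, 0, 0) + (-1, 0, 0) = t.
Proof. by case: t => -[a b] c; congr (_, _, _); rewrite /= ?addr0 // addrK. Qed.

Lemma allP_forall (X : color_dga chi) (I : Type) (L : seq (var X)) (P : I -> var X -> Prop) :
 (forall i, allP L (P i)) -> allP L (fun v => forall i, P i v).
Proof.
elim: L => //= v L IH h; split=> [i|]; first exact: (h i).1.
by apply: IH => i; exact: (h i).2.
Qed.

Lemma allP_choice (X W : color_dga chi) (L : seq (var X)) (R : var X -> W -> Prop) :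
 allP L (fun v => exists z, R v z) -> exists f, allP L (fun v => R v (f v)).
Proof.
have [f hf] : exists f : var X -> W, forall v, (exists z, R v z) -> R v (f v).
 have /choice[f hf] : forall v, exists z', (exists z, R v z) -> R v z'.
  by move=> v; case: (pselect (exists z, R v z)) => [[z hz]|no]; [exists z | exists 0].
 by exists f.
by move=> h; exists f; apply: allP_impl h.
Qed.

Lemma galg_tau (X : color_dga chi) (C : X -> Prop) a : galg C -> C a -> C (tau a).
Proof. by move=> gC; apply: (gsub_tw (galg_sub gC)). Qed.

Lemma lcB_closed (X : color_dga chi) (C : X -> Prop) (L : seq (var X)) c : galg C -> (forall i, C (c i)) ->
 allP L (fun v => C (dif (one v))) -> C (dif (lcB (ones L) c) - lcB (ones L) (fun i => dif (c i))).
Proof.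
move=> gC; elim: L c => [|v L IH] c Cc /=; first by rewrite dif0 subr0; move=> _; apply: (gsub0 (galg_sub gC)).
move=> [Cv CL]; rewrite difD difM [dif (c 0) * _ + _]addrC opprD addrACA -[_ + _ + - _]addrA subrr addr0.
by apply: (gsubD (galg_sub gC)); [apply: (galgM gC) => //; exact: galg_tau | apply: (IH (fun i => c i.+1))].
Qed.

Lemma dmap_lcB (X W : color_dga chi) (f : W -> X) (I : Type) (r : seq I) (F : I -> W) a : is_dmap f ->
 f (lcB (map F r) (scal W a)) = lcB (map (f \o F) r) (scal X a).
Proof.
move=> hf; elim: r a => [|i r IH] a /=; first exact: dmap0.
by rewrite (dmapD hf) (dmapM hf) (dmapZ hf) (dmap1 hf) (IH (fun i => a i.+1)).
Qed.

Lemma dif_lcB (X : color_dga chi) (I : Type) (r : seq I) (F : I -> X) a :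
 dif (lcB (map F r) (scal X a)) = lcB (map (fun i => dif (F i)) r) (scal X a).
Proof.
elim: r a => [|i r IH] a /=; first exact: dif0.
by rewrite difD -(IH (fun i => a i.+1)) /scal -!scalerAl !mul1r difZ.
Qed.

Lemma dif_deg0 (X : color_dga chi) t (b : X) : hom t b -> t.1.1 = 0 -> dif b = 0.
Proof. by move=> hb t0; apply: (hom_ge0 (dgaP X)) (hom_dif hb); rewrite /= t0. Qed.

Section Closure.
Variables (X : color_dga chi) (F0 : X -> Prop) (L : nat -> seq (var X)) (e : X -> k).
Hypothesis hX : aclo F0 L e.
Let fl := acl_fl hX.
Let ha := fl_aug fl.
Notation Lev := (lev F0 L).

Definition DS (u : T) (D : X -> X) : Prop :=
 fder (id : X -> X) (@full _ _ _ X) u D /\ forall i, allP (L i) (fdpow (id : X -> X) D).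

Lemma cv_good i : allP (L i) (fun v => good DS v.1 v.2).
Proof.
have h : allP (L i) (fun v => forall p : {p : T * (X -> X) | DS p.1 p.2}, fdpow (id : X -> X) (sval p).2 v).
 by apply: allP_forall => -[[u D] /= [_ hD]]; apply: hD.
apply: allP_impl h => v hv ev u D dsD l.
exact: (hv (exist _ (u, D) dsD)) (even_dpow_ok _ ev).
Qed.

Lemma DSf u D : DS u D -> fder (id : X -> X) (@full _ _ _ X) u D. Proof. by case. Qed.

Lemma lev_pos i : allP (L i) (fun v => 0 < v.1.1.1).
Proof. by apply: allP_impl (fl_deg fl i) => v ->. Qed.

Lemma lev_dpclosed N : dpclosed (good DS) (Lev N).
Proof.
elim: N => [|N IH] /=.
 move=> t b et Fb hb t0; rewrite (acl_deg0 hX Fb hb t0).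
 exists (@zero_dps _ _ _ X); split=> //; [exact: zero_dpsP | | exact: (ok_zero (dpfam_good DSf))].
 move=> [|l]; rewrite /zero_dps /=; [exact: (galg1 (fl_galg fl)) | exact: (gsub0 (galg_sub (fl_galg fl)))].
apply: (dpclosed_spanL (dpfam_good DSf)) => //.
- exact: flev_galg fl N.
- exact: (fl_dps fl).
- exact: lev_pos.
- exact: cv_good.
Qed.

Lemma full_lev i t b : hom t b -> t.1.1 <= i%:Z -> Lev i b.
Proof. by move=> hb ti; have [j] := fl_all fl b; apply: (flev_hom fl ti hb). Qed.

Lemma aug_pos t b : hom t b -> 0 < t.1.1 -> e b = 0.
Proof. by move=> hb t0; apply: (au_hom ha hb) => t0'; rewrite t0' in t0. Qed.

Lemma acyclic_hom' t b : hom t b -> dif b = 0 -> e b = 0 -> exists b', hom (t + (1, 0, 0)) b' /\ dif b' = b.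
Proof.
move=> hb db eb; have [b' h] := acl_acyclic hX db eb.
exists (prj (t + (1, 0, 0)) b'); split; first exact: hom_prj.
by rewrite -prj_dif h prj_id.
Qed.

(** Any filling of u is affine in the variables v_i of degree N + 1. Its coefficients differ from
    their augmentations by boundaries of elements xi_i; subtracting the boundary of the sum of the
    xi_i v_i makes them scalars modulo [Lev N]. *)
Lemma lift_lin N t u : (0 < N)%N -> hom (t + (-1, 0, 0)) u -> t.1.1 = N.+1%:Z -> dif u = 0 ->
 exists b a, [/\ hom t b, dif b = u & Lev N (b - lcB (ones (L N)) (scal X a))].
Proof.
move=> N0 hu tN du; have gN := flev_galg fl N; have gS := galg_sub gN.
have [|b [hb db]] := acyclic_hom' hu du.
 by apply: (aug_pos hu); rewrite /= tN; lia.
rewrite dnup in hb.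
have Lb : Lev N.+1 b by apply: full_lev hb _; rewrite tN.
have [c [w [_ hc Cw hw eb]]] := spanL_low gS (fl_dps fl N) (isT : 0 < N.+1%:Z) (fl_deg fl N) hb ltac:(by rewrite tN) Lb.
have dg i : (i < size (L N))%N -> (t - nth 0 (map fst (L N)) i).1.1 = 0.
 by move=> iL; rewrite /= (nth_deg (fl_deg fl N) iL) tN subrr.
have /choice[xi hxi] : forall i, exists x : X, [/\ Lev N x,
  (i < size (L N))%N -> hom (t - nth 0 (map fst (L N)) i + (1, 0, 0)) x &
  (i < size (L N))%N -> dif x = c i - e (c i) *: 1].
 move=> i; case: (boolP (i < size (L N))%N) => iL; last by exists 0; split=> //; apply: (gsub0 gS).
 have hc' : hom (t - nth 0 (map fst (L N)) i) (c i - e (c i) *: 1).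
  apply: homB; first exact: hc.
  case: (eqVneq (t - nth 0 (map fst (L N)) i) 0) => [->|/eqP t0]; first by apply: homZ; apply: hom1.
  by rewrite (au_hom ha (hc _ iL) t0) scale0r; apply: hom0.
 have [||x [hx dx]] := acyclic_hom' hc'.
 - exact: dif_deg0 hc' (dg _ iL).
 - by rewrite -scaleN1r addrC (au_lin ha) (auZ ha) (au_one ha) mulr1 mulN1r addNr.
 exists x; split=> //; apply: full_lev hx _; rewrite /= -/(_.1.1) .
 by have := dg _ iL => /= ->; rewrite add0r lez_nat.
exists (b - dif (lcB (ones (L N)) xi)), (fun i => e (c i)); split.
- apply: homB => //; rewrite -[t in hom t]updn; apply: hom_dif.
 have : forall (M : seq (var X)) (y : nat -> X), dpsL M ->
   (forall i, (i < size M)%N -> hom (t - nth 0 (map fst M) i + (1, 0, 0)) (y i)) -> hom (t + (1, 0, 0)) (lcB (ones M) y).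
  elim=> [|v M IH] y dM hy /=; first exact: hom0.
  apply: homD; last by apply: (IH (fun i => y i.+1) dM.2) => i iM; apply: (hy i.+1).
  by have := homM (hy 0%N isT) (dps_hom1 dM.1); rewrite /= addrAC subrK.
 by apply; [exact: (fl_dps fl) | move=> i iL; have [_ h _] := hxi i; apply: h].
- by rewrite difB difK subr0.
have := lcB_closed gN (fun i => let: And3 h _ _ := hxi i in h) (fl_bd fl N).
rewrite (@lcB_ext _ _ _ _ (ones (L N)) (fun i => dif (xi i)) (fun i => (- 1) * scal X (fun i => e (c i)) i + c i)); last first.
 by move=> i; rewrite size_map => iL; have [_ _ ->] := hxi i; rewrite // mulN1r addrC.
rewrite lcB_lin mulN1r => h; rewrite eb.
set l1 := lcB _ c in h *; set l2 := lcB _ (scal X _) in h *; set l3 := dif _ in h *.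
have -> : l1 + w - l3 - l2 = w - (l3 - (- l2 + l1)) by rewrite opprB !addrA [LHS](AC 4 (((2*4)*1)*3)).
exact: (gsubB gS).
Qed.

Lemma indep_lin N w a : Lev N w -> dif (lcB (ones (L N)) (scal X a)) = dif w ->
 forall i, (i < size (L N))%N -> a i = 0.
Proof.
move=> Lw h i iL; have gF := fl_galg fl.
have := fl_min fl (c := scal X a) (w := - w) (fun i => gsubZ (galg_sub gF) _ (galg1 gF))
 (fun i _ => ex_intro _ 0 (conj erefl (homZ _ (hom1 X)))) (gsubN (galg_sub (flev_galg fl N)) Lw).
by rewrite difD difN h subrr => /(_ erefl i iL); rewrite /scal (auZ ha) (au_one ha) mulr1.
Qed.

Section Map.
Variables (W : color_dga chi) (psi : W -> X) (N : nat).
Hypotheses (hp : is_dmap psi) (N0 : (0 < N)%N) (pL : forall w, Lev N (psi w))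
 (cp : cone psi (@full _ _ _ W) (Lev N)).

(** The classes of the cycles in zs form a k-basis of H_N(W). *)
Definition basis_cycles (zs : seq (T * W)) : Prop := [/\
 forall p, p \in zs -> [/\ p.1.1.1 = N.+1%:Z, hom (p.1 + (-1, 0, 0)) p.2 & dif p.2 = 0],
 forall t z, hom t z -> t.1.1 = N%:Z -> dif z = 0 ->
  exists a w, z = lcB (map snd zs) (scal W a) + dif w &
 forall a w, lcB (map snd zs) (scal W a) = dif w -> forall i, (i < size zs)%N -> a i = 0].

(** Since psi is a quasi-isomorphism to level N, the boundary of each variable of degree N + 1 is
    homologous to the image of a cycle of W. These cycles generate by [lift_lin] and are independent
    by [indep_lin]. *)
Lemma choose_cycles : exists zs, basis_cycles zs.
Proof.
have /allP_choice[f hf] : allP (L N) (fun v => exists z, [/\ hom (v.1 + (-1, 0, 0)) z, dif z = 0 &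
  exists w, Lev N w /\ dif (one v) = psi z + dif w]).
 have := allP_and (fl_dps fl N) (fl_bd fl N); apply: allP_impl => v [dv bv].
 have [|z [w [_ Lw dz ew]]] := cp (z := 0) (w := dif (v.2 1)) I bv (dif0 _).
 - by rewrite (dmap0 hp) difK.
 have hd := hom_dif (dps_hom1 dv); have gS := galg_sub (flev_galg fl N).
 exists (prj (v.1 + (-1, 0, 0)) z); split; first exact: hom_prj.
  by rewrite -[RHS](prj0 _ (v.1 + (-1, 0, 0) + (-1, 0, 0))) -dz prj_dif dnup.
 exists (prj v.1 w); split; first exact: (gsubP gS).
 by rewrite /one -(prj_id hd) ew prjD (dmap_prj hp) prj_dif dnup.
have [g hg] := allP_choice (allP_impl (fun v (h : [/\ _, _ & _]) => let: And3 _ _ h3 := h in h3) hf).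
have gS := galg_sub (flev_galg fl N).
have key a : exists w, Lev N w /\ dif (lcB (ones (L N)) (scal X a)) = psi (lcB (map f (L N)) (scal W a)) + dif w.
 elim: (L N) (hg) a => [|v M IH] /=.
  by move=> _ a; exists 0; rewrite dif0 (dmap0 hp) addr0; split=> //; apply: (gsub0 gS).
 move=> [[Lg dg] hM] a; have [w [Lw ew]] := IH hM (fun i => a i.+1).
 exists (a 0%N *: g v + w); split; first exact: (gsubL gS).
 rewrite !difD ew /scal -!scalerAl !mul1r !difZ dg (dmapD hp) (dmapZ hp) scalerDr. 
 by rewrite addrACA.
pose zs := [seq (v.1, f v) | v <- L N]; have ez : map snd zs = map f (L N) by rewrite -map_comp.
exists zs; split.
- move=> p; rewrite /zs; elim: (L N) (hf) (fl_deg fl N) => //= v M IH [[h1 h2 _] hM] [d1 dM].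
 by rewrite in_cons => /predU1P[->|/IH]; [split | apply].
- move=> t z hz tN dz; rewrite ez.
 have hz' : hom (t + (1, 0, 0) + (-1, 0, 0)) (psi z) by rewrite updn; apply: (dmap_hom hp).
 have [||b [a [hb db Lb]]] := lift_lin N0 hz'.
 - by rewrite /= tN; lia.
 - by rewrite -(dmap_dif hp) dz (dmap0 hp).
 have [w [Lw ew]] := key a; set y := lcB _ (scal W a) in ew.
 have [|||z' [w' [_ _ dz' _]]] := cp (z := z - y) (w := (b - lcB (ones (L N)) (scal X a)) + w) I.
 - exact: (gsubD gS).
 - rewrite difB dz sub0r; have := congr1 (fun x => dif x) ew.
  rewrite difK difD difK addr0 => /esym; rewrite -(dmap_dif hp) => h0.
  rewrite /y dif_lcB; rewrite [X in - X](_ : _ = 0) ?oppr0 //.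
  elim: (L N) (hf) a {Lb y ew w Lw h0} => //= v M IH [[_ dv _] hM] a.
  by rewrite dv mulr0 add0r; apply: IH.
 - by rewrite (dmapB hp) difD difB db ew opprD addrA subrK.
 by exists a, z'; rewrite -/y dz' addrC subrK.
move=> a w; rewrite ez size_map => h; have [w' [Lw' ew]] := key a.
apply: (@indep_lin N (psi w + w')); first exact: (gsubD gS).
by rewrite ew h difD (dmap_dif hp).
Qed.

(** The variables of degree N + 1 are exchanged for elements whose boundaries are exactly the images
    of the basis cycles, so that psi extends to them. *)
Lemma side_step zs : basis_cycles zs -> exists E, [/\ dpsL E, freeL (Lev N) E,
 spanL (Lev N) E = Lev N.+1, map (@vbd _ _ _ X) E = map (zmap psi) zs & allP E (fun v => good DS v.1 v.2)].
Proof.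
move=> [z1 z2 z3]; have gN := flev_galg fl N; have gS := galg_sub gN.
have [f hf] : exists f : T * W -> X, forall p, p \in zs -> exists a,
 [/\ hom p.1 (f p), dif (f p) = psi p.2 & Lev N (f p - lcB (ones (L N)) (scal X a))].
 have /choice[f hf] : forall p : T * W, exists b, p \in zs -> exists a,
  [/\ hom p.1 b, dif b = psi p.2 & Lev N (b - lcB (ones (L N)) (scal X a))].
  move=> p; case: (boolP (p \in zs)) => [/z1[pN hz dz]|_]; last by exists 0.
  have [|b [a h]] := lift_lin N0 (dmap_hom hp hz) pN; first by rewrite -(dmap_dif hp) dz (dmap0 hp).
  by exists b => _; exists a.
 by exists f.
pose es : seq (T * X) := [seq (p.1, f p) | p <- zs].
(* [lift_lin] has made the coefficients scalar, so scalars serve as the coefficient algebra; a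
   scalar of nonzero degree is 0, whence absorption. *)
pose Sc (c : X) := exists a : k, c = a *: 1.
pose J (b : X) := exists2 w, Lev N w & dif b = dif w.
have gSc : galg Sc.
 split; first split.
 - by exists 0; rewrite scale0r.
 - by move=> c _ _ [a ->] [b ->]; exists (c * a + b); rewrite scalerDl scalerA.
 - move=> t _ [a ->]; rewrite prjZ (prj_hom t (hom1 X)); case: eqP => _; first by exists a.
  by exists 0; rewrite scaler0 scale0r.
 - by exists 1; rewrite scale1r.
 by move=> _ _ [a ->] [b ->]; exists (a * b); rewrite -scalerAl mul1r scalerA.
have ScV b : Sc b -> Lev N b by move=> [a ->]; apply: (gsubZ gS); apply: (galg1 gN).
have gJ : gsub J.
 split.
 - by exists 0; rewrite ?dif0 //; apply: (gsub0 gS).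
 - move=> c a b [w Lw ew] [w' Lw' ew']; exists (c *: w + w'); first exact: (gsubL gS).
  by rewrite !difD !difZ ew ew'.
 - move=> t a [w Lw ew]; exists (prj t w); first exact: (gsubP gS).
  have h x : dif (prj t x) = prj (t + (-1, 0, 0)) (dif x :> X) by rewrite prj_dif dnup.
  by rewrite !h ew.
have VJ b : Lev N b -> J b by exists b.
have abs b : absorbed Sc J b.
 move=> u c u0 [a ->] hc; have e0 := au_hom ha hc (elimN eqP u0).
 by move: e0; rewrite (auZ ha) (au_one ha) mulr1 => ->; rewrite scale0r mul0r; apply: (gsub0 gJ).
have les a : lcB (map snd es) (scal X a) = lcB (map f zs) (scal X a) by rewrite -map_comp.
have des a : dif (lcB (map f zs) (scal X a)) = psi (lcB (map snd zs) (scal W a)).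
 rewrite dif_lcB (dmap_lcB _ _ _ hp); congr lcB; apply/eq_in_map => p pz.
 by have [b [_ -> _]] := hf p pz.
have iE : indep J (map snd es).
 move=> a [w Lw]; rewrite les des size_map size_map => h.
 have [||z' [_ [_ _ dz' _]]] := cp (z := lcB (map snd zs) (scal W a)) I Lw.
 - rewrite dif_lcB; elim: (zs) (z1) (a) => //= p zs' IH h1 a'.
  have [_ _ ->] := h1 p (mem_head _ _); rewrite mulr0 add0r; apply: IH => q qz; apply: h1.
  by rewrite in_cons qz orbT.
 - exact: h.
 exact: (z3 a z' (esym dz')).
have := @steinitz _ _ _ X _ (dpfam_good DSf) (Lev N) Sc J gN (@lev_dpclosed N) gSc ScV
 (fun c (h : Sc c) _ => h) gJ VJ es (L N) [::].
rewrite !cats0 => st.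
have [||||R' [E [/= h1 h2 h3 h4 [h5 [h6 h7]]]]] := st (fl_dps fl N) (fl_free fl N) (lev_pos N) (cv_good N).
- by apply: allP_impl (fl_dps fl N) => v _; apply: abs.
- by move=> a [w Lw ew] i; rewrite size_map; apply: (indep_lin Lw ew).
- exact: iE.
- move=> p /mapP[q qz ->] /=; have [a [hq _ Lq]] := hf q qz; split=> //.
  by exists (scal X a); split=> // i; exists (a i).
 by have [-> _ _] := z1 q qz.
have oE : ones E = map f zs.
 by have := congr1 (map snd) h5; rewrite -!map_comp => e'; rewrite -[RHS]e'; apply: eq_map.
case: R' h1 h2 h3 h4 h6 => [|v R'] h1 h2 h3 h4 h6.
 exists E; split=> //; transitivity [seq (p.1, dif p.2) | p <- es].
  by rewrite -h5 -map_comp.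
 rewrite -map_comp; apply/eq_in_map => p pz; by have [b [_ e' _]] := hf p pz; rewrite /zmap /= e'.
(* The boundary of a leftover variable is homologous to the image of a combination of the basis
   cycles, so the variable depends on E modulo [J]. *)
exfalso; have [dv [bv vN]] : dps v.1 v.2 /\ Lev N (dif (one v)) /\ v.1.1.1 = N.+1%:Z.
 have H P : allP (L N) P -> P v by move=> /h6[].
 by split; [exact: H (fl_dps fl N) | split; [exact: H (fl_bd fl N) | exact: H (fl_deg fl N)]].
have [|z [w [_ Lw dz ew]]] := cp (z := 0) (w := dif (one v)) I bv (dif0 _).
- by rewrite (dmap0 hp) difK.
set t := v.1 + (-1, 0, 0).
have dz' : dif (prj t z) = 0 by rewrite -[RHS](prj0 _ (t + (-1, 0, 0))) -dz prj_dif dnup.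
have [|a [w' ez]] := z2 t _ (hom_prj t z) _ dz'; first by rewrite /= vN; lia.
have : J (lcB (ones (v :: R' ++ E)) (scal X (fun i => if i is i'.+1 then if (i' < size R')%N then 0 else - a (i' - size R')%N else 1))).
 rewrite /= /ones map_cat lcB_cat -/(ones E) oE size_map {1}/scal scale1r mul1r.
 rewrite (@lcB_ext _ _ _ _ [seq one v0 | v0 <- R'] _ (fun=> 0)) => [|l]; last first.
  by rewrite size_map /scal => ->; rewrite scale0r.
 rewrite lcB0 add0r; exists (prj v.1 w + psi w').
  by apply: (gsubD gS) => //; apply: (gsubP gS).
 rewrite (@lcB_ext _ _ _ _ [seq f i | i <- zs] _ (fun i => (-1) * scal X a i + 0)); last first.
  by move=> i _; rewrite /scal ltnNge leq_addr /= addKn addr0 scaleNr mulN1r.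
 rewrite lcB_lin lcB0 addr0 mulN1r !difD difN des -(dmap_dif hp).
 have -> : lcB (map snd zs) (scal W a) = prj t z - dif w' by rewrite ez addrK.
 have -> : dif (one v) = psi (prj t z) + dif (prj v.1 w).
  rewrite -(prj_id (hom_dif (dps_hom1 dv))) -/(one v) ew prjD (dmap_prj hp) prj_dif /t dnup. by [].
 rewrite (dmapB hp) opprB [_ - psi _]addrC addrACA [psi _ + _]addrC addrC. 
 by rewrite addrA subrK addrC.
by move=> /h4-/(_ 0%N isT)/eqP; rewrite oner_eq0.
Qed.
End Map.
End Closure.
End AbstractClosure.

End AbstractClosures.
Import AbstractClosures.

(** * A minimal model shared by a family of closures, built degree by degree *)

Module CommonModels.

Section StageStep.
Variables (k : fieldType) (G : zmodType) (chi : alt_bicharacter G k).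
Notation T := (tridegree G).

(** An augmentation only sees degree 0, and the elements of degree 0 lie in [F0]. *)
Lemma aug_eq (W : color_dga chi) F0 L (e e1 e2 : W -> k) : filt F0 L e -> augm e1 -> augm e2 ->
 (forall w, F0 w -> e1 w = e2 w) -> forall w, e1 w = e2 w.
Proof.
move=> fl h1 h2 e12 w; have [r [c [hc ->]]] := hom_span (dgaP W) w.
rewrite (au_sum h1) (au_sum h2); apply: eq_bigr => t _.
case: (eqVneq t 0) => [t0|/eqP t0]; last by rewrite (au_hom h1 (hc t) t0) (au_hom h2 (hc t) t0).
apply: e12; have [j] := fl_all fl (c t); apply: (flev_hom fl (i := 0) (t := 0)) => //.
by rewrite -t0.
Qed.

Lemma augm_comp (W X : color_dga chi) (f : W -> X) (e : X -> k) : is_dmap f -> augm e -> augm (e \o f).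
Proof.
move=> hf h; split=> [c a b|a b||t a hom_a t0] /=.
- by rewrite (dmapL hf) (au_lin h).
- by rewrite (dmapM hf) (au_mul h).
- by rewrite (dmap1 hf) (au_one h).
- exact: (au_hom h (dmap_hom hf hom_a) t0).
Qed.

Lemma image_galg (W X : color_dga chi) (f : W -> X) C : is_dmap f -> galg C -> galg (image f C).
Proof.
move=> hf [gC C1 CM]; split; first exact: image_gsub.
- by exists 1; rewrite // (dmap1 hf).
- by move=> _ _ [a Ca ->] [b Cb ->]; exists (a * b); rewrite ?(dmapM hf) //; apply: CM.
Qed.

Lemma allP_map (W X : color_dga chi) (f : W -> X) (L : seq (var W)) P :
 allP (map (vmap f) L) P <-> allP L (fun v => P (vmap f v)).
Proof. by elim: L => //= v L IH; split=> -[h1 /IH]. Qed.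

Lemma dmap_lcB' (W X : color_dga chi) (f : W -> X) (L : seq (var W)) c : is_dmap f ->
 f (lcB (ones L) c) = lcB (ones (map (vmap f) L)) (fun i => f (c i)).
Proof.
move=> hf; elim: L c => [|v L IH] c /=; first exact: dmap0.
by rewrite (dmapD hf) (dmapM hf) (IH (fun i => c i.+1)).
Qed.

Lemma hom_inj (W X : color_dga chi) (f : W -> X) t a : is_dmap f -> injective f -> hom t (f a) -> hom t a.
Proof.
move=> hf fi h; have -> : a = prj t a by apply: fi; rewrite (dmap_prj hf) prj_id.
exact: hom_prj.
Qed.

(* [W] is a minimal model below degree N, [psi] its comparison with the levels of the closure [X]. *)
Record stage (X : color_dga chi) (G0 : X -> Prop) (M : nat -> seq (var X)) (eX : X -> k)
 (W : color_dga chi) (F0 : W -> Prop) (L : nat -> seq (var W)) (e : W -> k) (N : nat) (psi : W -> X) : Prop := {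
 sg_dmap : is_dmap psi;
 sg_lev : forall w, lev G0 M N (psi w);
 sg_cone : cone psi (@full _ _ _ W) (lev G0 M N);
 sg_aug : forall w, eX (psi w) = e w;
 sg_base : forall w, F0 w -> lev G0 M 1 (psi w);
 sg_free : forall j, (0 < j < N)%N -> freeL (lev G0 M j) (map (vmap psi) (L j));
 sg_span : forall j, (0 < j < N)%N -> spanL (lev G0 M j) (map (vmap psi) (L j)) = lev G0 M j.+1;
 sg_good : forall j, (0 < j < N)%N -> allP (map (vmap psi) (L j)) (fun v => good (DS M) v.1 v.2) }.

(** [L 0] is empty because the variables of degree 1 belong to the base [F0], the Koszul complex. *)
Record model (W : color_dga chi) (F0 : W -> Prop) (L : nat -> seq (var W)) (e : W -> k) (N : nat) : Prop := {
 md_filt : filt F0 L e;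
 md_full : forall b, lev F0 L N b;
 md_L0 : L 0%N = [::];
 md_LN : forall j, (N <= j)%N -> L j = [::] }.

Section Family.
Variables (I : Type) (X : I -> color_dga chi) (G0 : forall p, X p -> Prop) (M : forall p, nat -> seq (var (X p)))
 (eX : forall p, X p -> k) (hX : forall p, aclo (@G0 p) (M p) (@eX p)) (p0 : I).

Section Step.
Variables (W : color_dga chi) (F0 : W -> Prop) (L : nat -> seq (var W)) (e : W -> k) (N : nat).
Hypotheses (N0 : (0 < N)%N) (md : model F0 L e N)
 (psis : forall p, W -> X p) (st : forall p, stage (@G0 p) (M p) (@eX p) F0 L e N (psis p)).
Let fl := md_filt md.

(** The element is a boundary in the closure by acyclicity, already at level N since N > 0; the cone
    brings this back to W. *)
Lemma deg0_bd s c : hom s c -> s.1.1 = 0 -> e c = 0 -> exists z, dif z = c.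
Proof.
move=> hc s0 ec; have sp := st p0; have hp := sg_dmap sp.
have dc := dif_deg0 hc s0.
have [||b [hb db]] := acyclic_hom' (hX p0) (dmap_hom hp hc).
- by rewrite -(dmap_dif hp) dc (dmap0 hp).
- by rewrite (sg_aug sp).
have Lb : lev (@G0 p0) (M p0) N b by apply: (full_lev (hX p0)) hb _; rewrite /= s0; lia.
have [z [_ [_ _ dz _]]] := sg_cone sp (z := c) (w := b) Logic.I Lb dc (esym db).
by exists z.
Qed.

(** The same basis of H_N(W), found with the help of p0 alone, is used for every member of the
    family; the new variables therefore correspond to each other. *)
Lemma stage_step : exists (W' : color_dga chi) (F0' : W' -> Prop) (L' : nat -> seq (var W')) (e' : W' -> k)
  (psis' : forall p, W' -> X p), [/\ model F0' L' e' N.+1,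
 forall p, stage (@G0 p) (M p) (@eX p) F0' L' e' N.+1 (psis' p) &
 forall p j, (j < N)%N -> map (vmap (psis' p)) (L' j) = map (vmap (psis p)) (L j)].
Proof.
have [zs hz] : exists zs, basis_cycles N (W := W) zs.
 have sp := st p0.
 exact: (choose_cycles (hX p0) (sg_dmap sp) N0 (sg_lev sp) (sg_cone sp)).
have [z1 z2 z3] := hz.
have ok : cycles_ok zs.
 elim: (zs) (z1) => //= p zs' IH h1; have [pN hp dp] := h1 p (mem_head _ _); split=> //; first by rewrite pN.
 by apply: IH => q qz; apply: h1; rewrite in_cons qz orbT.
have [W' [i [L1 tw]]] := tower_ex ok; have hi := tw_dmap tw; have ii := tw_inj tw.
pose F0' := image i F0.
pose L' j := if j == N then L1 else map (vmap i) (L j).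
have gF j := galg_sub (flev_galg fl j).
have levE j : (j <= N)%N -> lev F0' L' j = image i (lev F0 L j).
 elim: j => [//|j IH] jN /=; rewrite IH; last exact: ltnW.
 rewrite /L' ltn_eqF //; apply/funext => b; apply/propext.
 exact: (spanL_image hi b (gF j) (fl_dps fl j)).
have fN : lev F0 L N = @full _ _ _ W by apply/funext => b; apply/propext; split=> // _; exact: (md_full md).
have gI : galg (image i (@full _ _ _ W)) by apply: image_galg => //; apply: full_galg.
have LNE : L' N = L1 by rewrite /L' eqxx.
have fN1 b : lev F0' L' N.+1 b by rewrite /= levE // LNE fN; apply: (tw_gen tw).
have sz1 : size zs = size L1 by have := congr1 size (tw_bd tw); rewrite !size_map.
have side p : exists psi' : W' -> X p, [/\ is_dmap psi',
  forall w, psi' (i w) = psis p w & [/\ freeL (lev (@G0 p) (M p) N) (map (vmap psi') L1),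
  spanL (lev (@G0 p) (M p) N) (map (vmap psi') L1) = lev (@G0 p) (M p) N.+1 &
  allP (map (vmap psi') L1) (fun v => good (DS (M p)) v.1 v.2)]].
 have sp := st p; have hp := sg_dmap sp.
 have [E [dE fE sE bE gE]] := side_step (hX p) hp N0 (sg_lev sp) (sg_cone sp) hz.
 have [psi' [hp' pi pL]] := tw_univ tw hp dE bE.
 by exists psi'; split=> //; rewrite pL.
have sp0 := st p0; have [psi0' [hp0' pi0 _]] := side p0.
pose e' w := @eX p0 (psi0' w).
have ae' : augm e' by apply: augm_comp => //; exact: fl_aug (acl_fl (hX p0)).
have ei w : e' (i w) = e w by rewrite /e' pi0 (sg_aug sp0).
have ltN j : (j < N)%N -> L' j = map (vmap i) (L j) by move=> jN; rewrite /L' ltn_eqF.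
have gtN j : (N < j)%N -> L' j = [::] by move=> jN; rewrite /L' gtn_eqF // (md_LN md) // ltnW.
have choose_c (c : nat -> W') : (forall l, F0' (c l)) -> exists c0 : nat -> W, forall l, F0 (c0 l) /\ c l = i (c0 l).
 move=> Fc; have /choice[c0 h] : forall l, exists a, F0 a /\ c l = i a.
  by move=> l; have [a Fa ea] := Fc l; exists a.
 by exists c0.
have fl' : filt F0' L' e'.
 split=> //.
 - exact: (image_galg hi (fl_galg fl)).
 - by move=> _ [a Fa ->]; rewrite -(dmap_dif hi); exists (dif a) => //; apply: (fl_dif0 fl).
 - move=> j; case: (ltngtP j N) => jN; [|by rewrite gtN|by rewrite jN LNE; apply: (tw_dps tw)].
  by rewrite ltN //; apply: vmap_dpsL => //; exact: (fl_dps fl j).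
 - move=> j; case: (ltngtP j N) => jN; [|by rewrite gtN|].
   by rewrite ltN //; apply/allP_map; exact: (fl_deg fl j).
  rewrite jN LNE; elim: (L1) (zs) (tw_bd tw) (z1) => [|v M' IH] [|p zs'] //= [e1 _ e2] h1; split.
   by rewrite e1; have [] := h1 p (mem_head _ _).
  by apply: (IH zs') => // q qz; apply: h1; rewrite in_cons qz orbT.
 - move=> j; case: (ltngtP j N) => jN; [|by rewrite gtN|].
   rewrite ltN // levE ?(ltnW jN) //; exact: (freeL_image hi (gF j) (fl_dps fl j) ii (fl_free fl j)).
  by rewrite jN LNE levE // fN; apply: (tw_free tw).
 - move=> j; case: (ltngtP j N) => jN; [|by rewrite gtN|].
   rewrite ltN // levE ?(ltnW jN) //; apply/allP_map; apply: allP_impl (fl_bd fl j) => v Lv /=.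
   by rewrite -(dmap_dif hi); eexists; first exact: Lv.
  rewrite jN LNE levE // fN; elim: (L1) (zs) (tw_bd tw) => [|v M' IH] [|p zs'] //= [_ e1 e2]; split.
   by exists p.2.
  exact: (IH zs').
 - by move=> b; exists N.+1.
 move=> j c w Fc hc Lw; have [c0 hc0] := choose_c c Fc.
 case: (ltngtP j N) => jN; [|by rewrite gtN|].
  rewrite ltN // levE ?(ltnW jN) // in hc Lw *; have [w0 Lw0 ->] := Lw.
  have -> : c = (fun l => i (c0 l)) by apply/funext => l; exact: (hc0 l).2.
  rewrite -(dmap_lcB' _ _ hi) -(dmapD hi) -(dmap_dif hi) -(dmap0 hi) => /ii h l; rewrite size_map ei => lL.
  apply: (fl_min fl (c := c0) _ _ Lw0 h lL) => [l'|l' lL']; first exact: (hc0 l').1.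
  have [|s [s0 hs]] := hc l'; first by rewrite size_map.
  by exists s; split=> //; apply: (hom_inj hi ii); rewrite -(hc0 l').2.
 move: hc Lw; rewrite jN LNE levE // fN => hc [w0 _ ->] dw l lL.
 have /choice[xi hxi] : forall l, exists x : W, (l < size L1)%N -> dif (i x) = c l - e' (c l) *: 1.
  move=> l'; case: (boolP (l' < size L1)%N) => lL'; last by exists 0.
  have [s [s0 hs]] := hc l' lL'; have hs' : hom s (c l' - e' (c l') *: 1).
   apply: homB => //; case: (eqVneq s 0) => [->|/eqP sn]; first by apply: homZ; apply: hom1.
   by rewrite (au_hom ae' hs sn) scale0r; apply: hom0.
  have hs0 : hom s (c0 l' - e' (c l') *: 1).
   by apply: (hom_inj hi ii); rewrite (dmapB hi) (dmapZ hi) (dmap1 hi) -(hc0 l').2.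
  have [|x dx] := deg0_bd hs0 s0.
   by rewrite -scaleN1r addrC (au_lin (fl_aug fl)) (auZ (fl_aug fl)) (au_one (fl_aug fl)) mulr1 mulN1r -ei -(hc0 l').2 addNr.
  by exists x => _; rewrite -(dmap_dif hi) dx (dmapB hi) (dmapZ hi) (dmap1 hi) -(hc0 l').2.
 have bL1 : allP L1 (fun v => image i (@full _ _ _ W) (dif (one v))).
  elim: (L1) (zs) (tw_bd tw) => [|v M' IH] [|p zs'] //= [_ e1 e2]; split; first by exists p.2.
  exact: (IH zs').
 have [w1 _ ew1] := lcB_closed (c := fun l => i (xi l)) gI (fun l => ex_intro2 _ _ (xi l) Logic.I erefl) bL1.
 rewrite (@lcB_ext _ _ _ _ (ones L1) (fun l => dif (i (xi l))) (fun l => (- 1) * scal W' (fun l => e' (c l)) l + c l)) in ew1; last first.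
  by move=> l'; rewrite size_map => lL'; rewrite hxi // mulN1r addrC.
 rewrite lcB_lin mulN1r in ew1.
 have bz a : dif (lcB (ones L1) (scal W' a)) = i (lcB (map snd zs) (scal W a)).
  rewrite (dmap_lcB _ _ _ hi) dif_lcB; congr lcB.
  elim: (L1) (zs) (tw_bd tw) => [|v M' IH] [|p zs'] //= [_ e1 e2]; congr (_ :: _); first exact: e1.
  exact: (IH zs').
 (* Coefficients of degree 0 differ from their augmentations by boundaries, so the relation becomes
    one with scalar coefficients among the basis cycles. *)
 apply: (z3 (fun l => e' (c l)) (w1 - w0) _ l); last by rewrite sz1.
 apply: ii; rewrite -bz (dmap_dif hi) (dmapB hi) -ew1 !difB difK difD difN sub0r opprD opprK -addrA -opprD.
 by move: dw; rewrite difD => ->; rewrite subr0.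
have pv p (psi' : W' -> X p) j : (forall w, psi' (i w) = psis p w) -> (j < N)%N ->
  map (vmap psi') (L' j) = map (vmap (psis p)) (L j).
 move=> pi jN; rewrite ltN // -map_comp; apply: eq_map => v /=; rewrite /vmap /=; congr (_, _).
 by apply/funext => l; rewrite /= pi.
exists W', F0', L', e', (fun p => sval (cid (side p))); split; first 1 last.
- move=> p; case: cid => psi' /= [hp' pi [fE sE gE]]; have sp := st p; have hp := sg_dmap sp.
 have gp j : galg (lev (@G0 p) (M p) j) by exact: flev_galg (acl_fl (hX p)) j.
 have pI w : image i (@full _ _ _ W) w -> lev (@G0 p) (M p) N (psi' w).
  by move=> [w0 _ ->]; rewrite pi; apply: (sg_lev sp).
 have bL1 : allP L1 (fun v => image i (@full _ _ _ W) (dif (v.2 1))).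
  elim: (L1) (zs) (tw_bd tw) => [|v M' IH] [|q zs'] //= [_ e1 e2]; split; first by exists q.2.
  exact: (IH zs').
 split=> //.
 - move=> w; rewrite /= -sE; apply: (@spanL_mono _ _ _ _ (image psi' (image i (@full _ _ _ W)))).
   by move=> _ [a Ia ->]; apply: pI.
  apply/(spanL_image hp' _ (galg_sub gI) (tw_dps tw)); exists w => //; exact: (tw_gen tw).
 - have := @cone_spanL _ _ _ _ _ psi' (image i (@full _ _ _ W)) (lev (@G0 p) (M p) N) L1 hp' (galg_sub gI)
   (galg_sub (gp N)) pI _ _ (tw_dps tw).
  rewrite sE => h; apply: (cone_ext (C := spanL (image i (@full _ _ _ W)) L1) (D := lev (@G0 p) (M p) N.+1)) => //.
   by move=> a; split=> // _; apply: (tw_gen tw).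
  apply: h => //.
  + by move=> _ [a _ ->]; rewrite -(dmap_dif hi); exists (dif a).
  + by move=> a; apply: (flev_dif (acl_fl (hX p))).
  + apply: allP_impl bL1 => v bv a Ia; exact: (galgM gI).
  + apply: allP_impl bL1 => v bv a Ia; apply: (galgM (gp N)) => //; exact: pI.
  + exact: (tw_free tw).
  + move=> _ w [z0 _ ->] Lw dz ez; have dz0 : dif z0 = 0 by apply: ii; rewrite (dmap_dif hi) dz (dmap0 hi).
   rewrite pi in ez; have [z' [w' [_ Lw' <- ->]]] := sg_cone sp Logic.I Lw dz0 ez.
   by exists (i z'), w'; split=> //; [exists z' | rewrite (dmap_dif hi) | rewrite pi].
 - apply: (aug_eq fl' (augm_comp hp' (fl_aug (acl_fl (hX p)))) ae') => _ [w _ ->] /=.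
  by rewrite pi (sg_aug sp) ei.
 - by move=> _ [w Fw ->]; rewrite pi; apply: (sg_base sp).
 - move=> j /andP[j0]; rewrite ltnS leq_eqVlt => /predU1P[->|jN]; first by rewrite LNE.
  by rewrite (pv p psi') //; apply: (sg_free sp); rewrite j0.
 - move=> j /andP[j0]; rewrite ltnS leq_eqVlt => /predU1P[->|jN]; first by rewrite LNE.
  by rewrite (pv p psi') //; apply: (sg_span sp); rewrite j0.
 - move=> j /andP[j0]; rewrite ltnS leq_eqVlt => /predU1P[->|jN]; first by rewrite LNE.
  by rewrite (pv p psi') //; apply: (sg_good sp); rewrite j0.
- by move=> p j jN; case: cid => psi' /= [hp' pi _]; apply: pv.
split=> //; first by rewrite ltN // (md_L0 md).
Qed.
End Step.

Variable Ku : color_dga chi.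
Hypotheses (hK : forall p, exists psi : Ku -> X p, [/\ is_dmap psi, forall w, lev (@G0 p) (M p) 1 (psi w) &
  cone psi (@full _ _ _ Ku) (lev (@G0 p) (M p) 1)])
 (eK : forall p q (psi : Ku -> X p) (psi' : Ku -> X q), is_dmap psi -> is_dmap psi' ->
  forall w, eX (psi w) = eX (psi' w)).

Record state (N : nat) := State {
 st_W : color_dga chi; st_F0 : st_W -> Prop; st_L : nat -> seq (var st_W); st_e : st_W -> k;
 st_psi : forall p, st_W -> X p;
 st_model : model st_F0 st_L st_e N;
 st_stage : forall p, stage (@G0 p) (M p) (@eX p) st_F0 st_L st_e N (st_psi p) }.

Definition stvars N (S : state N) p j := map (vmap (@st_psi _ S p)) (st_L S j).

Lemma state1 : exists S : state 1, True.
Proof.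
have [hp pl pc] := projT2 (cid (hK p0)); set psi := projT1 _ in hp pl pc.
unshelve eexists (@State 1 Ku (@full _ _ _ Ku) (fun=> [::]) (fun w => eX (psi w)) (fun p => projT1 (cid (hK p))) _ _) => //.
 split=> //; split=> //.
 - by move=> b; exists 0%N.
 - exact: (augm_comp hp (fl_aug (acl_fl (hX p0)))).
move=> p; have [hp' pl' pc'] := projT2 (cid (hK p)); split=> //; try by case=> [|[]].
by move=> w; exact: (eK hp' hp).
Qed.

Lemma stateS N (S : state N.+1) : exists S' : state N.+2, forall p j, (j < N.+1)%N -> stvars S' p j = stvars S p j.
Proof.
case: S => W F0 L e psis md st; have [W' [F0' [L' [e' [psis' [md' st' h]]]]]] := stage_step (ltn0Sn N) md st.
by exists (State md' st').
Qed.

Fixpoint states N : state N.+1 :=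
 if N is N'.+1 then projT1 (cid (stateS (states N'))) else projT1 (cid state1).

(** Later stages leave the images of earlier variables unchanged, so those of degree j + 1 can be
    examined in any later stage. *)
Lemma stvars_states N p j : (j <= N)%N -> stvars (states N) p j = stvars (states j) p j.
Proof.
elim: N => [|N IH]; first by case: j.
rewrite leq_eqVlt => /predU1P[->//|jN]; rewrite -IH //=.
by case: cid => S' /= ->.
Qed.

End Family.
End StageStep.

End CommonModels.
Import CommonModels.

(** * Derivations of the closure and of the model, compared along psi *)

Module Homotopies.

Section Derivations.
Variables (k : fieldType) (G : zmodType) (chi : alt_bicharacter G k).
Notation T := (tridegree G).

Record cder (A : color_dga chi) (F0 : A -> Prop) (L : nat -> seq (var A)) (u : T) (D : A -> A) : Prop := {
 cd_fd : fder (id : A -> A) (@full _ _ _ A) u D;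
 cd_F0 : forall a, F0 a -> D a = 0;
 cd_pow : forall i, allP (L i) (fdpow (id : A -> A) D);
 cd_dif : forall a, dif (D a) = sg k u *: D (dif a) }.

Lemma eder_homI (A : color_dga chi) (e d : A -> k) : augm e ->
 (forall c a b, d (c *: a + b) = c * d a + d b) ->
 (forall t a b, hom t a -> d (a * b) = d a * e b + e a * d b) -> eder e (@full _ _ _ A) d.
Proof.
move=> ha dl dm; split=> [c a b _ _|a b _ _]; first exact: dl.
have d0 : d 0 = 0 by have := dl (-1) 0 0; rewrite scaler0 addr0 mulN1r addNr.
have dD x y : d (x + y) = d x + d y by have := dl 1 x y; rewrite scale1r mul1r.
have [r [c [hc ->]]] := hom_span (dgaP A) a.
elim: r => [|t r IH]; first by rewrite big_nil mul0r d0 (au0 ha) !mul0r addr0.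
by rewrite big_cons mulrDl !dD (dm t) // IH (auD ha) !mulrDl addrACA.
Qed.

Lemma eder_ext0 (A : color_dga chi) F0 L (e d : A -> k) m : filt F0 L e -> eder e (@full _ _ _ A) d ->
 (forall a, F0 a -> d a = 0) -> (forall i, allP (L i) (edpow d)) ->
 (forall s a, hom s a -> s.1.1 <> m.+1%:Z -> d a = 0) ->
 allP (L m) (fun v => d (v.2 1) = 0) -> forall a, d a = 0.
Proof.
move=> fl ed d0 dp dg dm a; have [i] := fl_all fl a; elim: i a => [|i IH] a; first exact: d0.
apply: (ed_eq0 (flev_galg fl i) (fl_dps fl i) (ed_mono (fun _ _ => Logic.I) ed) IH).
apply: allP_and (dp i); case: (eqVneq i m) => [->//|im].
have := allP_and (fl_dps fl i) (fl_deg fl i); apply: allP_impl => v [dv vi].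
apply: (dg _ _ (dps_hom1 dv)); rewrite vi => -[] e1; by rewrite e1 eqxx in im.
Qed.

Lemma der_hom_mul (A : color_dga chi) u (D : A -> A) t a b : fder (id : A -> A) (@full _ _ _ A) u D ->
 hom t a -> D (a * b) = D a * b + csign chi u t *: (a * D b).
Proof. by move=> hD ha; rewrite (fd_mul hD) //= (ctw_hom u ha) scalerAl. Qed.

Lemma fder_hom_mul (A B : color_dga chi) (f : A -> B) u h t a b : is_dmap f -> fder f (@full _ _ _ A) u h ->
 hom t a -> h (a * b) = h a * f b + csign chi u t *: (f a * h b).
Proof. by move=> hf hh ha; rewrite (fd_mul hh) //= (ctw_hom u ha) (dmapZ hf) scalerAl. Qed.

Lemma der_eq0 (A : color_dga chi) u (D : A -> A) C (L : seq (var A)) : fder (id : A -> A) (@full _ _ _ A) u D ->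
 galg C -> dpsL L -> (forall a, C a -> D a = 0) -> allP L (fun v => forall l, D (v.2 l) = 0) ->
 forall a, spanL C L a -> D a = 0.
Proof.
move=> hD; elim: L C => //= v L IH C gC [dv dL] DC [Dv DL]; apply: IH => //; first exact: adjoin_galg.
move=> a; apply: (adj1_hom_ind (C := C) (v := v) (P := fun a => D a = 0) (galg_sub gC)) => [|x y hx hy|c l s ol Cc hc].
- exact: (fd0 (@gsub_full _ _ _ A) hD).
- by rewrite (fdD hD) // hx hy addr0.
- by rewrite (der_hom_mul _ hD hc) DC // Dv mulr0 scaler0 mul0r addr0.
Qed.

Section Stage.
Variables (X : color_dga chi) (G0 : X -> Prop) (M : nat -> seq (var X)) (eX : X -> k) (hX : aclo G0 M eX).
Variables (W : color_dga chi) (F0 : W -> Prop) (L : nat -> seq (var W)) (e : W -> k) (N : nat).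
Hypothesis md : model F0 L e N.
Variables (psi : W -> X) (sp : stage G0 M eX F0 L e N psi).
Let hp := sg_dmap sp.
Let flX := acl_fl hX.
Let aX := fl_aug flX.

Lemma filtW : filt F0 L (eX \o psi).
Proof. by have -> : eX \o psi = e; [apply/funext => w; apply: (sg_aug sp) | exact: (md_filt md)]. Qed.
Let flW := filtW.

Lemma psi_ctw u a : psi (ctw u a) = ctw u (psi a).
Proof. exact: dmap_tw. Qed.

Lemma psi_pos t w : hom t w -> 0 < t.1.1 -> eX (psi w) = 0.
Proof. by move=> hw t0; apply: (aug_pos hX (dmap_hom hp hw) t0). Qed.

Section One.
Variables (u : T) (D : X -> X) (m : nat).
Hypotheses (hD : cder G0 M u D) (um : u.1.1 = - m.+2%:Z).

(** The images of the variables of W carry other divided powers than the variables of X; [sg_good]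
    says that D respects those as well. *)
Lemma psi_pow i : allP (L i) (fdpow psi (D \o psi)).
Proof.
case: (posnP i) => i0; first by rewrite i0 (md_L0 md).
case: (leqP N i) => Ni; first by rewrite (md_LN md Ni).
have := sg_good sp (j := i); rewrite i0 Ni => /(_ isT)/allP_map h.
have := allP_and (fl_dps flW i) h; apply: allP_impl => v [dv gv] l /=.
rewrite /dpow_ok; case: (boolP (vodd v)) => [ov|ev _] /=.
 by case: l => // _; rewrite (dps0 dv) (dmap1 hp) mulr1.
exact: (gv ev u D (conj (cd_fd hD) (cd_pow hD)) l).
Qed.

(** D lowers the degree by at least 2, while the variables of this level have degree 1. *)
Lemma der_lev1 b : lev G0 M 1 b -> D b = 0.
Proof.
apply: (der_eq0 (cd_fd hD) (fl_galg flX) (fl_dps flX 0)); first exact: (cd_F0 hD).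
have := allP_and (allP_and (fl_dps flX 0) (fl_deg flX 0)) (cd_pow hD 0); apply: allP_impl => v [[dv v1] pv] l.
case: (boolP (dpow_ok (vodd v) l)) => ol; last by rewrite (dps_out dv ol) (fd0 (@gsub_full _ _ _ X) (cd_fd hD)).
case: l ol => [|l] ol; first by rewrite (dps0 dv) (gD_1 (cd_fd hD)).
rewrite (pv l ol) (hom_ge0 (dgaP X) _ (fd_hom (cd_fd hD) Logic.I (dps_hom1 dv))) ?mul0r //=.
by rewrite v1 um; lia.
Qed.

Lemma fder_Dpsi : fder psi (@full _ _ _ W) u (D \o psi).
Proof.
split=> [c a b _ _|t a _ ha|a b _ _] /=.
- by rewrite (dmapL hp) (fd_lin (cd_fd hD)).
- exact: (fd_hom (cd_fd hD) Logic.I (dmap_hom hp ha)).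
- by rewrite (dmapM hp) (fd_mul (cd_fd hD)) // psi_ctw.
Qed.

Lemma W_acyclic t z : hom t z -> t.1.1 < N%:Z -> dif z = 0 -> e z = 0 -> exists b, hom (t + (1, 0, 0)) b /\ dif b = z.
Proof.
move=> hz tN dz ez.
have [||b [hb db]] := acyclic_hom' hX (dmap_hom hp hz).
- by rewrite -(dmap_dif hp) dz (dmap0 hp).
- by rewrite (sg_aug sp).
have Lb : lev G0 M N b by apply: (full_lev hX) hb _; rewrite /=; lia.
have [z' [_ [_ _ dz' _]]] := sg_cone sp (z := z) (w := b) Logic.I Lb dz (esym db).
exists (prj (t + (1, 0, 0)) z'); split; first exact: hom_prj.
by rewrite -prj_dif dz' prj_id.
Qed.

(** On the variables of degree m + 2 the values are prescribed as scalars, namely the augmented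
    values of D. On later variables the obstruction is a cycle of degree less than N, where W has no
    homology besides k. *)
Lemma lift_der : (m.+1 < N)%N -> exists Du, cder F0 L u Du /\
 allP (L m.+1) (fun v => eX (D (psi (v.2 1))) = eX (psi (Du (v.2 1)))).
Proof.
move=> mN; have hid : is_dmap (id : W -> W) by [].
pose Q (v : var W) (b : W) := eX (psi b) = eX (D (psi (v.2 1))).
have [|||||||h [hh h0 hpow hdif hQ]] := @solve_filt k G chi W W id hid F0 L (eX \o psi) flW (fl_aug flW)
  u m.+1 (fun=> 0) Q um.
- by split=> *; rewrite ?scaler0 ?addr0 ?mul0r ?mulr0 ?addr0 //; apply: hom0.
- by move=> a; rewrite dif0 scaler0 oppr0.
- by [].
- by move=> i; elim: (L i) => //= v r IH; split=> // l _; rewrite mul0r.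
- by elim: (L m.+2) => //= v r IH; split=> //; rewrite (dmap0 hp) (au0 aX).
- apply: allP_impl (fl_dps flW m.+1) => v dv; exists (eX (D (psi (v.2 1))) *: 1); split.
  have hv := fd_hom (cd_fd hD) Logic.I (dmap_hom hp (dps_hom1 dv)).
  case: (eqVneq (v.1 + u) 0) => [->|/eqP n0]; first by apply: homZ; apply: hom1.
  by rewrite (au_hom aX hv n0) scale0r; apply: hom0.
 by rewrite /Q (dmapZ hp) (dmap1 hp) (auZ aX) (au_one aX) mulr1.
- move=> i mi; case: (leqP N i) => Ni; first by rewrite (md_LN md Ni).
 apply: allP_impl (fl_deg flW i) => v vi z hz dz ez.
 have [||b [hb db]] := W_acyclic hz _ dz; first by rewrite /= vi um; lia.
  by rewrite -(sg_aug sp).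
 by exists b; rewrite dnup in hb.
exists h; split; last by apply: allP_impl hQ => v; rewrite /Q => ->.
by split=> // a; rewrite hdif add0r.
Qed.

Variable Du : W -> W.
Hypothesis hDu : cder F0 L u Du.

Lemma fder_psiDu : fder psi (@full _ _ _ W) u (psi \o Du).
Proof.
split=> [c a b _ _|t a _ ha|a b _ _] /=.
- by rewrite (fd_lin (cd_fd hDu)) // (dmapL hp).
- exact: (dmap_hom hp (fd_hom (cd_fd hDu) Logic.I ha)).
- by rewrite (fd_mul (cd_fd hDu)) //= (dmapD hp) !(dmapM hp).
Qed.

Lemma psiDu_pow i : allP (L i) (fdpow psi (psi \o Du)).
Proof. by apply: allP_impl (cd_pow hDu i) => v h l ol /=; rewrite (h l ol) (dmapM hp). Qed.

Hypothesis mt : allP (L m.+1) (fun v => eX (D (psi (v.2 1))) = eX (psi (Du (v.2 1)))).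

Let D' a := D (psi a) - psi (Du a).

Lemma fder_D' : fder psi (@full _ _ _ W) u D'.
Proof.
have h1 := fder_Dpsi; have h2 := fder_psiDu; rewrite /D'; split=> [c a b _ _|t a _ ha|a b _ _].
- have := fd_lin h1 c (a := a) (b := b) Logic.I Logic.I; have := fd_lin h2 c (a := a) (b := b) Logic.I Logic.I.
 by move=> /= -> ->; rewrite scalerBr opprD addrACA.
- by apply: homB; [apply: (fd_hom h1) | apply: (fd_hom h2)].
- have := fd_mul h1 (a := a) (b := b) Logic.I Logic.I; have := fd_mul h2 (a := a) (b := b) Logic.I Logic.I.
 by move=> /= -> ->; rewrite mulrBl mulrBr opprD addrACA.
Qed.

Lemma D'_pow i : allP (L i) (fdpow psi D').
Proof.
have := allP_and (psi_pow i) (psiDu_pow i); apply: allP_impl => v [h1 h2] l ol; rewrite /D'.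
have := h1 l ol; have := h2 l ol => /= -> ->; by rewrite mulrBl.
Qed.

Lemma D'_0 a : F0 a -> D' a = 0.
Proof. by move=> Fa; rewrite /D' (cd_F0 hDu Fa) (dmap0 hp) der_lev1 ?subrr //; apply: (sg_base sp). Qed.

Lemma pow_eder u' (h : W -> X) i : fder psi (@full _ _ _ W) u' h -> allP (L i) (fdpow psi h) -> allP (L i) (edpow (eX \o h)).
Proof.
move=> hh hpow; have := allP_and (allP_and (fl_dps flW i) (fl_deg flW i)) hpow; apply: allP_impl => v [[dv vi] pv].
by apply: (fdpow_edpow hp aX dv) => //; rewrite vi.
Qed.

(** The augmentation sees the derivation [D'] in degree m + 2 only, and there it vanishes on the
    variables. *)
Lemma match_all a : eX (D (psi a)) = eX (psi (Du a)).
Proof.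
have h := eder_ext0 (m := m.+1) (d := eX \o D') flW (fder_eder hp aX fder_D').
apply/eqP; rewrite -subr_eq0 -[X in _ - X]mul1r -mulNr addrC -(au_lin aX) scaleN1r addrC; apply/eqP.
apply: h => //.
- by move=> b Fb; rewrite /= D'_0 // (au0 aX).
- by move=> i; apply: pow_eder fder_D' (D'_pow i).
- move=> s b hb sn; apply: (au_hom aX (fd_hom fder_D' Logic.I hb)) => s0; apply: sn.
 by have := congr1 (fun t : T => t.1.1) s0; rewrite /= um; lia.
apply: allP_impl mt => v ev /=; by rewrite /D' addrC -scaleN1r (au_lin aX) mulN1r ev addNr.
Qed.

Lemma sg_up (t : T) : sg k (t + (1, 0, 0)) = - sg k t.
Proof. by rewrite /sg /= signzD expr1z mulrN1. Qed.

(** Vanishing of the augmented values on the variables of degree m + 2 removes the only obstruction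
    to solving for a homotopy. *)
Lemma htpy : exists h, [/\ fder psi (@full _ _ _ W) (u + (1, 0, 0)) h, forall a, F0 a -> h a = 0,
 forall i, allP (L i) (fdpow psi h) &
 forall a, dif (h a) = D (psi a) - psi (Du a) + sg k (u + (1, 0, 0)) *: h (dif a)].
Proof.
have [||||||||h [hh h0 hpow hdif _]] := @solve_filt k G chi W X psi hp F0 L eX flW aX
  (u + (1, 0, 0)) m D' (fun _ _ => True).
- by rewrite /= um; lia.
- by rewrite updn; exact: fder_D'.
- move=> a; rewrite sg_up scaleNr opprK /D' difB (cd_dif hD) -!(dmap_dif hp) (cd_dif hDu) (dmapZ hp).
 by rewrite scalerBr.
- exact: D'_0.
- exact: D'_pow.
- apply: allP_impl mt => v ev; by rewrite /D' addrC -scaleN1r (au_lin aX) mulN1r ev addNr.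
- by elim: (L m) => //= v r IH; split=> //; exists 0; split=> //; apply: hom0.
- move=> i mi; apply: allP_impl (fl_deg flW i) => v vi z hz dz ez.
 by have [b [hb db]] := acyclic_hom' hX hz dz ez; exists b; rewrite dnup in hb.
by exists h.
Qed.

Lemma eD_dif b : eX (D (dif b)) = 0.
Proof.
have := acl_dif hX (D b); rewrite (cd_dif hD) (auZ aX) => /eqP.
by rewrite mulf_eq0 /sg (negbTE (expfz_neq0 _ _)) ?oppr_eq0 ?oner_eq0 //= => /eqP.
Qed.
End One.

(* A composite of two derivations is not a derivation, but this graded commutator along [psi] is, hence
 its augmentation vanishes on boundaries. *)
Lemma keyK u u' D Du h m : cder G0 M u D -> cder F0 L u Du -> (forall a, eX (D (psi a)) = eX (psi (Du a))) ->
 fder psi (@full _ _ _ W) u' h -> (forall a, F0 a -> h a = 0) -> (forall i, allP (L i) (fdpow psi h)) ->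
 (u + u').1.1 = - m.+1%:Z -> forall a, eX (D (h (dif a))) = csign chi u u' * eX (h (Du (dif a))).
Proof.
move=> hD hDu dm hh h0 hpow um; have fD := cd_fd hD; have fDu := cd_fd hDu.
set c := csign chi u u'; have cc : c * csign chi u' u = 1 by apply: csign_swap.
pose d a := eX (D (h a)) - c * eX (h (Du a)).
have dl x a b : d (x *: a + b) = x * d a + d b.
 by rewrite /d (fd_lin hh) // (fd_lin fD) // (fd_lin fDu) // (fd_lin hh) // !(au_lin aX); ring.
suff H : forall a, d (dif a) = 0 by move=> a; apply/eqP; rewrite -subr_eq0; apply/eqP/H.
move=> a0; apply: (eder_dif flW (m := m)).
- apply: (eder_homI (fl_aug flW) dl) => t a b ha; rewrite /d.
 have hha := fd_hom hh Logic.I ha; have hDa := fd_hom fDu Logic.I ha; have hpa := dmap_hom hp ha.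
 rewrite (fder_hom_mul _ hp hh ha) (fdD fD) // (der_hom_mul _ fD hha) (fdZ _ (@gsub_full _ _ _ X) fD) //.
 rewrite (der_hom_mul _ fD hpa) (der_hom_mul _ fDu ha) (fdD hh) // (fder_hom_mul _ hp hh hDa).
 rewrite (fdZ _ (@gsub_full _ _ _ W) hh) // (fder_hom_mul _ hp hh ha).
 rewrite !csignDr -/c !(auD aX, auZ aX, au_mul aX) !dm.
 set al := csign chi u t; set be := csign chi u' t; set c' := csign chi u' u in cc *.
 (* The augmentation of a vanishes unless t = 0, and then both commutation factors are 1. The
    remaining mixed term disappears because c c' = 1. *)
 have ab : al * be * eX (psi a) = eX (psi a).
  case: (eqVneq t 0) => [t0|/eqP t0]; first by rewrite /al /be t0 !csign0r !mul1r.
  by rewrite (au_hom aX hpa t0) mulr0.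
 set ea := eX (psi a) in ab *; set y1 := eX _; set y2 := eX _; set y3 := eX _; set y4 := eX _.
 set y5 := eX (psi (Du a)); set y6 := eX (h b); set y7 := eX _; set y8 := eX _; set y9 := eX _.
 transitivity ((y1 - c * y8) * y2 + (al * be * ea) * (y7 - c * y9) + be * y5 * y6 * (1 - c * c')).
  by ring.
 by rewrite cc subrr mulr0 addr0 ab.
- by move=> a Fa; rewrite /d h0 // (cd_F0 hDu Fa) (fd0 (@gsub_full _ _ _ X) fD) (fd0 (@gsub_full _ _ _ W) hh) !(au0 aX) mulr0 subr0.
- move=> i; have := allP_and (allP_and (allP_and (fl_dps flW i) (fl_deg flW i)) (hpow i)) (cd_pow hDu i).
 apply: allP_impl => v [[[dv vi] pv] pDu] l ol; rewrite /d.
 have ev : even_deg v.1 by move: ol; rewrite /dpow_ok /even_deg -/(vodd v); case: (vodd v).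
 have ok q : dpow_ok (vodd v) q by apply: even_dpow_ok.
 have z0 q : eX (psi (v.2 q.+1)) = 0 by apply: (psi_pos (dps_hom dv (ok q.+1))); rewrite tdegMn1 vi pmulrn_lgt0.
 have hv := dps_hom1 dv; have hhv := fd_hom hh Logic.I hv; have hDv := fd_hom fDu Logic.I hv.
 rewrite (pv _ ol) (der_hom_mul _ fD hhv) (pDu _ ol) /= (fder_hom_mul _ hp hh hDv).
 rewrite !(auD aX, auZ aX, au_mul aX) !z0 !mulr0 !add0r dm (pDu _ (ok l.+1)) /= (dmapM hp) (pv _ (ok l.+1)) !(au_mul aX).
 rewrite !csignDr -/c.
 (* A nonzero value requires both u and u' to be opposite to the degree of v. Then u = u' is even,
    all factors are 1, and the two terms cancel. *)
 case: (eqVneq (v.1 + u') 0) => [e1|/eqP n1]; last by rewrite (au_hom aX hhv n1) !(mul0r, mulr0) subr0.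
 case: (eqVneq (v.1 + u) 0) => [e2|/eqP n2]; last by rewrite (au_hom aX (dmap_hom hp hDv) n2) !(mul0r, mulr0) subr0.
 have uu : u' = u by apply: (@addrI _ v.1); rewrite e1 e2.
 have eu : even_deg u.
  have := congr1 (fun t : T => t.1.1) e2; rewrite /= => e3; move: ev; rewrite /even_deg.
  have -> : u.1.1 = - v.1.1.1 by apply/eqP; rewrite -addr_eq0 addrC; apply/eqP.
  by rewrite abszN.
 have c1 : c = 1 by rewrite /c uu csign_even_self.
 by rewrite c1 uu csign_even_self //; ring.
- move=> s a ha sn; rewrite /d.
 have n0 : s + u' + u <> 0.
  move=> z; apply: sn; have := congr1 (fun t : T => t.1.1) z; move: um; rewrite /=; lia.
 rewrite (au_hom aX (fd_hom fD Logic.I (fd_hom hh Logic.I ha)) n0).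
 by rewrite (au_hom aX (fd_hom hh Logic.I (fd_hom fDu Logic.I ha))) ?mulr0 ?subr0 // addrAC.
Qed.

(** E psi differs from psi Eu by a boundary and a multiple of h d. The augmentation of D on the
    boundary is 0, and [keyK] replaces D h d by a multiple of h Du d, hence of h d Du; its
    augmentation is 0 since that of h d is, by the homotopy formula. *)
Lemma comp_match u v D E Du Eu m n : cder G0 M u D -> u.1.1 = - m.+2%:Z -> cder F0 L u Du ->
 allP (L m.+1) (fun x => eX (D (psi (x.2 1))) = eX (psi (Du (x.2 1)))) ->
 cder G0 M v E -> v.1.1 = - n.+2%:Z -> cder F0 L v Eu ->
 allP (L n.+1) (fun x => eX (E (psi (x.2 1))) = eX (psi (Eu (x.2 1)))) ->
 forall a, eX (D (E (psi a))) = eX (psi (Du (Eu a))).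
Proof.
move=> hD um hDu mD hE vn hEu mE a.
have dmD := match_all hD um hDu mD; have dmE := match_all hE vn hEu mE.
have [h [hh h0 hpow hdif]] := htpy hE vn hEu mE.
set s := sg k (v + (1, 0, 0)) in hdif; have s0 : s != 0.
 by rewrite /s /sg expfz_neq0 ?oppr_eq0 ?oner_eq0.
have eh b : eX (h (dif b)) = 0.
 have := congr1 eX (hdif b); rewrite (acl_dif hX) (auD aX) -scaleN1r addrC [_ + -1 *: _]addrC (auZ aX) (au_lin aX) dmE mulN1r addNr addr0.
 by move/esym/eqP; rewrite mulf_eq0 (negbTE s0) => /eqP.
have -> : E (psi a) = psi (Eu a) + dif (h a) + (- s) *: h (dif a).
 by rewrite hdif addrA [_ + (_ - _)]addrC subrK scaleNr addrK.
rewrite !(fdD (cd_fd hD)) // (fdZ _ (@gsub_full _ _ _ X) (cd_fd hD)) // !(auD aX) (auZ aX) (eD_dif hD) dmD addr0.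
rewrite (keyK (m := (m + n).+2) hD hDu dmD hh h0 hpow); last by rewrite /= um vn; lia.
have -> : Du (dif a) = sg k u *: dif (Du a).
 by rewrite (cd_dif hDu) scalerA /sg -signzD signz_absz odd_abszD addbb expr0 scale1r.
by rewrite (fdZ _ (@gsub_full _ _ _ W) hh) // (auZ aX) eh !mulr0 addr0.
Qed.
End Stage.
End Derivations.

End Homotopies.
Import Homotopies.

(** * Classes in pi and the augmented values of their representatives *)

Module ClosureDerivations.

Section Closures.
Variables (k : fieldType) (s : nat) (G : zmodType) (chi : alt_bicharacter G k).
Notation T := (tridegree G).
Variables (Q : monomial_quotient s chi) (X : acyclic_closure Q).
Notation cX := (collapse X).
Notation bX := (@base _ _ _ _ _ _ _ _ X).
Notation cv := (@cvars _ _ _ _ _ _ _ _ X).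
Notation gt0 := (@mq_d_gt0 _ _ _ _ Q).
Notation spn := (@mq_span k s G chi Q).

Definition ceps (b : X) : k := eps gt0 spn b.
Definition cvf (i : nat) : seq (var cX) := map (@fl _ _ _ X) (cv i).

Lemma allP_fl (L : seq (var X)) (P : var cX -> Prop) : allP (map (@fl _ _ _ X) L) P <-> allP L (fun v => P (fl v)).
Proof. by elim: L => //= v L IH; split=> -[h1 /IH]. Qed.

Lemma lev_cvf i : lev (A := cX) bX cvf i = lev bX cv i.
Proof. by elim: i => //= i ->; exact: spanL_fl. Qed.

Lemma ones_fl (L : seq (var X)) : ones (B := cX) (map (@fl _ _ _ X) L) = ones L.
Proof. by elim: L => //= v L ->. Qed.

Lemma ceps_dif b : ceps (dif b) = 0.
Proof. exact: eps_dif. Qed.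

Lemma closure_aclo : aclo (X := X) bX cv ceps.
Proof.
split.
- split.
 + exact: base_galg gt0 spn.
 + by move=> _ [t ->]; exists 0; rewrite ac_incl_dif rmorph0.
 + exact: cvars_dps.
 + exact: cvars_deg.
 + exact: lev_free.
 + exact: cvars_bd.
 + exact: lev_all.
 + by split; [exact: epsL | exact: epsM | exact: eps1 | exact: eps_hom].
 + move=> m c w Fc _ Lw dw i; rewrite size_map size_iota => im; exact: (lev_min gt0 spn Fc Lw dw im).
- exact: closure_acyclic.
- exact: ceps_dif.
- by move=> t b [t' ->] hb t0; have [->//|[e _]] := base_hom gt0 spn hb; rewrite e in t0.
Qed.

Lemma collapse_aclo : aclo (X := cX) bX cvf ceps.
Proof.
have hX := closure_aclo; have fl := acl_fl hX; split.
- split.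
 + exact: galg_collapse (fl_galg fl).
 + exact: (fl_dif0 fl).
 + by move=> i; apply: dpsL_fl; exact: (fl_dps fl i).
 + by move=> i; apply/allP_fl; exact: (fl_deg fl i).
 + by move=> i; rewrite lev_cvf; apply: freeL_fl; exact: (fl_free fl i).
 + by move=> i; rewrite lev_cvf; apply/allP_fl; exact: (fl_bd fl i).
 + by move=> b; have [i h] := fl_all fl b; exists i; rewrite lev_cvf.
 + split; [exact: epsL | exact: epsM | exact: eps1 |].
  move=> t b hb t0; rewrite /ceps; apply: eps_uniq; rewrite scale0r; apply: hb => e; exact: t0.
 + move=> m c w Fc _ Lw dw i; rewrite !size_map size_iota => im; rewrite lev_cvf in Lw.
  rewrite ones_fl in dw; exact: (lev_min gt0 spn Fc Lw dw im).
- exact: closure_acyclic.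
- exact: ceps_dif.
- move=> t b Fb hb t0; apply: (@prj_inj _ _ _ X) => u; rewrite prj0.
 case: (pselect (flat u = t)) => [ut|/hb//].
 have [t' e] := gsubP (galg_sub (fl_galg fl)) u Fb.
 have h : hom (c := X) u (ac_incl X t') := eq_ind _ (fun z => hom (c := X) u z) (@hom_prj _ _ _ X u b) _ e.
 apply: (etrans e); have [//|[e1 _]] := base_hom gt0 spn h.
 by move: t0; rewrite -ut /= e1.
Qed.

Lemma cd_0 u D : color_derivation (B := X) u D -> D 0 = 0.
Proof. by move=> hD; have := der_add hD 0 0; rewrite addr0 => /eqP; rewrite -subr_eq0 opprD addNKr oppr_eq0 => /eqP. Qed.

Lemma cd_prj u D b w : color_derivation (B := X) u D -> prj w (D b) = D (prj (w - u) b).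
Proof.
move=> hD; have [r [c [hc ->]]] := hom_span (dgaP X) b.
elim: r => [|t r IH]; first by rewrite big_nil prj0 (cd_0 hD) prj0.
rewrite big_cons prjD !(der_add hD) prjD IH; congr (_ + _).
rewrite (prj_hom _ (der_hom hD (hc t))) (prj_hom _ (hc t)) subr_eq.
by case: ifP => //; rewrite (cd_0 hD).
Qed.

Lemma cd_fder u D : color_derivation (B := X) u D -> fder (A := X) (B := X) id (@full _ _ _ X) u D.
Proof.
move=> hD; split=> [c a b _ _|t a _ ha|a b _ _].
- by rewrite (der_add hD) (color_derivationZ _ _ hD).
- exact: der_hom hD _ _ ha.
have [r [c [hc ->]]] := hom_span (dgaP X) a.
elim: r => [|t r IH]; first by rewrite big_nil mul0r (cd_0 hD) /ctw tw0 !mul0r addr0.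
rewrite big_cons mulrDl !(der_add hD) IH (der_mul hD _ (hc t)) /ctw twD -/(ctw u (c t)) (ctw_hom u (hc t)) !mulrDl.
by rewrite scalerAl addrACA.
Qed.

Lemma cd_fderc u D : color_derivation (B := X) u D -> fder (A := cX) (B := cX) id (@full _ _ _ cX) (flat u) D.
Proof.
move=> hD; split=> [c a b _ _|t a _ ha w wn|a b _ _].
- exact: (fd_lin (cd_fder hD)).
- rewrite (cd_prj _ _ hD) ha ?(cd_0 hD) // => e; apply: wn.
 by rewrite -e -flatD subrK.
have [r [c [hc ->]]] := hom_span (dgaP X) a.
elim: r => [|t r IH]; first by rewrite big_nil mul0r (cd_0 hD) /ctw (@tw0 _ _ _ cX) !mul0r addr0.
rewrite big_cons mulrDl !(der_add hD) IH (der_mul hD _ (hc t)) /ctw (@twD _ _ _ cX).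
rewrite (@tw_hom _ _ _ cX _ (flat t) _ (chom_hom (hc t))) !mulrDl.
by rewrite scalerAl addrACA.
Qed.

Lemma cvar_even r m : (m < ac_num X r)%N -> vodd (cvar X r m) = odd r.+1.
Proof. by move=> rm; rewrite /vodd /= (ac_deg1 rm). Qed.

Lemma cd_dpow u D i : color_derivation (B := X) u D -> allP (cv i) (fdpow (A := X) (B := X) id D).
Proof.
move=> hD; apply: cvars_allP => m im l; rewrite cvar_even // => ol.
have o1 q : (q < 2)%N -> dpow_ok (odd i.+1) q by move=> q2; rewrite /dpow_ok q2 implybT.
case: (boolP (odd i.+1)) => oi.
 have l0 : l = 0%N by move: ol; rewrite /dpow_ok oi; case: l.
 by rewrite l0 /cvar /= !o1 // (ac_var0 im) mulr1.
have ok q : dpow_ok (odd i.+1) q by rewrite /dpow_ok (negbTE oi).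
by rewrite /cvar /= !ok (der_dpow hD).
Qed.

Lemma fder_cd u h : fder (A := X) (B := X) id (@full _ _ _ X) u h -> (forall a, bX a -> h a = 0) ->
 (forall i, allP (cv i) (fdpow (A := X) (B := X) id h)) -> color_derivation (B := X) u h.
Proof.
move=> hh h0 hp; split=> [a b|t a ha|t|t a b ha|r m l rm or].
- exact: (fdD hh).
- exact: (fd_hom hh).
- by apply: h0; exists t.
- exact: (der_hom_mul _ hh ha).
have H : forall n a P, allP [seq cvar X r m' | m' <- iota a n] P -> forall m', (a <= m' < a + n)%N -> P (cvar X r m').
 elim=> [|n IH] a P /=; first by move=> _ m'; lia.
 move=> [Pa hP] m' hm; case: (eqVneq m' a) => [->//|na]; apply: (IH a.+1 P hP); lia.
have ok q : dpow_ok (odd r.+1) q by rewrite /dpow_ok (negbTE or).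
have := H _ 0%N _ (hp r) m; rewrite add0n rm => /(_ isT) /(_ l).
by rewrite cvar_even // /cvar /= !ok; apply.
Qed.

Definition cdeg (i : nat) (a : G) : T := (- i%:Z, 0, a).

(** A sum of derivations of several internal degrees becomes homogeneous once internal degrees are
    forgotten. *)
Record preder (u : T) (D : X -> X) : Prop := {
 pd_fd : fder (A := cX) (B := cX) id (@full _ _ _ cX) u D;
 pd_F0 : forall a, bX a -> D a = 0;
 pd_pow : forall i, allP (cvf i) (fdpow (A := cX) (B := cX) id D) }.

Lemma derivation_preder i a D : derivation (B := X) i a D -> preder (i, 0, a) D.
Proof.
elim=> [|e D1 D2 hD1 _ [fd2 z2 p2]].
 split=> //; first by split=> *; rewrite ?scaler0 ?mul0r ?mulr0 ?addr0 //; apply: hom0.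
 by move=> j; elim: (cvf j) => //= v L IH; split=> // l _; exact: (esym (mul0r _)).
have fd1 := cd_fderc hD1; split.
- split=> [c x y Fx Fy|t x Fx hx|x y Fx Fy]; rewrite !fctE.
 + by rewrite (fd_lin fd1) // (fd_lin fd2) // scalerDr addrACA.
 + by apply: homD; [apply: (fd_hom fd1) | apply: (fd_hom fd2)].
 + by rewrite (fd_mul fd1) // (fd_mul fd2) // mulrDl mulrDr addrACA.
- by move=> _ [t ->]; rewrite !fctE (der_incl hD1) z2 ?addr0 //; exists t.
move=> j; have p1 : allP (cvf j) (fdpow (A := cX) (B := cX) id D1) by apply/allP_fl; exact: (cd_dpow j hD1).
have := allP_and p1 (p2 j); apply: allP_impl => v [h1 h2] l ol.
by rewrite !fctE (h1 l ol) (h2 l ol) mulrDl.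
Qed.

Lemma cocycle_cder i a D : is_cocycle (B := X) i a D -> cder (A := cX) bX cvf (cdeg i a) D.
Proof.
move=> [dD D0]; have [h1 h2 h3] := derivation_preder dD; split=> // x.
exact: (der_dif_comm x D0).
Qed.

Let hX := closure_aclo.
Let hC := collapse_aclo.
Let aX := fl_aug (acl_fl hX).
Let flC := acl_fl hC.
Let flX := acl_fl hX.
Let aC := fl_aug flC.

Lemma aug_eder u D : preder u D -> eder (A := cX) ceps (@full _ _ _ cX) (ceps \o D).
Proof. by move=> h; apply: (fder_eder (f := id) (@dmap_id _ _ _ cX) aC (pd_fd h)). Qed.

Lemma aug_edpow u D i : preder u D -> allP (cvf i) (edpow (A := cX) (ceps \o D)).
Proof.
move=> h; have := allP_and (allP_and (fl_dps flC i) (fl_deg flC i)) (pd_pow h i).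
apply: allP_impl => v [[dv vi] pv]; apply: (fdpow_edpow (f := id) (@dmap_id _ _ _ cX) aC dv) => //.
by rewrite vi.
Qed.

Lemma aug_graded u D t a m : fder (A := cX) (B := cX) id (@full _ _ _ cX) u D -> u.1.1 = - m.+1%:Z -> hom (c := cX) t a -> t.1.1 <> m.+1%:Z -> ceps (D a) = 0.
Proof.
move=> h um ha tm; apply: (au_hom aC (fd_hom h Logic.I ha)) => e; apply: tm.
have := congr1 (fun t : T => t.1.1) e; rewrite /= um; lia.
Qed.

(** The augmentation of E is a derivation into k; by minimality it vanishes on boundaries, as the
    augmentation itself does. *)
Lemma coboundary_aug m a D x : is_coboundary (B := X) m.+2 a D -> ceps (D x) = 0.
Proof.
move=> [E dE ->]; have hE := derivation_preder dE; rewrite /der_dif !fctE.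
have um : ((1 - m.+2%:Z, 0, a) : T).1.1 = - m.+1%:Z by rewrite /=; lia.
rewrite -scaleNr addrC (au_lin aX) ceps_dif addr0.
have -> : ceps (E (dif x)) = 0; last by rewrite mulr0.
apply: (eder_dif flC (m := m) (d := ceps \o E) x (aug_eder hE)).
- by move=> y Fy /=; rewrite (pd_F0 hE) // (au0 aX).
- by move=> i; apply: aug_edpow hE.
- by move=> t y hy tm; apply: (aug_graded (pd_fd hE) um hy tm).
Qed.

Lemma aug_low d m i a : eder (A := cX) ceps (@full _ _ _ cX) d -> (forall b, bX b -> d b = 0) ->
 (forall j, allP (cvf j) (edpow (A := cX) d)) ->
 (forall t b, hom (c := cX) t b -> t.1.1 <> m%:Z -> d b = 0) ->
 (i < m)%N -> lev (A := cX) bX cvf i a -> d a = 0.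
Proof.
move=> ed d0 dp dg; elim: i a => [|i IH] a im; first exact: d0.
apply: (ed_eq0 (flev_galg flC i) (fl_dps flC i) (ed_mono (fun _ _ => Logic.I) ed)) => [b|].
 by apply: IH; exact: ltnW.
apply: allP_and (dp i); have := allP_and (fl_dps flC i) (fl_deg flC i).
apply: allP_impl => v [dv vi]; apply: (dg v.1 _ (dps_hom1 dv)).
by rewrite vi => -[] e; rewrite e ltnn in im.
Qed.

Lemma cocycle_low m a D i b : is_cocycle (B := X) m.+2 a D -> (i < m.+2)%N -> lev (A := cX) bX cvf i b -> ceps (D b) = 0.
Proof.
move=> [/derivation_preder hD _]; apply: (aug_low (d := ceps \o D) (aug_eder hD)).
- by move=> y Fy /=; rewrite (pd_F0 hD) // (au0 aX).
- by move=> j; apply: aug_edpow hD.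
- by move=> t y hy tm; apply: (aug_graded (pd_fd hD) (m := m.+1) erefl hy tm).
Qed.

(** E is another list of variables for the same level. As D respects its divided powers, vanishing
    on E spreads to the whole level, in particular to the original variables. *)
Lemma ev_zero m a D (E : seq (var cX)) : is_cocycle (B := X) m.+2 a D -> dpsL E ->
 allP E (fun v => good (DS cvf) v.1 v.2) ->
 spanL (B := cX) (lev (A := cX) bX cvf m.+1) E = lev (A := cX) bX cvf m.+2 ->
 allP E (fun v => ceps (D (v.2 1)) = 0) -> forall b, lev (A := cX) bX cvf m.+2 b -> ceps (D b) = 0.
Proof.
move=> cD dE gE sE zE b; rewrite -sE => Eb; have hD := derivation_preder cD.1.
refine (@ed_eq0 k G chi cX ceps _ E (ceps \o D) (flev_galg flC m.+1) dE (ed_mono (fun _ _ => Logic.I) (aug_eder hD)) _ _ b Eb) => [c|].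
 exact: (cocycle_low cD (ltnSn _)).
have := allP_and gE zE; apply: allP_impl => v [gv zv]; split=> // l ol /=.
have ev : even_deg v.1 by move: ol; rewrite /dpow_ok /even_deg -/(vodd v); case: (vodd v).
by rewrite (gv ev _ D (conj (pd_fd hD) (pd_pow hD))) (au_mul aC) zv mul0r.
Qed.

Lemma cd_zero u : color_derivation (B := X) u 0.
Proof.
split=> [x y|t x hx|t|t x y hx|r m l rm or].
- exact: (esym (addr0 _)).
- exact: hom0.
- by [].
- by change (0 = 0 * y + csign chi u t *: (x * 0) :> X); rewrite mul0r mulr0 scaler0 addr0.
- exact: (esym (mul0r _)).
Qed.

Lemma cd_add u D E : color_derivation (B := X) u D -> color_derivation (B := X) u E -> color_derivation (B := X) u (D + E).
Proof.
move=> hD hE; split=> [x y|t x hx|t|t x y hx|r m l rm or]; rewrite !fctE.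
- by rewrite (der_add hD) (der_add hE) addrACA.
- by apply: homD; [apply: (der_hom hD) | apply: (der_hom hE)].
- by rewrite (der_incl hD) (der_incl hE) addr0.
- by rewrite (der_mul hD _ hx) (der_mul hE _ hx) mulrDl mulrDr scalerDr addrACA.
- by rewrite (der_dpow hD) // (der_dpow hE) // mulrDl.
Qed.

Lemma derivation_dec i a D : derivation (B := X) i a D -> exists (es : seq int) (F : int -> X -> X),
 [/\ uniq es, forall e, color_derivation (B := X) (i, e, a) (F e) & forall x, D x = \sum_(e <- es) F e x].
Proof.
elim=> [|e1 D1 D2 hD1 _ [es [F [us hF eF]]]].
 by exists [::], (fun=> 0); split=> // [e|x]; [exact: cd_zero | rewrite big_nil].
exists (if e1 \in es then es else e1 :: es), (fun e => if e == e1 then D1 + (if e1 \in es then F e else 0) else F e).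
split=> [|e|x].
- by case: ifP => //= ->.
- case: eqP => [->|_ //]; apply: cd_add => //; case: ifP => _ //; exact: cd_zero.
rewrite fctE eF; case: ifP => e1s.
 rewrite (bigD1_seq e1) //= [RHS](bigD1_seq e1) //= eqxx fctE -addrA; congr (_ + (_ + _)).
 by apply: eq_bigr => e /negbTE ->.
rewrite big_cons eqxx fctE /= addr0; congr (_ + _); apply: eq_big_seq => e es1.
by case: eqP es1 => // ->; rewrite e1s.
Qed.

Lemma sgE (i : int) (e : int) (a : G) : sg k (i, e, a) = (-1) ^ i. Proof. by []. Qed.

(** [solve_filt] needs a homogeneous derivation, so D is split by internal degree. Each component is
    again a cocycle with augmented values 0 and is the boundary of a solution. *)
Lemma ev_coboundary m a D : is_cocycle (B := X) m.+2 a D -> allP (cv m.+1) (fun v => ceps (D (v.2 1)) = 0) ->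
 is_coboundary (B := X) m.+2 a D.
Proof.
move=> [dD D0] zD; have [es [F [us hF eF]]] := derivation_dec dD.
have Fprj e t x : e \in es -> hom t x -> F e x = prj (t + (- m.+2%:Z, e, a)) (D x).
 move=> ee hx; rewrite eF prj_sum (bigD1_seq e) //= big1 ?addr0.
  by rewrite prj_id //; exact: (der_hom (hF e) hx).
 move=> e' ne; rewrite (prj_hom _ (der_hom (hF e') hx)); case: eqP => // /addrI[] e2.
 by rewrite e2 eqxx in ne.
have Fdif e x : e \in es -> dif (F e x) = (-1) ^ (- m.+2%:Z) *: F e (dif x).
 move=> ee; have [r [c [hc ->]]] := hom_span (dgaP X) x.
 elim: r => [|t r IH]; first by rewrite big_nil dif0 (cd_0 (hF e)) dif0 scaler0.
 rewrite big_cons difD !(der_add (hF e)) difD scalerDr IH; congr (_ + _).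
 rewrite (Fprj _ _ _ ee (hc t)) (Fprj _ _ _ ee (hom_dif (hc t))).
 have pd w z : dif (prj w z) = prj (w + (-1, 0, 0)) (dif z : X) by rewrite prj_dif dnup.
 by rewrite pd (der_dif_comm _ D0) prjZ addrAC.
have Fz e : e \in es -> allP (cv m.+1) (fun v => ceps (F e (v.2 1)) = 0).
 move=> ee; have := allP_and (fl_dps flX m.+1) zD; apply: allP_impl => v [dv zv].
 have hv := dps_hom1 dv; case: (eqVneq (v.1 + (- m.+2%:Z, e, a)) 0) => [e0|/eqP n0]; last first.
  exact: (au_hom aX (der_hom (hF e) hv) n0).
 have ep b : ceps (prj 0 b) = ceps b by apply: eps_uniq; rewrite (prj_id (hom_prj 0 b)); exact: epsE.
 by rewrite (Fprj _ _ _ ee hv) e0 ep.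
have Fcob e : e \in es -> is_coboundary (B := X) m.+2 a (F e).
 move=> ee; set u : T := (- m.+2%:Z, e, a); have fF := cd_fder (hF e).
 have [||||||||h [hh h0 hpow hdif _]] := @solve_filt k G chi X X id (@dmap_id _ _ _ X) bX cv ceps flX aX
   (u + (1, 0, 0)) m (F e) (fun _ _ => True).
 - by rewrite /=; lia.
 - by rewrite updn.
 - by move=> x; rewrite sg_up scaleNr opprK (Fdif _ _ ee).
 - by move=> _ [t ->]; exact: (der_incl (hF e)).
 - by move=> j; exact: (cd_dpow j (hF e)).
 - exact: Fz.
 - by elim: (cv m) => //= v r IH; split=> //; exists 0; split=> //; apply: hom0.
 - move=> i mi; apply: allP_impl (fl_deg flX i) => v vi z hz dz ez.
  by have [b [hb db]] := acyclic_hom' hX hz dz ez; exists b; rewrite dnup in hb.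
 have uE : u + (1, 0, 0) = (1 - m.+2%:Z, e, a) by rewrite /u; congr (_, _, _); rewrite /= ?addr0 // addrC.
 exists h.
  apply: (derivation_of_color (e := e)); rewrite -uE; exact: fder_cd hh h0 hpow.
 apply/funext => x; rewrite /der_dif !fctE hdif uE sgE. by rewrite addrK.
have {eF} -> : D = (fun x => \sum_(e <- es) F e x) by apply/funext.
have : {subset es <= es} by [].
elim: {1 3}es => [|e r IH] rs.
 have -> : (fun x => \sum_(e <- [::]) F e x) = 0 by apply/funext => x; rewrite big_nil.
 exact: is_coboundary0.
have -> : (fun x => \sum_(e <- e :: r) F e x) = 1 *: F e + (fun x => \sum_(e <- r) F e x).
 by apply/funext => x; rewrite big_cons !fctE scale1r.
apply: is_coboundary_lin; first by apply: Fcob; apply: rs; exact: mem_head.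
by apply: IH => e' er; apply: rs; rewrite in_cons er orbT.
Qed.

(** For each internal degree e one solves with values prescribed on the variables of internal degree
    e and 0 on the others; the solutions are added over the finitely many degrees that occur. *)
Lemma cocycle_ex m a (val : var X -> k) :
 (forall v, flat v.1 + cdeg m.+2 a <> 0 -> val v = 0) ->
 exists D, is_cocycle (B := X) m.+2 a D /\ allP (cv m.+1) (fun v => ceps (D (v.2 1)) = val v).
Proof.
move=> hval.
have De e : exists D, is_cocycle (B := X) m.+2 a D /\
  allP (cv m.+1) (fun v => ceps (D (v.2 1)) = if v.1.1.2 == e then val v else 0).
 pose u : T := (- m.+2%:Z, - e, a).
 pose Q' (v : var X) b := ceps b = if v.1.1.2 == e then val v else 0.
 have [||||||||h [hh h0 hpow hdif hQ]] := @solve_filt k G chi X X id (@dmap_id _ _ _ X) bX cv ceps flX aX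
   u m.+1 (fun=> 0) Q'.
 - by [].
 - by split=> *; rewrite ?scaler0 ?addr0 ?mul0r ?mulr0 ?addr0 //; apply: hom0.
 - by move=> x; rewrite dif0 scaler0 oppr0.
 - by [].
 - by move=> i; elim: (cv i) => //= v r IH; split=> // l _; rewrite mul0r.
 - by elim: (cv m.+2) => //= v r IH; split=> //; exact: (au0 aX).
 - apply: allP_impl (fl_deg flX m.+1) => v vi; set c := if v.1.1.2 == e then val v else 0.
  exists (c *: 1); split; last by rewrite /Q' (auZ aX) (au_one aX) mulr1.
  have [c0|c0] := eqVneq c 0; first by rewrite c0 scale0r; apply: hom0.
  have -> : v.1 + u = 0; last by apply: homZ; apply: hom1.
  move: c0; rewrite /c; case: (v.1.1.2 =P e) => [ve|_]; last by rewrite eqxx.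
  case: (pselect (flat v.1 + cdeg m.+2 a = 0)) => [e0 _|n0]; last by rewrite hval // eqxx.
  move: e0 ve vi; rewrite /u /cdeg /flat; case: (v.1) => -[x1 x2] x3 /= [e1 e2] -> _.
  by congr (_, _, _); rewrite //= subrr.
 - move=> i mi; apply: allP_impl (fl_deg flX i) => v vi z hz dz ez.
  by have [b [hb db]] := acyclic_hom' hX hz dz ez; exists b; rewrite dnup in hb.
 exists h; split; last exact: hQ.
 split; first by apply: (derivation_of_color (e := - e)); exact: fder_cd hh h0 hpow.
 by apply/funext => x; rewrite /der_dif !fctE hdif sgE add0r subrr.
have /choice[F hF] := De.
pose es := undup (map (fun v : var X => v.1.1.2) (cv m.+1)).
exists (fun x => \sum_(e <- es) F e x); split.
 elim: es => [|e r IH].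
  have -> : (fun x => \sum_(e <- [::]) F e x) = 0 by apply/funext => x; rewrite big_nil.
  exact: is_cocycle0.
 have -> : (fun x => \sum_(e <- e :: r) F e x) = 1 *: F e + (fun x => \sum_(e <- r) F e x).
  by apply/funext => x; rewrite big_cons !fctE scale1r.
 by apply: is_cocycle_lin IH; exact: (hF e).1.
have mem : allP (cv m.+1) (fun v => v.1.1.2 \in es).
 have : {subset map (fun v : var X => v.1.1.2) (cv m.+1) <= es} by move=> x; rewrite mem_undup.
 elim: (cv m.+1) => //= v r IH sub; split; first by apply: sub; exact: mem_head.
 by apply: IH => x xr; apply: sub; rewrite in_cons xr orbT.
have := allP_and mem (allP_forall (P := fun e v => ceps (F e (v.2 1)) = if v.1.1.2 == e then val v else 0) (fun e => (hF e).2)).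
apply: allP_impl => v [ve hv]; rewrite (au_sum aX) (bigD1_seq v.1.1.2) ?undup_uniq //= hv eqxx big1 ?addr0 // => e ne.
by rewrite hv eq_sym (negbTE ne).
Qed.

Lemma fder_list (W : color_dga chi) (psi : W -> cX) (hp : is_dmap psi) u (val : var W -> k) (L : seq (var W)) (C : cX -> Prop) (h0 : cX -> cX) :
 galg C -> fder (A := cX) (B := cX) id C u h0 -> dpsL L -> freeL C (map (vmap psi) L) ->
 (forall v, v.1 + u <> 0 -> val v = 0) ->
 exists h, [/\ fder (A := cX) (B := cX) id (spanL C (map (vmap psi) L)) u h, forall c, C c -> h c = h0 c &
  allP L (fun v => h (psi (v.2 1)) = val v *: 1)].
Proof.
elim: L C h0 => [|v L IH] C h0 gC hh dL fL hval /=; first by exists h0.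
have [dv dL'] := dL; have [fv fL'] := fL; have dpv := vmap_dps hp dv.
have hb : hom (c := cX) ((vmap psi v).1 + u) (val v *: 1).
 case: (pselect (v.1 + u = 0)) => [e0|n0]; first by rewrite /= e0; apply: (@homZ k G chi cX); apply: (@hom1 k G chi cX).
 by rewrite hval // scale0r; apply: (@hom0 k G chi cX).
have [h1 [fh1 e1 b1 _]] := fder_ext (@dmap_id _ _ _ cX) gC hh dpv fv hb.
have [h [fh eh vh]] := IH (adj1 C (vmap psi v)) h1 (adjoin_galg gC dpv) fh1 dL' fL' hval.
exists h; split=> // [c Cc|].
 by rewrite eh ?e1 //; apply: (adjoin_incl (galg_sub gC) dpv).
split=> //; rewrite eh //.
by have [h3 _] := spanL_one (V := C) gC (L := [:: vmap psi v]) (conj dpv Logic.I); exact: h3.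
Qed.

(** A derivation with the wanted values on the new variables exists on the level by freeness.
    [cocycle_ex] realises its augmented values on the original variables, and the two then agree
    under the augmentation on the whole level. *)
Lemma cocycle_match (W : color_dga chi) (psi : W -> cX) (hp : is_dmap psi) m a (val : var W -> k) (L : seq (var W)) :
 dpsL L -> freeL (lev (A := cX) bX cvf m.+1) (map (vmap psi) L) ->
 spanL (lev (A := cX) bX cvf m.+1) (map (vmap psi) L) = lev (A := cX) bX cvf m.+2 ->
 (forall v, v.1 + cdeg m.+2 a <> 0 -> val v = 0) ->
 exists D, is_cocycle (B := X) m.+2 a D /\ allP L (fun v => ceps (D (psi (v.2 1))) = val v).
Proof.
move=> dL fL sL hval; have gl := flev_galg flC m.+1.
have f0 : fder (A := cX) (B := cX) id (lev (A := cX) bX cvf m.+1) (cdeg m.+2 a) (fun=> 0).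
 by split=> *; rewrite ?scaler0 ?addr0 ?mul0r ?mulr0 ?addr0 //; apply: hom0.
have [h [fh h0 hv]] := fder_list hp gl f0 dL fL hval; rewrite sL in fh.
have vl := vars_lev flC m.+1.
have ok1 (v : var cX) : dpow_ok (vodd v) 1 by rewrite /dpow_ok implybT.
(* [cocycle_ex] quantifies over all v, also those not in the level or not homogeneous; these get the
   value 0. *)
have [|D [cD vD]] := @cocycle_ex m a (fun v => if pselect (lev (A := cX) bX cvf m.+2 (v.2 1) /\ hom (c := cX) (flat v.1) (v.2 1)) then ceps (h (v.2 1)) else 0).
 move=> v n0; case: pselect => // -[Lv hv1]; exact: (au_hom aC (fd_hom fh Lv hv1) n0).
exists D; split=> //; have hD := derivation_preder cD.1.
pose d x := ceps (D x) - ceps (h x).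
have hsub x y : ceps (x - y) = ceps x - ceps y by rewrite -scaleN1r addrC (au_lin aX) mulN1r addrC.
have ed : eder (A := cX) ceps (lev (A := cX) bX cvf m.+2) d.
 have e1 := aug_eder hD; have e2 := fder_eder (f := id) (@dmap_id _ _ _ cX) aC fh.
 split=> [c x y Lx Ly|x y Lx Ly]; rewrite /d.
  have := ed_lin e1 c (a := x) (b := y) Logic.I Logic.I; have := ed_lin e2 c Lx Ly => /= -> ->; ring.
 have := ed_mul e1 (a := x) (b := y) Logic.I Logic.I; have := ed_mul e2 Lx Ly => /= -> ->; ring.
have dz b : lev (A := cX) bX cvf m.+2 b -> d b = 0.
 apply: (ed_eq0 gl (fl_dps flC m.+1) ed) => [c Lc|].
  by rewrite /d h0 // (cocycle_low cD (ltnSn _) Lc) (au0 aX) subr0.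
 have vD' : allP (cvf m.+1) (fun v => lev (A := cX) bX cvf m.+2 (v.2 1) -> hom (c := cX) v.1 (v.2 1) -> ceps (D (v.2 1)) = ceps (h (v.2 1))).
  by apply/allP_fl; apply: allP_impl vD => v /= -> Lv hv1; case: pselect => // -[].
 have := allP_and (allP_and (allP_and (fl_dps flC m.+1) (fl_deg flC m.+1)) vl) vD'.
 apply: allP_impl => v [[[dv vi] Lv] ev]; split=> [|l ol].
  by rewrite /d ev ?subrr //; [exact: Lv (ok1 v) | exact: dps_hom1 dv].
 have hl := dps_hom dv ol; have tl : (v.1 *+ l.+2).1.1 <> m.+2%:Z.
  rewrite tdegMn1 vi mulrS => /eqP; rewrite -subr_eq0 addrAC subrr add0r mulrn_eq0. by [].
 rewrite /d (aug_graded (pd_fd hD) (m := m.+1) erefl hl tl) sub0r.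
 have -> : ceps (h (v.2 l.+2)) = 0; last by rewrite oppr0.
 apply: (au_hom aC (fd_hom fh (Lv _ ol) hl)) => e0; apply: tl.
 by have := congr1 (fun t : T => t.1.1) e0; rewrite /=; lia.
have Lp : allP L (fun v => lev (A := cX) bX cvf m.+2 (psi (v.2 1))).
 have := spanL_one (V := lev (A := cX) bX cvf m.+1) gl (vmap_dpsL hp dL); rewrite sL; move/allP_map.
 by apply: allP_impl => v; rewrite /one.
have := allP_and Lp hv; apply: allP_impl => v [Lv ev].
by have := dz _ Lv; rewrite /d ev (auZ aX) (au_one aX) mulr1 => /eqP; rewrite subr_eq0 => /eqP.
Qed.
End Closures.

End ClosureDerivations.
Import ClosureDerivations.

(** * The isomorphism for equal invariants, and finiteness *)

Module ColorLieComparison.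

Section LinearIso.
Variables (k : fieldType) (U V : lmodType k) (eU : U -> seq k) (eV : V -> seq k).
Definition seqlin (c : k) (s t : seq k) : seq k := [seq c * z.1 + z.2 | z <- zip s t].
Hypotheses (iU : injective eU) (iV : injective eV)
 (lU : forall c x y, eU (c *: x + y) = seqlin c (eU x) (eU y))
 (lV : forall c x y, eV (c *: x + y) = seqlin c (eV x) (eV y))
 (UV : forall x, exists y, eV y = eU x) (VU : forall y, exists x, eU x = eV y).

(** Both spaces are embedded linearly, with the same image, into lists of coordinates; the
    isomorphism matches coordinates. *)
Lemma linear_iso : exists f : {linear U -> V}, bijective f /\ forall x, eV (f x) = eU x.
Proof.
have /choice[f hf] := UV; have /choice[g hg] := VU.
have lf : linear f by move=> c x y; apply: iV; rewrite lV !hf lU.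
pose lfm := GRing.isLinear.Build k U V _ f lf.
exists (HB.pack_for {linear U -> V} f lfm); split=> //.
by exists g => x; [apply: iU; rewrite hg hf | apply: iV; rewrite /= hf hg].
Qed.
End LinearIso.

Section Final.
Variables (k : fieldType) (s : nat) (G : zmodType) (chi : alt_bicharacter G k).
Notation T := (tridegree G).

Lemma spanL_sub (A : color_dga chi) (V C : A -> Prop) (L : seq (var A)) : galg V -> (forall a, C a -> V a) ->
 allP L (fun v => forall l, V (v.2 l)) -> forall a, spanL C L a -> V a.
Proof.
move=> gV; elim: L C => //= v L IH C CV [Vv VL]; apply: IH => // a [N [c [Cc ->]]].
by apply: (gsub_sum (galg_sub gV)) => l _; apply: (galgM gV) => //; apply: CV.
Qed.

Lemma map_allP (A : color_dga chi) (Y : Type) (f g : var A -> Y) (L : seq (var A)) :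
 map f L = map g L <-> allP L (fun v => f v = g v).
Proof.
elim: L => //= v L IH; split=> [[e1 e2]|[-> /IH ->]//].
by split=> //; apply/IH.
Qed.

Notation closure := {Q : monomial_quotient s chi & acyclic_closure Q}.
Implicit Types P : closure.
Notation XX P := (projT2 P).

(** The generators come in no canonical order. Any choice will do, since an isomorphism is derived
    from equality of the chosen data. *)
Definition exps P := projT1 (cid (@min_exponents_ex _ _ _ _ (projT1 P))).
Lemma exps_ok P : min_exponents (exps P). Proof. exact: projT2 (cid _). Qed.
Definition Dinv P : {set {set 'I_s}} := Dinc (exps P).
Definition hinv P : {ffun {set 'I_s} -> G} :=
 [ffun A => if A \in Dinv P then \sum_j mq_g j *+ einc (exps P) A j else 0].

Variable P : bool -> closure.
Hypotheses (eD : Dinv (P true) = Dinv (P false)) (eh : hinv (P true) = hinv (P false)).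
Notation X p := (collapse (XX (P p))).
Notation G0 p := (@base _ _ _ _ _ _ _ _ (XX (P p))).
Notation M p := (cvf (XX (P p))).
Notation eX p := (@ceps _ _ _ _ _ (XX (P p))).

Definition fam_aclo p : aclo (X := X p) (G0 p) (M p) (eX p) := collapse_aclo (XX (P p)).

Let D := Dinv (P true).
Let h := hinv (P true).
Let E0 : Eind D 0 := Eind_base (exps_ok (P true)) erefl.
Let Su := @skew_dga k G chi _ (gA h) (Eind D) E0 (@Eind_down s D).
Let cyc := @kos_cycles k G chi _ (gA h) (Eind D) E0 (@Eind_down s D).

Lemma kos_ex : exists Ku : color_dga chi, exists (iu : Su -> Ku) (Lu : seq (var Ku)), tower iu cyc Lu.
Proof. exact: tower_ex (@kos_cycles_ok k G chi _ (gA h) (Eind D) E0 (@Eind_down s D)). Qed.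

Definition Ku := projT1 (cid kos_ex).

Lemma Ku_tower : exists (iu : Su -> Ku) (Lu : seq (var Ku)), tower iu cyc Lu.
Proof. exact: projT2 (cid kos_ex). Qed.

Lemma tower_deg1 (iu : Su -> Ku) Lu : tower iu cyc Lu -> allP Lu (fun v => v.1.1.1 = 1).
Proof.
move=> tw; have := tw_bd tw; rewrite /cyc /kos_cycles -map_comp.
by elim: (Lu) (enum _) => [|v L IH] [|j r] //= [-> _ /IH].
Qed.

Lemma Ku_map p : exists psi : Ku -> X p, [/\ is_dmap psi, forall w, lev (A := X p) (G0 p) (M p) 1 (psi w) &
 cone psi (@full _ _ _ Ku) (lev (A := X p) (G0 p) (M p) 1)].
Proof.
have [iu [Lu tw]] := Ku_tower.
have mD : D = Dinc (exps (P p)) by rewrite /D; case: p => //; exact: eD.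
have mh A : A \in D -> h A = \sum_j mq_g j *+ einc (exps (P p)) A j.
 move=> AD; have -> : h = hinv (P p) by rewrite /h; case: (p) => //; exact: eh.
 by rewrite ffunE /Dinv -mD AD.
have [psi [hp cp]] := koszul_base (exps_ok (P p)) (XX (P p)) mD mh tw.
exists psi; split=> // [w|]; last by rewrite lev_cvf.
have hX := fam_aclo p; have gV := flev_galg (acl_fl hX) 1.
have gI : gsub (image iu (@full _ _ _ Su)) by apply: (image_gsub (tw_dmap tw)); exact: galg_sub (full_galg _).
have := iffRL (spanL_image hp (psi w) gI (tw_dps tw)) (ex_intro2 _ _ w (tw_gen tw w) erefl).
apply: (spanL_sub gV).
 move=> _ [_ [f _ ->] ->]; elim/skew_ind: f => [|f1 f2 h1 h2|c a _].
 - by rewrite (dmap0 (tw_dmap tw)) (dmap0 hp); apply: (gsub0 (galg_sub gV)).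
 - by rewrite (dmapD (tw_dmap tw)) (dmapD hp); apply: (gsubD (galg_sub gV)).
 - rewrite (dmapZ (tw_dmap tw)) (dmapZ hp); apply: (gsubZ (galg_sub gV)).
  have hs := dmap_hom hp (dmap_hom (tw_dmap tw) (smono_hom chi (gA h) E0 (@Eind_down s D) a)).
  by apply: (full_lev hX hs); rewrite mdeg_hom.
apply/allP_map; have := allP_and (tw_dps tw) (tower_deg1 tw); apply: allP_impl => v [dv v1] l; rewrite -[(vmap psi v).2 l]/(psi (v.2 l)).
case: (boolP (dpow_ok (vodd v) l)) => ol; last by rewrite (dps_out dv ol) (dmap0 hp); apply: (gsub0 (galg_sub gV)).
apply: (full_lev hX (dmap_hom hp (dps_hom dv ol))); rewrite tdegMn1 v1.
by move: ol; rewrite /vodd v1 /dpow_ok /=; case: l => [|[|l]].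
Qed.

Lemma Ku_eps p q (psi : Ku -> X p) (psi' : Ku -> X q) : is_dmap psi -> is_dmap psi' ->
 forall w, eX p (psi w) = eX q (psi' w).
Proof.
move=> hp hp' w; have [iu [Lu tw]] := Ku_tower.
have dm r (f : Ku -> X r) : is_dmap f -> is_dmap (fun w => eX r (f w) : base_dga chi).
 move=> hf; have aX := fl_aug (acl_fl (fam_aclo r)); split=> [c a b|a b||t a ha|a].
 - by rewrite (dmapL hf) (au_lin aX).
 - by rewrite (dmapM hf) (au_mul aX).
 - by rewrite (dmap1 hf) (au_one aX).
 - case: (eqVneq t 0) => [->|/eqP t0]; first exact: (or_introl erefl).
  rewrite (au_hom aX (dmap_hom hf ha) t0); exact: hom0.
 - by rewrite (dmap_dif hf) (acl_dif (fam_aclo r)).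
have pos : allP Lu (fun v => 0 < v.1.1.1) by apply: allP_impl (tower_deg1 tw) => v ->.
exact: (eps_base_eq tw pos (dm p psi hp) (dm q psi' hp')).
Qed.

Let St := @states k G chi bool (fun p => X p) (fun p => G0 p) (fun p => M p) (fun p => eX p) fam_aclo true Ku Ku_map Ku_eps.
Notation W N := (st_W (St N)).
Notation L N := (st_L (St N)).
Notation psi N p := (@st_psi _ _ _ _ _ _ _ _ _ (St N) p).

Lemma st_ok N p : stage (X := X p) (G0 p) (M p) (eX p) (st_F0 (s := St N)) (L N) (st_e (s := St N)) N.+1 (psi N p).
Proof. exact: (@st_stage _ _ _ _ _ _ _ _ _ (St N) p). Qed.

(** Coordinates of a derivation: its augmented values on the images of the variables of degree j + 1
    of the common model. *)
Definition evs p j (f : X p -> X p) : seq k := [seq eX p (f (v.2 1)) | v <- stvars (St j) p j].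

Lemma evsE N p j f : (j <= N)%N -> evs j f = [seq eX p (f (psi N p (v.2 1))) | v <- L N j].
Proof. by move=> jN; rewrite /evs -(@stvars_states _ _ _ _ _ _ _ _ _ _ _ _ _ N p j jN) /stvars -map_comp. Qed.

Lemma evs_lin p j c (f g : X p -> X p) : evs j (c *: f + g) = seqlin c (evs j f) (evs j g).
Proof.
rewrite /evs /seqlin; elim: (stvars _ _ _) => //= v r ->; congr (_ :: _).
exact: (au_lin (fl_aug (acl_fl (fam_aclo p)))).
Qed.

Lemma evs_coboundary p m a f : is_coboundary (B := XX (P p)) m.+2 a f -> allP (stvars (St m.+1) p m.+1) (fun v => eX p (f (v.2 1)) = 0).
Proof. by move=> h1; elim: (stvars _ _ _) => //= v r IH; split=> //; apply: coboundary_aug h1. Qed.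

Lemma stv_dps p m : dpsL (stvars (St m.+1) p m.+1).
Proof. apply: vmap_dpsL; [exact: sg_dmap (st_ok _ _) | exact: fl_dps (md_filt (st_model (St m.+1))) _]. Qed.

Lemma evs_zero p m a f : is_cocycle (B := XX (P p)) m.+2 a f -> allP (stvars (St m.+1) p m.+1) (fun v => eX p (f (v.2 1)) = 0) ->
 is_coboundary (B := XX (P p)) m.+2 a f.
Proof.
move=> cf zf; apply: ev_coboundary => //.
have lt : (0 < m.+1 < m.+2)%N by rewrite ltnS leqnn.
have H := ev_zero cf (stv_dps p m) (sg_good (st_ok m.+1 p) lt) (sg_span (st_ok m.+1 p) lt) zf.
have := allP_and (fl_dps (acl_fl (fam_aclo p)) m.+1) (vars_lev (acl_fl (fam_aclo p)) m.+1).
by move/allP_fl; apply: allP_impl => v [_ Lv]; apply: H; apply: (Lv 1%N); rewrite /dpow_ok implybT.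
Qed.

Lemma evs_match p q m a f : is_cocycle (B := XX (P p)) m.+2 a f ->
 exists f', is_cocycle (B := XX (P q)) m.+2 a f' /\ @evs q m.+1 f' = @evs p m.+1 f.
Proof.
move=> cf; have lt : (0 < m.+1 < m.+2)%N by rewrite ltnS leqnn.
have hp := sg_dmap (st_ok m.+1 p); have hq := sg_dmap (st_ok m.+1 q).
have dL := fl_dps (md_filt (st_model (St m.+1))) m.+1.
pose val (v : var (W m.+1)) : k := if pselect (dps v.1 v.2) then eX p (f (psi m.+1 p (v.2 1))) else 0.
have [|f' [cf' vf]] := cocycle_match hq (val := val) dL (sg_free (st_ok m.+1 q) lt) (sg_span (st_ok m.+1 q) lt) (a := a).
 move=> v v0; rewrite /val; case: pselect => // dv.
 have hd := cocycle_cder cf.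
 exact: (au_hom (fl_aug (acl_fl (fam_aclo p))) (fd_hom (cd_fd hd) Logic.I (dmap_hom hp (dps_hom1 dv))) v0).
exists f'; split=> //; rewrite !(@evsE m.+1) //; apply/map_allP.
have := allP_and dL vf; apply: allP_impl => v [dv ->]; by rewrite /val; case: pselect.
Qed.

(** Equal coordinates let the derivations of both closures share the lifts [fu] and [gu] on the
    model, and [comp_match] expresses the values of either composite through these lifts. *)
Lemma evs_comp p q m n a b f g f' g' :
 is_cocycle (B := XX (P p)) m.+2 a f -> is_cocycle (B := XX (P p)) n.+2 b g ->
 is_cocycle (B := XX (P q)) m.+2 a f' -> is_cocycle (B := XX (P q)) n.+2 b g' ->
 @evs p m.+1 f = @evs q m.+1 f' -> @evs p n.+1 g = @evs q n.+1 g' ->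
 forall j, @evs p j (f \o g) = @evs q j (f' \o g').
Proof.
(* N is large enough for the variables at which the composite is evaluated and for both lifts. *)
move=> cf cg cf' cg' ef eg j; pose N := (j + m + n).+2.
have md := st_model (St N); have sp := st_ok N p; have sq := st_ok N q.
have df := cocycle_cder cf; have dg := cocycle_cder cg.
have df' := cocycle_cder cf'; have dg' := cocycle_cder cg'.
have [|fu [hfu mf]] := lift_der (fam_aclo p) md sp df erefl (m := m); first by rewrite /N; lia.
have [|gu [hgu mg]] := lift_der (fam_aclo p) md sp dg erefl (m := n); first by rewrite /N; lia.
have tr i r r' ru : (i <= N)%N -> @evs p i r = @evs q i r' ->
  allP (L N i) (fun v => eX p (r (psi N p (v.2 1))) = eX p (psi N p (ru (v.2 1)))) ->
  allP (L N i) (fun v => eX q (r' (psi N q (v.2 1))) = eX q (psi N q (ru (v.2 1)))).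
 move=> iN; rewrite !(@evsE N) // => /map_allP h1 h2; have := allP_and h1 h2; apply: allP_impl => v [<- ->].
 by rewrite (sg_aug sp) (sg_aug sq).
have mf' : allP (L N m.+1) (fun v => eX q (f' (psi N q (v.2 1))) = eX q (psi N q (fu (v.2 1)))).
 by apply: tr ef mf; rewrite /N; lia.
have mg' : allP (L N n.+1) (fun v => eX q (g' (psi N q (v.2 1))) = eX q (psi N q (gu (v.2 1)))).
 by apply: tr eg mg; rewrite /N; lia.
have jN : (j <= N)%N by rewrite /N; lia.
rewrite !(@evsE N) //; apply: eq_map => v /=.
rewrite (comp_match (fam_aclo p) md sp df erefl hfu mf dg erefl hgu mg).
rewrite (comp_match (fam_aclo q) md sq df' erefl hfu mf' dg' erefl hgu mg').
by rewrite (sg_aug sp) (sg_aug sq).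
Qed.

Definition evc p m a (x : homotopy_comp (XX (P p)) m.+2 a) : seq k := @evs p m.+1 (subquot_repr x).

(** Coboundaries have augmented values 0, so the coordinates do not depend on the representative. *)
Lemma evc_pi p m a (u : sub_of (cocycles (XX (P p)) m.+2 a)) :
 evc (subquot_pi (coboundaries (XX (P p)) m.+2 a) u) = @evs p m.+1 (sub_val u).
Proof.
set x := subquot_pi _ u.
have := subquot_reprK x; rewrite {2}/x => /subquot_piP /evs_coboundary h1.
rewrite /evc /evs; apply/map_allP; apply: allP_impl h1 => v.
rewrite /subquot_repr; have aX := fl_aug (acl_fl (fam_aclo p)).
set y := sub_val (repr x); set z := sub_val u.
change (eX p (y (v.2 1) - z (v.2 1)) = 0 -> eX p (y (v.2 1)) = eX p (z (v.2 1))).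
rewrite -scaleN1r addrC (au_lin aX) mulN1r addrC => /eqP; by rewrite subr_eq0 => /eqP.
Qed.

Lemma evc_lin p m a c (x y : homotopy_comp (XX (P p)) m.+2 a) : evc (c *: x + y) = seqlin c (evc x) (evc y).
Proof.
have -> : c *: x + y = subquot_pi (coboundaries (XX (P p)) m.+2 a) (c *: repr x + repr y).
 by rewrite subquot_piD subquot_reprK.
rewrite evc_pi -[sub_val _]/(val _) linearP; exact: evs_lin.
Qed.

Lemma evc_inj p m a : injective (@evc p m a).
Proof.
move=> x y e; rewrite -(subquot_reprK x) -(subquot_reprK y); apply/subquot_piP.
have aX := fl_aug (acl_fl (fam_aclo p)).
apply: evs_zero.
 have := is_cocycle_lin (-1) (sub_ofP (repr y)) (sub_ofP (repr x)).
 by rewrite scaleN1r addrC.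
move: e; rewrite /evc /evs => /map_allP; apply: allP_impl => v e.
change (eX p (subquot_repr x (v.2 1) - subquot_repr y (v.2 1)) = 0).
by rewrite -scaleN1r addrC (au_lin aX) e mulN1r addNr.
Qed.

Lemma evc_class p m a f (cf : cocycles (XX (P p)) m.+2 a f) :
 evc (subquot_class (coboundaries (XX (P p)) m.+2 a) cf) = @evs p m.+1 f.
Proof. exact: evc_pi. Qed.

Lemma evc_match p q m a (x : homotopy_comp (XX (P p)) m.+2 a) : exists y : homotopy_comp (XX (P q)) m.+2 a, evc y = evc x.
Proof.
have [f' [cf' e]] := evs_match q (subquot_reprP x : is_cocycle m.+2 a _).
by exists (subquot_class (coboundaries _ m.+2 a) (cf' : cocycles (XX (P q)) m.+2 a f')); rewrite evc_class e.
Qed.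

Notation pi p := (pi_ge2 (XX (P p))).

(** Degrees 0 and 1, where the components of [lie_ge2] are zero, carry no condition. *)
Definition matched i a : pi true i a -> pi false i a -> Prop :=
 match i return pi true i a -> pi false i a -> Prop with
 | m.+2 => fun x y => @evc false m a y = @evc true m a x
 | _ => fun _ _ => True end.

Lemma comp_iso i a : exists f : {linear pi true i a -> pi false i a}, bijective f /\ forall x, matched x (f x).
Proof.
case: i => [|[|m]]; try by exists idfun; split=> //; exists id.
apply: (linear_iso (eU := @evc true m a) (eV := @evc false m a)).
- exact: evc_inj.
- exact: evc_inj.
- exact: evc_lin.
- exact: evc_lin.
- exact: evc_match.
- exact: evc_match.
Qed.

(** A class is determined by its coordinates, and the coordinates of brackets and squares by those
    of the factors; so the degreewise isomorphisms that match coordinates respect both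
    operations. *)
Theorem same_invariant_iso : lie_iso (pi true) (pi false).
Proof.
exists (fun i a => projT1 (cid (comp_iso i a))).
have hm i a x : matched x (projT1 (cid (comp_iso i a)) x) by exact: (projT2 (cid (comp_iso i a))).2.
split.
- by move=> i a; exact: (projT2 (cid (comp_iso i a))).1.
- move=> i j a b x y; case: i x => [|[|m]] x; try exact: linear0.
 case: j y => [|[|n]] y; try exact: linear0.
 pose x' : homotopy_comp (XX (P true)) m.+2 a := x; pose y' : homotopy_comp (XX (P true)) n.+2 b := y.
 pose fx : homotopy_comp (XX (P false)) m.+2 a := projT1 (cid (comp_iso m.+2 a)) x.
 pose fy : homotopy_comp (XX (P false)) n.+2 b := projT1 (cid (comp_iso n.+2 b)) y.
 have hx : evc fx = evc x' := hm m.+2 a x; have hy : evc fy = evc y' := hm n.+2 b y.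
 apply: (@evc_inj false (m + n.+2)%N (a + b)).
 apply: (etrans (hm (m.+2 + n.+2)%N (a + b) _)).
 pose brk p (f g : XX (P p) -> XX (P p)) := @evs p (m + n.+2).+1 (der_br (- m.+2%:Z) (- n.+2%:Z) a b f g).
 transitivity (brk true (subquot_repr x') (subquot_repr y')); first exact: evc_class.
 transitivity (brk false (subquot_repr fx) (subquot_repr fy)); last by symmetry; exact: evc_class.
 have ex : @evs true m.+1 (subquot_repr x') = @evs false m.+1 (subquot_repr fx) by rewrite -[LHS]hx.
 have ey : @evs true n.+1 (subquot_repr y') = @evs false n.+1 (subquot_repr fy) by rewrite -[LHS]hy.
 (* A bracket combines the composites in both orders, with the same scalar in the two closures. *)
 have e1 := evs_comp (subquot_reprP x') (subquot_reprP y') (subquot_reprP fx) (subquot_reprP fy) ex ey.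
 have e2 := evs_comp (subquot_reprP y') (subquot_reprP x') (subquot_reprP fy) (subquot_reprP fx) ey ex.
 have br p f g c j : @evs p j (f \o g - c *: (g \o f)) = seqlin (- c) (@evs p j (g \o f)) (@evs p j (f \o g)).
  by rewrite -evs_lin scaleNr addrC.
 by rewrite /brk /der_br !br e1 e2.
- move=> i a oi x; case: i oi x => [|[|m]] oi x; try exact: linear0.
 pose x' : homotopy_comp (XX (P true)) m.+2 a := x.
 pose fx : homotopy_comp (XX (P false)) m.+2 a := projT1 (cid (comp_iso m.+2 a)) x.
 have hx : evc fx = evc x' := hm m.+2 a x.
 apply: (@evc_inj false (m + m.+2)%N (a + a)).
 apply: (etrans (hm (m.+2 + m.+2)%N (a + a) _)).
 transitivity (@evs true (m + m.+2).+1 (subquot_repr x' \o subquot_repr x')); first exact: evc_class.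
 transitivity (@evs false (m + m.+2).+1 (subquot_repr fx \o subquot_repr fx)); last by symmetry; exact: evc_class.
 have ex : @evs true m.+1 (subquot_repr x') = @evs false m.+1 (subquot_repr fx) by rewrite -[LHS]hx.
 exact: (evs_comp (subquot_reprP x') (subquot_reprP x') (subquot_reprP fx) (subquot_reprP fx) ex ex).
Qed.
End Final.

End ColorLieComparison.
Import ColorLieComparison.

Theorem corollary7p6 (k : fieldType) (s : nat) (G : finZmodType)
  (chi : alt_bicharacter G k) :
 exists (N : nat) (Q : 'I_N -> monomial_quotient s chi)
    (X : forall l : 'I_N, acyclic_closure (Q l)),
  forall (Q' : monomial_quotient s chi) (X' : acyclic_closure Q'),
  exists l : 'I_N, lie_iso (pi_ge2 X') (pi_ge2 (X l)).
Proof.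
pose C := {Q : monomial_quotient s chi & acyclic_closure Q}.
pose I := ({set {set 'I_s}} * {ffun {set 'I_s} -> G})%type.
pose inv (P : C) : I := (Dinv P, hinv P).
(* The type of invariants is finite; a representative is chosen for each invariant that is
   attained. *)
pose att := [set i : I | `[< exists P, inv P = i >]].
have rep (l : 'I_#|att|) : {P : C | inv P = enum_val l}.
 by apply: cid; have := enum_valP l; rewrite inE => /asboolP.
exists #|att|, (fun l => projT1 (sval (rep l))), (fun l => projT2 (sval (rep l))) => Q' X'.
pose P' : C := existT _ Q' X'.
have iP : inv P' \in att by rewrite inE; apply/asboolP; exists P'.
pose l := enum_rank_in iP (inv P'); exists l.
have e : inv (sval (rep l)) = inv P' by rewrite (svalP (rep l)) enum_rankK_in.
have [e1 e2] : Dinv P' = Dinv (sval (rep l)) /\ hinv P' = hinv (sval (rep l)) by case: e => -> ->.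
exact: (@same_invariant_iso k s G chi (fun b => if b then P' else sval (rep l)) e1 e2).
Qed.
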